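(* Let $\lambda\in(0,1/2]$, let $f_\varepsilon^0$ and $\psi_\varepsilon$ satisfy (H1) and (H2) (stated in the context), and let $f_\varepsilon$ be the strong global-in-time solution of the scaled kinetic equation given in the context with initial datum $f_\varepsilon^0$. Let $\rho$ and $j$ be limits, along a subsequence $\varepsilon\to0$ (not relabelled), $$\rho_\varepsilon\overset{*}{\rightharpoonup}\rho\ \text{ in } L^\infty(0,T;\mathcal{M}(\mathbb{R}^N)),\qquad j_\varepsilon\overset{*}{\rightharpoonup}j\ \text{ in } L^2(0,T;\mathcal{M}(\mathbb{R}^N))^N.$$ Then, for every $\varphi\in C_c^\infty([0,T)\times\mathbb{R}^N;\mathbb{R}^N)$, $$\lim_{\varepsilon\to0}\frac12\int_0^T\!\!\int_{\mathbb{R}^N}\!\int_{\mathbb{R}^N}H_\varphi^{\lambda,\varepsilon}\cdot(\rho_\varepsilon\otimes j_\varepsilon-j_\varepsilon\otimes\rho_\varepsilon)\,dx\,dy\,dt=\frac12\int_0^T\!\!\int_{\mathbb{R}^N}\!\int_{\mathbb{R}^N}H_\varphi^{\lambda,0}\cdot(\rho\otimes j-j\otimes\rho)\,dx\,dy\,dt,$$ $$\lim_{\varepsilon\to0}\int_0^T\!\!\int_{\mathbb{R}^N}\rho_\varepsilon\,\nabla\psi_\varepsilon\cdot\varphi\,dx\,dt=\int_0^T\!\!\int_{\mathbb{R}^N}\rho\,\nabla\psi\cdot\varphi\,dx\,dt,$$ where on the right-hand sides the integrals are against the measures $\rho(t)\otimes j(t)-j(t)\otimes\rho(t)$ and $\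rho(t)$.
   Context: $N$ is the space dimension, $0<T<\infty$. Put $c_\lambda=2^{1/\lambda}-1$, $\phi_\varepsilon(r)=(\varepsilon^2+c_\lambda r^2)^{-\lambda}$ for $\varepsilon>0$, and $\phi_0(r)=c_\lambda^{-\lambda}r^{-2\lambda}$; convolutions with $\phi_\varepsilon$ are in $x$ with kernel $\phi_\varepsilon(|x|)$. For $\varepsilon\ge0$, $H_\varphi^{\lambda,\varepsilon}(t,x,y)=\phi_\varepsilon(|x-y|)(\varphi(t,x)-\varphi(t,y))$, taken to be $0$ for $x=y$. The expression $\rho\otimes j-j\otimes\rho$ stands for $\rho(t,x)j(t,y)-j(t,x)\rho(t,y)$. $\mathcal{M}(\mathbb{R}^N)=C_0(\mathbb{R}^N)^*$ is the space of finite Radon measures; $L^\infty(0,T;\mathcal{M})=L^1(0,T;C_0)^*$ and $L^2(0,T;\mathcal{M})=L^2(0,T;C_0)^*$. Kinetic equation: $f_\varepsilon=f_\varepsilon(t,x,v)\ge0$ is the strong global-in-time solution, with enough decay at infinity in $(x,v)$ for its velocity moments to be finite and integrations by parts to be legitimate, of $$\varepsilon\partial_tf_\varepsilon+\varepsilon v\cdot\nabla_xf_\varepsilon-\nabla_x\psi_\varepsilon\cdot\nabla_vf_\varepsilon=\operatorname{div}_v\big(f_\varepsilon v+\nabla_vf_\varepsilon+f_\varepsilon(\phi_\varepsilon*\rho_\varepsilon)v-f_\varepsilon(\phi_\varepsilon*j_\varepsilon)\big),\quad f_\varepsilon(0,\cdot,\cdot)=f_\varepsilon^0,$$ where $\rho_\varepsilon(t,x)=\int_{\mathbb{R}^N}f_\varepsilon\,dv$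 and $j_\varepsilon(t,x)=\int_{\mathbb{R}^N}vf_\varepsilon\,dv$. (H1): $f_\varepsilon^0\ge0$, $f_\varepsilon^0\in C_c^\infty(\mathbb{R}^N\times\mathbb{R}^N)$, $\|f_\varepsilon^0\|_{L^1(\mathbb{R}^{2N})}\le M_0$, $\||v|^2f_\varepsilon^0\|_{L^1(\mathbb{R}^{2N})}\le E_0$ for all $\varepsilon>0$, with $M_0,E_0>0$ independent of $\varepsilon$, and $\rho_\varepsilon^0:=\int f_\varepsilon^0\,dv\overset{*}{\rightharpoonup}\rho^0$ in $\mathcal{M}(\mathbb{R}^N)$ as $\varepsilon\to0$. (H2): $\psi_\varepsilon,\psi\in L^2(0,T;W^{1,\infty}(\mathbb{R}^N))$; $\nabla\psi_\varepsilon(t,\cdot),\nabla\psi(t,\cdot)\in C_0(\mathbb{R}^N,\mathbb{R}^N)$ for a.e. $t$; $\|\nabla\psi_\varepsilon\|_{L^2(0,T;L^\infty(\mathbb{R}^N,\mathbb{R}^N))}\le F_0$ for all $\varepsilon>0$ with $F_0>0$ independent of $\varepsilon$; $\nabla\psi_\varepsilon\to\nabla\psi$ in $L^1(0,T;C_0(\mathbb{R}^N))$. *)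

(* Defs.v *)
From HB Require Import structures.
From mathcomp Require Import all_boot all_order all_algebra.
From mathcomp Require Import all_classical all_reals all_analysis.

Set Implicit Arguments.
Unset Strict Implicit.
Unset Printing Implicit Defensive.

Import Order.TTheory GRing.Theory Num.Theory.
Import numFieldNormedType.Exports.

Local Open Scope classical_set_scope.
Local Open Scope ring_scope.

(* The Borel sigma-algebra of R^N, generated by the coordinates. *)
Definition measure_rV_display : measure_display.
Proof. exact (measure_tuple_display default_measure_display). Qed.

Section measurable_rV.
Variables (R : realType) (N : nat).

Let coord (i : 'I_N) (x : 'rV[R]_N) : measurableTypeR R := x 0 i.

Let rV_set0 : g_sigma_preimage coord set0.
Proof. exact: sigma_algebra0. Qed.

Let rV_setC A : g_sigma_preimage coord A -> g_sigma_preimage coord (~` A).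
Proof. exact: sigma_algebraC. Qed.

Let rV_bigcup (F : (set _)^nat) : (forall i, g_sigma_preimage coord (F i)) ->
  g_sigma_preimage coord (\bigcup_i F i).
Proof. exact: sigma_algebra_bigcup. Qed.

HB.instance Definition _ := @isMeasurable.Build measure_rV_display
  'rV[R]_N (g_sigma_preimage coord) rV_set0 rV_setC rV_bigcup.

Lemma measurable_rV_coord (i : 'I_N) :
  measurable_fun [set: 'rV[R]_N] (fun x => x 0 i : measurableTypeR R).
Proof.
move=> _ Y mY; rewrite setTI; apply: sub_sigma_algebra => /=.
rewrite -bigcup_seq/=; exists i => /=; first by rewrite mem_index_enum.
by exists Y => //; rewrite setTI.
Qed.

Lemma measurable_fun_rVP d (T : measurableType d) (f : T -> 'rV[R]_N) :
  (forall i, measurable_fun [set: T] (fun t => f t 0 i : measurableTypeR R)) ->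
  measurable_fun [set: T] f.
Proof.
move=> mf _ A mA; rewrite setTI.
have : preimage_set_system [set: T] f (g_sigma_preimage coord) (f @^-1` A).
  by exists A => //; rewrite setTI.
rewrite -g_sigma_preimage_comp; apply: smallest_sub.
  exact: sigma_algebra_measurable.
rewrite -bigcup_seq; apply: bigcup_sub => i _ B [C mC <-].
exact: mf.
Qed.

End measurable_rV.

Lemma sigma_finite_product d1 d2 (T1 : measurableType d1)
    (T2 : measurableType d2) (R : realType)
    (m1 : {sigma_finite_measure set T1 -> \bar R})
    (m2 : {sigma_finite_measure set T2 -> \bar R}) :
  sigma_finite setT (m1 \x m2)%E.
Proof.
have /sigma_finiteP[F [TF ndF Foo]] := sigma_finiteT m1.
have /sigma_finiteP[G [TG ndG Goo]] := sigma_finiteT m2.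
exists (fun n => F n `*` G n).
  rewrite -setXTT TF TG predeqE => -[x y]; split.
    move=> [/= [n _ Fnx] [k _ Gky]]; exists (maxn n k) => //; split.
    - by move: x Fnx; exact/subsetPset/ndF/leq_maxl.
    - by move: y Gky; exact/subsetPset/ndG/leq_maxr.
  by move=> [n _ []/= ? ?]; split; exists n.
move=> k; have [? ?] := Foo k; have [? ?] := Goo k.
split; first exact: measurableX.
by rewrite product_measure1E// lte_mul_pinfty// ge0_fin_numE.
Qed.

(* Lebesgue measure on R^N, by recursion on N: the image of the product of the
   Lebesgue measures on R and on R^N under (r, x) |-> row_mx r x. *)
Section lebesgue_rV_step.
Variables (R : realType) (n : nat).
Variable m : {sigma_finite_measure set 'rV[R]_n -> \bar R}.

Definition consrV (p : measurableTypeR R * 'rV[R]_n) : 'rV[R]_n.+1 :=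
  row_mx (const_mx p.1 : 'rV[R]_1) p.2.

Lemma measurable_consrV : measurable_fun [set: _] consrV.
Proof.
apply: measurable_fun_rVP => i; rewrite /consrV.
case: (splitP (i : 'I_(1 + n))) => [j ij|j ij].
- have -> : (i : 'I_(1 + n)) = lshift n j by exact/val_inj.
  rewrite [X in measurable_fun _ X](_ : _ = fst); first exact: measurable_fst.
  apply/funext => p /=.
  exact: (etrans (row_mxEl (const_mx p.1 : 'rV[R]_1) p.2 0 j) (mxE _ _ _ _)).
- have -> : (i : 'I_(1 + n)) = rshift 1 j by exact/val_inj.
  rewrite [X in measurable_fun _ X](_ : _ =
    (fun x : 'rV[R]_n => x 0 j : measurableTypeR R) \o snd).
    by apply: measurableT_comp; [exact: measurable_rV_coord|].
  apply/funext => p /=.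
  exact: (row_mxEr (const_mx p.1 : 'rV[R]_1) p.2 0 j).
Qed.

Definition lebesgue_rV_step : set 'rV[R]_n.+1 -> \bar R :=
  pushforward (lebesgue_measure \x m)%E consrV.

HB.instance Definition _ := Measure.copy lebesgue_rV_step
  (measure_function_pushforward__canonical__measure_function_Measure
    (lebesgue_measure \x m)%E measurable_consrV).


Let lebesgue_rV_step_sigma_finite : sigma_finite setT lebesgue_rV_step.
Proof.
have [F FU Ffin] := sigma_finite_product (@lebesgue_measure R) m.
pose G (x : 'rV[R]_n.+1) : measurableTypeR R * 'rV[R]_n :=
  (x 0 0, \row_i x 0 (lift 0 i)).
have mG : measurable_fun setT G.
  apply/measurable_fun_pair; first exact: measurable_rV_coord.
  apply: measurable_fun_rVP => i.
  rewrite [X in measurable_fun _ X](_ : _ =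
    (fun x : 'rV[R]_n.+1 => x 0 (lift 0 i) : measurableTypeR R)).
    exact: measurable_rV_coord.
  by apply/funext => x; exact: mxE.
have GK : cancel consrV G.
  move=> -[r x]; rewrite /G /consrV; congr pair.
    have -> : (0 : 'I_n.+1) = lshift n (0 : 'I_1) by exact/val_inj.
    exact: (etrans (row_mxEl (const_mx r : 'rV[R]_1) x 0 0) (mxE _ _ _ _)).
  apply/rowP => i; rewrite mxE.
  have -> : lift 0 i = rshift 1 i by exact/val_inj.
  exact: (row_mxEr (const_mx r : 'rV[R]_1) x 0 i).
exists (fun k => G @^-1` F k).
  by rewrite -preimage_bigcup -FU preimage_setT.
move=> k; have [mF Flty] := Ffin k; split.
  by rewrite -[X in measurable X]setTI; exact: mG.
rewrite /lebesgue_rV_step /pushforward.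
by rewrite -comp_preimage (_ : G \o consrV = id)//; apply/funext => p; exact: GK.
Qed.

HB.instance Definition _ := @Measure_isSigmaFinite.Build _ _ _
  lebesgue_rV_step lebesgue_rV_step_sigma_finite.

End lebesgue_rV_step.

Fixpoint lebesgue_rV (R : realType) (N : nat) :
    {sigma_finite_measure set 'rV[R]_N -> \bar R} :=
  match N with
  | 0 => \d_(0 : 'rV[R]_0)
  | n.+1 => lebesgue_rV_step (lebesgue_rV R n)
  end.

(* Euclidean structure of R^N; the norm `|x| on 'rV is the sup norm. *)
Section euclidean.
Variables (R : realType) (N : nat).
Implicit Types x y : 'rV[R]_N.

Definition dot x y : R := \sum_(i < N) x 0 i * y 0 i.
Definition enorm x : R := Num.sqrt (dot x x).

End euclidean.

Section calculus.
Variable R : realType.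

Definition smooth (V W : normedModType R) (g : V -> W) : Prop :=
  forall (vs : seq V) (x : V),
    differentiable (foldr (fun v h => fun y => 'D_v h y) g vs) x.

Definition supported_in (V : topologicalType) (W : nmodType) (D : set V)
    (g : V -> W) : Prop :=
  exists K : set V, [/\ compact K, K `<=` D & forall x, ~ K x -> g x = 0].

Definition Ccinf (V W : normedModType R) (g : V -> W) : Prop :=
  smooth g /\ supported_in setT g.

Definition C0 (V W : normedModType R) (g : V -> W) : Prop :=
  continuous g /\
  forall e : R, 0 < e ->
    exists2 K : set V, compact K & forall x, ~ K x -> `|g x| < e.

Variable N : nat.
Local Notation E := 'rV[R]_N.

Definition partial (i : 'I_N) (g : E -> R) (x : E) : R :=
  'D_(delta_mx 0 i) g x.

Definition grad (g : E -> R) (x : E) : E := \row_i partial i g x.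

Definition divergence (F : E -> E) (x : E) : R :=
  \sum_(i < N) partial i (fun y => F y 0 i) x.

Definition sup_norm (g : E -> R) : \bar R :=
  ereal_sup (range (fun x => `|g x|%:E)).

Definition Linf_norm (g : E -> R) : \bar R :=
  Lnorm (lebesgue_rV R N) +oo%E (EFin \o g).

Definition weak_gradient (g : E -> R) (G : E -> E) : Prop :=
  forall (eta : E -> R) (i : 'I_N), Ccinf eta ->
    \int[lebesgue_rV R N]_x (g x * partial i eta x) =
    - \int[lebesgue_rV R N]_x (G x 0 i * eta x).

(* An element of W^{1,oo}(R^N) is the pair of the function and its gradient. *)
Definition W1inf : set ((E -> R) * (E -> E)) :=
  [set u | [/\ measurable_fun setT u.1, measurable_fun setT u.2,
    (Linf_norm u.1 < +oo)%E, (Linf_norm (@enorm R N \o u.2) < +oo)%E &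
    weak_gradient u.1 u.2]].

Definition W1inf_norm (u : (E -> R) * (E -> E)) : \bar R :=
  (Linf_norm u.1 + Linf_norm (@enorm R N \o u.2))%E.

End calculus.

(* Bochner spaces L^p(0,T;X), X a set of elements of U normed by nrm. *)
Section bochner.
Variables (R : realType) (U : zmodType).
Local Notation leb := (@lebesgue_measure R).

Definition simple_in (X : set U) (s : R -> U) : Prop :=
  [/\ finite_set (range s), forall t, X (s t) &
      forall u, measurable (s @^-1` [set u])].

Definition Lp_time_norm (T : R) (p : \bar R) (nrm : U -> \bar R)
    (u : R -> U) : \bar R :=
  Lnorm leb p ((nrm \o u) \_ `]0, T[).

Definition Lp_bochner (T : R) (p : \bar R) (X : set U) (nrm : U -> \bar R)
    (u : R -> U) : Prop :=
  [/\ {ae leb, forall t, t \in `]0, T[ -> X (u t)},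
      exists s : nat -> R -> U, (forall n, simple_in X (s n)) /\
        {ae leb, forall t, t \in `]0, T[ ->
          nrm (s n t - u t) @[n --> \oo] --> 0%E} &
      (Lp_time_norm T p nrm u < +oo)%E].

End bochner.

(* Finite signed Borel measures are the library's charges; integration against
   a charge goes through its Jordan decomposition. *)
Section charge_integral.
Context d (X : measurableType d) (R : realType).
Implicit Types nu : {charge set X -> \bar R}.

Definition hahn_pos nu : set X := sval (cid (Hahn_decomposition nu)).
Definition hahn_neg nu : set X :=
  sval (cid (svalP (cid (Hahn_decomposition nu)))).

Lemma hahn_posneg nu : hahn_decomposition nu (hahn_pos nu) (hahn_neg nu).
Proof. exact: (svalP (cid (svalP (cid (Hahn_decomposition nu))))). Qed.

Definition charge_pos nu : {finite_measure set X -> \bar R} :=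
  jordan_pos (hahn_posneg nu).
Definition charge_neg nu : {finite_measure set X -> \bar R} :=
  jordan_neg (hahn_posneg nu).

Definition charge_norm nu : \bar R := charge_variation (hahn_posneg nu) setT.

Definition cint nu (g : X -> R) : R :=
  \int[charge_pos nu]_x g x - \int[charge_neg nu]_x g x.

(* Integral against the product charge mu \otimes nu. *)
Definition cint_prod (mu nu : {charge set X -> \bar R}) (h : X * X -> R) : R :=
    \int[(charge_pos mu \x charge_pos nu)%E]_z h z
  - \int[(charge_pos mu \x charge_neg nu)%E]_z h z
  - \int[(charge_neg mu \x charge_pos nu)%E]_z h z
  + \int[(charge_neg mu \x charge_neg nu)%E]_z h z.

End charge_integral.

Section kinetic.
Variables (R : realType) (N : nat).
Local Notation E := 'rV[R]_N.
Local Notation leb := (@lebesgue_measure R).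
Local Notation lebN := (lebesgue_rV R N).
Local Notation M := (charge E R).

(* L^q(0,T;M(R^N)) as the dual of L^p(0,T;C_0(R^N)), 1/p + 1/q = 1: weakly-*
   measurable families of measures whose total variation is in L^q(0,T). *)
Definition Lq_measures (T : R) (q : \bar R) (mu : R -> M) : Prop :=
  (forall g : E -> R, C0 g ->
     measurable_fun (`]0, T[ : set R) (fun t => cint (mu t) g)) /\
  (Lnorm leb q ((fun t => charge_norm (mu t)) \_ `]0%R, T[) < +oo)%E.

(* Weak-* convergence in (L^p(0,T;C_0))^* of a sequence of densities. *)
Definition weak_star_cvg (T : R) (p : \bar R) (r : nat -> R -> E -> R)
    (mu : R -> M) : Prop :=
  forall g : R -> E -> R,
    Lp_bochner T p [set h : E -> R | C0 h] (@sup_norm R N) g ->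
    \int[leb]_(t in `]0, T[) \int[lebN]_x (r n t x * g t x) @[n --> \oo] -->
    \int[leb]_(t in `]0, T[) cint (mu t) (g t).

Definition phi_kernel (lam eps r : R) : R :=
  let c := 2 `^ lam^-1 - 1 in
  if eps == 0 then c `^ (- lam) * r `^ (- (2 * lam))
  else (eps ^+ 2 + c * r ^+ 2) `^ (- lam).

Definition H_kernel (lam eps : R) (phi : R -> E -> E) (t : R) (x y : E) : E :=
  if x == y then 0
  else phi_kernel lam eps (enorm (x - y)) *: (phi t x - phi t y).

Definition density (f : R -> E -> E -> R) (t : R) (x : E) : R :=
  \int[lebN]_v f t x v.

Definition current (f : R -> E -> E -> R) (t : R) (x : E) : E :=
  \row_i \int[lebN]_v (v 0 i * f t x v).

Definition phi_conv (lam eps : R) (r : E -> R) (x : E) : R :=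
  \int[lebN]_y (phi_kernel lam eps (enorm (x - y)) * r y).

(* Regularity in (x,v) of a classical solution: C^1 in x and C^2 in v. *)
Definition C1x_C2v (h : E -> E -> R) : Prop :=
  [/\ continuous (fun z : E * E => h z.1 z.2),
   forall i : 'I_N,
     (forall x v, derivable (h ^~ v) x (delta_mx 0 i)) /\
     continuous (fun z : E * E => partial i (h ^~ z.2) z.1),
   forall i : 'I_N,
     (forall x v, derivable (h x) v (delta_mx 0 i)) /\
     continuous (fun z : E * E => partial i (h z.1) z.2) &
   forall i k : 'I_N,
     (forall x v, derivable (partial i (h x)) v (delta_mx 0 k)) /\
     continuous (fun z : E * E => partial k (partial i (h z.1)) z.2)].

(* The weight (1 + |v|)^3 is what makes every term of the kinetic equation
   times |v|^2 integrable. *)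
Definition weighted_norm (h : E -> E -> R) : \bar R :=
  (\int[lebN \x lebN]_z
    ((1 + enorm z.2) ^+ 3 *
     (`|h z.1 z.2|
      + \sum_(i < N) `|partial i (h ^~ z.2) z.1|
      + \sum_(i < N) `|partial i (h z.1) z.2|
      + \sum_(i < N) \sum_(k < N) `|partial k (partial i (h z.1)) z.2|))%:E)%E.

(* F stands for the gradient of the potential, which is only measurable in
   time: the equation holds for a.e. t, and t |-> f(t,x,v) is absolutely
   continuous with derivative g. *)
Record strong_solution (lam T eps : R) (F : R -> E -> E) (f0 : E -> E -> R)
    (f : R -> E -> E -> R) : Prop := {
  solution_measurable :
    measurable_fun ((`[0, T] `*` setT) : set (R * (E * E)))
      (fun p => f p.1 p.2.1 p.2.2);
  solution_ge0 : forall t x v, t \in `[0, T] -> 0 <= f t x v;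
  solution_regular : forall t, t \in `]0, T[ -> C1x_C2v (f t);
  solution_decay :
    (Lnorm leb 2%:E ((fun t => weighted_norm (f t)) \_ `]0%R, T[) < +oo)%E;
  solution_initial : forall x v, f 0 x v = f0 x v;
  solution_equation : forall x v, exists g : R -> R,
    [/\ leb.-integrable `]0, T[ (EFin \o g),
        forall t, t \in `[0, T] ->
          f t x v = f 0 x v + \int[leb]_(s in `]0, t[) g s &
        {ae leb, forall t, t \in `]0, T[ ->
          eps * g t + eps * dot v (grad (fun y => f t y v) x)
            - dot (F t x) (grad (f t x) v) =
          divergence (fun w =>
            f t x w *: w + grad (f t x) w
            + (f t x w * phi_conv lam eps (density f t) x) *: w
            - f t x w *:
                (\row_i phi_conv lam eps (fun y => current f t y 0 i) x)) v}]
}.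

Definition hypothesis_H1 (f0 : R -> E -> E -> R) (rho0 : M) : Prop :=
  [/\ forall eps, 0 < eps -> forall x v, 0 <= f0 eps x v,
   forall eps, 0 < eps -> Ccinf (fun z : E * E => f0 eps z.1 z.2),
   exists M0 E0 : R, [/\ 0 < M0, 0 < E0 & forall eps, 0 < eps ->
     (\int[lebN \x lebN]_z `|f0 eps z.1 z.2|%:E <= M0%:E)%E /\
     (\int[lebN \x lebN]_z `|enorm z.2 ^+ 2 * f0 eps z.1 z.2|%:E
       <= E0%:E)%E] &
   forall g : E -> R, C0 g ->
     \int[lebN]_x ((\int[lebN]_v f0 eps x v) * g x) @[eps --> 0^'+] -->
     cint rho0 g].

(* dpsi eps and dpsi' are the gradients in x of psi eps and psi', in their
   continuous representatives. *)
Definition hypothesis_H2 (T : R) (psi : R -> R -> E -> R)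
    (dpsi : R -> R -> E -> E) (psi' : R -> E -> R) (dpsi' : R -> E -> E) :
    Prop :=
  let L2W u du :=
    Lp_bochner T 2%:E (@W1inf R N) (@W1inf_norm R N) (fun t => (u t, du t)) in
  let C0v := [set G : E -> E | C0 G] in
  let supv (G : E -> E) := sup_norm (@enorm R N \o G) in
  [/\ (forall eps, 0 < eps -> L2W (psi eps) (dpsi eps)) /\ L2W psi' dpsi',
   (forall eps, 0 < eps -> {ae leb, forall t, t \in `]0, T[ -> C0v (dpsi eps t)})
     /\ {ae leb, forall t, t \in `]0, T[ -> C0v (dpsi' t)},
   exists F0 : R, 0 < F0 /\ forall eps, 0 < eps ->
     (Lp_time_norm T 2%:E (fun G => Linf_norm (@enorm R N \o G)) (dpsi eps)
       <= F0%:E)%E,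
   (forall eps, 0 < eps -> Lp_bochner T 1%:E C0v supv (dpsi eps)) /\
     Lp_bochner T 1%:E C0v supv dpsi' &
   Lp_time_norm T 1%:E supv (fun t => dpsi eps t - dpsi' t)
     @[eps --> 0^'+] --> 0%E].

End kinetic.

(* Main.v *)
Require Import Defs.
From HB Require Import structures.
From mathcomp Require Import all_boot all_order all_algebra.
From mathcomp Require Import all_classical all_reals all_analysis.
From mathcomp Require Import measurable_realfun ess_sup_inf ring lra.

(** Testing the kinetic equation with 1 and |v|^2 bounds, uniformly in eps, the
    mass, the kinetic energy int |v|^2 f and the dissipation
    int phi_eps(|x - y|) |v - w|^2 f(x, v) f(y, w).  The left-hand side of the
    nonlocal term is the integral over t, x, v, y, w of
    H^eps(t, x, y) . (w - v) f(x, v) f(y, w).  For lam <= 1/2 the kernels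
    H^eps are uniformly bounded, and H^eps - H^eps' is, for small parameters,
    small against 1 + s^2 + phi_eps(|x - y|) s^2 with s = |v - w|: near the
    diagonal phi_eps is large and the dissipation controls |v - w|.  Hence
    H^eps may be replaced by a fixed H^eps', and then by a finite sum of tensor
    products chi_k(x) chi_l(y).  For those, the moments int rho_eps chi_k are
    equicontinuous in time and so converge pointwise, which suffices to pass to
    the limit in their products with the weakly convergent int j_eps chi_l.
    The force term only needs the mass bound and the strong convergence of the
    potentials' gradients. *)

Set Implicit Arguments.
Unset Strict Implicit.
Unset Printing Implicit Defensive.

Import Order.TTheory GRing.Theory Num.Theory.
Import numFieldNormedType.Exports.

Local Open Scope classical_set_scope.
Local Open Scope ring_scope.

(** For [lam = 1/2] the kernel H^0 is bounded but in general discontinuous on the diagonal, where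
    the limit measures may have atoms, so neither uniform approximation of H^0 nor weak convergence
    alone suffices. What saves the argument is that the dissipation makes the error of replacing
    H^eps by H^eps' small in L^1(0, T), uniformly along the sequence. The limits in eps and eps' are
    then interchanged through L^1 distances, which survive weak limits; against the limit charges,
    H^eps' tends to H^0 by bounded pointwise convergence, every kernel being 0 on the diagonal. The
    condition lam <= 1/2 enters as boundedness of r phi_0(r) for r <= 1. Equicontinuity costs no
    power of 1/eps because a test function of x alone kills the velocity flux. The kinetic energy is
    bounded only in L^1 in time; the inequality |a| <= k a^2 + 1/k with k free makes its
    contribution small before anything else is chosen. Time norms of the data are not shown to be
    measurable, whence the use of lower integrals. *)

Notation rint mu f := (integrable mu setT (EFin \o f)).

(** * Integration of real-valued functions *)

Section real_integral.
Context d (X : measurableType d) (R : realType) (mu : {measure set X -> \bar R}).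
Implicit Types f g : X -> R.

Lemma rint_measurable f : rint mu f -> measurable_fun setT f.
Proof. by move=> /measurable_int /measurable_EFinP. Qed.

Lemma le_rint f g : measurable_fun setT f -> rint mu g ->
  (forall x, `|f x| <= g x) -> rint mu f.
Proof.
move=> mf ig fg; apply: le_integrable ig => //; first exact/measurable_EFinP.
by move=> x _ /=; rewrite lee_fin (le_trans (fg x))// ler_norm.
Qed.

Lemma rintD f g : rint mu f -> rint mu g -> rint mu (fun x => f x + g x).
Proof. by move=> jf jg; exact: (integrableD measurableT jf jg). Qed.

Lemma rintN f : rint mu f -> rint mu (fun x => - f x).
Proof. by move=> jf; exact: (integrableN jf). Qed.

Lemma rintB f g : rint mu f -> rint mu g -> rint mu (fun x => f x - g x).
Proof. by move=> jf jg; apply: rintD => //; apply: rintN. Qed.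

Lemma rintZl k f : rint mu f -> rint mu (fun x => k * f x).
Proof. by move=> jf; exact: (integrableZl measurableT k jf). Qed.

Lemma rintZr k f : rint mu f -> rint mu (fun x => f x * k).
Proof.
by move=> jf; rewrite (_ : (fun x => _) = (fun x => k * f x)); [exact: rintZl|apply/funext => x; rewrite mulrC].
Qed.

Lemma rint0 : rint mu (fun _ : X => 0 : R).
Proof. exact: integrable0. Qed.

Lemma rint_norm f : rint mu f -> rint mu (fun x => `|f x|).
Proof. by move=> jf; apply: integrable_norm. Qed.

Lemma rint_sum I (s : seq I) (P : pred I) (F : I -> X -> R) :
  (forall i, rint mu (F i)) -> rint mu (fun x => \sum_(i <- s | P i) F i x).
Proof.
move=> iF; elim: s => [|i s IH].
  by rewrite (_ : (fun x => _) = fun=> 0); [exact: rint0|apply/funext => x; rewrite big_nil].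
rewrite (_ : (fun x => _) = fun x => (if P i then F i x else 0) + \sum_(i <- s | P i) F i x); last first.
  by apply/funext => x; rewrite big_cons; case: ifP => // _; rewrite add0r.
by apply: rintD => //; case: (P i) => //; exact: rint0.
Qed.

Lemma Rint_sum I (s : seq I) (P : pred I) (F : I -> X -> R) :
  (forall i, rint mu (F i)) ->
  \int[mu]_x (\sum_(i <- s | P i) F i x) = \sum_(i <- s | P i) \int[mu]_x F i x.
Proof.
move=> iF; elim: s => [|i s IH].
  rewrite big_nil; under eq_Rintegral do rewrite big_nil.
  by rewrite Rintegral_cst// mul0r.
rewrite big_cons; under eq_Rintegral do rewrite big_cons.
case: ifP => Pi //; rewrite RintegralD// ?IH//.
exact: rint_sum.
Qed.

Lemma Rint_EFin f : rint mu f -> (\int[mu]_x f x)%:E = (\int[mu]_x (f x)%:E)%E.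
Proof. by move=> jf; rewrite /Rintegral fineK//; exact: integrable_fin_num. Qed.

Lemma ge0_rintP f : measurable_fun setT f -> (forall x, 0 <= f x) ->
  rint mu f <-> (\int[mu]_x (f x)%:E < +oo)%E.
Proof.
move=> mf f0; split => [/integrableP[_]|h].
  by under eq_integral do rewrite /= ger0_norm//.
apply/integrableP; split; first exact/measurable_EFinP.
by under eq_integral do rewrite /= ger0_norm//.
Qed.

Lemma rint_ae_eq f g : measurable_fun setT g -> {ae mu, forall x, f x = g x} ->
  rint mu f -> rint mu g.
Proof.
move=> mg fg jf.
have mf := rint_measurable jf.
apply/integrableP; split; first exact/measurable_EFinP.
case/integrableP : jf => _; apply: le_lt_trans.
rewrite le_eqVlt; apply/orP; left; apply/eqP.
apply: ge0_ae_eq_integral => //=.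
- by apply/measurable_EFinP/measurableT_comp.
- by apply/measurable_EFinP/measurableT_comp.
- by apply: filterS fg => x -> _.
Qed.

Lemma ae_eq_Rint f g : measurable_fun setT f -> measurable_fun setT g ->
  {ae mu, forall x, f x = g x} -> \int[mu]_x f x = \int[mu]_x g x.
Proof.
move=> mf mg fg; rewrite /Rintegral; congr fine.
apply: ae_eq_integral => //; [exact/measurable_EFinP|exact/measurable_EFinP|].
by apply: filterS fg => x -> _.
Qed.

Lemma le_Rint f g : rint mu f -> rint mu g -> (forall x, f x <= g x) ->
  \int[mu]_x f x <= \int[mu]_x g x.
Proof. by move=> jf jg fg; apply: le_Rintegral. Qed.

Lemma ae_le_Rint f g : rint mu f -> rint mu g -> {ae mu, forall x, f x <= g x} ->
  \int[mu]_x f x <= \int[mu]_x g x.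
Proof.
move=> jf jg fg; have mf := rint_measurable jf; have mg := rint_measurable jg.
rewrite (@ae_eq_Rint g (fun x => Num.max (f x) (g x)))//; last 2 first.
- exact: measurable_maxr.
- by apply: filterS fg => x fgx; rewrite max_r.
apply: le_Rint => //; last by move=> x; rewrite le_max lexx.
apply: (@le_rint _ (fun x => `|f x| + `|g x|)).
- exact: measurable_maxr.
- by apply: rintD; exact: rint_norm.
- move=> x; rewrite maxEge; case: ifPn => _; [by rewrite lerDl|by rewrite lerDr].
Qed.

(* No measurability is needed: the integral of a nonnegative function is a
   supremum over the simple functions below it. *)
Lemma ge0_le_integral_nonmeasurable (f g : X -> \bar R) :
  (forall x, 0 <= f x)%E -> (forall x, f x <= g x)%E ->
  (\int[mu]_x f x <= \int[mu]_x g x)%E.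
Proof.
move=> f0 fg; have g0 x : (0 <= g x)%E by apply: le_trans (fg x).
rewrite !ge0_integralTE//; apply/ge_ereal_sup => _ [h hf <-].
by apply: ereal_sup_ubound; exists h => // x; apply: le_trans (fg x).
Qed.

End real_integral.

(** * Fubini's theorem for real-valued integrals *)

Section fubini_real.
Context d1 d2 (X : measurableType d1) (Y : measurableType d2) (R : realType).
Variables (m1 : {sigma_finite_measure set X -> \bar R}).
Variables (m2 : {sigma_finite_measure set Y -> \bar R}).
Implicit Types f : X * Y -> R.

Lemma measurable_Rint1 f : measurable_fun setT f ->
  measurable_fun setT (fun x => \int[m2]_y f (x, y)).
Proof.
move=> mf; have mE : measurable_fun setT (EFin \o f) by exact/measurable_EFinP.
rewrite /Rintegral; apply: measurableT_comp => //.
have -> : (fun x => \int[m2]_y (f (x, y))%:E)%E =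
    (fubini_F m2 (EFin \o f)^\+ \- fubini_F m2 (EFin \o f)^\-)%E.
  apply/funext => x; rewrite [LHS]integralE.
  by congr (_ - _)%E; apply: eq_integral => y _; [rewrite !funeposE|rewrite !funenegE].
apply: emeasurable_funB; apply: measurable_fun_fubini_tonelli_F => //.
- exact: measurable_funepos.
- exact: measurable_funeneg.
Qed.

Lemma measurable_Rint2 f : measurable_fun setT f ->
  measurable_fun setT (fun y => \int[m1]_x f (x, y)).
Proof.
move=> mf; have mE : measurable_fun setT (EFin \o f) by exact/measurable_EFinP.
rewrite /Rintegral; apply: measurableT_comp => //.
have -> : (fun y => \int[m1]_x (f (x, y))%:E)%E =
    (fubini_G m1 (EFin \o f)^\+ \- fubini_G m1 (EFin \o f)^\-)%E.
  apply/funext => x; rewrite [LHS]integralE.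
  by congr (_ - _)%E; apply: eq_integral => y _; [rewrite !funeposE|rewrite !funenegE].
apply: emeasurable_funB; apply: measurable_fun_fubini_tonelli_G => //.
- exact: measurable_funepos.
- exact: measurable_funeneg.
Qed.

(** The inner real integral can differ from the extended one only where the section is not
    integrable, which is a null set of [x]. *)
Lemma rint_fubini1 f : rint (m1 \x m2)%E f ->
  rint m1 (fun x => \int[m2]_y f (x, y)) /\
  \int[m1]_x \int[m2]_y f (x, y) = \int[(m1 \x m2)%E]_z f z.
Proof.
move=> jf; have mf := rint_measurable jf.
have jF := integrable_fubini_F jf.
have E : {ae m1, forall x, fubini_F m2 (EFin \o f) x = (EFin (\int[m2]_y f (x, y)))}.
  by apply: filterS (ae_integrable1 jf) => x jx; rewrite Rint_EFin.
have jF' : rint m1 (fun x => \int[m2]_y f (x, y)).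
  apply/integrableP; split; first exact/measurable_EFinP/measurable_Rint1.
  case/integrableP : jF => mF; apply: le_lt_trans.
  rewrite le_eqVlt; apply/orP; left; apply/eqP.
  apply: ge0_ae_eq_integral => //=.
  - by apply/measurable_EFinP/measurableT_comp => //; exact: measurable_Rint1.
  - exact: measurableT_comp.
  - by apply: filterS E => x -> _.
split => //; apply: EFin_inj; rewrite !Rint_EFin//.
rewrite -(integral12_prod_meas1 jf); apply: ae_eq_integral => //.
- exact: measurable_int jF'.
- exact: measurable_int jF.
- by apply: filterS E => x -> _.
Qed.

Lemma rint_fubini2 f : rint (m1 \x m2)%E f ->
  rint m2 (fun y => \int[m1]_x f (x, y)) /\
  \int[m2]_y \int[m1]_x f (x, y) = \int[(m1 \x m2)%E]_z f z.
Proof.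
move=> jf; have mf := rint_measurable jf.
have mE : measurable_fun setT (EFin \o f) by exact/measurable_EFinP.
have E : {ae m2, forall x, fubini_G m1 (EFin \o f) x = (EFin (\int[m1]_y f (y, x)))}.
  by apply: filterS (ae_integrable2 jf) => x jx; rewrite Rint_EFin.
have jF' : rint m2 (fun x => \int[m1]_y f (y, x)).
  apply/integrableP; split; first exact/measurable_EFinP/measurable_Rint2.
  apply: le_lt_trans ((integrable21ltyP _ _ mE).1 jf).
  apply: ae_ge0_le_integral => //=.
  - by apply/measurable_EFinP/measurableT_comp => //; exact: measurable_Rint2.
  - by move=> x _; exact: integral_ge0.
  - apply: (measurable_fun_fubini_tonelli_G (fun z => `|f z|%:E)) => //.
    by apply/measurable_EFinP/measurableT_comp.
  - apply: filterS (ae_integrable2 jf) => y jy _.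
    rewrite EFin_normr_Rintegral//; apply: le_abse_integral => //.
    exact: measurable_int jy.
split => //; apply: EFin_inj; rewrite !Rint_EFin//.
rewrite -(integral21_prod_meas1 jf); apply: ae_eq_integral => //.
- exact: measurable_int jF'.
- exact: measurable_fubini_G jf.
- by apply: filterS E => x -> _.
Qed.

Lemma rint_prod_le f (g : X -> R) : measurable_fun setT f -> rint m1 g ->
  {ae m1, forall x, (\int[m2]_y `|f (x, y)|%:E <= (g x)%:E)%E} ->
  rint (m1 \x m2)%E f.
Proof.
move=> mf jg fg.
apply/(integrable12ltyP _ _ _).2; first exact/measurable_EFinP.
apply: (@le_lt_trans _ _ (\int[m1]_x `|g x|%:E)%E); last by case/integrableP : jg.
apply: ae_ge0_le_integral => //=.
- by move=> x _; exact: integral_ge0.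
- apply: (measurable_fun_fubini_tonelli_F (fun z => `|f z|%:E)) => //.
  by apply/measurable_EFinP/measurableT_comp.
- by apply/measurable_EFinP/measurableT_comp => //; exact: rint_measurable jg.
- by apply: filterS fg => x h _; apply: le_trans h _; rewrite lee_fin ler_norm.
Qed.

End fubini_real.

(** * Open sets and continuous functions are Borel on R^N *)

Section rV_borel.
Variables (R : realType) (N : nat).
Local Notation E := 'rV[R]_N.

(** The sigma-algebra is generated by the coordinates, so the open set is written as a countable
    union of cubes with rational centres. *)
Lemma measurable_rV_open (A : set E) : open A -> measurable A.
Proof.
move=> oA.
pose B (p : {ffun 'I_N -> rat} * nat) : set E :=
  [set x | forall i, x 0 i \in `](ratr (p.1 i) - p.2.+1%:R^-1), (ratr (p.1 i) + p.2.+1%:R^-1)[].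
have mB p : measurable (B p).
  rewrite (_ : B p = \bigcap_(i in [set: 'I_N])
    ((fun x : E => x 0 i : measurableTypeR R) @^-1` `](ratr (p.1 i) - p.2.+1%:R^-1), (ratr (p.1 i) + p.2.+1%:R^-1)[)); last first.
    by apply/seteqP; split => [x h i _|x h i]; [exact: h|exact: (h i I)].
  apply: fin_bigcap_measurable => // i _.
  rewrite -[X in measurable X]setTI; exact: measurable_rV_coord.
rewrite (_ : A = \bigcup_p (if `[< B p `<=` A >] then B p else set0)); last first.
  apply/seteqP; split => [x Ax|x [p _]]; last first.
    by case: ifPn => // /asboolP; exact.
  have /nbhs_ballP[r r0 xrA] : nbhs x A by exact: open_nbhs_nbhs.
  (* Two points of a cube of half-side 1/(n+1) are then less than [r] apart in every coordinate. *)
  have [n _ hn] : \forall n \near \oo, (n.+1%:R^-1 : R) < r / 2.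
    by have := near_infty_natSinv_lt (PosNum (divr_gt0 r0 (ltr0n _ 2))); exact.
  have {}hn := hn n (leqnn n).
  have hq (i : 'I_N) : exists q : rat, ratr q \in `](x 0 i - n.+1%:R^-1), (x 0 i + n.+1%:R^-1)[.
    by apply: rat_in_itvoo; rewrite ltrBlDr -addrA ltrDl addr_gt0.
  have [q {}hq] := choice hq.
  exists ([ffun i => q i], n) => //.
  have Bx : B ([ffun i => q i], n) x.
    move=> i /=; rewrite ffunE; have := hq i; rewrite !in_itv/= => /andP[? ?].
    by apply/andP; split; [rewrite ltrBlDr|rewrite -ltrBlDr].
  rewrite asboolT// => y By.
  apply: xrA; rewrite -ball_normE /ball_ /= [`|_|]mx_normrE.
  apply: bigmax_lt => // -[i0 i] _ /=; rewrite !mxE (ord1 i0).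
  have near_center (c a b e : R) : e < r / 2 -> c - e < a -> a < c + e ->
      c - e < b -> b < c + e -> `|a - b| < r.
    by move=> *; rewrite ltr_norml; apply/andP; split; lra.
  move: (Bx i) (By i); rewrite /= !ffunE !in_itv/= => /andP[? ?] /andP[? ?].
  by apply: (near_center (ratr (q i)) _ _ n.+1%:R^-1).
apply: countable_bigcupT_measurable; first exact: countableP.
by move=> p; case: ifP.
Qed.

Lemma continuous_rV_measurable (f : E -> R) :
  continuous f -> measurable_fun setT f.
Proof.
move=> /continuousP cf; apply: (measurability _ (RGenOpens.measurableE R)).
move=> _ [_ [a [b ->]] <-]; rewrite setTI; apply: measurable_rV_open.
by apply: cf; exact: interval_open.
Qed.

End rV_borel.

(** * Measure-preserving flows *)

Section preserving.
Variable R : realType.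

Definition preserves d (X : measurableType d) (m : {measure set X -> \bar R}) (s : X -> X) :=
  measurable_fun setT s /\ forall A, measurable A -> m (s @^-1` A) = m A.

Lemma preserves_id d (X : measurableType d) (m : {measure set X -> \bar R}) : preserves m id.
Proof. by split. Qed.

(** The image measure agrees with the product measure on rectangles, and these determine it. *)
Lemma preserves_prod d1 d2 (X : measurableType d1) (Y : measurableType d2)
  (m1 : {sigma_finite_measure set X -> \bar R}) (m2 : {sigma_finite_measure set Y -> \bar R})
  (s1 : X -> X) (s2 : Y -> Y) : preserves m1 s1 -> preserves m2 s2 ->
  preserves (m1 \x m2)%E (fun z => (s1 z.1, s2 z.2)).
Proof.
move=> [ms1 p1] [ms2 p2].
have ms : measurable_fun setT (fun z : X * Y => (s1 z.1, s2 z.2)).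
  by apply/measurable_fun_pair; exact: measurableT_comp.
split => // A mA; apply/esym.
pose m' := measure_function_pushforward__canonical__measure_function_Measure (m1 \x m2)%E ms.
apply: (product_measure_unique (m' := m')) => // B C mB mC.
rewrite /m' /= /pushforward (_ : _ @^-1` (B `*` C) = (s1 @^-1` B) `*` (s2 @^-1` C))//.
have m1B : measurable (s1 @^-1` B) by rewrite -[X in measurable X]setTI; exact: ms1.
have m2C : measurable (s2 @^-1` C) by rewrite -[X in measurable X]setTI; exact: ms2.
by rewrite product_measure1E// p1// p2.
Qed.

Section change_of_variables.
Context d (X : measurableType d) (m : {measure set X -> \bar R}) (s : X -> X).
Hypothesis ps : preserves m s.

Lemma preserves_integral (f : X -> \bar R) : measurable_fun setT f ->
  (forall x, 0 <= f x)%E -> (\int[m]_x f (s x) = \int[m]_x f x)%E.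
Proof.
case: ps => ms p mf f0.
rewrite -[LHS](ge0_integral_pushforward ms m measurableT)//.
by apply: eq_measure_integral => A mA _; exact: p.
Qed.

Lemma preserves_rint (f : X -> R) : rint m f -> rint m (fun x => f (s x)).
Proof.
move=> jf; have mf := rint_measurable jf; have [ms p] := ps.
apply/integrableP; split; first exact/measurable_EFinP/measurableT_comp.
rewrite (preserves_integral (f := fun x => `|f x|%:E))//.
- by case/integrableP : jf.
- by apply/measurable_EFinP/measurableT_comp.
Qed.

Lemma preserves_Rint (f : X -> R) : rint m f -> \int[m]_x f (s x) = \int[m]_x f x.
Proof.
move=> jf; have mf : measurable_fun setT (EFin \o f) by exact: measurable_int jf.
have Ep : (\int[m]_x (EFin \o f)^\+ (s x) = \int[m]_x (EFin \o f)^\+ x)%E.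
  by apply: preserves_integral => //; exact: measurable_funepos.
have En : (\int[m]_x (EFin \o f)^\- (s x) = \int[m]_x (EFin \o f)^\- x)%E.
  by apply: preserves_integral => //; exact: measurable_funeneg.
rewrite /Rintegral; congr fine; rewrite [LHS]integralE [RHS]integralE.
rewrite -Ep -En; by congr (_ - _)%E; apply: eq_integral => x _; [rewrite !funeposE|rewrite !funenegE].
Qed.

End change_of_variables.

Lemma lebesgue_shift (a : R) :
  preserves (@lebesgue_measure R) (fun x => x + a).
Proof.
have ms : measurable_fun setT (fun x : measurableTypeR R => x + a : measurableTypeR R).
  exact: (@measurable_funD _ (measurableTypeR R) R setT (fun x => x) (fun=> a)).
split => // A mA; apply/esym.
pose m' := measure_function_pushforward__canonical__measure_function_Measure (@lebesgue_measure R) ms.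
change (lebesgue_measure A = m' A).
apply: lebesgue_measure_unique => // _ [[x y] /= xy <-].
rewrite /m' /= /pushforward.
rewrite (_ : _ @^-1` _ = `]x - a, y - a]%classic); last first.
  by apply/seteqP; split => z /=; rewrite !in_itv/= => /andP[? ?]; apply/andP; split; lra.
rewrite !lebesgue_measure_itv/= !lte_fin ltrD2r; case: ifP => // _.
by rewrite -!EFinD opprB addrA subrK.
Qed.

(** By induction: through [consrV], a shift is the product of a shift of the first coordinate and a
    shift in one dimension less. *)
Lemma lebesgue_rV_shift N (a : 'rV[R]_N) :
  preserves (lebesgue_rV R N) (fun x => x + a).
Proof.
elim: N a => [|n IH] a.
  rewrite (_ : (fun x => _) = id); first exact: preserves_id.
  by apply/funext => x; apply/rowP => -[].
have ms : measurable_fun setT (fun x : 'rV[R]_n.+1 => x + a).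
  apply: measurable_fun_rVP => i.
  rewrite (_ : (fun x => _) = fun x : 'rV[R]_n.+1 => x 0 i + a 0 i); last first.
    by apply/funext => x; rewrite mxE.
  by apply: measurable_funD => //; exact: measurable_rV_coord.
split => // A mA.
pose a' : 'rV[R]_n := \row_i a 0 (lift 0 i).
have [ms' p'] := preserves_prod (lebesgue_shift (a 0 0)) (IH a').
have mB : measurable (@consrV R n @^-1` A).
  by rewrite -[X in measurable X]setTI; exact: measurable_consrV.
rewrite /= /lebesgue_rV_step /pushforward -[RHS](p' _ mB).
congr ((_ \x _)%E _); apply/seteqP.
suff H z : consrV z + a = consrV (z.1 + a 0 0, z.2 + a').
  by split => z /=; rewrite H.
apply/rowP => i; rewrite /consrV mxE.
case: (splitP (i : 'I_(1 + n))) => [j ij|j ij].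
- have -> : (i : 'I_(1 + n)) = lshift n j by exact/val_inj.
  rewrite (ord1 j); rewrite [X in X + _ = _](row_mxEl (const_mx z.1 : 'rV[R]_1) z.2 0 0).
  rewrite [RHS](row_mxEl (const_mx _ : 'rV[R]_1) _ 0 0) !mxE.
  by congr (_ + a 0 _); exact/val_inj.
- have -> : (i : 'I_(1 + n)) = rshift 1 j by exact/val_inj.
  rewrite [X in X + _ = _](row_mxEr (const_mx z.1 : 'rV[R]_1) z.2 0 j).
  rewrite [RHS](row_mxEr (const_mx _ : 'rV[R]_1) _ 0 j) !mxE.
  by congr (_ + a 0 _); exact/val_inj.
Qed.

(* The integral over X of h(tau_1 x) - h(x) vanishes by invariance and, by
   Fubini, equals the integral of the derivative of h along the flow. *)
Lemma flow_integral0 d (X : measurableType d) (m : {sigma_finite_measure set X -> \bar R})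
  (tau : R -> X -> X) (h Dh : X -> R) :
  measurable_fun setT (fun p : R * X => tau p.1 p.2) ->
  (forall u, preserves m (tau u)) -> rint m h -> rint m Dh ->
  (forall x, h (tau 1 x) - h x =
     \int[@lebesgue_measure R]_(u in `[0, 1]) Dh (tau u x)) ->
  \int[m]_x Dh x = 0.
Proof.
move=> mtau ptau jh jD ftc.
pose D01 : set R := `[0, 1]%classic.
have m01 : measurable D01 by exact: measurable_itv.
pose g (p : R * X) : R := Dh (tau p.1 p.2) * \1_D01 p.1.
have mD := rint_measurable jD.
have mg : measurable_fun setT g.
  apply: measurable_funM; first exact: measurableT_comp.
  by apply: measurableT_comp => //; exact: measurable_indic.
have j01 : rint (@lebesgue_measure R) (\1_D01 : R -> R).
  exact: integrable_indic_itv.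
have e01 : \int[@lebesgue_measure R]_u \1_D01 u = 1.
  have l01 : lebesgue_measure D01 = 1%E.
    by rewrite lebesgue_measure_itv/= lte_fin ltr01 -EFinD subr0.
  by rewrite /Rintegral integral_indic// setIT; exact: (congr1 fine l01).
have jg : rint (@lebesgue_measure R \x m)%E g.
  (* By invariance every slice at a time [u] in [0, 1] has the L^1 norm of [Dh]. *)
  apply: (@rint_prod_le _ _ (measurableTypeR R) X R (@lebesgue_measure R) m g (fun u => (\int[m]_x `|Dh x|) * \1_D01 u)) => //.
    exact: rintZl.
  apply/nearW => u /=.
  under eq_integral do rewrite normrM EFinM muleC.
  rewrite /=.
  rewrite ge0_integralZl//; last 1 first.
  - by apply/measurable_EFinP/measurableT_comp => //; apply: measurableT_comp => //;
      case: (ptau u).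
  rewrite (preserves_integral (ptau u) (f := fun x => `|Dh x|%:E))//; last first.
    by apply/measurable_EFinP/measurableT_comp.
  rewrite -Rint_EFin; last exact: rint_norm.
  by rewrite -EFinM lee_fin mulrC ger0_norm.
have [_ F1] := rint_fubini1 jg; have [_ F2] := rint_fubini2 jg.
have : \int[m]_x (\int[@lebesgue_measure R]_u g (u, x)) = 0.
  under eq_Rintegral => x _.
    have -> : \int[@lebesgue_measure R]_u g (u, x) = h (tau 1 x) - h x.
      rewrite ftc [RHS]Rintegral_mkcond; apply: eq_Rintegral => u _.
      by rewrite patch_indic.
    over.
  rewrite RintegralB//; last exact: preserves_rint.
  by rewrite (preserves_Rint (ptau 1))// subrr.
have E u : \int[m]_y g (u, y) = (\int[m]_x Dh x) * \1_D01 u.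
  rewrite /g /= RintegralZr//; last exact: preserves_rint.
  by rewrite (preserves_Rint (ptau u)).
rewrite F2 -F1; under eq_Rintegral do rewrite E.
by rewrite RintegralZl// e01 mulr1.
Qed.

End preserving.

(** * The fundamental theorem of calculus along a line *)

Section derivative_along_line.
Variables (R : realType) (V : normedModType R).

Lemma is_derive_line (h : V -> R) (x e : V) (u : R) :
  derivable h (x + u *: e) e ->
  is_derive u 1 (fun s : R => h (x + s *: e)) ('D_e h (x + u *: e)).
Proof.
move=> dh.
have E : (fun w : R => w^-1 *: (h (x + (w *: (1 : R) + u) *: e) - h (x + u *: e)))
       = (fun w : R => w^-1 *: (h (w *: e + (x + u *: e)) - h (x + u *: e))).
  by apply/funext => w; rewrite scalerDl addrCA addrA [_ *: 1]mulr1 -!addrA.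
by split; rewrite /derivable /derive /= E.
Qed.

Lemma FTC_line (h : V -> R) (x e : V) :
  (forall u : R, derivable h (x + u *: e) e) ->
  continuous (fun u : R => 'D_e h (x + u *: e)) ->
  h (x + e) - h x = \int[@lebesgue_measure R]_(u in `[0, 1]) 'D_e h (x + u *: e).
Proof.
move=> dh ch; pose F (s : R) := h (x + s *: e).
have dF (u : R) : is_derive u 1 F ('D_e h (x + u *: e)) by exact: is_derive_line.
rewrite /Rintegral (@continuous_FTC2 _ _ F)//=.
- by rewrite /F scale1r scale0r addr0.
- exact: continuous_subspaceT.
- have cF : continuous F.
    by move=> u; apply/differentiable_continuous/derivable1_diffP; case: (dF u).
  by split => [u _||]; [case: (dF u)|apply: cvg_at_right_filter; exact: cF|apply: cvg_at_left_filter; exact: cF].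
- by move=> u _; rewrite derive1E; exact: derive_val.
Qed.

End derivative_along_line.

(** Lebesgue measure with its carrier and sigma-finite structure made explicit, so that it can be a
    factor of [prodm]. *)
Definition lebR (R : realType) : {sigma_finite_measure set (measurableTypeR R) -> \bar R} :=
  @lebesgue_measure R.

(** * Integrals of functions not known to be measurable *)

Section nonmeasurable.
Context d (X : measurableType d) (R : realType) (mu : {measure set X -> \bar R}).
Import HBNNSimple.

(** A simple function below [f] keeps its integral when set to 0 on the exceptional null set, and is
    then below [g] everywhere. *)
Lemma ge0_ae_le_integral_nonmeasurable (f g : X -> \bar R) :
  (forall x, 0 <= f x)%E -> (forall x, 0 <= g x)%E ->
  {ae mu, forall x, (f x <= g x)%E} -> (\int[mu]_x f x <= \int[mu]_x g x)%E.
Proof.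
move=> f0 g0 [A [mA A0 fgA]].
rewrite [X in (X <= _)%E]ge0_integralTE//; apply/ge_ereal_sup => _ [h hf <-].
have mAc : measurable (~` A) by exact: measurableC.
pose h' x := ((h x * \1_(~` A) x)%:E)%E.
have -> : sintegral mu h = (\int[mu]_x h' x)%E.
  rewrite -integralT_nnsfun; apply: ae_eq_integral => //.
  - by apply/measurable_EFinP; exact: measurable_funP.
  - apply/measurable_EFinP/measurable_funM; first exact: measurable_funP.
    exact: measurable_indic.
  - exists A; split => // x /= Ax; apply: contrapT => nAx; apply: Ax => _.
    by rewrite /h' indicE mem_set// mulr1.
apply: ge0_le_integral_nonmeasurable => x.
  by rewrite lee_fin mulr_ge0// indicE.
rewrite /h' indicE; have [xA|xA] := boolP (x \in ~` A); last by rewrite mulr0.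
rewrite mulr1; apply: le_trans (hf x) _.
by apply: contrapT => nfg; move: xA; rewrite inE => /=; apply; exact: fgA.
Qed.

Lemma ae_eq_integral_nonmeasurable (f g : X -> \bar R) :
  {ae mu, forall x, f x = g x} -> (\int[mu]_x f x = \int[mu]_x g x)%E.
Proof.
move=> fg; rewrite integralE [RHS]integralE.
have E (a b : X -> \bar R) : (forall x, 0 <= a x)%E -> (forall x, 0 <= b x)%E ->
    {ae mu, forall x, a x = b x} -> (\int[mu]_x a x = \int[mu]_x b x)%E.
  move=> a0 b0 ab; apply/eqP; rewrite eq_le; apply/andP; split;
    apply: ge0_ae_le_integral_nonmeasurable => //.
  - by apply: filterS ab => x ->.
  - by apply: filterS ab => x ->.
congr (_ - _)%E; apply: E => //.
- by apply: filterS fg => x fgx; rewrite !funeposE fgx.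
- by apply: filterS fg => x fgx; rewrite !funenegE fgx.
Qed.

Lemma ae_eq_Rint_nonmeasurable (f g : X -> R) :
  {ae mu, forall x, f x = g x} -> \int[mu]_x f x = \int[mu]_x g x.
Proof.
move=> fg; rewrite /Rintegral; congr fine; apply: ae_eq_integral_nonmeasurable.
by apply: filterS fg => x ->.
Qed.

(** Division by [c] carries the simple functions below [c f] to simple functions below [f]. *)
Lemma lower_integralZl (f : X -> \bar R) (c : R) : (forall x, 0 <= f x)%E -> 0 <= c ->
  (\int[mu]_x (c%:E * f x) <= c%:E * \int[mu]_x f x)%E.
Proof.
move=> f0 c0.
have [->|cn0] := eqVneq c 0.
  by under eq_integral do rewrite mul0e; rewrite integral0 mul0e.
have cp : 0 < c by rewrite lt_neqAle eq_sym cn0.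
rewrite ge0_integralTE; last by move=> x; rewrite mule_ge0.
apply/ge_ereal_sup => _ [h hf <-].
have cV0 : 0 <= c^-1 by rewrite invr_ge0.
rewrite -integralT_nnsfun.
have -> : (\int[mu]_x (h x)%:E = c%:E * \int[mu]_x ((c^-1 * h x)%:E))%E.
  rewrite -ge0_integralZl//.
  - by apply: eq_integral => x _; rewrite -EFinM mulrA divff// mul1r.
  - by apply/measurable_EFinP/measurable_funM => //; exact: measurable_funP.
  - by move=> x _; rewrite lee_fin mulr_ge0.
apply: lee_wpmul2l => //; apply: ge0_le_integral_nonmeasurable => x.
  by rewrite lee_fin mulr_ge0.
by rewrite -(@lee_pmul2l _ c%:E)// -EFinM mulrA divff// mul1r; exact: hf.
Qed.

(* L need not be measurable, so that the hypothesis on L only concerns its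
   lower integral. *)
Lemma integral_le_lower (q L : X -> \bar R) (V : X -> R) (c : R) (B : \bar R) :
  measurable_fun setT q -> (forall x, 0 <= q x)%E -> rint mu V ->
  (forall x, 0 <= V x) -> 0 <= c ->
  {ae mu, forall x, (q x <= c%:E * `|L x| `^ 2 + (V x)%:E)%E} ->
  (\int[mu]_x (`|L x| `^ 2) <= B)%E ->
  (\int[mu]_x q x <= c%:E * B + (\int[mu]_x V x)%:E)%E.
Proof.
move=> mq q0 jV V0 c0 qL LB.
have mV : measurable_fun setT (EFin \o V) by exact: measurable_int jV.
(* The integrable part [V] is moved to the left, so that the right-hand side is a multiple of the
   nonmeasurable term alone; monotonicity and scaling of lower integrals then suffice. *)
pose q' x := maxe (q x - (V x)%:E)%E 0%E.
have mq' : measurable_fun setT q'.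
  by apply: measurable_maxe => //; exact: emeasurable_funB.
apply: (@le_trans _ _ (\int[mu]_x (q' x + (V x)%:E))%E).
  apply: ge0_le_integral => //; first exact: emeasurable_funD.
  move=> x _; rewrite -leeBlDr//; by rewrite /q' le_max lexx.
rewrite ge0_integralD//; last 2 first.
- by move=> x _; rewrite /q' le_max lexx orbT.
- by move=> x _; rewrite lee_fin.
rewrite Rint_EFin//; apply: leeD => //.
apply: (@le_trans _ _ (c%:E * \int[mu]_x (`|L x| `^ 2))%E); last first.
  exact: lee_wpmul2l.
have H : (\int[mu]_x q' x <= \int[mu]_x (c%:E * `|L x| `^ 2))%E.
  apply: ge0_ae_le_integral_nonmeasurable.
  - by move=> x; rewrite /q' le_max lexx orbT.
  - by move=> x; rewrite mule_ge0// poweR_ge0.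
  apply: filterS qL => x qLx; rewrite /q' ge_max; apply/andP; split.
    by rewrite leeBlDr.
  by rewrite mule_ge0// poweR_ge0.
apply: le_trans H _; apply: lower_integralZl => // x; exact: poweR_ge0.
Qed.

End nonmeasurable.

(* A copy of the library's product measure, whose sigma-finite structure is not
   inferred for products of measures that are merely sigma-finite. *)
Section sigma_finite_product_measure.
Context d1 d2 (X : measurableType d1) (Y : measurableType d2) (R : realType).
Variables (m1 : {sigma_finite_measure set X -> \bar R}).
Variables (m2 : {sigma_finite_measure set Y -> \bar R}).

Definition prodm : set (X * Y) -> \bar R := (m1 \x m2)%E.

HB.instance Definition _ := Measure.copy prodm (m1 \x m2)%E.

HB.instance Definition _ := @Measure_isSigmaFinite.Build _ _ _
  prodm (sigma_finite_product m1 m2).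

End sigma_finite_product_measure.

(** * Integrals over pairs of particles and velocity moments *)

Section products.
Context (R : realType).

Lemma rint_mul_prod d1 d2 (X : measurableType d1) (Y : measurableType d2)
  (m1 : {sigma_finite_measure set X -> \bar R})
  (m2 : {sigma_finite_measure set Y -> \bar R}) (a : X -> R) (b : Y -> R) :
  rint m1 a -> rint m2 b -> rint (m1 \x m2)%E (fun z => a z.1 * b z.2).
Proof.
move=> ja jb; have ma := rint_measurable ja; have mb := rint_measurable jb.
apply: (rint_prod_le (g := fun x => `|a x| * \int[m2]_y `|b y|)).
- by apply: measurable_funM; exact: measurableT_comp.
- by apply: rintZr; exact: rint_norm.
apply/nearW => x /=; under eq_integral do rewrite normrM EFinM.
rewrite ge0_integralZl//=.
- by rewrite -Rint_EFin//; exact: rint_norm.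
- by apply/measurable_EFinP/measurableT_comp.
Qed.

Context d (E : measurableType d) (l : {sigma_finite_measure set E -> \bar R}).
Variables (U : E * E -> R) (q1 q2 : E -> R) (h : E * E -> R) (C : R).
Local Notation m := (prodm l l).
Hypothesis j1 : rint m (fun z => q1 z.2 * U z).
Hypothesis j2 : rint m (fun z => q2 z.2 * U z).
Hypothesis mh : measurable_fun setT h.
Hypothesis hC : forall z, `|h z| <= C.

Let M1 x := \int[l]_v (q1 v * U (x, v)).
Let M2 x := \int[l]_v (q2 v * U (x, v)).
Let g (p : (E * E) * (E * E)) :=
  h (p.1.1, p.2.1) * (q1 p.1.2 * U p.1) * (q2 p.2.2 * U p.2).

Let mp11 : measurable_fun setT (fun p : (E * E) * (E * E) => (p.1.1, p.2.1)).
Proof.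
by apply/measurable_fun_pair; apply: measurableT_comp.
Qed.

Lemma rint_pair : rint (m \x m)%E g.
Proof.
have jj := rint_mul_prod j1 j2.
have mj := rint_measurable jj.
apply: (le_rint (g := fun p => C * `|(q1 p.1.2 * U p.1) * (q2 p.2.2 * U p.2)|)).
- rewrite /g; under eq_fun do rewrite -mulrA.
  apply: measurable_funM => //; exact: measurableT_comp.
- by apply: rintZl; exact: rint_norm.
- by move=> p; rewrite /g -mulrA normrM ler_wpM2r.
Qed.

Lemma Rint_fiber (x : E) : \int[m]_z' (h (x, z'.1) * (q2 z'.2 * U z')) = \int[l]_y (h (x, y) * M2 y).
Proof.
have jh : rint m (fun z' : E * E => h (x, z'.1) * (q2 z'.2 * U z')).
  apply: (le_rint (g := fun z' => C * `|q2 z'.2 * U z'|)).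
  - apply: measurable_funM; last exact: rint_measurable j2.
    by apply: measurableT_comp => //; apply: measurableT_comp => //.
  - by apply: rintZl; exact: rint_norm.
  - by move=> p; rewrite normrM ler_wpM2r.
have [_ <-] := rint_fubini1 jh.
apply: ae_eq_Rint_nonmeasurable.
apply: filterS (ae_integrable1 j2) => y jy.
by rewrite /= RintegralZl.
Qed.

(** Integrating out the second particle first leaves the convolution of a moment, the form in which
    the alignment terms occur in the equation. *)
Lemma Rint_pair_conv :
  rint m (fun z => (q1 z.2 * U z) * \int[l]_y (h (z.1, y) * M2 y)) /\
  \int[(m \x m)%E]_p g p =
  \int[m]_z ((q1 z.2 * U z) * \int[l]_y (h (z.1, y) * M2 y)).
Proof.
have [jF <-] := rint_fubini1 rint_pair.
have jg z : \int[m]_z' g (z, z') = (q1 z.2 * U z) * \int[l]_y (h (z.1, y) * M2 y).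
  rewrite -Rint_fiber -RintegralZl//.
    by apply: eq_Rintegral => z' _; rewrite /g /=; ring.
  apply: (le_rint (g := fun z' => C * `|q2 z'.2 * U z'|)).
  - apply: measurable_funM; last exact: rint_measurable j2.
    by apply: measurableT_comp => //; apply: measurableT_comp => //.
  - by apply: rintZl; exact: rint_norm.
  - by move=> p; rewrite normrM ler_wpM2r.
split; last by apply: eq_Rintegral => z _.
by apply: eq_integrable jF => // z _ /=; rewrite jg.
Qed.

(** Integrating out both velocities instead leaves a product of moments, the form of the nonlocal
    term in the theorem. *)
Lemma Rint_pair_moments :
  rint m (fun z => h z * (M1 z.1 * M2 z.2)) /\
  \int[m]_z (h z * (M1 z.1 * M2 z.2)) = \int[(m \x m)%E]_p g p.
Proof.
have [jM1 _] := rint_fubini1 j1; have [jM2 _] := rint_fubini1 j2.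
have jMM := rint_mul_prod jM1 jM2.
have jm : rint m (fun z => h z * (M1 z.1 * M2 z.2)).
  apply: (le_rint (g := fun z => C * `|M1 z.1 * M2 z.2|)).
  - by apply: measurable_funM => //; exact: rint_measurable jMM.
  - by apply: rintZl; exact: rint_norm.
  - by move=> p; rewrite normrM ler_wpM2r.
split => //.
have [jc ->] := Rint_pair_conv.
have [_ <-] := rint_fubini1 jc; have [_ <-] := rint_fubini1 jm.
apply: ae_eq_Rint_nonmeasurable.
apply: filterS (ae_integrable1 j1) => x jx /=.
rewrite RintegralZr// -/(M1 x) -RintegralZl//.
  by apply: eq_Rintegral => y _; ring.
apply: (le_rint (g := fun y => C * `|M2 y|)).
- apply: measurable_funM; last exact: rint_measurable jM2.
  by apply: measurableT_comp => //; exact: pair1_measurable.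
- by apply: rintZl; exact: rint_norm.
- by move=> y; rewrite normrM ler_wpM2r.
Qed.

End products.

Lemma continuous_sumr (V : topologicalType) (R : realType) I (r : seq I) (P : pred I)
  (F : I -> V -> R) : (forall i, continuous (F i)) ->
  continuous (fun x => \sum_(i <- r | P i) F i x).
Proof.
move=> cF; elim: r => [|i r IH].
  by rewrite (_ : (fun x => _) = fun=> 0); [exact: cst_continuous|apply/funext => x; rewrite big_nil].
rewrite (_ : (fun x => _) = fun x => (if P i then F i x else 0) + \sum_(i <- r | P i) F i x); last first.
  by apply/funext => x; rewrite big_cons; case: ifP => // _; rewrite add0r.
move=> x; apply: cvgD; last exact: IH.
by case: (P i); [exact: cF|exact: cvg_cst].
Qed.

(** * The Euclidean norm on row vectors *)

Section euclidean_norm.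
Variables (R : realType) (N : nat).
Local Notation E := 'rV[R]_N.
Implicit Types x y : E.

Lemma enorm_ge0 x : 0 <= enorm x.
Proof. exact: sqrtr_ge0. Qed.

Lemma dot_ge0 x : 0 <= dot x x.
Proof. by apply: sumr_ge0 => i _; rewrite -expr2 sqr_ge0. Qed.

Lemma enorm_sqr x : enorm x ^+ 2 = \sum_(i < N) x 0 i ^+ 2.
Proof. by rewrite sqr_sqrtr ?dot_ge0//; apply: eq_bigr => i _; rewrite expr2. Qed.

Lemma coord_le_enorm x i : `|x 0 i| <= enorm x.
Proof.
rewrite -(@ler_pXn2r _ 2)// ?nnegrE ?enorm_ge0// enorm_sqr real_normK ?num_real//.
by rewrite (bigD1 i)//= lerDl; apply: sumr_ge0 => k _; exact: sqr_ge0.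
Qed.

Lemma norm_le_enorm x : `|x| <= enorm x.
Proof.
rewrite [`|x|]mx_normrE; apply: bigmax_le => [|[a b] _ /=]; first exact: enorm_ge0.
by rewrite (ord1 a); exact: coord_le_enorm.
Qed.

Lemma coord_le_norm x i : `|x 0 i| <= `|x|.
Proof.
by rewrite [`|x|]mx_normrE; apply: (le_bigmax _ (fun ij : 'I_1 * 'I_N => `|x ij.1 ij.2|) (0, i)).
Qed.

Lemma enorm_le x : enorm x <= Num.sqrt N%:R * `|x|.
Proof.
rewrite -(@ler_pXn2r _ 2)// ?nnegrE ?enorm_ge0 ?mulr_ge0 ?sqrtr_ge0//.
rewrite enorm_sqr exprMn sqr_sqrtr// mulr_natl -[X in _ *+ X]card_ord -sumr_const.
apply: ler_sum => i _; rewrite -(@real_normK _ (x 0 i)) ?num_real//.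
by rewrite ler_pXn2r ?nnegrE// coord_le_norm.
Qed.

Lemma continuous_coord i : continuous (fun x : E => x 0 i).
Proof. exact: coord_continuous. Qed.

Lemma continuous_enorm : continuous (@enorm R N).
Proof.
move=> x; apply: (@continuous_comp _ _ _ (fun x : E => dot x x) Num.sqrt).
  apply: continuous_sumr => i.
  by move=> y; exact: (cvgM (@coord_continuous R 1 N 0 i y) (@coord_continuous R 1 N 0 i y)).
exact: sqrt_continuous.
Qed.

Lemma measurable_enorm : measurable_fun setT (@enorm R N).
Proof. by apply: continuous_rV_measurable; exact: continuous_enorm. Qed.

Lemma enormC x y : enorm (x - y) = enorm (y - x).
Proof.
by congr Num.sqrt; apply: eq_bigr => i _; rewrite !mxE; ring.
Qed.

Lemma is_derive_coord (x e : E) i : is_derive x e (fun y : E => y 0 i) (e 0 i).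
Proof.
have H : (fun h : R => h^-1 *: ((h *: e + x) 0 i - x 0 i)) @ 0^' --> e 0 i.
  apply: cvg_near_cst; near=> h; rewrite !mxE addrK.
  rewrite /GRing.scale/= mulrA mulVf ?mul1r//; near: h; exact: nbhs_dnbhs_neq.
by split; [apply/cvg_ex; exists (e 0 i)|exact/cvg_lim].
Unshelve. all: by end_near. Qed.

End euclidean_norm.

(* Derivatives are pointwise limits of difference quotients. *)
Lemma measurable_derivative (R : realType) d (Y : measurableType d)
  (g : R -> Y -> R) (D : Y -> R) :
  (forall s, measurable_fun setT (g s)) ->
  (forall y, is_derive (0 : R) 1 (g^~ y) (D y)) -> measurable_fun setT D.
Proof.
move=> mg dg.
pose q (n : nat) y : R := n.+1%:R * (g n.+1%:R^-1 y - g 0 y).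
apply: (@measurable_fun_cvg _ _ _ setT q).
  by move=> n; apply: measurable_funM => //; exact: measurable_funB.
move=> y _; have [dgy <-] := dg y.
have h0 : (n.+1%:R^-1 : R) @[n --> \oo] --> (0 : R) by exact: cvg_harmonic.
have hd : (n.+1%:R^-1 : R) @[n --> \oo] --> (0 : R)^'.
  move=> A dA; change (\forall n \near \oo, A n.+1%:R^-1).
  have H : \forall n \near \oo, [set y | y != 0 -> A y] (n.+1%:R^-1 : R) by exact: h0 dA.
  by apply: filterS H => n; apply; rewrite invr_eq0 pnatr_eq0.
have := cvg_comp _ _ hd dgy.
rewrite /derive/=; apply: cvg_trans; apply: near_eq_cvg; near=> n.
by rewrite /= invrK addr0 [_ *: 1]mulr1.
Unshelve. all: by end_near. Qed.

(** * The convolution kernel *)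

Section kernel.
Variables (R : realType) (N : nat) (lam eps : R).
Hypotheses (eps_gt0 : 0 < eps) (lam_gt0 : 0 < lam).
Local Notation E := 'rV[R]_N.

Definition clam : R := 2 `^ lam^-1 - 1.

Lemma clam_gt0 : 0 < clam.
Proof.
have l0 : 0 < lam^-1 by rewrite invr_gt0.
have := gt0_ltr_powR l0 (x := 1) (y := 2); rewrite !nnegrE ltr1n powR1 subr_gt0.
exact.
Qed.

Lemma phi_kernelE r : phi_kernel lam eps r = (eps ^+ 2 + clam * r ^+ 2) `^ (- lam).
Proof. by rewrite /phi_kernel gt_eqF. Qed.

Lemma phi_kernel_ge0 r : 0 <= phi_kernel lam eps r.
Proof. by rewrite phi_kernelE powR_ge0. Qed.

(** The maximum of the kernel, attained at r = 0. It blows up as eps tends to 0 and only serves at a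
    fixed eps, for integrability and for uniform continuity. *)
Definition kphi : R := (eps ^+ 2) `^ (- lam).

Lemma kphi_ge0 : 0 <= kphi.
Proof. exact: powR_ge0. Qed.

Lemma ler_powRN (a b : R) : 0 < a -> a <= b -> b `^ (- lam) <= a `^ (- lam).
Proof.
move=> a0 ab; rewrite !powRN lef_pV2 ?posrE ?powR_gt0//; last exact: lt_le_trans ab.
by apply: ge0_ler_powR; rewrite ?nnegrE// ltW// (lt_le_trans a0).
Qed.

Lemma phi_kernel_le r : phi_kernel lam eps r <= kphi.
Proof.
rewrite phi_kernelE ler_powRN// ?exprn_gt0// lerDl mulr_ge0 ?sqr_ge0//.
exact/ltW/clam_gt0.
Qed.

Lemma norm_phi_kernel_le r : `|phi_kernel lam eps r| <= kphi.
Proof. by rewrite ger0_norm ?phi_kernel_ge0 ?phi_kernel_le. Qed.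

Lemma measurable_rV_sub : measurable_fun setT (fun z : E * E => z.1 - z.2).
Proof.
apply: measurable_fun_rVP => i.
rewrite (_ : (fun z => _) = fun z : E * E => z.1 0 i - z.2 0 i); last first.
  by apply/funext => z; rewrite !mxE.
by apply: measurable_funB; apply: (measurableT_comp (measurable_rV_coord i)).
Qed.

Lemma measurable_phi_kernel :
  measurable_fun setT (fun z : E * E => phi_kernel lam eps (enorm (z.1 - z.2))).
Proof.
have H : measurable_fun setT (fun z : E * E => eps ^+ 2 + clam * enorm (z.1 - z.2) ^+ 2).
  apply: measurable_funD => //; apply: measurable_funM => //; apply: measurable_funX.
  exact: (measurableT_comp (@measurable_enorm R N) measurable_rV_sub).
rewrite (_ : (fun z => _) = (@powR R ^~ (- lam)) \o
  (fun z : E * E => eps ^+ 2 + clam * enorm (z.1 - z.2) ^+ 2)); last first.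
  by apply/funext => z; rewrite phi_kernelE.
by apply: measurableT_comp H; exact: measurable_powR.
Qed.

End kernel.

(** By Tonelli, a null set of positions remains negligible after velocities are added. This serves
    for the force, whose bound is an essential supremum. *)
Lemma integral_ae_bounded_factor (R : realType) (N : nat) (a : 'rV[R]_N -> R)
    (h : 'rV[R]_N * 'rV[R]_N -> R) (K : R) :
  let l := lebesgue_rV R N in
  measurable_fun setT a -> measurable_fun setT h ->
  (forall x, 0 <= a x) -> (forall z, 0 <= h z) -> 0 <= K ->
  {ae l, forall x, a x <= K} ->
  (\int[prodm l l]_z (a z.1 * h z)%:E <= K%:E * \int[prodm l l]_z (h z)%:E)%E.
Proof.
move=> l ma mh a0 h0 K0 aK.
have mah : measurable_fun setT (fun z : 'rV[R]_N * 'rV[R]_N => (a z.1 * h z)%:E).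
  by apply/measurable_EFinP/measurable_funM => //; exact: measurableT_comp.
have mhE : measurable_fun setT (fun z : 'rV[R]_N * 'rV[R]_N => (h z)%:E).
  exact/measurable_EFinP.
rewrite (fubini_tonelli1 (fun z => (a z.1 * h z)%:E))//=; last first.
  by move=> z; rewrite lee_fin mulr_ge0.
rewrite (fubini_tonelli1 (fun z => (h z)%:E))//=.
rewrite -ge0_integralZl//; last 2 first.
- by apply: (measurable_fun_fubini_tonelli_F (fun z => (h z)%:E)).
- by move=> x _; apply: integral_ge0 => v _; rewrite lee_fin.
apply: ge0_ae_le_integral_nonmeasurable.
- by move=> x; apply: integral_ge0 => v _; rewrite lee_fin mulr_ge0.
- by move=> x; rewrite mule_ge0//; apply: integral_ge0 => v _; rewrite lee_fin.
apply: filterS aK => x aKx.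
rewrite /fubini_F /= -ge0_integralZl//; last 2 first.
- by apply/measurable_EFinP; apply: (measurableT_comp mh); exact: pair1_measurable.
- by move=> v _; rewrite lee_fin.
apply: ge0_le_integral_nonmeasurable => v; first by rewrite lee_fin mulr_ge0.
by rewrite -EFinM lee_fin ler_wpM2r.
Qed.

Lemma continuous_pairl (U V W : topologicalType) (G : U * V -> W) (x : U) :
  continuous G -> continuous (fun w => G (x, w)).
Proof.
move=> cG w; apply: (@continuous_comp _ _ _ (fun w : V => (x, w)) G); last exact: cG.
by apply: cvg_pair => /=; [exact: cvg_cst|exact: cvg_id].
Qed.

Lemma continuous_pairr (U V W : topologicalType) (G : U * V -> W) (w : V) :
  continuous G -> continuous (fun x => G (x, w)).
Proof.
move=> cG x; apply: (@continuous_comp _ _ _ (fun x : U => (x, w)) G); last exact: cG.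
by apply: cvg_pair => /=; [exact: cvg_id|exact: cvg_cst].
Qed.

Section pointwise_continuity.
Variables (R : realType) (V : topologicalType) (f g : V -> R).
Hypotheses (cf : continuous f) (cg : continuous g).

Lemma continuous_mul : continuous (fun x => f x * g x).
Proof. by move=> x; apply: continuousM; [exact: cf|exact: cg]. Qed.

Lemma continuous_add : continuous (fun x => f x + g x).
Proof. by move=> x; apply: continuousD; [exact: cf|exact: cg]. Qed.

Lemma continuous_sub : continuous (fun x => f x - g x).
Proof. by move=> x; apply: continuousB; [exact: cf|exact: cg]. Qed.

Lemma continuous_scale (c : R) : continuous (fun x => c * f x).
Proof. by move=> x; apply: continuousM; [exact: cst_continuous|exact: cf]. Qed.

End pointwise_continuity.

Section pointwise_derivatives.
Variables (R : realType) (V : normedModType R) (f g : V -> R) (x v : V) (df dg : R).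
Hypotheses (f' : is_derive x v f df) (g' : is_derive x v g dg).

Lemma is_derive_mul : is_derive x v (fun y => f y * g y) (f x * dg + g x * df).
Proof. exact: (is_deriveM f' g'). Qed.

Lemma is_derive_add : is_derive x v (fun y => f y + g y) (df + dg).
Proof. exact: (is_deriveD f' g'). Qed.

Lemma is_derive_sub : is_derive x v (fun y => f y - g y) (df - dg).
Proof. exact: (is_deriveB f' g'). Qed.

Lemma is_derive_scale (c : R) : is_derive x v (fun y => c * f y) (c * df).
Proof. exact: (is_deriveZ c f'). Qed.

End pointwise_derivatives.

(** * Integration by parts *)

Section integration_by_parts.
Variables (R : realType) (N : nat).
Local Notation E := 'rV[R]_N.
Local Notation lebN := (lebesgue_rV R N).
Local Notation m := (prodm lebN lebN).
Local Notation e_ i := (delta_mx 0 i : E).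

Lemma measurable_translation (e : E) :
  measurable_fun setT (fun p : R * E => p.2 + p.1 *: e).
Proof.
apply: measurable_fun_rVP => i.
rewrite (_ : (fun p => _) = fun p : R * E => p.2 0 i + p.1 * e 0 i); last first.
  by apply/funext => p; rewrite !mxE.
apply: measurable_funD; first exact: (measurableT_comp (measurable_rV_coord i)).
by apply: measurable_funM => //; exact: measurable_fst.
Qed.

Lemma continuous_line (G : E -> R) (x e : E) : continuous G ->
  continuous (fun u : R => G (x + u *: e)).
Proof.
move=> cG u; apply: (@continuous_comp _ _ _ (fun u : R => x + u *: e) G); last exact: cG.
by apply: cvgD; [exact: cvg_cst|apply: cvgZr_tmp; exact: cvg_id].
Qed.

Lemma FTC_line_is_derive (K DK : E -> R) (e x : E) :
  (forall x, is_derive x e K (DK x)) -> continuous DK ->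
  K (x + 1 *: e) - K x = \int[@lebesgue_measure R]_(u in `[0, 1]) DK (x + u *: e).
Proof.
move=> dK cD; have D u : 'D_e K (x + u *: e) = DK (x + u *: e).
  by have [_] := dK (x + u *: e).
rewrite scale1r (@FTC_line R E K x e).
- by apply: eq_Rintegral => u _; rewrite D.
- by move=> u; case: (dK (x + u *: e)).
- by under eq_fun do rewrite D; exact: continuous_line.
Qed.

(** Integrability of [K] and of its derivative replaces decay at infinity: translations preserve the
    measure, so no boundary term arises. *)
Lemma Rint_derive_x (K DK : E * E -> R) i :
  (forall x v, is_derive x (e_ i) (fun y => K (y, v)) (DK (x, v))) ->
  (forall v, continuous (fun x => DK (x, v))) ->
  rint m K -> rint m DK -> \int[m]_z DK z = 0.
Proof.
move=> dK cD jK jD.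
apply: (@flow_integral0 R _ _ m (fun s z => (z.1 + s *: e_ i, z.2)) K) => //.
- apply/measurable_fun_pair => /=; last by apply: (measurableT_comp measurable_snd).
  have H : measurable_fun setT (fun p : R * (E * E) => (p.1, p.2.1)).
    by apply/measurable_fun_pair => //=; exact: measurableT_comp.
  exact: (measurableT_comp (measurable_translation (e_ i)) H).
- by move=> u; exact: (preserves_prod (lebesgue_rV_shift (u *: e_ i)) (preserves_id lebN)).
- move=> [x v] /=.
  exact: (@FTC_line_is_derive (fun y => K (y, v)) (fun y => DK (y, v))).
Qed.

Lemma Rint_derive_v (K DK : E * E -> R) i :
  (forall x v, is_derive v (e_ i) (fun w => K (x, w)) (DK (x, v))) ->
  (forall x, continuous (fun v => DK (x, v))) ->
  rint m K -> rint m DK -> \int[m]_z DK z = 0.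
Proof.
move=> dK cD jK jD.
apply: (@flow_integral0 R _ _ m (fun s z => (z.1, z.2 + s *: e_ i)) K) => //.
- apply/measurable_fun_pair => /=; first by apply: (measurableT_comp measurable_fst).
  have H : measurable_fun setT (fun p : R * (E * E) => (p.1, p.2.2)).
    by apply/measurable_fun_pair => //=; exact: measurableT_comp.
  exact: (measurableT_comp (measurable_translation (e_ i)) H).
- by move=> u; exact: (preserves_prod (preserves_id lebN) (lebesgue_rV_shift (u *: e_ i))).
- move=> [x v] /=.
  exact: (@FTC_line_is_derive (fun y => K (x, y)) (fun y => DK (x, y))).
Qed.

End integration_by_parts.

(** * A priori estimates for the kinetic equation *)

Section extension.
Variables (R : realType) (T : R) (Z : Type).

Definition ext (g : R -> Z -> R) (p : R * Z) : R :=
  if p.1 \in `]0, T[ then g p.1 p.2 else 0.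

Lemma extE g t z : t \in `]0, T[ -> ext g (t, z) = g t z.
Proof. by rewrite /ext /= => ->. Qed.

Lemma ext0 g t z : t \notin `]0, T[ -> ext g (t, z) = 0.
Proof. by rewrite /ext /= => /negbTE ->. Qed.

End extension.

Section linear_combinations.
Variable R : realType.

Lemma sum_sub2 n (a b : 'I_n -> R) :
  \sum_(i < n) (2 * a i - 2 * b i) = 2 * (\sum_(i < n) a i) - 2 * \sum_(i < n) b i.
Proof. by rewrite sumrB !mulr_sumr. Qed.

Lemma rint_sub2 d (X : measurableType d) (mu : {measure set X -> \bar R}) (h1 h2 : X -> R) :
  rint mu h1 -> rint mu h2 -> rint mu (fun x => 2 * h1 x - 2 * h2 x).
Proof. by move=> j1 j2; apply: rintB; apply: rintZl. Qed.

Lemma Rint_sub2 d (X : measurableType d) (mu : {measure set X -> \bar R}) (h1 h2 : X -> R) :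
  rint mu h1 -> rint mu h2 ->
  \int[mu]_x (2 * h1 x - 2 * h2 x) = 2 * \int[mu]_x h1 x - 2 * \int[mu]_x h2 x.
Proof.
by move=> j1 j2; rewrite RintegralB//; [rewrite !RintegralZl|exact: rintZl|exact: rintZl].
Qed.

(** In [energy], [a1] is the force term, [a2] the kinetic energy, [a3] comes from diffusion, [a4]
    and [a5] from alignment, and [a6] is the integral of |F|^2 f. Young's inequality spends one of
    the two copies of [a2]; the other is kept. *)
Lemma energy_arith (a1 a2 a3 a4 a5 a6 b c n0 k : R) : 2 * (a1 + a2 - a3 + a4 - a5) <= b ->
  - (2 * a1) <= a6 + a2 -> a6 <= c -> a3 <= n0 * k -> a2 + (2 * a4 - 2 * a5) <= b + 2 * (n0 * k) + c.
Proof. set nn := n0 * k; move=> *; lra. Qed.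

Lemma Rint_five d (X : measurableType d) (mu : {measure set X -> \bar R}) (h1 h2 h3 h4 h5 : X -> R) (c : R) :
  rint mu h1 -> rint mu h2 -> rint mu h3 -> rint mu h4 -> rint mu h5 ->
  \int[mu]_x (c * (2 * (h1 x + h2 x + h3 x + h4 x - h5 x))) =
  c * (2 * (\int[mu]_x h1 x + \int[mu]_x h2 x + \int[mu]_x h3 x + \int[mu]_x h4 x - \int[mu]_x h5 x)).
Proof.
move=> j1 j2 j3 j4 j5.
have j12 := rintD j1 j2; have j13 := rintD j12 j3; have j14 := rintD j13 j4.
have j15 := rintB j14 j5.
rewrite RintegralZl//; last exact: rintZl.
by rewrite RintegralZl// RintegralB// RintegralD// RintegralD// RintegralD.
Qed.

End linear_combinations.

Section solution.
Variables (R : realType) (N : nat) (lam T eps : R).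
Local Notation E := 'rV[R]_N.
Local Notation TR := (measurableTypeR R).
Local Notation leb := (lebR R).
Local Notation lebN := (lebesgue_rV R N).
Local Notation m := (prodm lebN lebN).
Local Notation I0T := (`]0, T[%classic : set R).
Variables (F : R -> E -> E) (f0 : E -> E -> R) (f : R -> E -> E -> R).
Hypothesis sol : strong_solution lam T eps F f0 f.
Hypotheses (T_gt0 : 0 < T) (eps_gt0 : 0 < eps) (lam_gt0 : 0 < lam).

(* uu, ux, uv, uvv: the solution and its derivatives, extended by 0 to all
   times, hence integrable over the whole of R x R^N x R^N. *)
Definition uu : TR * (E * E) -> R := ext T (fun t z => f t z.1 z.2).
Definition ux i : TR * (E * E) -> R :=
  ext T (fun t z => partial i (fun y => f t y z.2) z.1).
Definition uv i : TR * (E * E) -> R :=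
  ext T (fun t z => partial i (f t z.1) z.2).
Definition uvv i k : TR * (E * E) -> R :=
  ext T (fun t z => partial k (partial i (f t z.1)) z.2).

Lemma uu_ge0 p : 0 <= uu p.
Proof.
rewrite /uu /ext; case: ifPn => // tT; apply: (solution_ge0 sol).
by apply: subset_itvW tT.
Qed.

Lemma measurable_uu : measurable_fun setT uu.
Proof.
rewrite (_ : uu = (fun p => f p.1 p.2.1 p.2.2) \_ (I0T `*` setT : set (TR * (E * E)))); last first.
  apply/funext => p; rewrite /uu /ext patchE; case: ifPn => pI.
    by rewrite mem_set.
  by rewrite memNset// => -[/= h _]; rewrite h in pI.
apply/(measurable_restrictT _ _).1; first exact: measurableX.
apply: measurable_funS (solution_measurable sol).
- by apply: measurableX => //; exact: measurable_itv.
- by move=> p [/= h _]; split => //=; apply: subset_itvW h.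
Qed.

Section shifts.
Variable (i : 'I_N).

Lemma measurable_shift_x (g : TR * (E * E) -> R) s : measurable_fun setT g ->
  measurable_fun setT (fun p : TR * (E * E) => g (p.1, (p.2.1 + s *: delta_mx 0 i, p.2.2))).
Proof.
move=> mg; apply: measurableT_comp => //; apply/measurable_fun_pair => //=.
apply/measurable_fun_pair => /=; last by apply: measurableT_comp.
have [ms _] := lebesgue_rV_shift (s *: delta_mx 0 i : E).
apply: (measurableT_comp ms); exact: measurableT_comp.
Qed.

Lemma measurable_shift_v (g : TR * (E * E) -> R) s : measurable_fun setT g ->
  measurable_fun setT (fun p : TR * (E * E) => g (p.1, (p.2.1, p.2.2 + s *: delta_mx 0 i))).
Proof.
move=> mg; apply: measurableT_comp => //; apply/measurable_fun_pair => //=.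
apply/measurable_fun_pair => /=; first by apply: measurableT_comp.
have [ms _] := lebesgue_rV_shift (s *: delta_mx 0 i : E).
apply: (measurableT_comp ms); exact: measurableT_comp.
Qed.

End shifts.

Let is_derive_ext (G : E -> R) (x e : E) (b : bool) : (b -> derivable G x e) ->
  is_derive (0 : R) 1 (fun s : R => if b then G (x + s *: e) else 0)
    (if b then 'D_e G x else 0).
Proof.
case: b => dG; last exact: is_derive_cst.
have := @is_derive_line R E G x e 0; rewrite scale0r addr0; apply; exact: dG.
Qed.

Lemma measurable_ux i : measurable_fun setT (ux i).
Proof.
apply: (@measurable_derivative R _ (TR * (E * E))%type
  (fun s p => uu (p.1, (p.2.1 + s *: delta_mx 0 i, p.2.2)))).
  by move=> s; exact: (measurable_shift_x i s measurable_uu).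
move=> [t [x v]]; rewrite /uu /ux /ext /=.
apply: (@is_derive_ext (fun y => f t y v)) => tI.
by have [_ /(_ i)[h _] _ _] := solution_regular sol tI; exact: h.
Qed.

Lemma measurable_uv i : measurable_fun setT (uv i).
Proof.
apply: (@measurable_derivative R _ (TR * (E * E))%type
  (fun s p => uu (p.1, (p.2.1, p.2.2 + s *: delta_mx 0 i)))).
  by move=> s; exact: (measurable_shift_v i s measurable_uu).
move=> [t [x v]]; rewrite /uu /uv /ext /=.
apply: (@is_derive_ext (f t x)) => tI.
by have [_ _ /(_ i)[h _] _] := solution_regular sol tI; exact: h.
Qed.

Lemma measurable_uvv i k : measurable_fun setT (uvv i k).
Proof.
apply: (@measurable_derivative R _ (TR * (E * E))%type
  (fun s p => uv i (p.1, (p.2.1, p.2.2 + s *: delta_mx 0 k)))).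
  by move=> s; exact: (measurable_shift_v k s (measurable_uv i)).
move=> [t [x v]]; rewrite /uvv /uv /ext /=.
apply: (@is_derive_ext (partial i (f t x))) => tI.
by have [_ _ _ /(_ i k)[h _]] := solution_regular sol tI; exact: h.
Qed.

Definition om (z : E * E) : R := (1 + enorm z.2) ^+ 3.

(* The integrand of [weighted_norm]; its integrals at time t are WW and Wr. *)
Definition PP (p : TR * (E * E)) : R := om p.2 *
  (`|uu p| + \sum_(i < N) `|ux i p| + \sum_(i < N) `|uv i p|
   + \sum_(i < N) \sum_(k < N) `|uvv i k p|).

Lemma om_ge1 z : 1 <= om z.
Proof. by rewrite exprn_ege1// lerDl enorm_ge0. Qed.

Lemma om_ge0 z : 0 <= om z.
Proof. exact: le_trans (om_ge1 z). Qed.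

Lemma measurable_om : measurable_fun setT om.
Proof.
apply: measurable_funX; apply: measurable_funD => //.
by apply: measurableT_comp => //; exact: measurable_enorm.
Qed.

Lemma measurable_PP : measurable_fun setT PP.
Proof.
apply: measurable_funM; first by apply: measurableT_comp => //; exact: measurable_om.
have mn (h : TR * (E * E) -> R) : measurable_fun setT h -> measurable_fun setT (fun p => `|h p|).
  by move=> mh; exact: measurableT_comp.
apply: measurable_funD; [apply: measurable_funD; [apply: measurable_funD|]|].
- apply: mn; exact: measurable_uu.
- by apply: measurable_sum => i; apply: mn; exact: measurable_ux.
- by apply: measurable_sum => i; apply: mn; exact: measurable_uv.
- by apply: measurable_sum => i; apply: measurable_sum => k; apply: mn; exact: measurable_uvv.
Qed.

Let sge0 (I0 : finType) (g : I0 -> R) : 0 <= \sum_i `|g i|.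
Proof. exact: sumr_ge0. Qed.

Let ssge0 (I0 : finType) (g : I0 -> I0 -> R) : 0 <= \sum_i \sum_k `|g i k|.
Proof. by apply: sumr_ge0 => i _. Qed.

Let le_sum1 (I0 : finType) (g : I0 -> R) (i : I0) : (forall j, 0 <= g j) -> g i <= \sum_j g j.
Proof. by move=> g0; rewrite (bigD1 i)//= lerDl sumr_ge0. Qed.

Lemma uu_le_PP p : om p.2 * uu p <= PP p.
Proof.
rewrite ler_wpM2l ?om_ge0// -[leLHS]ger0_norm ?uu_ge0//.
by rewrite -!addrA lerDl !addr_ge0.
Qed.

Lemma ux_le_PP i p : om p.2 * `|ux i p| <= PP p.
Proof.
rewrite ler_wpM2l ?om_ge0//.
have : `|ux i p| <= \sum_(i < N) `|ux i p| by rewrite (bigD1 i)//= lerDl sumr_ge0.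
have := sge0 (uv^~ p); have := ssge0 (fun i k => uvv i k p); have := normr_ge0 (uu p).
lra.
Qed.

Lemma uv_le_PP i p : om p.2 * `|uv i p| <= PP p.
Proof.
rewrite ler_wpM2l ?om_ge0//.
have : `|uv i p| <= \sum_(i < N) `|uv i p| by rewrite (bigD1 i)//= lerDl sumr_ge0.
have := sge0 (ux^~ p); have := ssge0 (fun i k => uvv i k p); have := normr_ge0 (uu p).
lra.
Qed.

Lemma uvv_le_PP i k p : om p.2 * `|uvv i k p| <= PP p.
Proof.
rewrite ler_wpM2l ?om_ge0//.
have : `|uvv i k p| <= \sum_(i < N) \sum_(k < N) `|uvv i k p|.
  apply: le_trans (le_sum1 (g := fun i => \sum_(k < N) `|uvv i k p|) i _).
    by apply: (le_sum1 (g := fun k => `|uvv i k p|)).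
  by move=> j; exact: sge0.
have := sge0 (ux^~ p); have := sge0 (uv^~ p); have := normr_ge0 (uu p).
lra.
Qed.

Lemma PP_ge0 p : 0 <= PP p.
Proof. by apply: le_trans (uu_le_PP p); rewrite mulr_ge0 ?om_ge0 ?uu_ge0. Qed.

Lemma PP0 t z : t \notin `]0, T[ -> PP (t, z) = 0.
Proof.
move=> tT; rewrite /PP /uu ext0// normr0.
rewrite !big1 ?addr0 ?mulr0// => i _; rewrite ?big1 ?normr0// => *;
  by rewrite /ux /uv /uvv ext0// normr0.
Qed.

Definition WW (t : TR) : \bar R := (\int[m]_z (PP (t, z))%:E)%E.
Definition Wr (t : TR) : R := \int[m]_z PP (t, z).

Lemma WW_ge0 t : (0 <= WW t)%E.
Proof. by apply: integral_ge0 => z _; rewrite lee_fin PP_ge0. Qed.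

Lemma Wr_ge0 t : 0 <= Wr t.
Proof. by apply: Rintegral_ge0 => z _; exact: PP_ge0. Qed.

Lemma measurable_WW : measurable_fun setT WW.
Proof.
apply: (@measurable_fun_fubini_tonelli_F _ _ _ _ R m (EFin \o PP)).
- by apply/measurable_EFinP; exact: measurable_PP.
- by move=> p /=; rewrite lee_fin PP_ge0.
Qed.

Lemma measurable_Wr : measurable_fun setT Wr.
Proof. exact: (measurable_Rint1 m measurable_PP). Qed.

Lemma WWE t : t \in `]0, T[ -> WW t = weighted_norm (f t).
Proof.
move=> tI; apply: eq_integral => z _; congr (_%:E).
rewrite /PP /uu extE//=; congr (_ * _).
congr (_ + _ + _ + _); apply: eq_bigr => i _; rewrite /ux /uv ?extE//.
by apply: eq_bigr => k _; rewrite /uvv extE.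
Qed.

Lemma WW0 t : t \notin `]0, T[ -> WW t = 0%E.
Proof. by move=> tI; rewrite /WW integral0_eq// => z _; rewrite PP0. Qed.

Lemma integral_WW2 : (\int[leb]_t (WW t `^ 2) < +oo)%E.
Proof.
have := solution_decay sol.
set g := (fun t => _) \_ _ => h.
rewrite (_ : (fun t => _) = fun t => (`|g t| `^ 2)%E); last first.
  apply/funext => t; rewrite /g patchE; case: ifPn => tI.
    by rewrite -WWE ?gee0_abs ?WW_ge0//; rewrite inE in tI.
  rewrite WW0 ?abse0//.
  by apply: contra tI => tI; rewrite mem_set.
rewrite -poweR_Lnorm//; exact: poweR_lty.
Qed.

Lemma ae_WW : {ae leb, forall t, (WW t < +oo)%E}.
Proof.
have j : leb.-integrable setT (fun t => WW t `^ 2)%E.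
  apply/integrableP; split.
    by apply: (measurableT_comp (measurable_poweR _)); exact: measurable_WW.
  by under eq_integral do rewrite gee0_abs ?poweR_ge0//; exact: integral_WW2.
have := integrable_ae measurableT j; apply: filterS => t /(_ Logic.I).
rewrite ge0_fin_numE ?poweR_ge0// => h.
exact: (@lty_poweRy _ _ 2 _ h).
Qed.

Lemma rint_PP t : (WW t < +oo)%E -> rint m (fun z => PP (t, z)).
Proof.
move=> h; apply/ge0_rintP => //; last by move=> z; exact: PP_ge0.
apply: measurableT_comp; first exact: measurable_PP.
exact: pair1_measurable.
Qed.

Lemma WrE t : (WW t < +oo)%E -> WW t = (Wr t)%:E.
Proof. by move=> h; rewrite /Wr Rint_EFin//; exact: rint_PP. Qed.

Lemma rint_Wr2 : rint leb (fun t => Wr t ^+ 2).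
Proof.
apply/ge0_rintP.
- by apply: measurable_funX; exact: measurable_Wr.
- by move=> t; exact: sqr_ge0.
apply: le_lt_trans integral_WW2; apply: ge0_ae_le_integral_nonmeasurable.
- by move=> t; rewrite lee_fin sqr_ge0.
- by move=> t; exact: poweR_ge0.
apply: filterS ae_WW => t h; rewrite (WrE h) poweR_EFin.
by rewrite lee_fin powR_mulrn ?Wr_ge0.
Qed.

Lemma Wr0 t : t \notin `]0, T[ -> Wr t = 0.
Proof. by move=> tI; rewrite /Wr /Rintegral -/(WW t) WW0. Qed.

Lemma rint_I0T : rint leb (\1_I0T : TR -> R).
Proof. exact: integrable_indic_itv. Qed.

Lemma rint_Wr : rint leb Wr.
Proof.
apply: (le_rint (g := fun t : TR => \1_I0T t + Wr t ^+ 2)).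
- exact: measurable_Wr.
- by apply: rintD; [exact: rint_I0T|exact: rint_Wr2].
move=> t; rewrite ger0_norm ?Wr_ge0// indicE.
have [tI|tI] := boolP (t \in `]0, T[).
  by rewrite mem_set//=; have := Wr_ge0 t; nra.
by rewrite Wr0// expr2 mulr0 addr0.
Qed.

(** The factor [k] of time is there for the convolutions, which are bounded by a multiple of [Wr]:
    their products with the solution need [Wr ^+ 2] integrable, whence the square in
    [solution_decay]. *)
Lemma rint_dom (h : TR * (E * E) -> R) (k : TR -> R) : measurable_fun setT h ->
  (forall t, 0 <= k t) -> measurable_fun setT k -> rint leb (fun t => k t * Wr t) ->
  {ae leb, forall t, forall z, `|h (t, z)| <= k t * PP (t, z)} ->
  rint (prodm leb m) h.
Proof.
move=> mh k0 mk jk hk; apply: rint_prod_le jk _ => //.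
apply: filterS2 hk ae_WW => t ht Wt.
apply: (@le_trans _ _ (\int[m]_z (k t * PP (t, z))%:E)%E).
  by apply: ge0_le_integral_nonmeasurable => z; rewrite ?lee_fin// ht.
rewrite -Rint_EFin; last by apply: rintZl; exact: rint_PP.
by rewrite RintegralZl//; exact: rint_PP.
Qed.

Lemma rint_dom_section (g : E * E -> R) t c : measurable_fun setT g ->
  (WW t < +oo)%E -> (forall z, `|g z| <= c * PP (t, z)) -> rint m g.
Proof.
move=> mg Wt gP; apply: le_rint mg _ gP; exact/rintZl/rint_PP.
Qed.

(** * Convolutions of the kernel with velocity moments *)

Section convolution.
Variable q : E -> R.
Hypothesis mq : measurable_fun setT q.
Hypothesis q_le : forall w, `|q w| <= (1 + enorm w) ^+ 3.

Definition mom (p : TR * E) : R := \int[lebN]_w (q w * uu (p.1, (p.2, w))).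
Definition conv (p : TR * E) : R :=
  \int[lebN]_y (phi_kernel lam eps (enorm (p.2 - y)) * mom (p.1, y)).

Lemma measurable_mom : measurable_fun setT mom.
Proof.
apply: (measurable_Rint1 lebN
  (f := fun r : (TR * E) * E => q r.2 * uu (r.1.1, (r.1.2, r.2)))).
apply: measurable_funM; first exact: measurableT_comp.
apply: (measurableT_comp measurable_uu); apply/measurable_fun_pair => /=.
  exact: measurableT_comp.
by apply/measurable_fun_pair => //=; exact: measurableT_comp.
Qed.

Lemma measurable_conv : measurable_fun setT conv.
Proof.
apply: (measurable_Rint1 lebN
  (f := fun r : (TR * E) * E => phi_kernel lam eps (enorm (r.1.2 - r.2)) * mom (r.1.1, r.2))).
have H : measurable_fun setT (fun r : (TR * E) * E => (r.1.2, r.2)).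
  by apply/measurable_fun_pair => //=; exact: measurableT_comp.
have H' : measurable_fun setT (fun r : (TR * E) * E => (r.1.1, r.2)).
  by apply/measurable_fun_pair => //=; exact: measurableT_comp.
apply: measurable_funM.
- exact: (measurableT_comp (@measurable_phi_kernel R N lam eps eps_gt0) H).
- exact: (measurableT_comp measurable_mom H').
Qed.

Lemma measurable_section (h : TR * (E * E) -> R) t : measurable_fun setT h ->
  measurable_fun setT (fun z => h (t, z)).
Proof. by move=> mh; apply: (measurableT_comp mh); exact: pair1_measurable. Qed.

Lemma rint_moment t : (WW t < +oo)%E -> rint m (fun z => q z.2 * uu (t, z)).
Proof.
move=> Wt; apply: (rint_dom_section (c := 1)) Wt _.
  apply: measurable_funM; first exact: measurableT_comp.
  by apply: measurable_section; exact: measurable_uu.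
move=> z; rewrite mul1r normrM (ger0_norm (uu_ge0 _)).
by apply: le_trans (uu_le_PP _); rewrite ler_wpM2r ?uu_ge0.
Qed.

Lemma conv_le t x : (WW t < +oo)%E -> `|conv (t, x)| <= kphi lam eps * Wr t.
Proof.
move=> Wt; have jm := rint_moment Wt.
have mphi := @measurable_phi_kernel R N lam eps eps_gt0.
have E1 : conv (t, x) = \int[m]_z' (phi_kernel lam eps (enorm (x - z'.1)) * (q z'.2 * uu (t, z'))).
  by rewrite (@Rint_fiber _ _ _ _ (fun z => uu (t, z)) q _ (kphi lam eps) jm mphi
    (fun z => norm_phi_kernel_le eps_gt0 lam_gt0 _)).
have mf : measurable_fun setT (fun z' : E * E => phi_kernel lam eps (enorm (x - z'.1)) * (q z'.2 * uu (t, z'))).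
  apply: measurable_funM; last exact: rint_measurable jm.
  have H : measurable_fun setT (fun z' : E * E => (x, z'.1)) by apply/measurable_fun_pair.
  exact: (measurableT_comp mphi H).
have bf z' : `|phi_kernel lam eps (enorm (x - z'.1)) * (q z'.2 * uu (t, z'))| <=
    kphi lam eps * PP (t, z').
  rewrite normrM ler_pM ?norm_phi_kernel_le//.
  rewrite normrM (ger0_norm (uu_ge0 _)).
  by apply: le_trans (uu_le_PP _); rewrite ler_wpM2r ?uu_ge0.
have jf : rint m (fun z' => phi_kernel lam eps (enorm (x - z'.1)) * (q z'.2 * uu (t, z'))).
  exact: rint_dom_section mf Wt bf.
rewrite E1; apply: le_trans (le_normr_Rintegral measurableT jf) _.
rewrite -RintegralZl//; last exact: rint_PP.
apply: le_Rint => //; first exact: rint_norm.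
by apply: rintZl; exact: rint_PP.
Qed.

End convolution.

Definition coord (i : 'I_N) (w : E) : R := w 0 i.

Lemma one_le_weight (w : E) : `|(fun=> 1) w : R| <= (1 + enorm w) ^+ 3.
Proof. by rewrite normr1 exprn_ege1// lerDl enorm_ge0. Qed.

Lemma coord_le_weight i w : `|coord i w| <= (1 + enorm w) ^+ 3.
Proof.
apply: le_trans (coord_le_enorm w i) _; have := enorm_ge0 w.
set a := enorm w => a0; rewrite (@le_trans _ _ (1 + a))// ?lerDr//.
by rewrite ler_eXnr// lerDl.
Qed.

Lemma measurable_coord i : measurable_fun setT (coord i).
Proof. exact: measurable_rV_coord. Qed.

(** * The force and its integrability against the solution *)

Variables (A0 : set TR) (F0 : R).
Hypotheses (mA0 : measurable A0) (A00 : leb A0 = 0%E).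

(* The force, cut off outside a null set A0 of times so as to become jointly
   measurable. *)
Definition Ft i (p : TR * E) : R := F p.1 p.2 0 i * \1_(I0T `\` A0) p.1.

Hypothesis mFt : forall i, measurable_fun setT (Ft i).
Hypothesis FL : (Lp_time_norm T 2%:E (fun G => Linf_norm (@enorm R N \o G)) F <= F0%:E)%E.

Lemma FtE : {ae leb, forall t : TR, t \in `]0, T[ -> forall i x, Ft i (t, x) = F t x 0 i}.
Proof.
exists A0; split => // t /= h; apply: contrapT => tA; apply: h => tI i x.
by rewrite /Ft indicE mem_set ?mulr1.
Qed.

Lemma Ft0 i t x : t \notin `]0, T[ -> Ft i (t, x) = 0.
Proof. by move=> tI; rewrite /Ft indicE memNset ?mulr0// => -[/= h]; rewrite h in tI. Qed.

(** Its measurability in time is not established; only the lower integral of its square is used,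
    through [integral_le_lower]. *)
Definition LF (t : TR) : \bar R := ((fun t => Linf_norm (@enorm R N \o F t)) \_ I0T) t.

Lemma LF_ge0 t : (0 <= LF t)%E.
Proof. by rewrite /LF patchE; case: ifP => // _; exact: Lnorm_ge0. Qed.

Lemma integral_LF2 : (\int[leb]_t (`|LF t| `^ 2) <= (F0 ^+ 2)%:E)%E.
Proof.
rewrite -powR_mulrn ?lee_fin//; last by rewrite -lee_fin (le_trans _ FL)// Lnorm_ge0.
rewrite -poweR_EFin -poweR_Lnorm//.
apply: gt0_ler_poweR => //; rewrite ?in_itv/= ?leey ?andbT ?Lnorm_ge0//.
by rewrite (le_trans _ FL)// Lnorm_ge0.
Qed.

Lemma LF_ae t : t \in `]0, T[ -> (LF t < +oo)%E ->
  exists2 K : R, 0 <= K /\ LF t = K%:E & {ae lebN, forall x, enorm (F t x) <= K}.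
Proof.
move=> tI Lt; have L0 := LF_ge0 t.
exists (fine (LF t)).
  by rewrite fine_ge0// fineK// ge0_fin_numE.
have : (LF t <= (fine (LF t))%:E)%E by rewrite fineK// ge0_fin_numE.
rewrite {1}/LF patchE mem_set// /Linf_norm unlock; case: ifPn => [_|].
  move/ess_supP; apply: filterS => x /=.
  by rewrite ger0_norm ?enorm_ge0// lee_fin.
(* By convention the L^oo norm is an essential supremum only on a space of positive measure;
   otherwise every property holds a.e. *)
rewrite -leNgt => l0 _; exists setT; split => //.
by apply/eqP; rewrite eq_le l0 measure_ge0.
Qed.

Lemma coord_Ft_le i : {ae leb, forall t : TR, t \in `]0, T[ ->
  forall x, `|Ft i (t, x)| <= enorm (F t x)}.
Proof. by apply: filterS FtE => t h tI x; rewrite h// coord_le_enorm. Qed.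

(** At a.e. time the integral in phase space is at most [LF t] times [Wr t], hence at most the sum
    of their squares, and both are square integrable in time. *)
Lemma rint_Ft_PP i : rint (prodm leb m) (fun p => `|Ft i (p.1, p.2.1)| * PP p).
Proof.
have mg : measurable_fun setT (fun p : TR * (E * E) => `|Ft i (p.1, p.2.1)| * PP p).
  apply: measurable_funM; last exact: measurable_PP.
  apply: measurableT_comp => //; apply: (measurableT_comp (mFt i)).
  by apply/measurable_fun_pair => //=; exact: measurableT_comp.
have mgE : measurable_fun setT (fun p : TR * (E * E) => (`|Ft i (p.1, p.2.1)| * PP p)%:E).
  exact/measurable_EFinP.
have g0 (p : TR * (E * E)) : 0 <= `|Ft i (p.1, p.2.1)| * PP p by rewrite mulr_ge0 ?PP_ge0.
apply/(integrable12ltyP _ _ mgE).2.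
pose q (t : TR) := (\int[m]_z (`|Ft i (t, z.1)| * PP (t, z))%:E)%E.
rewrite (_ : (fun t => _) = q); last first.
  by apply/funext => t; apply: eq_integral => z _; rewrite gee0_abs ?lee_fin// (g0 (t, z)).
have mq : measurable_fun setT q.
  apply: (measurable_fun_fubini_tonelli_F (fun p : TR * (E * E) => (`|Ft i (p.1, p.2.1)| * PP p)%:E)) => //.
have := @integral_le_lower _ _ _ leb q LF (fun t => Wr t ^+ 2) 1 (F0 ^+ 2)%:E mq.
move=> H; apply: (le_lt_trans (H _ _ _ _ _ _)) => {H}.
- by move=> t; apply: integral_ge0 => z _; rewrite lee_fin (g0 (t, z)).
- exact: rint_Wr2.
- by move=> t; exact: sqr_ge0.
- by [].
- apply: filterS2 (coord_Ft_le i) ae_WW => t hF Wt.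
  have [tI|tI] := boolP (t \in `]0, T[); last first.
    rewrite /q integral0_eq ?adde_ge0 ?mule_ge0 ?poweR_ge0 ?lee_fin ?sqr_ge0//.
    by move=> z _; rewrite Ft0// normr0 mul0r.
  have [Lt|] := ltP (LF t) +oo%E; last first.
    by rewrite leye_eq => /eqP ->; rewrite /= gt_eqF// mul1e leey.
  have [K [K0 LK] aeK] := LF_ae tI Lt.
  have qK : (q t <= K%:E * WW t)%E.
    apply: (integral_ae_bounded_factor (a := fun x => `|Ft i (t, x)|) (h := fun z => PP (t, z))) => //.
    + apply: measurableT_comp => //; apply: (measurableT_comp (mFt i)); exact: pair1_measurable.
    + by apply: measurable_section; exact: measurable_PP.
    + by move=> z; exact: PP_ge0.
    + by apply: filterS aeK => x; apply: le_trans; exact: hF.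
  apply: le_trans qK _; rewrite WrE// LK /= mul1e -EFinM -EFinD lee_fin.
  rewrite powR_mulrn// ger0_norm//.
  have := sqr_ge0 (K - Wr t); have := Wr_ge0 t; have := sqr_ge0 K; have := sqr_ge0 (Wr t).
  nra.
- exact: integral_LF2.
- by rewrite mul1e -EFinD ltry.
Qed.

Local Notation c1 := (conv (fun=> 1)).
Local Notation ci i := (conv (coord i)).

Lemma conv1E t x : t \in `]0, T[ ->
  phi_conv lam eps (density f t) x = c1 (t, x).
Proof.
move=> tI; apply: eq_Rintegral => y _; congr (_ * _).
by apply: eq_Rintegral => w _; rewrite mul1r /uu extE.
Qed.

Lemma convE i t x : t \in `]0, T[ ->
  phi_conv lam eps (fun y => current f t y 0 i) x = ci i (t, x).
Proof.
move=> tI; apply: eq_Rintegral => y _; congr (_ * _); rewrite mxE.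
by apply: eq_Rintegral => w _; rewrite /uu extE.
Qed.

(* With GG the time derivative of f and TH the flux in velocity, the equation
   reads eps GG = div_v TH - eps v . grad_x f; DT i is the i-th term of
   div_v TH, and SS i is DT i without the force. *)
Definition SS i (p : TR * (E * E)) : R :=
  uu p + p.2.2 0 i * uv i p + uvv i i p
  + c1 (p.1, p.2.1) * (uu p + p.2.2 0 i * uv i p)
  - ci i (p.1, p.2.1) * uv i p.

Definition TH i (p : TR * (E * E)) : R :=
  Ft i (p.1, p.2.1) * uu p + p.2.2 0 i * uu p + uv i p
  + p.2.2 0 i * (c1 (p.1, p.2.1) * uu p) - ci i (p.1, p.2.1) * uu p.

Definition DT i (p : TR * (E * E)) : R := Ft i (p.1, p.2.1) * uv i p + SS i p.

Definition GG (p : TR * (E * E)) : R :=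
  eps^-1 * (\sum_(i < N) DT i p) - \sum_(i < N) p.2.2 0 i * ux i p.

Lemma is_derive_uu_x i t x v : t \in `]0, T[ ->
  is_derive x (delta_mx 0 i : E) (fun y => uu (t, (y, v))) (ux i (t, (x, v))).
Proof.
move=> tI; rewrite /ux extE//=.
rewrite (_ : (fun y => _) = (fun y => f t y v)); last first.
  by apply/funext => y; rewrite /uu extE.
apply: derivableP; have [_ /(_ i)[h _] _ _] := solution_regular sol tI; exact: h.
Qed.

Lemma is_derive_uu_v i t x v : t \in `]0, T[ ->
  is_derive v (delta_mx 0 i : E) (fun w => uu (t, (x, w))) (uv i (t, (x, v))).
Proof.
move=> tI; rewrite /uv extE//=.
rewrite (_ : (fun y => _) = f t x); last by apply/funext => y; rewrite /uu extE.
apply: derivableP; have [_ _ /(_ i)[h _] _] := solution_regular sol tI; exact: h.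
Qed.

Lemma is_derive_uv i k t x v : t \in `]0, T[ ->
  is_derive v (delta_mx 0 k : E) (fun w => uv i (t, (x, w))) (uvv i k (t, (x, v))).
Proof.
move=> tI; rewrite /uvv extE//=.
rewrite (_ : (fun y => _) = partial i (f t x)); last by apply/funext => y; rewrite /uv extE.
apply: derivableP; have [_ _ _ /(_ i k)[h _]] := solution_regular sol tI; exact: h.
Qed.

Lemma is_derive_TH i t x v : t \in `]0, T[ ->
  is_derive v (delta_mx 0 i : E) (fun w => TH i (t, (x, w))) (DT i (t, (x, v))).
Proof.
move=> tI.
have d1 := is_derive_uu_v i x v tI.
have d2 := is_derive_coord v (delta_mx 0 i) i.
have d3 := is_derive_uv i i x v tI.
rewrite mxE !eqxx /= in d2.
have dTH := is_derive_sub (is_derive_add (is_derive_add (is_derive_add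
   (is_derive_scale d1 (Ft i (t, x))) (is_derive_mul d2 d1)) d3)
   (is_derive_mul d2 (is_derive_scale d1 (c1 (t, x))))) (is_derive_scale d1 (ci i (t, x))).
apply: (is_derive_eq dTH).
by rewrite /DT /SS /=; ring.
Qed.

Lemma divergence_flux t x v : t \in `]0, T[ ->
  divergence (fun w =>
    f t x w *: w + grad (f t x) w
    + (f t x w * phi_conv lam eps (density f t) x) *: w
    - f t x w *: (\row_i phi_conv lam eps (fun y => current f t y 0 i) x)) v
  = \sum_(i < N) SS i (t, (x, v)).
Proof.
move=> tI; apply: eq_bigr => i _.
have d1 := is_derive_uu_v i x v tI.
have d2 := is_derive_coord v (delta_mx 0 i) i.
have d3 := is_derive_uv i i x v tI.
rewrite mxE !eqxx /= in d2.
have dTH := is_derive_sub (is_derive_add (is_derive_add (is_derive_mul d1 d2) d3)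
   (is_derive_mul (is_derive_scale d1 (c1 (t, x))) d2)) (is_derive_scale d1 (ci i (t, x))).
rewrite /partial.
rewrite [X in 'D_ _ X _](_ : _ = (fun w => uu (t, (x, w)) * w 0 i + uv i (t, (x, w)) +
   c1 (t, x) * uu (t, (x, w)) * w 0 i - ci i (t, x) * uu (t, (x, w)))); last first.
  apply/funext => w; rewrite !mxE conv1E// convE// /uu /uv !extE//=; ring.
have [_ ->] := dTH.
by rewrite /SS /=; ring.
Qed.

(** Each [z] comes with a time derivative [g] of its own, with no joint measurability in time and
    [z]. For a.e. time it equals [GG], which is jointly measurable, so that Fubini becomes
    available. *)
Lemma solutionE z t : t \in `[0, T] ->
  f t z.1 z.2 = f0 z.1 z.2 + \int[leb]_s (GG (s, z) * \1_(`]0, t[) s).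
Proof.
case: z => x v /= tT; have [g [jg fg aeg]] := solution_equation sol x v.
rewrite fg// (solution_initial sol); congr (_ + _).
rewrite Rintegral_mkcond; apply: (@ae_eq_Rint_nonmeasurable _ TR R leb).
apply: (@filterS2 TR _ _ _ _ _ _ aeg FtE) => s gs Fs; rewrite patch_indic /= !indicE.
have [st|st] := boolP (s \in (`]0, t[%classic : set R)); last by rewrite !mulr0.
have sI : s \in `]0, T[.
  move: st; rewrite inE/= !in_itv/= => /andP[-> st] /=.
  by move: tT; rewrite in_itv/= => /andP[_]; exact: lt_le_trans.
congr (_ * _); have := gs sI; rewrite divergence_flux// /GG.
have -> : \sum_(i < N) DT i (s, (x, v)) = \sum_(i < N) Ft i (s, x) * uv i (s, (x, v)) +
    \sum_(i < N) SS i (s, (x, v)) by rewrite -big_split.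
have -> : dot v (grad (f s ^~ v) x) = \sum_(i < N) v 0 i * ux i (s, (x, v)).
  by apply: eq_bigr => i _; rewrite mxE /ux extE.
have -> : dot (F s x) (grad (f s x) v) = \sum_(i < N) Ft i (s, x) * uv i (s, (x, v)).
  by apply: eq_bigr => i _; rewrite mxE /uv extE// Fs.
move=> E1; have {}E1 : eps * g s = \sum_(i < N) SS i (s, (x, v)) +
   \sum_(i < N) Ft i (s, x) * uv i (s, (x, v)) - eps * \sum_(i < N) v 0 i * ux i (s, (x, v)).
  by rewrite -E1; ring.
have eN0 : eps != 0 by rewrite gt_eqF.
apply: (mulfI eN0); rewrite E1 mulrBr mulrA divff// mul1r; ring.
Qed.

(** * Domination of the terms of the equation by the decay norm *)

Definition field (y : TR * (E * E) -> R) :=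
  measurable_fun setT y /\ forall p, om p.2 * `|y p| <= PP p.

Lemma field_uu : field uu.
Proof.
split; [exact: measurable_uu|move=> p].
by rewrite ger0_norm ?uu_ge0//; exact: uu_le_PP.
Qed.

Lemma field_ux i : field (ux i).
Proof. by split; [exact: measurable_ux|exact: ux_le_PP]. Qed.

Lemma field_uv i : field (uv i).
Proof. by split; [exact: measurable_uv|exact: uv_le_PP]. Qed.

Lemma field_uvv i k : field (uvv i k).
Proof. by split; [exact: measurable_uvv|exact: uvv_le_PP]. Qed.

(** The growth allowed here is the one that [field] pays for: a weight times a field is dominated by
    [c] times [PP]. *)
Definition weight (c : R) (b : E * E -> R) :=
  [/\ 0 <= c, measurable_fun setT b & forall z, `|b z| <= c * om z].

Lemma weight_field_le c b y p : weight c b -> field y ->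
  `|b p.2 * y p| <= c * PP p.
Proof.
move=> [c0 _ bc] [_ yP]; rewrite normrM.
apply: (@le_trans _ _ (c * om p.2 * `|y p|)); first by rewrite ler_wpM2r.
by rewrite -mulrA ler_wpM2l.
Qed.

Lemma measurable_weight_field c b y : weight c b -> field y ->
  measurable_fun setT (fun p : TR * (E * E) => b p.2 * y p).
Proof. by move=> [_ mb _] [my _]; apply: measurable_funM => //; exact: measurableT_comp. Qed.

Lemma rint_weight_field c b y : weight c b -> field y ->
  rint (prodm leb m) (fun p => b p.2 * y p).
Proof.
move=> wb fy; have [c0 _ _] := wb; apply: (@rint_dom _ (fun=> c)) => //.
- exact: measurable_weight_field wb fy.
- by apply: rintZl; exact: rint_Wr.
- by apply/nearW => t z; exact: (weight_field_le (t, z) wb fy).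
Qed.

Lemma measurable_tx : measurable_fun setT (fun p : TR * (E * E) => (p.1, p.2.1)).
Proof. by apply/measurable_fun_pair => //=; exact: measurableT_comp. Qed.

Lemma rint_weight_Ft c b y i : weight c b -> field y ->
  rint (prodm leb m) (fun p => b p.2 * (Ft i (p.1, p.2.1) * y p)).
Proof.
move=> wb fy; apply: (le_rint (g := fun p => c * (`|Ft i (p.1, p.2.1)| * PP p))).
- under eq_fun do rewrite mulrCA.
  apply: measurable_funM; last exact: measurable_weight_field wb fy.
  exact: (measurableT_comp (mFt i) measurable_tx).
- by apply: rintZl; exact: rint_Ft_PP.
- move=> p; rewrite mulrCA normrM [leRHS]mulrCA ler_wpM2l//.
  exact: weight_field_le.
Qed.

Lemma rint_weight_conv c b y (q : E -> R) : weight c b -> field y -> measurable_fun setT q ->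
  (forall w, `|q w| <= (1 + enorm w) ^+ 3) ->
  rint (prodm leb m) (fun p => b p.2 * (conv q (p.1, p.2.1) * y p)).
Proof.
move=> wb fy mq qle; have [c0 _ _] := wb.
have k0 : 0 <= kphi lam eps by exact: kphi_ge0.
apply: (@rint_dom _ (fun t => kphi lam eps * Wr t * c)).
- under eq_fun do rewrite mulrCA.
  apply: measurable_funM; last exact: measurable_weight_field wb fy.
  exact: (measurableT_comp (measurable_conv mq) measurable_tx).
- by move=> t; rewrite !mulr_ge0// Wr_ge0.
- by do 2 apply: measurable_funM => //; exact: measurable_Wr.
- rewrite (_ : (fun t => _) = (fun t => (kphi lam eps * c) * Wr t ^+ 2)); last first.
    by apply/funext => t; ring.
  by apply: rintZl; exact: rint_Wr2.
- apply: filterS ae_WW => t Wt z; rewrite mulrCA normrM -mulrA.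
  apply: ler_pM => //; first exact: conv_le.
  exact: (weight_field_le (t, z) wb fy).
Qed.

Section two_weights.
Variables (c : R) (b : E * E -> R) (i : 'I_N).
Hypothesis wb : weight c b.
Hypothesis wbv : weight c (fun z => b z * z.2 0 i).

(** The friction part of the flux contains v_i f, so both [b] and [b] times v_i have to be
    weights. *)
Lemma rint_weight_TH : rint (prodm leb m) (fun p => b p.2 * TH i p).
Proof.
rewrite (_ : (fun p => _) = (fun p : TR * (E * E) =>
  b p.2 * (Ft i (p.1, p.2.1) * uu p) + b p.2 * p.2.2 0 i * uu p + b p.2 * uv i p
  + b p.2 * p.2.2 0 i * (c1 (p.1, p.2.1) * uu p) - b p.2 * (ci i (p.1, p.2.1) * uu p))); last first.
  by apply/funext => p; rewrite /TH; ring.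
apply: rintB; [apply: rintD; [apply: rintD; [apply: rintD|]|]|].
- exact: rint_weight_Ft wb field_uu.
- exact: rint_weight_field wbv field_uu.
- exact: rint_weight_field wb (field_uv i).
- by apply: rint_weight_conv wbv field_uu _ one_le_weight.
- apply: rint_weight_conv wb field_uu _ (coord_le_weight i); exact: measurable_coord.
Qed.

Lemma rint_weight_DT : rint (prodm leb m) (fun p => b p.2 * DT i p).
Proof.
rewrite (_ : (fun p => _) = (fun p : TR * (E * E) =>
  b p.2 * (Ft i (p.1, p.2.1) * uv i p) + b p.2 * uu p + b p.2 * p.2.2 0 i * uv i p
  + b p.2 * uvv i i p + b p.2 * (c1 (p.1, p.2.1) * uu p)
  + b p.2 * p.2.2 0 i * (c1 (p.1, p.2.1) * uv i p)
  - b p.2 * (ci i (p.1, p.2.1) * uv i p))); last first.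
  by apply/funext => p; rewrite /DT /SS; ring.
apply: rintB; [apply: rintD; [apply: rintD; [apply: rintD; [apply: rintD; [apply: rintD|]|]|]|]|].
- exact: rint_weight_Ft wb (field_uv i).
- exact: rint_weight_field wb field_uu.
- exact: rint_weight_field wbv (field_uv i).
- exact: rint_weight_field wb (field_uvv i i).
- by apply: rint_weight_conv wb field_uu _ one_le_weight.
- by apply: rint_weight_conv wbv (field_uv i) _ one_le_weight.
- apply: rint_weight_conv wb (field_uv i) _ (coord_le_weight i); exact: measurable_coord.
Qed.

End two_weights.

Lemma continuous_uu t : continuous (fun z => uu (t, z)).
Proof.
have [tI|tI] := boolP (t \in `]0, T[).
  rewrite (_ : (fun z => _) = fun z => f t z.1 z.2); last by apply/funext => z; rewrite /uu extE.
  by have [] := solution_regular sol tI.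
rewrite (_ : (fun z => _) = fun z => 0); last by apply/funext => z; rewrite /uu ext0.
exact: cst_continuous.
Qed.

Lemma continuous_ux i t : continuous (fun z => ux i (t, z)).
Proof.
have [tI|tI] := boolP (t \in `]0, T[).
  rewrite (_ : (fun z => _) = fun z => partial i (f t ^~ z.2) z.1); last by apply/funext => z; rewrite /ux extE.
  by have [_ /(_ i)[]] := solution_regular sol tI.
rewrite (_ : (fun z => _) = fun z => 0); last by apply/funext => z; rewrite /ux ext0.
exact: cst_continuous.
Qed.

Lemma continuous_uv i t : continuous (fun z => uv i (t, z)).
Proof.
have [tI|tI] := boolP (t \in `]0, T[).
  rewrite (_ : (fun z => _) = fun z => partial i (f t z.1) z.2); last by apply/funext => z; rewrite /uv extE.
  by have [_ _ /(_ i)[]] := solution_regular sol tI.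
rewrite (_ : (fun z => _) = fun z => 0); last by apply/funext => z; rewrite /uv ext0.
exact: cst_continuous.
Qed.

Lemma continuous_uvv i k t : continuous (fun z => uvv i k (t, z)).
Proof.
have [tI|tI] := boolP (t \in `]0, T[).
  rewrite (_ : (fun z => _) = fun z => partial k (partial i (f t z.1)) z.2); last by apply/funext => z; rewrite /uvv extE.
  by have [_ _ _ /(_ i k)[]] := solution_regular sol tI.
rewrite (_ : (fun z => _) = fun z => 0); last by apply/funext => z; rewrite /uvv ext0.
exact: cst_continuous.
Qed.

(** * The weak formulation with test functions chi(x) w(v) *)

Section test_function.
Variables (chi : E -> R) (dchi : 'I_N -> E -> R).
Variables (w : E -> R) (dw : 'I_N -> E -> R) (C : R).
Hypothesis C0' : 0 <= C.
Hypothesis chi' : forall i x, is_derive x (delta_mx 0 i : E) chi (dchi i x).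
Hypothesis cchi : continuous chi.
Hypothesis cdchi : forall i, continuous (dchi i).
Hypothesis chi_le : forall x, `|chi x| <= C.
Hypothesis dchi_le : forall i x, `|dchi i x| <= C.
Hypothesis w' : forall i v, is_derive v (delta_mx 0 i : E) w (dw i v).
Hypothesis cw : continuous w.
Hypothesis cdw : forall i, continuous (dw i).
Hypothesis w_le : forall v, `|w v| <= (1 + enorm v) ^+ 2.
Hypothesis dw_le : forall i v, `|dw i v| <= 2 * (1 + enorm v).

Definition Psi (z : E * E) : R := chi z.1 * w z.2.

Let mz1 (g : E -> R) : continuous g -> measurable_fun setT (fun z : E * E => g z.1).
Proof. by move=> cg; apply: measurableT_comp => //; exact: continuous_rV_measurable. Qed.

Let mz2 (g : E -> R) : continuous g -> measurable_fun setT (fun z : E * E => g z.2).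
Proof. by move=> cg; apply: measurableT_comp => //; exact: continuous_rV_measurable. Qed.

Let ge1 (v : E) : 1 <= 1 + enorm v.
Proof. by rewrite lerDl enorm_ge0. Qed.


Let coord_le (v : E) i : `|v 0 i| <= 1 + enorm v.
Proof. by apply: le_trans (coord_le_enorm v i) _; rewrite lerDr. Qed.

Lemma measurable_Psi : measurable_fun setT Psi.
Proof. by apply: measurable_funM; [exact: mz1|exact: mz2]. Qed.

Lemma Psi_le z : `|Psi z| <= C * (1 + enorm z.2) ^+ 2.
Proof. by rewrite normrM ler_pM. Qed.

Lemma weight_Psi : weight C Psi.
Proof.
split => //; first exact: measurable_Psi.
move=> z; apply: le_trans (Psi_le z) _; rewrite ler_wpM2l//.
by rewrite /om ler_weXn2l.
Qed.

(** The quadratic growth of [w] leaves one power of the cubic weight for the factor v_i of the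
    transport and friction terms. *)
Lemma weight_Psi_v i : weight C (fun z => Psi z * z.2 0 i).
Proof.
split => //.
  by apply: measurable_funM; [exact: measurable_Psi|exact: (mz2 (@continuous_coord R N i))].
move=> z; rewrite normrM /om exprSr mulrA ler_pM//; exact: Psi_le.
Qed.

Lemma weight_dw i : weight (2 * C) (fun z => chi z.1 * dw i z.2).
Proof.
split; [by rewrite mulr_ge0|by apply: measurable_funM; [exact: mz1|exact: mz2]|].
move=> z; rewrite normrM; apply: (@le_trans _ _ (C * (2 * (1 + enorm z.2)))).
  by rewrite ler_pM.
rewrite mulrA [C * 2]mulrC ler_wpM2l ?mulr_ge0//.
by rewrite /om -[leLHS]expr1 ler_weXn2l.
Qed.

Lemma weight_dw_v i : weight (2 * C) (fun z => chi z.1 * dw i z.2 * z.2 0 i).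
Proof.
split; first by rewrite mulr_ge0.
  apply: measurable_funM; first by apply: measurable_funM; [exact: mz1|exact: mz2].
  by exact: (mz2 (@continuous_coord R N i)).
move=> z; rewrite !normrM; apply: (@le_trans _ _ (C * (2 * (1 + enorm z.2)) * (1 + enorm z.2))).
  by rewrite ler_pM// ler_pM.
rewrite (_ : C * _ * _ = 2 * C * (1 + enorm z.2) ^+ 2); last by ring.
by rewrite ler_wpM2l ?mulr_ge0// /om ler_weXn2l.
Qed.

Lemma weight_dchi i : weight C (fun z => dchi i z.1 * w z.2 * z.2 0 i).
Proof.
split => //.
  apply: measurable_funM; first by apply: measurable_funM; [exact: mz1|exact: mz2].
  by exact: (mz2 (@continuous_coord R N i)).
by move=> z; rewrite !normrM /om exprSr mulrA ler_pM// ler_pM.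
Qed.

(** [D1 i] is the derivative of [K1 i] in x_i and [D2 i] that of [K2 i] in v_i, so both integrate to
    0. By [Psi_GG], [bb] is what then remains of [Psi] times the time derivative: the transport and
    flux terms with the derivative moved onto the test function. *)
Definition K1 i (p : TR * (E * E)) : R := Psi p.2 * p.2.2 0 i * uu p.
Definition D1 i (p : TR * (E * E)) : R :=
  Psi p.2 * p.2.2 0 i * ux i p + dchi i p.2.1 * w p.2.2 * p.2.2 0 i * uu p.
Definition K2 i (p : TR * (E * E)) : R := Psi p.2 * TH i p.
Definition D2 i (p : TR * (E * E)) : R :=
  Psi p.2 * DT i p + chi p.2.1 * dw i p.2.2 * TH i p.
Definition bb (p : TR * (E * E)) : R :=
  \sum_(i < N) dchi i p.2.1 * w p.2.2 * p.2.2 0 i * uu p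
  - eps^-1 * \sum_(i < N) chi p.2.1 * dw i p.2.2 * TH i p.

Lemma rint_K1 i : rint (prodm leb m) (K1 i).
Proof. exact: rint_weight_field (weight_Psi_v i) field_uu. Qed.

Lemma rint_D1 i : rint (prodm leb m) (D1 i).
Proof.
apply: rintD; first exact: rint_weight_field (weight_Psi_v i) (field_ux i).
exact: (rint_weight_field (weight_dchi i) field_uu).
Qed.

Lemma rint_K2 i : rint (prodm leb m) (K2 i).
Proof. exact: (rint_weight_TH weight_Psi (weight_Psi_v i)). Qed.

Lemma rint_D2 i : rint (prodm leb m) (D2 i).
Proof.
apply: rintD; first exact: (rint_weight_DT weight_Psi (weight_Psi_v i)).
exact: (rint_weight_TH (weight_dw i) (weight_dw_v i)).
Qed.

Lemma rint_bb : rint (prodm leb m) bb.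
Proof.
apply: rintB; first by apply: rint_sum => i; exact: (rint_weight_field (weight_dchi i) field_uu).
by apply: rintZl; apply: rint_sum => i; exact: (rint_weight_TH (weight_dw i) (weight_dw_v i)).
Qed.

Lemma Rint_D1 i : {ae leb, forall t : TR, \int[m]_z D1 i (t, z) = 0}.
Proof.
apply: filterS2 (ae_integrable1 (rint_K1 i)) (ae_integrable1 (rint_D1 i)) => t jK jD.
have [tI|tI] := boolP (t \in `]0, T[); last first.
  rewrite (_ : (fun z => _) = fun=> 0); first by rewrite Rintegral_cst// mul0r.
  by apply/funext => z; rewrite /D1 /ux /uu !ext0// !mulr0 addr0.
apply: (@Rint_derive_x R N (fun z => K1 i (t, z)) _ i) => //.
- move=> x v; have d1 := is_derive_mul (chi' i x) (is_derive_uu_x i x v tI).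
  have d2 := is_derive_scale d1 (w v * v 0 i).
  rewrite (_ : (fun y => _) = fun y => w v * v 0 i * (chi y * uu (t, (y, v)))); last first.
    by apply/funext => y; rewrite /K1 /Psi /=; ring.
  by apply: (is_derive_eq d2); rewrite /D1 /Psi /=; ring.
- move=> v; rewrite /D1 /Psi /=.
  rewrite (_ : (fun x => _) = fun x => w v * v 0 i * (chi x * ux i (t, (x, v)) + dchi i x * uu (t, (x, v)))).
    apply: continuous_scale; apply: continuous_add; apply: continuous_mul => //.
    + exact: (continuous_pairr (@continuous_ux i t)).
    + exact: (continuous_pairr (@continuous_uu t)).
  by apply/funext => x; ring.
Qed.

Lemma continuous_TH i t x : continuous (fun v => TH i (t, (x, v))).
Proof.
have cu := continuous_pairl (x := x) (@continuous_uu t).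
have cuv := continuous_pairl (x := x) (@continuous_uv i t).
have cc := @continuous_coord R N i.
rewrite /TH /=; apply: continuous_sub; [apply: continuous_add; [apply: continuous_add;
  [apply: continuous_add|]|]|] => //.
- exact: continuous_scale.
- exact: continuous_mul.
- by apply: continuous_mul => //; exact: continuous_scale.
- exact: continuous_scale.
Qed.

Lemma continuous_DT i t x : continuous (fun v => DT i (t, (x, v))).
Proof.
have cu := continuous_pairl (x := x) (@continuous_uu t).
have cuv := continuous_pairl (x := x) (@continuous_uv i t).
have cuvv := continuous_pairl (x := x) (@continuous_uvv i i t).
have cc := @continuous_coord R N i.
rewrite /DT /SS /=; apply: continuous_add; first exact: continuous_scale.
apply: continuous_sub; [apply: continuous_add; [apply: continuous_add;
  [apply: continuous_add|]|]|] => //.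
- exact: continuous_mul.
- by apply: continuous_scale; apply: continuous_add => //; exact: continuous_mul.
- exact: continuous_scale.
Qed.

Lemma Rint_D2 i : {ae leb, forall t : TR, \int[m]_z D2 i (t, z) = 0}.
Proof.
apply: filterS2 (ae_integrable1 (rint_K2 i)) (ae_integrable1 (rint_D2 i)) => t jK jD.
have [tI|tI] := boolP (t \in `]0, T[); last first.
  rewrite (_ : (fun z => _) = fun=> 0); first by rewrite Rintegral_cst// mul0r.
  by apply/funext => z; rewrite /D2 /DT /TH /SS /uv /uvv /uu !ext0//; ring.
apply: (@Rint_derive_v R N (fun z => K2 i (t, z)) _ i) => //.
- move=> x v; have d1 := is_derive_mul (w' i v) (is_derive_TH i x v tI).
  have d2 := is_derive_scale d1 (chi x).
  rewrite (_ : (fun y => _) = fun y => chi x * (w y * TH i (t, (x, y)))); last first.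
    by apply/funext => y; rewrite /K2 /Psi /=; ring.
  by apply: (is_derive_eq d2); rewrite /D2 /Psi /=; ring.
- move=> x; rewrite /D2 /Psi /=.
  rewrite (_ : (fun v => _) = fun v => chi x * (w v * DT i (t, (x, v)) + dw i v * TH i (t, (x, v)))).
    apply: continuous_scale; apply: continuous_add; apply: continuous_mul => //.
    + exact: continuous_DT.
    + exact: continuous_TH.
  by apply/funext => v; ring.
Qed.

Lemma Psi_GG p : Psi p.2 * GG p =
  bb p + eps^-1 * (\sum_(i < N) D2 i p) - \sum_(i < N) D1 i p.
Proof.
have E2 : \sum_(i < N) D2 i p = Psi p.2 * (\sum_(i < N) DT i p) +
    \sum_(i < N) chi p.2.1 * dw i p.2.2 * TH i p by rewrite mulr_sumr -big_split.
have E1 : \sum_(i < N) D1 i p = Psi p.2 * (\sum_(i < N) p.2.2 0 i * ux i p) +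
    \sum_(i < N) dchi i p.2.1 * w p.2.2 * p.2.2 0 i * uu p.
  by rewrite mulr_sumr -big_split; apply: eq_bigr => i _; rewrite /D1 mulrA.
rewrite E1 E2 /bb /GG; ring.
Qed.

Lemma rint_Psi_GG : rint (prodm leb m) (fun p => Psi p.2 * GG p).
Proof.
under eq_fun do rewrite Psi_GG.
apply: rintB; last by apply: rint_sum => i; exact: rint_D1.
apply: rintD; first exact: rint_bb.
by apply: rintZl; apply: rint_sum => i; exact: rint_D2.
Qed.

Lemma ae_all (P : 'I_N -> TR -> Prop) : (forall i, {ae leb, forall t, P i t}) ->
  {ae leb, forall t, forall i, P i t}.
Proof. by move=> h; apply: filter_forall. Qed.

Lemma Rint_Psi_GG : {ae leb, forall t : TR,
  \int[m]_z (Psi z * GG (t, z)) = \int[m]_z bb (t, z)}.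
Proof.
have a1 := ae_all Rint_D1; have a2 := ae_all Rint_D2.
have a3 := ae_all (fun i => ae_integrable1 (rint_D1 i)).
have a4 := ae_all (fun i => ae_integrable1 (rint_D2 i)).
have a5 := ae_integrable1 rint_bb.
apply: filterS3 a1 a2 (filterI a3 (filterI a4 a5)) => t h1 h2 [h3 [h4 h5]].
under eq_Rintegral do rewrite (Psi_GG (t, _)).
rewrite RintegralB//; last 2 first.
- by apply: rintD => //; apply: rintZl; apply: rint_sum => i; exact: h4.
- by apply: rint_sum => i; exact: h3.
rewrite RintegralD//; last by apply: rintZl; apply: rint_sum => i; exact: h4.
rewrite RintegralZl//; last by apply: rint_sum => i; exact: h4.
rewrite (Rint_sum _ _ h3) (Rint_sum _ _ h4).
rewrite [X in _ * X]big1; last by move=> i _; exact: h2.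
by rewrite big1 ?mulr0 ?addr0 ?subr0// => i _; exact: h1.
Qed.

Definition Bt (s : TR) : R := \int[m]_z bb (s, z).

Lemma rint_Bt : rint leb Bt.
Proof. by have [] := rint_fubini1 rint_bb. Qed.

Hypothesis jf0 : rint m (fun z => Psi z * f0 z.1 z.2).

Lemma measurable_f_section t : t \in `[0, T] -> measurable_fun setT (fun z : E * E => f t z.1 z.2).
Proof.
move=> tT; have H := solution_measurable sol.
have H' : measurable_fun setT (fun z : E * E => (t : TR, z)) by exact: pair1_measurable.
have mD : measurable (`[0, T] `*` setT : set (TR * (E * E))).
  by apply: measurableX => //; exact: measurable_itv.
apply: (measurable_comp mD _ H H').
by move=> _ [z _ <-] /=; split.
Qed.

(** [solutionE] is multiplied by [Psi], and time and phase space are exchanged. The identity is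
    obtained at every time of [0, T], although the decay norm is finite only at almost every
    time. *)
Lemma weak_formulation t : t \in `[0, T] ->
  rint m (fun z => Psi z * f t z.1 z.2) /\
  \int[m]_z (Psi z * f t z.1 z.2) =
  \int[m]_z (Psi z * f0 z.1 z.2) + \int[leb]_s (Bt s * \1_(`]0, t[) s).
Proof.
move=> tT.
have mI : measurable (`]0, t[%classic : set TR) by exact: measurable_itv.
pose h (p : TR * (E * E)) := Psi p.2 * GG p * \1_(`]0, t[) p.1.
have mi : measurable_fun setT (fun p : TR * (E * E) => \1_(`]0, t[) p.1 : R).
  by apply: measurableT_comp => //; exact: measurable_indic.
have jh : rint (prodm leb m) h.
  apply: (le_rint (g := fun p => `|Psi p.2 * GG p|)).
  - by apply: measurable_funM => //; exact: rint_measurable rint_Psi_GG.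
  - by apply: rint_norm; exact: rint_Psi_GG.
  - move=> p; rewrite normrM ler_piMr// indicE ger0_norm// lern1.
    by case: (_ \in _).
have [jz e2] := rint_fubini2 jh; have [js e1] := rint_fubini1 jh.
have E1 : {ae m, forall z, Psi z * f0 z.1 z.2 + \int[leb]_s h (s, z) = Psi z * f t z.1 z.2}.
  have GGm : rint (prodm leb m) h := jh.
  apply: filterS (ae_integrable2 jh) => z jz'.
  rewrite solutionE// mulrDr; congr (_ + _).
  (* Integrability in time is known only for [Psi z] times [GG]; it gives that of [GG] after
     division, which requires [Psi z] to be nonzero. *)
  have [P0|P0] := eqVneq (Psi z) 0.
    rewrite P0 mul0r /h /=; under eq_Rintegral do rewrite P0 !mul0r.
    by rewrite Rintegral_cst// mul0r.
  rewrite -RintegralZl//.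
    by apply: eq_Rintegral => s _; rewrite /h /= mulrA.
  have := rintZl (Psi z)^-1 jz'; apply: eq_integrable => // s _ /=.
  by rewrite /h /= -mulrA mulKf.
have j1 : rint m (fun z => Psi z * f0 z.1 z.2 + \int[leb]_s h (s, z)) by exact: rintD.
have mPf : measurable_fun setT (fun z => Psi z * f t z.1 z.2).
  by apply: measurable_funM; [exact: measurable_Psi|exact: measurable_f_section].
split; first exact: rint_ae_eq mPf E1 j1.
rewrite -(ae_eq_Rint_nonmeasurable E1) RintegralD//; congr (_ + _).
rewrite e2 -e1; apply: (@ae_eq_Rint_nonmeasurable _ TR R leb).
apply: filterS2 Rint_Psi_GG (ae_integrable1 rint_Psi_GG) => s hs js'.
by rewrite /h /= RintegralZr// hs.
Qed.

End test_function.

Lemma is_derive_sqr_norm i (v : E) : is_derive v (delta_mx 0 i : E)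
  (fun y : E => \sum_(k < N) y 0 k * y 0 k) (2 * v 0 i).
Proof.
have d k : is_derive v (delta_mx 0 i : E) (fun y : E => y 0 k * y 0 k)
    (2 * (v 0 k * (k == i)%:R)).
  have := is_derive_mul (is_derive_coord v (delta_mx 0 i) k) (is_derive_coord v (delta_mx 0 i) k).
  by rewrite mxE eqxx /= => h; apply: (is_derive_eq h); ring.
have := is_derive_sum d; rewrite fct_sumE => h; apply: (is_derive_eq h).
rewrite (bigD1 i)//= eqxx mulr1 big1 ?addr0// => k /negbTE ->.
by rewrite !mulr0.
Qed.

(** * Conservation of mass and the energy-dissipation bound *)

Variables (M0 E0 : R).
Hypothesis f0_ge0 : forall x v, 0 <= f0 x v.
Hypothesis jf0 : rint m (fun z => f0 z.1 z.2).
Hypothesis f0_le : \int[m]_z f0 z.1 z.2 <= M0.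
Hypothesis jf0v : rint m (fun z => enorm z.2 ^+ 2 * f0 z.1 z.2).
Hypothesis f0v_le : \int[m]_z (enorm z.2 ^+ 2 * f0 z.1 z.2) <= E0.

(** With chi = w = 1 all derivatives of the test function vanish, hence [Bt] too. *)
Lemma mass t : t \in `[0, T] ->
  rint m (fun z => f t z.1 z.2) /\ \int[m]_z f t z.1 z.2 = \int[m]_z f0 z.1 z.2.
Proof.
move=> tT.
have d1 i (x : E) : is_derive x (delta_mx 0 i : E) (fun=> 1 : R) ((fun _ _ => 0) i x).
  exact: is_derive_cst.
have cc (c : R) : continuous (fun _ : E => c) by exact: cst_continuous.
have b1 (x : E) : `|1 : R| <= 1 by rewrite normr1.
have b0 (i : 'I_N) (x : E) : `|0 : R| <= 1 by rewrite normr0.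
have w1 (v : E) : `|1 : R| <= (1 + enorm v) ^+ 2.
  by rewrite normr1 exprn_ege1// lerDl enorm_ge0.
have w0 (i : 'I_N) (v : E) : `|0 : R| <= 2 * (1 + enorm v).
  by rewrite normr0 mulr_ge0// addr_ge0// enorm_ge0.
have j0 : rint m (fun z => Psi (fun=> 1) (fun=> 1) z * f0 z.1 z.2).
  by apply: eq_integrable jf0 => // z _; rewrite /Psi /= !mul1r.
have [] := weak_formulation ler01 d1 (cc 1) (fun _ => cc 0) b1 b0 d1 (cc 1) (fun _ => cc 0) w1 w0 j0 tT.
have B0 s : Bt (fun=> 1) (fun _ _ => 0) (fun=> 1) (fun _ _ => 0) s = 0.
  rewrite /Bt (_ : (fun z => _) = fun=> 0); first by rewrite Rintegral_cst// mul0r.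
  apply/funext => z; rewrite /bb !big1 ?mulr0 ?subr0// => i _; by rewrite !(mulr0, mul0r).
under [in X in _ -> X -> _]eq_Rintegral do rewrite /Psi !mul1r.
under [X in _ -> _ = X + _ -> _]eq_Rintegral do rewrite /Psi !mul1r.
under [X in _ -> _ = _ + X -> _]eq_Rintegral do rewrite B0 mul0r.
rewrite Rintegral_cst// mul0r addr0 => j1 e1; split => //.
by apply: eq_integrable j1 => // z _; rewrite /Psi /= !mul1r.
Qed.

Lemma M0_ge0 : 0 <= M0.
Proof. by apply: le_trans f0_le; apply: Rintegral_ge0 => z _; exact: f0_ge0. Qed.

Lemma itv_oo_cc t : t \in `]0, T[ -> t \in `[0, T].
Proof. exact: subset_itvW. Qed.

(** Conservation of mass gives this at every time, where [solution_decay] gives it only a.e.;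
    pointwise limits in time will need every [t]. *)
Lemma rint_uu t : rint m (fun z => uu (t, z)).
Proof.
have [tI|tI] := boolP (t \in `]0, T[); last first.
  by apply: eq_integrable (rint0 m) => // z _ /=; rewrite /uu ext0.
have [j _] := mass (itv_oo_cc tI).
by apply: eq_integrable j => // z _ /=; rewrite /uu extE.
Qed.

Lemma Rint_uu_le t : \int[m]_z uu (t, z) <= M0.
Proof.
have [tI|tI] := boolP (t \in `]0, T[); last first.
  under eq_Rintegral do rewrite /uu ext0//.
  by rewrite Rintegral_cst// mul0r M0_ge0.
have [_ e] := mass (itv_oo_cc tI).
by under eq_Rintegral do rewrite /uu extE//; rewrite e.
Qed.

Let coord_le1 (v : E) i : `|v 0 i| <= 1 + enorm v.
Proof. by apply: le_trans (coord_le_enorm v i) _; rewrite lerDr. Qed.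

Let mcoord2 i : measurable_fun setT (fun z : E * E => z.2 0 i).
Proof. exact: (measurableT_comp (measurable_rV_coord i) measurable_snd). Qed.

Lemma weight_vi i : weight 1 (fun z => z.2 0 i).
Proof. by split => // z; rewrite mul1r; exact: coord_le_weight. Qed.

Lemma weight_vivi i : weight 1 (fun z => z.2 0 i * z.2 0 i).
Proof.
split => //; first exact: measurable_funM.
move=> z; rewrite mul1r normrM; have h1 : 1 <= 1 + enorm z.2 by rewrite lerDl enorm_ge0.
apply: (@le_trans _ _ ((1 + enorm z.2) ^+ 2)); first by rewrite expr2 ler_pM.
by rewrite /om ler_weXn2l.
Qed.

Lemma weight_one : weight 1 (fun=> 1).
Proof. by split => // z; rewrite mul1r normr1 om_ge1. Qed.

Definition Lf := prodm leb m.

Lemma rint_kin i : rint Lf (fun p : TR * (E * E) => p.2.2 0 i * p.2.2 0 i * uu p).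
Proof. exact: (rint_weight_field (weight_vivi i) field_uu). Qed.

Definition kin (p : TR * (E * E)) : R := enorm p.2.2 ^+ 2 * uu p.

Lemma kinE p : kin p = \sum_(i < N) p.2.2 0 i * p.2.2 0 i * uu p.
Proof. by rewrite /kin enorm_sqr mulr_suml; apply: eq_bigr => i _; rewrite expr2. Qed.

Lemma rint_kinetic : rint Lf kin.
Proof.
rewrite (_ : kin = fun p => \sum_(i < N) p.2.2 0 i * p.2.2 0 i * uu p); last first.
  by apply/funext => p; rewrite kinE.
by apply: rint_sum => i; exact: rint_kin.
Qed.

Lemma kin_ge0 p : 0 <= kin p.
Proof. by rewrite mulr_ge0 ?sqr_ge0 ?uu_ge0. Qed.

Definition FF (p : TR * (E * E)) : R := (\sum_(i < N) Ft i (p.1, p.2.1) ^+ 2) * uu p.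

Lemma FF_ge0 p : 0 <= FF p.
Proof. by rewrite mulr_ge0 ?uu_ge0//; apply: sumr_ge0 => i _; exact: sqr_ge0. Qed.

Lemma measurable_sumFt : measurable_fun setT (fun p : TR * E => \sum_(i < N) Ft i p ^+ 2).
Proof. by apply: measurable_sum => i; apply: measurable_funX. Qed.

(** At a.e. time |F|^2 is at most [LF t] squared for a.e. x, while the mass is at most [M0]; the
    time integral is then bounded by the norm of the force. *)
Lemma rint_FF : rint Lf FF /\ \int[Lf]_p FF p <= (M0 + 1) * F0 ^+ 2.
Proof.
have mF : measurable_fun setT FF.
  apply: measurable_funM; last exact: measurable_uu.
  exact: (measurableT_comp measurable_sumFt measurable_tx).
have mFE : measurable_fun setT (fun p => (FF p)%:E) by exact/measurable_EFinP.
pose q (t : TR) := (\int[m]_z (FF (t, z))%:E)%E.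
have mq : measurable_fun setT q.
  apply: (measurable_fun_fubini_tonelli_F (fun p => (FF p)%:E)) => //.
  by move=> p; rewrite lee_fin FF_ge0.
have qle : (\int[leb]_t q t <= ((M0 + 1) * F0 ^+ 2)%:E)%E.
  (* The constant is [M0 + 1] and not [M0] so as to be positive: the bound is then trivial at the
     times where [LF] is infinite. *)
  have := @integral_le_lower _ _ _ leb q LF (fun=> 0) (M0 + 1) (F0 ^+ 2)%:E mq.
  move=> H; apply: (le_trans (H _ _ _ _ _ _)) => {H}.
  - by move=> t; apply: integral_ge0 => z _; rewrite lee_fin FF_ge0.
  - exact: rint0.
  - by [].
  - by rewrite addr_ge0// M0_ge0.
  - apply: filterS FtE => t hF; rewrite adde0.
    have [tI|tI] := boolP (t \in `]0, T[); last first.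
      rewrite /q integral0_eq ?mule_ge0 ?poweR_ge0 ?lee_fin ?addr_ge0 ?M0_ge0//.
      by move=> z _; rewrite /FF /uu ext0// mulr0.
    have M00 := M0_ge0.
    have jt := rint_uu t.
    have tle : (\int[m]_z (uu (t, z))%:E <= (M0 + 1)%:E)%E.
      by rewrite -Rint_EFin// lee_fin (le_trans (Rint_uu_le t))// lerDl.
    have [Lt|] := ltP (LF t) +oo%E; last first.
      rewrite leye_eq => /eqP ->; rewrite /= gt_eqF//.
      by rewrite gt0_muley ?leey// lte_fin ltr_wpDl.
    have [K [K0 LK] aeK] := LF_ae tI Lt.
    have qK : (q t <= (K ^+ 2)%:E * \int[m]_z (uu (t, z))%:E)%E.
      apply: (integral_ae_bounded_factor (a := fun x => \sum_(i < N) Ft i (t, x) ^+ 2)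
        (h := fun z => uu (t, z))) => //.
      + by apply: (measurableT_comp measurable_sumFt); exact: pair1_measurable.
      + by apply: measurable_section; exact: measurable_uu.
      + by move=> x; apply: sumr_ge0 => i _; exact: sqr_ge0.
      + by move=> z; exact: uu_ge0.
      + by exact: sqr_ge0.
      + apply: filterS aeK => x xK; rewrite (_ : \sum_(i < N) _ = enorm (F t x) ^+ 2).
          by rewrite ler_pXn2r ?nnegrE ?enorm_ge0.
        by rewrite enorm_sqr; apply: eq_bigr => i _; rewrite hF.
    apply: le_trans qK _; rewrite LK /= ger0_norm// powR_mulrn// muleC.
    by apply: lee_wpmul2r => //; rewrite lee_fin sqr_ge0.
  - exact: integral_LF2.
  - by rewrite Rintegral_cst// mul0r adde0.
have e : (\int[Lf]_p (FF p)%:E = \int[leb]_t q t)%E.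
  apply: (fubini_tonelli1 (fun p => (FF p)%:E)) => //.
  by move=> p; rewrite lee_fin FF_ge0.
have jF : rint Lf FF.
  apply/ge0_rintP => //; first exact: FF_ge0.
  by rewrite e; apply: le_lt_trans qle _; rewrite ltry.
by split => //; rewrite -lee_fin Rint_EFin// e.
Qed.

Lemma rint_v_uv i : rint Lf (fun p : TR * (E * E) => p.2.2 0 i * uv i p).
Proof. exact: (rint_weight_field (weight_vi i) (field_uv i)). Qed.

Lemma rint_Lf_uu : rint Lf uu.
Proof.
have := rint_weight_field weight_one field_uu.
by apply: eq_integrable => // p _ /=; rewrite mul1r.
Qed.

(** Integration by parts in v_i; this is how the diffusion contributes a multiple of the mass to the
    energy balance. *)
Lemma Rint_v_uv i : \int[Lf]_p (p.2.2 0 i * uv i p) = - \int[Lf]_p uu p.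
Proof.
have jK : rint Lf (fun p : TR * (E * E) => p.2.2 0 i * uu p).
  exact: (rint_weight_field (weight_vi i) field_uu).
have jD : rint Lf (fun p : TR * (E * E) => p.2.2 0 i * uv i p + uu p).
  by apply: rintD; [exact: rint_v_uv|exact: rint_Lf_uu].
suff : \int[Lf]_p (p.2.2 0 i * uv i p + uu p) = 0.
  rewrite RintegralD//; [|exact: rint_v_uv|exact: rint_Lf_uu].
  by move=> h; rewrite -[RHS]add0r -h addrK.
have [_ <-] := rint_fubini1 jD.
rewrite (@ae_eq_Rint_nonmeasurable _ TR R leb _ (fun=> 0)).
  by rewrite Rintegral_cst// mul0r.
apply: filterS2 (ae_integrable1 jK) (ae_integrable1 jD) => t jKt jDt.
have [tI|tI] := boolP (t \in `]0, T[); last first.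
  rewrite (_ : (fun z => _) = fun=> 0); first by rewrite Rintegral_cst// mul0r.
  by apply/funext => z; rewrite /uv /uu !ext0// mulr0 addr0.
apply: (@Rint_derive_v R N (fun z => z.2 0 i * uu (t, z)) _ i) => //.
- move=> x v; have d2 := is_derive_coord v (delta_mx 0 i) i.
  rewrite mxE !eqxx /= in d2.
  have d1 := is_derive_mul d2 (is_derive_uu_v i x v tI).
  by apply: (is_derive_eq d1) => /=; ring.
- move=> x /=; apply: continuous_add.
    apply: continuous_mul; first exact: continuous_coord.
    exact: (continuous_pairl (@continuous_uv i t)).
  exact: (continuous_pairl (@continuous_uu t)).
Qed.

Definition diss (p : TR * ((E * E) * (E * E))) : R :=
  phi_kernel lam eps (enorm (p.2.1.1 - p.2.2.1)) * enorm (p.2.1.2 - p.2.2.2) ^+ 2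
  * (uu (p.1, p.2.1) * uu (p.1, p.2.2)).

Lemma diss_ge0 p : 0 <= diss p.
Proof.
apply: mulr_ge0; last by apply: mulr_ge0; exact: uu_ge0.
by apply: mulr_ge0; [exact: phi_kernel_ge0|exact: sqr_ge0].
Qed.

Lemma measurable_diss : measurable_fun setT diss.
Proof.
have mX : measurable_fun setT (fun p : TR * ((E * E) * (E * E)) => (p.2.1.1, p.2.2.1)).
  by apply/measurable_fun_pair => /=; do ?apply: measurableT_comp => //.
have mV : measurable_fun setT (fun p : TR * ((E * E) * (E * E)) => (p.2.1.2, p.2.2.2)).
  by apply/measurable_fun_pair => /=; do ?apply: measurableT_comp => //.
have m1 : measurable_fun setT (fun p : TR * ((E * E) * (E * E)) => (p.1, p.2.1)).
  by apply/measurable_fun_pair => //=; apply: measurableT_comp.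
have m2 : measurable_fun setT (fun p : TR * ((E * E) * (E * E)) => (p.1, p.2.2)).
  by apply/measurable_fun_pair => //=; apply: measurableT_comp.
apply: measurable_funM; last first.
  by apply: measurable_funM; [exact: (measurableT_comp measurable_uu m1)|
    exact: (measurableT_comp measurable_uu m2)].
apply: measurable_funM; first exact: (measurableT_comp (@measurable_phi_kernel R N lam eps eps_gt0) mX).
apply: measurable_funX.
exact: (measurableT_comp (measurableT_comp (@measurable_enorm R N) (@measurable_rV_sub R N)) mV).
Qed.

Let mm := prodm m m.

Lemma Rint_swap (g : (E * E) * (E * E) -> R) : rint mm g ->
  rint mm (fun p => g (p.2, p.1)) ->
  \int[mm]_p g (p.2, p.1) = \int[mm]_p g p.
Proof.
move=> jg js; have [_ <-] := rint_fubini1 js; by have [_ <-] := rint_fubini2 jg.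
Qed.

Definition A4 i (p : TR * (E * E)) : R := p.2.2 0 i * p.2.2 0 i * (c1 (p.1, p.2.1) * uu p).
Definition A5 i (p : TR * (E * E)) : R := p.2.2 0 i * (ci i (p.1, p.2.1) * uu p).

Lemma rint_A4 i : rint Lf (A4 i).
Proof. by apply: (rint_weight_conv (weight_vivi i) field_uu _ one_le_weight). Qed.

Lemma rint_A5 i : rint Lf (A5 i).
Proof.
apply: (rint_weight_conv (weight_vi i) field_uu _ (coord_le_weight i)).
exact: measurable_coord.
Qed.

(** Expand |v - w|^2 and exchange the two particles: the kernel is symmetric, so the two square
    terms agree and the cross term gives the convolution with the current. *)
Lemma Rint_diss_section (t : TR) : (WW t < +oo)%E ->
  rint mm (fun q => diss (t, q)) /\
  \int[mm]_q diss (t, q) =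
  2 * (\sum_(i < N) \int[m]_z A4 i (t, z)) - 2 * \sum_(i < N) \int[m]_z A5 i (t, z).
Proof.
move=> Wt.
pose phi (z : E * E) := phi_kernel lam eps (enorm (z.1 - z.2)).
have mphi : measurable_fun setT phi by exact: (@measurable_phi_kernel R N lam eps eps_gt0).
have phile z : `|phi z| <= kphi lam eps by exact: norm_phi_kernel_le.
pose U z := uu (t, z).
pose g q1 q2 (p : (E * E) * (E * E)) : R :=
  phi (p.1.1, p.2.1) * (q1 p.1.2 * U p.1) * (q2 p.2.2 * U p.2).
pose one (_ : E) : R := 1; pose sq (i : 'I_N) (v : E) : R := v 0 i * v 0 i.
have jw b : weight 1 (fun z => b z.2) -> rint m (fun z => b z.2 * U z).
  move=> wb; apply: (@rint_dom_section _ t 1) => //.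
    apply: measurable_funM; first by case: wb.
    by apply: measurable_section; exact: measurable_uu.
  by move=> z; exact: (weight_field_le (t, z) wb field_uu).
have j1 : rint m (fun z => one z.2 * U z) by exact: (jw one) weight_one.
have ji i : rint m (fun z => coord i z.2 * U z) by exact: (jw (coord i)) (weight_vi i).
have jii i : rint m (fun z => (sq i) z.2 * U z).
  exact: (jw (sq i)) (weight_vivi i).
pose gi i (p : (E * E) * (E * E)) : R := g (sq i) one p
   + g (sq i) one (p.2, p.1)
   - 2 * g (coord i) (coord i) p.
have ja i : rint mm (g (sq i) one).
  exact: (rint_pair (q1 := sq i) (q2 := one) (jii i) j1 mphi phile).
have jas i : rint mm (fun p => g (sq i) one (p.2, p.1)).
  have := rint_pair (q1 := one) (q2 := sq i) j1 (jii i) mphi phile.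
  by apply: eq_integrable => // p _ /=; rewrite /g /phi /sq /one /= enormC; congr (_%:E); ring.
have jb i : rint mm (g (coord i) (coord i)) by exact: (rint_pair (q1 := coord i) (q2 := coord i) (ji i) (ji i) mphi phile).
have jgi i : rint mm (gi i).
  by apply: rintB; [apply: rintD|apply: rintZl].
have dE q : diss (t, q) = \sum_(i < N) gi i q.
  rewrite /diss /= enorm_sqr mulr_sumr mulr_suml; apply: eq_bigr => i _.
  by rewrite /gi /g /phi /coord /sq /one /U /= !mxE (enormC q.2.1); ring.
split; first by under eq_fun do rewrite dE; apply: rint_sum.
under eq_Rintegral do rewrite dE.
rewrite (Rint_sum _ _ jgi).
transitivity (\sum_(i < N) (2 * \int[m]_z A4 i (t, z) - 2 * \int[m]_z A5 i (t, z))); last first.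
  exact: sum_sub2.
apply: eq_bigr => i _.
rewrite RintegralB//; [|exact: rintD|exact: rintZl].
rewrite RintegralD// RintegralZl// Rint_swap//.
have [_ ->] := Rint_pair_conv (q1 := sq i) (q2 := one) (jii i) j1 mphi phile.
have [_ ->] := Rint_pair_conv (q1 := coord i) (q2 := coord i) (ji i) (ji i) mphi phile.
have dbl (a : R) : a + a = 2 * a by ring.
rewrite dbl; congr (_ - _); congr (_ * _); apply: eq_Rintegral => z _.
- by rewrite /A4 /U /conv /mom /phi /sq /one /=; ring.
- by rewrite /A5 /U /conv /mom /phi /coord /=; ring.
Qed.

Lemma rint_diss : rint (prodm leb mm) diss /\ \int[prodm leb mm]_p diss p =
  2 * (\sum_(i < N) \int[Lf]_p A4 i p) - 2 * \sum_(i < N) \int[Lf]_p A5 i p.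
Proof.
pose h (t : TR) := 2 * (\sum_(i < N) \int[m]_z A4 i (t, z)) - 2 * \sum_(i < N) \int[m]_z A5 i (t, z).
have j4 i := rint_fubini1 (rint_A4 i).
have j5 i := rint_fubini1 (rint_A5 i).
have js4 : rint leb (fun t => \sum_(i < N) \int[m]_z A4 i (t, z)).
  by apply: rint_sum => i; case: (j4 i).
have js5 : rint leb (fun t => \sum_(i < N) \int[m]_z A5 i (t, z)).
  by apply: rint_sum => i; case: (j5 i).
have jh : rint leb h := rint_sub2 js4 js5.
have jd : rint (prodm leb mm) diss.
  apply: (rint_prod_le measurable_diss jh).
  apply: filterS ae_WW => t Wt; have [jt et] := Rint_diss_section Wt.
  by under eq_integral do rewrite ger0_norm ?diss_ge0//; rewrite -Rint_EFin// et.
split => //; have [_ <-] := rint_fubini1 jd.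
rewrite (@ae_eq_Rint_nonmeasurable _ TR R leb _ h); last first.
  by apply: filterS ae_WW => t Wt; have [jt et] := Rint_diss_section Wt.
have s4 : \int[leb]_t (\sum_(i < N) \int[m]_z A4 i (t, z)) = \sum_(i < N) \int[Lf]_p A4 i p.
  apply: etrans (Rint_sum _ _ (fun i => proj1 (j4 i))) _.
  by apply: eq_bigr => i _; exact: proj2 (j4 i).
have s5 : \int[leb]_t (\sum_(i < N) \int[m]_z A5 i (t, z)) = \sum_(i < N) \int[Lf]_p A5 i p.
  apply: etrans (Rint_sum _ _ (fun i => proj1 (j5 i))) _.
  by apply: eq_bigr => i _; exact: proj2 (j5 i).
exact: etrans (Rint_sub2 js4 js5) (congr2 (fun a b : R => 2 * a - 2 * b) s4 s5).
Qed.

(** The three terms come from the initial energy, which the scaling multiplies by [eps], from the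
    diffusion, and from the force after Young's inequality. *)
Definition Cdiss : R := eps * E0 + 2 * N%:R * M0 * T + (M0 + 1) * F0 ^+ 2.

Lemma Rint_I0T : \int[leb]_t (\1_I0T t : R) = T.
Proof.
have lI : lebesgue_measure (`]0, T[%classic : set R) = T%:E.
  by rewrite lebesgue_measure_itv/= lte_fin T_gt0 -EFinD subr0.
by rewrite /Rintegral integral_indic// setIT; exact: (congr1 fine lI).
Qed.

Lemma Rint_Lf_uu : \int[Lf]_p uu p <= M0 * T.
Proof.
have [jm <-] := rint_fubini1 rint_Lf_uu.
apply: (@le_trans _ _ (\int[leb]_t (M0 * \1_I0T t))).
  apply: le_Rint => //; first by apply: rintZl; exact: rint_I0T.
  move=> t; rewrite indicE; have [tI|tI] := boolP (t \in `]0, T[).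
    by rewrite mem_set// mulr1; exact: Rint_uu_le.
  under eq_Rintegral do rewrite /uu ext0//.
  by rewrite Rintegral_cst// mul0r mulr_ge0// M0_ge0.
by rewrite RintegralZl ?Rint_I0T//; exact: rint_I0T.
Qed.

(* The test with |v|^2, at the final time, where the energy is dropped for being
   nonnegative. *)
Lemma energy : \int[Lf]_p kin p + \int[prodm leb mm]_p diss p <= Cdiss.
Proof.
have TT : T \in `[0, T] by rewrite in_itv/= lexx ltW.
have d1 i (x : E) : is_derive x (delta_mx 0 i : E) (fun=> 1 : R) ((fun _ _ => 0) i x).
  exact: is_derive_cst.
have cc (c : R) : continuous (fun _ : E => c) by exact: cst_continuous.
have b1 (x : E) : `|1 : R| <= 1 by rewrite normr1.
have b0 (i : 'I_N) (x : E) : `|0 : R| <= 1 by rewrite normr0.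
pose w (v : E) : R := \sum_(k < N) v 0 k * v 0 k.
pose dw (i : 'I_N) (v : E) : R := 2 * v 0 i.
have wE v : w v = enorm v ^+ 2 by rewrite enorm_sqr; apply: eq_bigr => k _; rewrite expr2.
have w' i v : is_derive v (delta_mx 0 i : E) w (dw i v) by exact: is_derive_sqr_norm.
have cw : continuous w.
  by apply: continuous_sumr => k; apply: continuous_mul; exact: continuous_coord.
have cdw i : continuous (dw i) by apply: continuous_scale; exact: continuous_coord.
have wle v : `|w v| <= (1 + enorm v) ^+ 2.
  by rewrite wE ger0_norm ?sqr_ge0// ler_pXn2r ?nnegrE ?addr_ge0 ?enorm_ge0// lerDr.
have dwle i v : `|dw i v| <= 2 * (1 + enorm v).
  by rewrite /dw normrM ger0_norm// ler_wpM2l// coord_le1.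
have j0 : rint m (fun z => Psi (fun=> 1) w z * f0 z.1 z.2).
  by apply: eq_integrable jf0v => // z _; rewrite /Psi /= mul1r wE.
have [jT eT] := weak_formulation ler01 d1 (cc 1) (fun _ => cc 0) b1 b0 w' cw cdw wle dwle j0 TT.
have jb := rint_bb ler01 (cc 1) (fun _ => cc 0) b1 b0 cw cdw wle dwle.
have bbE p : bb (fun=> 1) (fun _ _ => 0) w dw p = - eps^-1 * (2 * (
    \sum_(i < N) p.2.2 0 i * (Ft i (p.1, p.2.1) * uu p) + kin p +
    \sum_(i < N) p.2.2 0 i * uv i p + \sum_(i < N) A4 i p - \sum_(i < N) A5 i p)).
  rewrite /bb big1; last by move=> i _; rewrite !mul0r.
  rewrite sub0r -mulNr; congr (_ * _); rewrite kinE -!big_split/= -sumrB mulr_sumr.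
  by apply: eq_bigr => i _; rewrite /TH /A4 /A5 /dw; ring.
have Bpos : 0 <= E0 + \int[leb]_s (Bt (fun=> 1) (fun _ _ => 0) w dw s * \1_(`]0, T[) s).
  apply: (@le_trans _ _ (\int[m]_z (Psi (fun=> 1) w z * f T z.1 z.2))).
    apply: Rintegral_ge0 => z _; rewrite /Psi mul1r wE mulr_ge0 ?sqr_ge0//.
    exact: (solution_ge0 sol).
  rewrite eT lerD2r; apply: le_trans f0v_le.
  by rewrite le_eqVlt; apply/orP; left; apply/eqP; apply: eq_Rintegral => z _; rewrite /Psi mul1r wE.
have Bb : \int[leb]_s (Bt (fun=> 1) (fun _ _ => 0) w dw s * \1_(`]0, T[) s) =
    \int[Lf]_p bb (fun=> 1) (fun _ _ => 0) w dw p.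
  have [_ <-] := rint_fubini1 jb; apply: eq_Rintegral => s _; rewrite -/(Bt _ _ _ _ s).
  rewrite indicE; have [sI|sI] := boolP (s \in `]0, T[).
    by rewrite mem_set// mulr1.
  rewrite memNset ?mulr0; last by move/negP: sI.
  rewrite /Bt (_ : (fun z => _) = fun=> 0); first by rewrite Rintegral_cst// mul0r.
  apply/funext => z; rewrite bbE /kin /A4 /A5 /uu /uv !ext0//.
  by rewrite !big1 => *; rewrite ?ext0 ?(mulr0, addr0, subr0, oppr0).
rewrite Bb in Bpos.
have jF i : rint Lf (fun p : TR * (E * E) => p.2.2 0 i * (Ft i (p.1, p.2.1) * uu p)).
  exact: (rint_weight_Ft i (weight_vi i) field_uu).
have jFs : rint Lf (fun p : TR * (E * E) => \sum_(i < N) p.2.2 0 i * (Ft i (p.1, p.2.1) * uu p)).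
  exact: rint_sum.
have jvs : rint Lf (fun p : TR * (E * E) => \sum_(i < N) p.2.2 0 i * uv i p).
  by apply: rint_sum => i; exact: rint_v_uv.
have j4s : rint Lf (fun p => \sum_(i < N) A4 i p) by apply: rint_sum => i; exact: rint_A4.
have j5s : rint Lf (fun p => \sum_(i < N) A5 i p) by apply: rint_sum => i; exact: rint_A5.
have jk := rint_kinetic.
have I1 : \int[Lf]_p bb (fun=> 1) (fun _ _ => 0) w dw p = - eps^-1 * (2 * (
    \int[Lf]_p (\sum_(i < N) p.2.2 0 i * (Ft i (p.1, p.2.1) * uu p)) + \int[Lf]_p kin p +
    \sum_(i < N) \int[Lf]_p (p.2.2 0 i * uv i p) + \sum_(i < N) \int[Lf]_p A4 i p
     - \sum_(i < N) \int[Lf]_p A5 i p)).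
  under eq_Rintegral do rewrite bbE.
  rewrite (Rint_five _ jFs jk jvs j4s j5s).
  rewrite (Rint_sum _ _ rint_v_uv) (Rint_sum _ _ rint_A4) (Rint_sum _ _ rint_A5).
  by [].
rewrite I1 in Bpos.
have [jFF leFF] := rint_FF; have [jd ed] := rint_diss; have leu := Rint_Lf_uu.
have Iv : \sum_(i < N) \int[Lf]_p (p.2.2 0 i * uv i p) = - (N%:R * \int[Lf]_p uu p).
  under eq_bigr do rewrite Rint_v_uv.
  by rewrite sumr_const card_ord mulr_natl mulNrn.
(* Since |F + v|^2 f >= 0, the force term costs one of the two copies of the kinetic energy that the
   friction provides. *)
have young : - (2 * \int[Lf]_p (\sum_(i < N) p.2.2 0 i * (Ft i (p.1, p.2.1) * uu p))) <=
    \int[Lf]_p FF p + \int[Lf]_p kin p.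
  rewrite -RintegralD// -RintegralZl// -mulN1r -RintegralZl//; last exact: rintZl.
  apply: le_Rint; [exact/rintZl/rintZl|exact: rintD|].
  move=> p; rewrite /FF kinE mulr_suml -big_split/= !mulr_sumr; apply: ler_sum => i _.
  rewrite -subr_ge0 (_ : _ - _ = (Ft i (p.1, p.2.1) + p.2.2 0 i) ^+ 2 * uu p); last by ring.
  by rewrite mulr_ge0 ?sqr_ge0 ?uu_ge0.
rewrite Iv in Bpos.
have Bpos' : 2 * (\int[Lf]_p (\sum_(i < N) p.2.2 0 i * (Ft i (p.1, p.2.1) * uu p)) +
    \int[Lf]_p kin p - N%:R * \int[Lf]_p uu p + \sum_(i < N) \int[Lf]_p A4 i p
     - \sum_(i < N) \int[Lf]_p A5 i p) <= eps * E0.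
  rewrite -subr_ge0; move: Bpos; rewrite -(pmulr_rge0 _ eps_gt0) mulrDr mulrA mulrN divff ?gt_eqF//.
  by rewrite mulN1r.
have leu' : N%:R * \int[Lf]_p uu p <= N%:R * (M0 * T) by rewrite ler_wpM2l.
rewrite ed /Cdiss (_ : 2 * N%:R * M0 * T = 2 * (N%:R * (M0 * T))); last by rewrite !mulrA.
exact: (energy_arith Bpos' young leFF leu').
Qed.

(** * Moments of the density and of the current, and their regularity in time *)

Definition Amom (chi : E -> R) (t : TR) : R := \int[m]_z (chi z.1 * uu (t, z)).
Definition Bmom (chi : E -> R) i (t : TR) : R := \int[m]_z (chi z.1 * z.2 0 i * uu (t, z)).
Definition kinr (t : TR) : R := \int[m]_z kin (t, z).

Lemma kinr_ge0 t : 0 <= kinr t.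
Proof. by apply: Rintegral_ge0 => z _; exact: kin_ge0. Qed.

Lemma Rint_diss_ge0 : 0 <= \int[prodm leb mm]_p diss p.
Proof. by apply: Rintegral_ge0 => z _; exact: diss_ge0. Qed.

Lemma rint_kinr : rint leb kinr /\ \int[leb]_t kinr t <= Cdiss.
Proof.
have [j e] := rint_fubini1 rint_kinetic; split => //.
by rewrite e; apply: le_trans energy; rewrite lerDl Rint_diss_ge0.
Qed.

(** The free parameter [k] puts a small factor on the kinetic energy at the price of a large
    multiple of the mass. As the energy is merely integrable in time, this is what prevents
    concentration in time. *)
Lemma young_abs (k a : R) : 0 < k -> `|a| <= k * (a * a) + k^-1.
Proof.
move=> k0; rewrite -expr2 -real_normK ?num_real// -subr_ge0.
rewrite (_ : _ - _ = k * (`|a| - k^-1 / 2) ^+ 2 + 3 / 4 * k^-1).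
  by rewrite addr_ge0// mulr_ge0 ?sqr_ge0 ?invr_ge0// ltW.
by field; rewrite gt_eqF.
Qed.

(** For w = 1 the flux term, which carries 1/eps, disappears, and only the integral of f v . grad
    chi remains. The parameter [k] is left free: first [k] is taken small, then the time
    increment. *)
Lemma equicontinuity_le (chi : E -> R) (dchi : 'I_N -> E -> R) (C k t1 t2 : R) : 0 <= C ->
  (forall i x, is_derive x (delta_mx 0 i : E) chi (dchi i x)) ->
  continuous chi -> (forall i, continuous (dchi i)) ->
  (forall x, `|chi x| <= C) -> (forall i x, `|dchi i x| <= C) ->
  0 < k -> t1 \in `]0, T[ -> t2 \in `]0, T[ -> t1 <= t2 ->
  `|Amom chi t2 - Amom chi t1| <= C * (k * Cdiss + N%:R / k * M0 * (t2 - t1)).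
Proof.
move=> C0' chi' cchi cdchi chi_le dchi_le k0 t1I t2I t12.
have d1 i (x : E) : is_derive x (delta_mx 0 i : E) (fun=> 1 : R) ((fun _ _ => 0) i x).
  exact: is_derive_cst.
have cc (c : R) : continuous (fun _ : E => c) by exact: cst_continuous.
have w1 (v : E) : `|1 : R| <= (1 + enorm v) ^+ 2.
  by rewrite normr1 exprn_ege1// lerDl enorm_ge0.
have w0 (i : 'I_N) (v : E) : `|0 : R| <= 2 * (1 + enorm v).
  by rewrite normr0 mulr_ge0// addr_ge0// enorm_ge0.
have j0 : rint m (fun z => Psi chi (fun=> 1) z * f0 z.1 z.2).
  apply: (le_rint (g := fun z => C * `|f0 z.1 z.2|)).
  - apply: measurable_funM; last exact: rint_measurable jf0.
    exact: measurable_Psi.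
  - by apply: rintZl; exact: rint_norm.
  - by move=> z; rewrite normrM ler_wpM2r// /Psi mulr1.
pose B := Bt chi dchi (fun=> 1) (fun _ _ => 0).
have jB : rint leb B := rint_Bt C0' cchi cdchi chi_le dchi_le (cc 1) (fun _ => cc 0) w1 w0.
have jb := rint_bb C0' cchi cdchi chi_le dchi_le (cc 1) (fun _ => cc 0) w1 w0.
have wf t : t \in `]0, T[ -> Amom chi t = \int[m]_z (Psi chi (fun=> 1) z * f0 z.1 z.2)
    + \int[leb]_s (B s * \1_(`]0, t[) s).
  move=> tI.
  have [_ <-] := weak_formulation C0' chi' cchi cdchi chi_le dchi_le d1 (cc 1) (fun _ => cc 0) w1 w0 j0 (itv_oo_cc tI).
  by apply: eq_Rintegral => z _; rewrite /Psi mulr1 /uu extE.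
pose I (t : R) : TR -> R := \1_(`]0, t[%classic : set R).
have jI t : rint leb (I t) by exact: integrable_indic_itv.
have mI t : measurable_fun setT (I t) := rint_measurable (jI t).
have I01 t s : 0 <= I t s <= 1 by rewrite /I indicE lern1 ler0n; case: (_ \in _).
have jBI t : rint leb (fun s => B s * I t s).
  apply: (le_rint (g := fun s => `|B s|)); last first.
  - by move=> s; rewrite normrM ler_piMr// ger0_norm; case/andP: (I01 t s).
  - exact: rint_norm.
  - by apply: measurable_funM; [exact: rint_measurable jB|exact: mI].
pose g s := I t2 s - I t1 s.
have jg : rint leb g by exact: rintB.
have g0 s : 0 <= g s.
  rewrite /g /I !indicE subr_ge0 ler_nat; case: (boolP (s \in `]0, t1[)) => s1.
    rewrite !mem_set//=; move: s1; rewrite !in_itv/= => /andP[-> s1].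
    by rewrite (lt_le_trans s1).
  by rewrite [X in nat_of_bool X](memNset)//; apply/negP.
have Ig t : t \in `]0, T[ -> \int[leb]_s I t s = t.
  rewrite in_itv/= => /andP[tp _].
  have lI : lebesgue_measure (`]0, t[%classic : set R) = t%:E.
    by rewrite lebesgue_measure_itv/= lte_fin tp -EFinD subr0.
  by rewrite /Rintegral integral_indic// setIT; exact: (congr1 fine lI).
have gE : \int[leb]_s g s = t2 - t1 by rewrite RintegralB// !Ig.
rewrite !wf// opprD addrACA subrr add0r -RintegralB//; [|exact: (jBI t2)|exact: (jBI t1)].
have jD : rint leb (fun s => B s * I t2 s - B s * I t1 s) by exact: (rintB (jBI t2) (jBI t1)).
apply: le_trans (le_normr_Rintegral measurableT jD) _.
have [jk lek] := rint_kinr.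
have jbd : rint leb (fun s => C * (k * kinr s + N%:R / k * M0 * g s)).
  by apply: rintZl; apply: rintD; exact: rintZl.
apply: (@le_trans _ _ (\int[leb]_s (C * (k * kinr s + N%:R / k * M0 * g s)))); last first.
  rewrite RintegralZl//; last by apply: rintD; exact: rintZl.
  rewrite ler_wpM2l// RintegralD//; [|exact: rintZl|exact: rintZl].
  by rewrite !RintegralZl// gE lerD2r ler_wpM2l// ltW.
apply: ae_le_Rint => //; first exact: rint_norm.
apply: filterS2 (ae_integrable1 rint_kinetic) (ae_integrable1 jb) => s jks jbs.
rewrite -mulrBr -/(g s) normrM (ger0_norm (g0 s)).
have g1 : g s <= 1.
  by rewrite /g; have /andP[_] := I01 t2 s; have /andP[] := I01 t1 s => *; lra.
have Bs : `|B s| <= C * (k * kinr s + N%:R / k * M0).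
  rewrite /B /Bt; apply: le_trans (le_normr_Rintegral measurableT jbs) _.
  apply: (@le_trans _ _ (\int[m]_z (C * (k * kin (s, z) + N%:R / k * uu (s, z))))); last first.
    have ju := rint_uu s.
    rewrite RintegralZl//; last by apply: rintD; exact: rintZl.
    rewrite ler_wpM2l// RintegralD//; [|exact: rintZl|exact: rintZl].
    rewrite !RintegralZl// lerD2l ler_wpM2l ?Rint_uu_le//.
    by rewrite divr_ge0// ltW.
  apply: le_Rint; [exact: rint_norm|by apply: rintZl; apply: rintD; apply: rintZl => //; exact: rint_uu|].
  move=> z; have e0 : \sum_(i < N) chi z.1 * 0 * TH i (s, z) = 0.
    by apply: big1 => i _; rewrite mulr0 mul0r.
  rewrite /bb /= e0 mulr0 subr0.
  apply: le_trans (ler_norm_sum _ _ _) _.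
  rewrite kinE mulr_sumr (_ : N%:R / k * uu (s, z) = \sum_(i < N) (k^-1 * uu (s, z))); last first.
    by rewrite sumr_const card_ord -[RHS]mulr_natl mulrA.
  rewrite -big_split/= mulr_sumr; apply: ler_sum => i _.
  rewrite mulr1 !normrM (ger0_norm (uu_ge0 _)) -mulrA.
  apply: ler_pM => //; first by rewrite mulr_ge0// uu_ge0.
  have -> : k * (z.2 0 i * z.2 0 i * uu (s, z)) + k^-1 * uu (s, z) =
     (k * (z.2 0 i * z.2 0 i) + k^-1) * uu (s, z) by ring.
  rewrite ler_wpM2r ?uu_ge0//.
  exact: young_abs.
apply: le_trans (ler_wpM2r (g0 s) Bs) _.
rewrite -[leLHS]mulrA ler_wpM2l// mulrDl lerD2r ler_piMr// mulr_ge0 ?kinr_ge0//; exact: ltW.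
Qed.

Lemma equicontinuity (chi : E -> R) (dchi : 'I_N -> E -> R) (C k t1 t2 : R) : 0 <= C ->
  (forall i x, is_derive x (delta_mx 0 i : E) chi (dchi i x)) ->
  continuous chi -> (forall i, continuous (dchi i)) ->
  (forall x, `|chi x| <= C) -> (forall i x, `|dchi i x| <= C) ->
  0 < k -> t1 \in `]0, T[ -> t2 \in `]0, T[ ->
  `|Amom chi t2 - Amom chi t1| <= C * (k * Cdiss + N%:R / k * M0 * `|t2 - t1|).
Proof.
move=> C0' chi' cchi cdchi chi_le dchi_le k0 t1I t2I.
have [t12|/ltW t21] := leP t1 t2.
  by rewrite (@ger0_norm _ (t2 - t1)) ?subr_ge0//; exact: equicontinuity_le dchi_le k0 t1I t2I t12.
rewrite distrC [in X in _ <= X]distrC (@ger0_norm _ (t1 - t2)) ?subr_ge0//.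
exact: equicontinuity_le dchi_le k0 t2I t1I t21.
Qed.

Section bounded_weight.
Variables (chi : E -> R) (C : R).
Hypothesis mchi : measurable_fun setT chi.
Hypothesis chi_le : forall x, `|chi x| <= C.

Let C_ge0 : 0 <= C.
Proof. exact: le_trans (chi_le 0). Qed.

Let mchi1 : measurable_fun setT (fun z : E * E => chi z.1).
Proof. exact: measurableT_comp. Qed.

Lemma rint_Amom_section t : rint m (fun z => chi z.1 * uu (t, z)).
Proof.
apply: (le_rint (g := fun z => C * uu (t, z))).
- by apply: measurable_funM => //; apply: rint_measurable (rint_uu t).
- by apply: rintZl; exact: rint_uu.
- by move=> z; rewrite normrM (ger0_norm (uu_ge0 _)) ler_wpM2r ?uu_ge0.
Qed.

Lemma Amom_le t : `|Amom chi t| <= C * M0.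
Proof.
apply: le_trans (le_normr_Rintegral measurableT (rint_Amom_section t)) _.
apply: (@le_trans _ _ (\int[m]_z (C * uu (t, z)))).
  apply: le_Rint; [exact/rint_norm/rint_Amom_section|by apply: rintZl; exact: rint_uu|].
  by move=> z; rewrite normrM (ger0_norm (uu_ge0 _)) ler_wpM2r ?uu_ge0.
by rewrite RintegralZl ?ler_wpM2l ?Rint_uu_le//; exact: rint_uu.
Qed.

Lemma weight_chi : weight C (fun z => chi z.1).
Proof. by split => // z; apply: le_trans (chi_le _) _; rewrite ler_peMr// om_ge1. Qed.

Lemma weight_chi_v i : weight C (fun z => chi z.1 * z.2 0 i).
Proof.
split => //; first exact: measurable_funM.
by move=> z; rewrite normrM ler_pM//; exact: coord_le_weight.
Qed.

Lemma rint_Amom : rint leb (Amom chi).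
Proof. by have [] := rint_fubini1 (rint_weight_field weight_chi field_uu). Qed.

Lemma rint_Bmom i : rint leb (Bmom chi i).
Proof. by have [] := rint_fubini1 (rint_weight_field (weight_chi_v i) field_uu). Qed.

Lemma rint_Bmom_section i t : (WW t < +oo)%E -> rint m (fun z : E * E => chi z.1 * z.2 0 i * uu (t, z)).
Proof.
move=> Wt; apply: (@rint_dom_section _ t C) => //.
  apply: measurable_funM; first exact: measurable_funM.
  by apply: measurable_section; exact: measurable_uu.
by move=> z; exact: (weight_field_le (t, z) (weight_chi_v i) field_uu).
Qed.

(** Only for a.e. [t], namely where the decay norm and the kinetic energy are finite. *)
Lemma Bmom_le i k : 0 < k ->
  {ae leb, forall t : TR, `|Bmom chi i t| <= C * (k * kinr t + k^-1 * M0)}.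
Proof.
move=> k0; apply: filterS2 (ae_integrable1 rint_kinetic) ae_WW => t jk Wt.
have jB := rint_Bmom_section i Wt; have ju := rint_uu t.
apply: le_trans (le_normr_Rintegral measurableT jB) _.
apply: (@le_trans _ _ (\int[m]_z (C * (k * kin (t, z) + k^-1 * uu (t, z))))).
  apply: le_Rint; [exact: rint_norm|by apply: rintZl; apply: rintD; exact: rintZl|].
  move=> z; rewrite !normrM (ger0_norm (uu_ge0 _)) -mulrA; apply: ler_pM => //.
    by rewrite mulr_ge0// uu_ge0.
  rewrite /kin mulrA -mulrDl ler_wpM2r ?uu_ge0//.
  apply: le_trans (young_abs (z.2 0 i) k0) _.
  rewrite lerD2r ler_pM2l// -expr2 -real_normK ?num_real//.
  by rewrite ler_pXn2r ?nnegrE ?enorm_ge0//; exact: coord_le_enorm.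
rewrite RintegralZl//; last by apply: rintD; exact: rintZl.
rewrite ler_wpM2l// RintegralD//; [|exact: rintZl|exact: rintZl].
by rewrite !RintegralZl// lerD2l ler_wpM2l ?Rint_uu_le// invr_ge0 ltW.
Qed.

Lemma density_moment t : t \in `]0, T[ ->
  \int[lebN]_x (density f t x * chi x) = Amom chi t.
Proof.
move=> tI; rewrite /Amom; have [_ <-] := rint_fubini1 (rint_Amom_section t).
apply: ae_eq_Rint_nonmeasurable.
apply: filterS (ae_integrable1 (rint_uu t)) => x jx.
rewrite /= RintegralZl// mulrC; congr (_ * _).
by apply: eq_Rintegral => v _; rewrite /uu extE.
Qed.

Lemma current_moment i t : (WW t < +oo)%E -> t \in `]0, T[ ->
  \int[lebN]_x (current f t x 0 i * chi x) = Bmom chi i t.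
Proof.
move=> Wt tI; rewrite /Bmom; have jB := rint_Bmom_section i Wt.
have [_ <-] := rint_fubini1 jB.
apply: ae_eq_Rint_nonmeasurable.
have jv : rint m (fun z : E * E => z.2 0 i * uu (t, z)).
  apply: (@rint_dom_section _ t 1) => //.
    apply: measurable_funM; first exact: mcoord2.
    by apply: measurable_section; exact: measurable_uu.
  by move=> z; exact: (weight_field_le (t, z) (weight_vi i) field_uu).
apply: filterS (ae_integrable1 jv) => x jx.
rewrite /current mxE mulrC -RintegralZl//; last first.
  by apply: eq_integrable jx => // v _ /=; rewrite /uu extE.
by apply: eq_Rintegral => v _; rewrite /uu extE//= mulrA.
Qed.

End bounded_weight.

(** * Fluxes over pairs of particles *)

Definition sq_uu (p : TR * ((E * E) * (E * E))) : R :=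
  (1 + enorm (p.2.1.2 - p.2.2.2) ^+ 2) * (uu (p.1, p.2.1) * uu (p.1, p.2.2)).

Lemma sq_uu_ge0 p : 0 <= sq_uu p.
Proof. by apply: mulr_ge0; [rewrite addr_ge0// sqr_ge0|apply: mulr_ge0; exact: uu_ge0]. Qed.

Let muu1 : measurable_fun setT (fun p : TR * ((E * E) * (E * E)) => uu (p.1, p.2.1)).
Proof.
have m1 : measurable_fun setT (fun p : TR * ((E * E) * (E * E)) => (p.1, p.2.1)).
  by apply/measurable_fun_pair => //=; apply: measurableT_comp.
exact: (measurableT_comp measurable_uu m1).
Qed.

Let muu2 : measurable_fun setT (fun p : TR * ((E * E) * (E * E)) => uu (p.1, p.2.2)).
Proof.
have m1 : measurable_fun setT (fun p : TR * ((E * E) * (E * E)) => (p.1, p.2.2)).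
  by apply/measurable_fun_pair => //=; apply: measurableT_comp.
exact: (measurableT_comp measurable_uu m1).
Qed.

Let mV : measurable_fun setT (fun p : TR * ((E * E) * (E * E)) => (p.2.1.2, p.2.2.2)).
Proof. by apply/measurable_fun_pair => /=; do ?apply: measurableT_comp => //. Qed.

Lemma measurable_sq_uu : measurable_fun setT sq_uu.
Proof.
apply: measurable_funM; last exact: measurable_funM.
apply: measurable_funD => //; apply: measurable_funX.
exact: (measurableT_comp (measurableT_comp (@measurable_enorm R N) (@measurable_rV_sub R N)) mV).
Qed.

Lemma Rint_mul_prod d1 d2 (X : measurableType d1) (Y : measurableType d2)
  (m1 : {sigma_finite_measure set X -> \bar R})
  (m2 : {sigma_finite_measure set Y -> \bar R}) (a : X -> R) (b : Y -> R) :
  rint m1 a -> rint m2 b ->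
  \int[prodm m1 m2]_z (a z.1 * b z.2) = \int[m1]_x a x * \int[m2]_y b y.
Proof.
move=> ja jb; have [_ <-] := rint_fubini1 (rint_mul_prod ja jb).
by under eq_Rintegral do rewrite /= RintegralZl//; rewrite RintegralZr.
Qed.

(** From |v - w|^2 <= 2 |v|^2 + 2 |w|^2: each of the two squares contributes 2 [M0] times the
    kinetic energy, and the constant 1 contributes the squared mass. *)
Definition Csq : R := M0 ^+ 2 * T + 4 * M0 * Cdiss.

Lemma rint_sq_uu : rint (prodm leb mm) sq_uu /\ \int[prodm leb mm]_p sq_uu p <= Csq.
Proof.
pose g (t : TR) := M0 ^+ 2 * \1_I0T t + 4 * M0 * kinr t.
have [jk lek] := rint_kinr.
have jg : rint leb g by apply: rintD; apply: rintZl => //; exact: rint_I0T.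
have M00 := M0_ge0.
have ae : {ae leb, forall t : TR, rint mm (fun q => sq_uu (t, q)) /\ \int[mm]_q sq_uu (t, q) <= g t}.
  apply: filterS (ae_integrable1 rint_kinetic) => t jkt.
  have ju := rint_uu t.
  have j1 := rint_mul_prod ju ju.
  have j2 : rint mm (fun q => kin (t, q.1) * uu (t, q.2)) := rint_mul_prod jkt ju.
  have j3 : rint mm (fun q => uu (t, q.1) * kin (t, q.2)) := rint_mul_prod ju jkt.
  pose G (q : (E * E) * (E * E)) := uu (t, q.1) * uu (t, q.2) + 2 * (kin (t, q.1) * uu (t, q.2) + uu (t, q.1) * kin (t, q.2)).
  have jG : rint mm G by apply: rintD => //; apply: rintZl; exact: rintD.
  have leG q : sq_uu (t, q) <= G q.
    rewrite /G /sq_uu /kin /= mulrDl mul1r lerD2l.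
    rewrite (_ : 2 * _ = 2 * (enorm q.1.2 ^+ 2 + enorm q.2.2 ^+ 2) * (uu (t, q.1) * uu (t, q.2))); last by ring.
    rewrite ler_wpM2r ?mulr_ge0 ?uu_ge0// !enorm_sqr -big_split/= mulr_sumr.
    apply: ler_sum => i _; rewrite !mxE -subr_ge0.
    by rewrite (_ : _ - _ = (q.1.2 0 i + q.2.2 0 i) ^+ 2) ?sqr_ge0//; ring.
  have js : rint mm (fun q => sq_uu (t, q)).
    apply: (le_rint (g := G)) => //; last by move=> q; rewrite ger0_norm ?sq_uu_ge0.
    by apply: (measurableT_comp measurable_sq_uu); exact: pair1_measurable.
  split => //; apply: le_trans (le_Rint js jG leG) _.
  rewrite RintegralD//; last by apply: rintZl; exact: rintD.
  rewrite RintegralZl//; last exact: rintD.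
  rewrite RintegralD// (Rint_mul_prod ju ju) (Rint_mul_prod jkt ju) (Rint_mul_prod ju jkt) -/(kinr t).
  have k0 := kinr_ge0 t; have uM := Rint_uu_le t.
  have u0 : 0 <= \int[m]_z uu (t, z) by apply: Rintegral_ge0 => z _; exact: uu_ge0.
  have [tI|tI] := boolP (t \in `]0, T[).
    rewrite /g indicE mem_set// mulr1 lerD//; first by rewrite expr2 ler_pM.
    rewrite (_ : 2 * _ = 4 * (\int[m]_z uu (t, z) * kinr t)); last by ring.
    by rewrite -mulrA ler_wpM2l// ler_wpM2r.
  have -> : \int[m]_z uu (t, z) = 0.
    by under eq_Rintegral do rewrite /uu ext0//; rewrite Rintegral_cst// mul0r.
  rewrite !(mulr0, mul0r, addr0); apply: addr_ge0; apply: mulr_ge0 => //.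
  - exact: sqr_ge0.
  - exact: mulr_ge0.
have js : rint (prodm leb mm) sq_uu.
  apply: (rint_prod_le measurable_sq_uu jg).
  apply: filterS ae => t [jt et]; under eq_integral do rewrite ger0_norm ?sq_uu_ge0//.
  by rewrite -Rint_EFin// lee_fin.
split => //; have [js' <-] := rint_fubini1 js.
apply: (@le_trans _ _ (\int[leb]_t g t)).
  by apply: ae_le_Rint => //; apply: filterS ae => t [].
rewrite RintegralD//; [|by apply: rintZl; exact: rint_I0T|exact: rintZl].
rewrite !RintegralZl//; last exact: rint_I0T.
rewrite Rint_I0T lerD2l ler_wpM2l// mulr_ge0//.
Qed.

(** Its integral over time is bounded independently of small eps; it is the dominating function
    [dom] when [limit_interchange] is applied. *)
Definition DD (t : TR) : R := \int[mm]_q (sq_uu (t, q) + diss (t, q)).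

Lemma rint_sq_diss : rint (prodm leb mm) (fun p => sq_uu p + diss p).
Proof. by apply: rintD; [case: rint_sq_uu|case: rint_diss]. Qed.

Lemma rint_DD : rint leb DD /\ \int[leb]_t DD t <= Csq + Cdiss.
Proof.
have [jd ed] := rint_fubini1 rint_sq_diss; split => //; rewrite ed.
have [js les] := rint_sq_uu; have [jd' _] := rint_diss.
rewrite RintegralD// lerD//; apply: le_trans energy; rewrite lerDr.
by apply: Rintegral_ge0 => p _; exact: kin_ge0.
Qed.

Definition pairf (h : 'I_N -> TR * (E * E) -> R) (p : TR * ((E * E) * (E * E))) : R :=
  \sum_(i < N) h i (p.1, (p.2.1.1, p.2.2.1)) * (p.2.2.2 0 i - p.2.1.2 0 i)
    * (uu (p.1, p.2.1) * uu (p.1, p.2.2)).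

(* By Fubini, the nonlocal term with kernel h, written with f instead of its
   moments so that the factor w - v is visible. *)
Definition flux (h : 'I_N -> TR * (E * E) -> R) (t : TR) : R := \int[mm]_q pairf h (t, q).

Let uuuu_ge0 (p : TR * ((E * E) * (E * E))) : 0 <= uu (p.1, p.2.1) * uu (p.1, p.2.2).
Proof. by apply: mulr_ge0; exact: uu_ge0. Qed.

Section bounded_kernel.
Variables (h : 'I_N -> TR * (E * E) -> R) (C : R).
Hypothesis mh : forall i, measurable_fun setT (h i).
Hypothesis hC : forall i p, `|h i p| <= C.

Lemma rint_pairf : rint (prodm leb mm) (pairf h).
Proof.
have [js _] := rint_sq_uu.
have mX : measurable_fun setT (fun p : TR * ((E * E) * (E * E)) => (p.1, (p.2.1.1, p.2.2.1))).
  apply/measurable_fun_pair => //=.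
  by apply/measurable_fun_pair => /=; do ?apply: measurableT_comp => //.
apply: rint_sum => i; apply: (le_rint (g := fun p => C * sq_uu p)).
- apply: measurable_funM; last exact: measurable_funM muu1 muu2.
  apply: measurable_funM; first exact: (measurableT_comp (mh i) mX).
  by apply: measurable_funB;
    apply: (measurableT_comp (measurable_coord i)); do ?apply: measurableT_comp => //.
- exact: rintZl.
- move=> p; rewrite normrM (ger0_norm (uuuu_ge0 p)) /sq_uu mulrA ler_wpM2r//.
  rewrite normrM ler_pM//.
  apply: (@le_trans _ _ (1 + `|p.2.2.2 0 i - p.2.1.2 0 i| ^+ 2)).
    rewrite real_normK ?num_real// -(mul1r (_ ^+ 2)) expr2 [leRHS]addrC.
    by have := young_abs (p.2.2.2 0 i - p.2.1.2 0 i) ltr01; rewrite invr1.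
  rewrite lerD2l ler_pXn2r ?nnegrE ?enorm_ge0// distrC.
  by have := coord_le_enorm (p.2.1.2 - p.2.2.2) i; rewrite !mxE.
Qed.

Lemma rint_flux : rint leb (flux h).
Proof. by have [] := rint_fubini1 rint_pairf. Qed.

Lemma density_currentE : {ae leb, forall t : TR, t \in `]0, T[ ->
  \int[(lebN \x lebN)%E]_z (\sum_(i < N) h i (t, z) *
    (density f t z.1 * current f t z.2 0 i - density f t z.2 * current f t z.1 0 i)) = flux h t}.
Proof.
apply: filterS ae_WW => t Wt tI.
pose one (_ : E) : R := 1.
pose U z := uu (t, z).
have jw b : weight 1 (fun z => b z.2) -> rint m (fun z => b z.2 * U z).
  move=> wb; apply: (@rint_dom_section _ t 1) => //.
    apply: measurable_funM; first by case: wb.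
    by apply: measurable_section; exact: measurable_uu.
  by move=> z; exact: (weight_field_le (t, z) wb field_uu).
have j1 : rint m (fun z => one z.2 * U z) by exact: (jw one) weight_one.
have ji i : rint m (fun z => coord i z.2 * U z) by exact: (jw (coord i)) (weight_vi i).
have mht i : measurable_fun setT (fun z => h i (t, z)).
  by apply: (measurableT_comp (mh i)); exact: pair1_measurable.
have hCt i z : `|h i (t, z)| <= C by exact: hC.
have DE x : density f t x = \int[lebN]_v (one v * U (x, v)).
  by apply: eq_Rintegral => v _; rewrite /one /U mul1r /uu extE.
have CE i x : current f t x 0 i = \int[lebN]_v (coord i v * U (x, v)).
  by rewrite mxE; apply: eq_Rintegral => v _; rewrite /coord /U /uu extE.
have [k1 k2] : (forall i, rint m (fun z => h i (t, z) * (density f t z.1 * current f t z.2 0 i))) /\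
    (forall i, rint m (fun z => h i (t, z) * (current f t z.1 0 i * density f t z.2))).
  split => i.
    have [k _] := Rint_pair_moments (q1 := one) (q2 := coord i) j1 (ji i) (mht i) (hCt i).
    by apply: eq_integrable k => // z _ /=; rewrite DE CE.
  have [k _] := Rint_pair_moments (q1 := coord i) (q2 := one) (ji i) j1 (mht i) (hCt i).
  by apply: eq_integrable k => // z _ /=; rewrite DE CE.
transitivity (\sum_(i < N)
    (\int[m]_z (h i (t, z) * (density f t z.1 * current f t z.2 0 i))
    - \int[m]_z (h i (t, z) * (current f t z.1 0 i * density f t z.2)))).
  have jd i : rint m (fun z => h i (t, z) * (density f t z.1 * current f t z.2 0 i)
      - h i (t, z) * (current f t z.1 0 i * density f t z.2)).
    exact: (rintB (k1 i) (k2 i)).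
  transitivity (\int[m]_z \sum_(i < N) (h i (t, z) * (density f t z.1 * current f t z.2 0 i)
      - h i (t, z) * (current f t z.1 0 i * density f t z.2))).
    by apply: eq_Rintegral => z _; apply: eq_bigr => i _; ring.
  rewrite (Rint_sum _ _ jd); apply: eq_bigr => i _.
  by rewrite RintegralB.
pose g q1 q2 i (p : (E * E) * (E * E)) : R :=
  h i (t, (p.1.1, p.2.1)) * (q1 p.1.2 * U p.1) * (q2 p.2.2 * U p.2).
have g1 i : rint mm (g one (coord i) i).
  exact: (rint_pair (q1 := one) (q2 := coord i) j1 (ji i) (mht i) (hCt i)).
have g2 i : rint mm (g (coord i) one i).
  exact: (rint_pair (q1 := coord i) (q2 := one) (ji i) j1 (mht i) (hCt i)).
transitivity (\sum_(i < N) (\int[mm]_p g one (coord i) i p - \int[mm]_p g (coord i) one i p)).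
  apply: eq_bigr => i _; congr (_ - _).
    have [_ <-] := Rint_pair_moments (q1 := one) (q2 := coord i) j1 (ji i) (mht i) (hCt i).
    by apply: eq_Rintegral => z _; rewrite DE CE.
  have [_ <-] := Rint_pair_moments (q1 := coord i) (q2 := one) (ji i) j1 (mht i) (hCt i).
  by apply: eq_Rintegral => z _; rewrite DE CE.
have g12 i : rint mm (fun p => g one (coord i) i p - g (coord i) one i p) by exact: (rintB (g1 i) (g2 i)).
transitivity (\int[mm]_p (\sum_(i < N) (g one (coord i) i p - g (coord i) one i p))).
  rewrite (Rint_sum _ _ g12); apply: eq_bigr => i _.
  by rewrite RintegralB.
by apply: eq_Rintegral => p _; apply: eq_bigr => i _; rewrite /g /one /coord /U /=; ring.
Qed.

End bounded_kernel.

(** The hypothesis is used with s = |v - w|, for which the right-hand side integrates against f(x,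
    v) f(y, w) to a multiple of [DD]. The factor [N] counts the coordinates of w - v, each bounded
    by s. *)
Lemma flux_sub_le (h h' : 'I_N -> TR * (E * E) -> R) (C C' e : R) :
  (forall i, measurable_fun setT (h i)) -> (forall i, measurable_fun setT (h' i)) ->
  (forall i p, `|h i p| <= C) -> (forall i p, `|h' i p| <= C') ->
  (forall i (t : TR) x y s, 0 <= s -> `|h i (t, (x, y)) - h' i (t, (x, y))| * s <=
    e * (1 + s ^+ 2 + phi_kernel lam eps (enorm (x - y)) * s ^+ 2)) ->
  {ae leb, forall t : TR, `|flux h t - flux h' t| <= N%:R * e * DD t}.
Proof.
move=> mh mh' hC hC' hh'.
have jh := rint_pairf mh hC; have jh' := rint_pairf mh' hC'.
apply: filterS3 (ae_integrable1 jh) (ae_integrable1 jh') (ae_integrable1 rint_sq_diss) => t j1 j2 j3.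
rewrite /flux -RintegralB//; have j12 := rintB j1 j2.
apply: le_trans (le_normr_Rintegral measurableT j12) _.
rewrite -RintegralZl//.
apply: le_Rint; [exact: rint_norm|exact: rintZl|] => q /=.
rewrite /pairf -sumrB; apply: le_trans (ler_norm_sum _ _ _) _.
have -> : N%:R * e * (sq_uu (t, q) + diss (t, q)) = \sum_(i < N) e * (sq_uu (t, q) + diss (t, q)).
  by rewrite sumr_const card_ord -[RHS]mulr_natl mulrA.
apply: ler_sum => i _ /=.
rewrite -!mulrBl normrM (ger0_norm (uuuu_ge0 (t, q))) /sq_uu /diss /= -mulrDl mulrA.
rewrite ler_wpM2r ?(uuuu_ge0 (t, q))// normrM.
apply: le_trans (hh' i t q.1.1 q.2.1 _ (enorm_ge0 (q.1.2 - q.2.2))).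
rewrite ler_wpM2l// distrC.
by have := coord_le_enorm (q.1.2 - q.2.2) i; rewrite !mxE.
Qed.

(** For a tensor product the integral over pairs factorizes, leaving products of one density moment
    and one current moment. *)
Lemma flux_tensor (K : finType) (chi : K -> E -> R) (c : 'I_N -> K -> K -> TR -> R) (C : R) :
  (forall k, measurable_fun setT (chi k)) -> (forall k x, `|chi k x| <= C) ->
  {ae leb, forall t : TR,
    flux (fun i p => \sum_(k : K) \sum_(l : K) c i k l p.1 * (chi k p.2.1 * chi l p.2.2)) t =
    \sum_(i < N) \sum_(k : K) \sum_(l : K) c i k l t *
      (Amom (chi k) t * Bmom (chi l) i t - Bmom (chi k) i t * Amom (chi l) t)}.
Proof.
move=> mchi chiC; apply: filterS ae_WW => t Wt.
have ja k := rint_Amom_section (mchi k) (chiC k) t.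
have jb k i := rint_Bmom_section (mchi k) (chiC k) i Wt.
pose g i k l (q : (E * E) * (E * E)) : R :=
  (chi k q.1.1 * uu (t, q.1)) * (chi l q.2.1 * q.2.2 0 i * uu (t, q.2))
  - (chi k q.1.1 * q.1.2 0 i * uu (t, q.1)) * (chi l q.2.1 * uu (t, q.2)).
have jg i k l : rint mm (g i k l).
  by apply: rintB; [exact: (rint_mul_prod (ja k) (jb l i))|exact: (rint_mul_prod (jb k i) (ja l))].
have eg i k l : \int[mm]_q g i k l q =
    Amom (chi k) t * Bmom (chi l) i t - Bmom (chi k) i t * Amom (chi l) t.
  rewrite RintegralB//; [|exact: (rint_mul_prod (ja k) (jb l i))|exact: (rint_mul_prod (jb k i) (ja l))].
  by rewrite (Rint_mul_prod (ja k) (jb l i)) (Rint_mul_prod (jb k i) (ja l)).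
transitivity (\int[mm]_q (\sum_(i < N) \sum_(k : K) \sum_(l : K) c i k l t * g i k l q)).
  apply: eq_Rintegral => q _; apply: eq_bigr => i _ /=.
  rewrite !mulr_suml; apply: eq_bigr => k _; rewrite !mulr_suml; apply: eq_bigr => l _.
  by rewrite /g; ring.
have jl i k l : rint mm (fun q => c i k l t * g i k l q) by exact: (rintZl _ (jg i k l)).
have jk i k : rint mm (fun q => \sum_(l : K) c i k l t * g i k l q).
  by apply: rint_sum => l; exact: jl.
have jii i : rint mm (fun q => \sum_(k : K) \sum_(l : K) c i k l t * g i k l q).
  by apply: rint_sum => k; exact: jk.
rewrite (Rint_sum _ _ jii); apply: eq_bigr => i _.
rewrite (Rint_sum _ _ (jk i)); apply: eq_bigr => k _.
rewrite (Rint_sum _ _ (jl i k)); apply: eq_bigr => l _.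
by rewrite RintegralZl ?eg//; exact: jg.
Qed.

(* All that the limit uses of a solution; M and C will not depend on eps. *)
Record kinetic_estimates (M C : R) : Prop := {
  ke_out : forall t : TR, t \notin `]0, T[ -> forall chi i h,
    [/\ Amom chi t = 0, Bmom chi i t = 0 & flux h t = 0];
  ke_density : forall (chi : E -> R) (K : R), measurable_fun setT chi -> (forall x, `|chi x| <= K) ->
    forall t, t \in `]0, T[ -> \int[lebN]_x (density f t x * chi x) = Amom chi t;
  ke_current : {ae leb, forall t : TR, t \in `]0, T[ -> forall (chi : E -> R) (K : R) i,
    measurable_fun setT chi -> (forall x, `|chi x| <= K) ->
    \int[lebN]_x (current f t x 0 i * chi x) = Bmom chi i t /\
    forall c, Bmom (fun x => c * chi x) i t = c * Bmom chi i t};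
  ke_AmomZ : forall (chi : E -> R) (K : R), measurable_fun setT chi -> (forall x, `|chi x| <= K) ->
    forall c t, Amom (fun x => c * chi x) t = c * Amom chi t;
  ke_AmomB : forall (chi1 chi2 : E -> R) (K1 K2 : R),
    measurable_fun setT chi1 -> (forall x, `|chi1 x| <= K1) ->
    measurable_fun setT chi2 -> (forall x, `|chi2 x| <= K2) ->
    forall t, Amom (fun x => chi1 x - chi2 x) t = Amom chi1 t - Amom chi2 t;
  ke_Amom_le : forall (chi : E -> R) (K : R), measurable_fun setT chi -> (forall x, `|chi x| <= K) ->
    forall t, `|Amom chi t| <= K * M;
  ke_measurable_Amom : forall g : TR * E -> R, measurable_fun setT g ->
    measurable_fun setT (fun t => Amom (fun x => g (t, x)) t);
  ke_rint_Amom : forall (chi : E -> R) (K : R), measurable_fun setT chi -> (forall x, `|chi x| <= K) ->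
    rint leb (Amom chi);
  ke_rint_Bmom : forall (chi : E -> R) (K : R) i, measurable_fun setT chi -> (forall x, `|chi x| <= K) ->
    rint leb (Bmom chi i);
  ke_kinetic : [/\ rint leb kinr, forall t, 0 <= kinr t & \int[leb]_t kinr t <= C];
  ke_Bmom_le : forall (chi : E -> R) (K : R) i (k : R), measurable_fun setT chi -> (forall x, `|chi x| <= K) -> 0 < k ->
    {ae leb, forall t : TR, `|Bmom chi i t| <= K * (k * kinr t + k^-1 * M)};
  ke_equicontinuity : forall (chi : E -> R) (dchi : 'I_N -> E -> R) (K k t1 t2 : R), 0 <= K ->
    (forall i x, is_derive x (delta_mx 0 i : E) chi (dchi i x)) ->
    continuous chi -> (forall i, continuous (dchi i)) ->
    (forall x, `|chi x| <= K) -> (forall i x, `|dchi i x| <= K) ->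
    0 < k -> t1 \in `]0, T[ -> t2 \in `]0, T[ ->
    `|Amom chi t2 - Amom chi t1| <= K * (k * C + N%:R / k * M * `|t2 - t1|);
  ke_rint_flux : forall (h : 'I_N -> TR * (E * E) -> R) (K : R), (forall i, measurable_fun setT (h i)) ->
    (forall i p, `|h i p| <= K) -> rint leb (flux h);
  ke_flux : forall (h : 'I_N -> TR * (E * E) -> R) (K : R), (forall i, measurable_fun setT (h i)) -> (forall i p, `|h i p| <= K) ->
    {ae leb, forall t : TR, t \in `]0, T[ ->
      \int[(lebN \x lebN)%E]_z (\sum_(i < N) h i (t, z) *
      (density f t z.1 * current f t z.2 0 i - density f t z.2 * current f t z.1 0 i)) = flux h t};
  ke_DD : rint leb DD /\ \int[leb]_t DD t <= C;
  ke_flux_sub_le : forall (h h' : 'I_N -> TR * (E * E) -> R) (K K' e : R),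
    (forall i, measurable_fun setT (h i)) -> (forall i, measurable_fun setT (h' i)) ->
    (forall i p, `|h i p| <= K) -> (forall i p, `|h' i p| <= K') ->
    (forall i (t : TR) x y s, 0 <= s -> `|h i (t, (x, y)) - h' i (t, (x, y))| * s <=
      e * (1 + s ^+ 2 + phi_kernel lam eps (enorm (x - y)) * s ^+ 2)) ->
    {ae leb, forall t : TR, `|flux h t - flux h' t| <= N%:R * e * DD t};
  ke_flux_tensor : forall (I : finType) (chi : I -> E -> R) (c : 'I_N -> I -> I -> TR -> R) (K : R),
    (forall k, measurable_fun setT (chi k)) -> (forall k x, `|chi k x| <= K) ->
    {ae leb, forall t : TR,
      flux (fun i p => \sum_(k : I) \sum_(l : I) c i k l p.1 * (chi k p.2.1 * chi l p.2.2)) t =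
      \sum_(i < N) \sum_(k : I) \sum_(l : I) c i k l t *
        (Amom (chi k) t * Bmom (chi l) i t - Bmom (chi k) i t * Amom (chi l) t)}
}.

Lemma kinetic_estimatesP (M C : R) : M0 <= M -> Csq + Cdiss <= C -> kinetic_estimates M C.
Proof.
move=> M0M CC; have Cd : Cdiss <= C.
  apply: le_trans CC; rewrite lerDr; have [_] := rint_sq_uu; apply: le_trans.
  by apply: Rintegral_ge0 => p _; exact: sq_uu_ge0.
split.
- move=> t tI chi i h; split.
  + rewrite /Amom; under eq_Rintegral do rewrite /uu ext0// mulr0.
    by rewrite Rintegral_cst// mul0r.
  + rewrite /Bmom; under eq_Rintegral do rewrite /uu ext0// mulr0.
    by rewrite Rintegral_cst// mul0r.
  + rewrite /flux (_ : (fun q => _) = fun=> 0); first by rewrite Rintegral_cst// mul0r.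
    by apply/funext => q; rewrite /pairf big1// => k _; rewrite /uu /= !ext0// !mulr0.
- by move=> chi K mchi chiK t tI; exact: (density_moment mchi chiK tI).
- apply: filterS ae_WW => t Wt tI chi K i mchi chiK; split; first exact: (current_moment mchi chiK i Wt tI).
  move=> c; rewrite /Bmom -RintegralZl//; last exact: (rint_Bmom_section mchi chiK i Wt).
  by apply: eq_Rintegral => z _; rewrite !mulrA.
- move=> chi K mchi chiK c t; rewrite /Amom -RintegralZl//; last exact: (rint_Amom_section mchi chiK t).
  by apply: eq_Rintegral => z _; rewrite mulrA.
- move=> chi1 chi2 K1 K2 m1 h1 m2 h2 t; rewrite /Amom -RintegralB//; last 2 first.
  + exact: (rint_Amom_section m1 h1 t).
  + exact: (rint_Amom_section m2 h2 t).
  by apply: eq_Rintegral => z _; rewrite mulrBl.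
- move=> chi K mchi chiK t; apply: le_trans (Amom_le mchi chiK t) _.
  by rewrite ler_wpM2l// (le_trans (normr_ge0 (chi 0))).
- move=> g mg; apply: (@measurable_Rint1 _ _ _ _ _ m (fun p : TR * (E * E) => g (p.1, p.2.1) * uu p)).
  apply: measurable_funM; last exact: measurable_uu.
  have m1 : measurable_fun setT (fun p : TR * (E * E) => (p.1, p.2.1)).
    by apply/measurable_fun_pair => //=; exact: measurableT_comp.
  exact: (measurableT_comp mg m1).
- by move=> chi K mchi chiK; exact: (rint_Amom mchi chiK).
- by move=> chi K i mchi chiK; exact: (rint_Bmom mchi chiK).
- by have [jk lek] := rint_kinr; split => //; [exact: kinr_ge0|exact: le_trans Cd].
- move=> chi K i k mchi chiK k0; apply: filterS (Bmom_le mchi chiK i k0) => t h.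
  apply: le_trans h _; rewrite ler_wpM2l ?(le_trans (normr_ge0 (chi 0)))//.
  by rewrite lerD2l ler_wpM2l// invr_ge0 ltW.
- move=> chi dchi K k t1 t2 K0 h1 h2 h3 h4 h5 k0 t1I t2I.
  apply: le_trans (equicontinuity K0 h1 h2 h3 h4 h5 k0 t1I t2I) _.
  rewrite ler_wpM2l// lerD//; first by rewrite ler_wpM2l// ltW.
  by rewrite ler_wpM2r// ler_wpM2l// divr_ge0// ltW.
- by move=> h K mh hK; exact: (rint_flux mh hK).
- by move=> h K mh hK; exact: (density_currentE mh hK).
- by have [jk lek] := rint_DD; split => //; exact: le_trans CC.
- by move=> h h' K K' e m1 m2 k1 k2; exact: (flux_sub_le m1 m2 k1 k2).
- by move=> I chi c K mchi chiK; exact: (flux_tensor c mchi chiK).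
Qed.

End solution.

(** * Tensor-product approximation *)

Section smooth_step.
Variable R : realType.
Implicit Types s : R.

Definition pos s : R := Num.max s 0.

Lemma posP s : (0 <= s /\ pos s = s) \/ (s <= 0 /\ pos s = 0).
Proof. by rewrite /pos; case: (leP s 0) => h; [right|left; split => //; exact: ltW]. Qed.

Lemma pos_sqr_sub_le s h : `|pos (h + s) ^+ 2 - pos s ^+ 2 - 2 * pos s * h| <= h ^+ 2.
Proof.
rewrite ler_norml; have [[a0 ->]|[a0 ->]] := posP (h + s); have [[b0 ->]|[b0 ->]] := posP s; nra.
Qed.

(** A bound by h^2 on the first-order error, valid for all h, yields derivatives of piecewise
    functions without examining their junctions. *)
Lemma is_derive_of_quadratic_error (g : R -> R) s d :
  (forall h, `|g (h + s) - g s - d * h| <= h ^+ 2) -> is_derive s 1 g d.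
Proof.
move=> gd.
have H : (fun h : R => h^-1 *: (g (h *: 1 + s) - g s)) @ 0^' --> d.
  apply/cvgrPdist_le => e e0; near=> h.
  have h0 : h != 0 by near: h; exact: nbhs_dnbhs_neq.
  rewrite [h *: 1]mulr1 /GRing.scale/=.
  rewrite (_ : d - _ = - (h^-1 * (g (h + s) - g s - d * h))); last by field.
  rewrite normrN normrM; apply: (@le_trans _ _ (`|h^-1| * h ^+ 2)).
    by rewrite ler_wpM2l.
  rewrite -(@real_normK _ h) ?num_real// normfV expr2 mulrA mulVf ?normr_eq0// mul1r.
  near: h; apply: dnbhs0_le; exact: e0.
by split; [apply/cvg_ex; exists d|exact/cvg_lim].
Unshelve. all: by end_near. Qed.

Lemma is_derive_pos_sqr s : is_derive s 1 (fun s => pos s ^+ 2) (2 * pos s).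
Proof. apply: is_derive_of_quadratic_error => h; exact: pos_sqr_sub_le. Qed.

Lemma is_derive_pos_sqr_shift c s : is_derive s 1 (fun s => pos (s - c) ^+ 2) (2 * pos (s - c)).
Proof.
apply: is_derive_of_quadratic_error => h; rewrite -[h + s - c]addrA; exact: pos_sqr_sub_le.
Qed.

(* The primitive of the hat function supported in [0, 1]. *)
Definition step s : R := 2 * pos s ^+ 2 - 4 * pos (s - 2^-1) ^+ 2 + 2 * pos (s - 1) ^+ 2.
Definition dstep s : R := 4 * pos s - 8 * pos (s - 2^-1) + 4 * pos (s - 1).

Lemma is_derive_step s : is_derive s 1 step (dstep s).
Proof.
have h1 := is_derive_scale (is_derive_pos_sqr s) 2.
have h2 := is_derive_scale (is_derive_pos_sqr_shift 2^-1 s) 4.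
have h3 := is_derive_scale (is_derive_pos_sqr_shift 1 s) 2.
have := is_derive_add (is_derive_sub h1 h2) h3.
by move=> h; apply: (is_derive_eq h); rewrite /dstep; ring.
Qed.

Lemma step_cases s :
  [\/ s <= 0 /\ (step s = 0 /\ dstep s = 0), 0 <= s <= 2^-1 /\ (step s = 2 * s ^+ 2 /\ dstep s = 4 * s),
   2^-1 <= s <= 1 /\ (step s = 1 - 2 * (1 - s) ^+ 2 /\ dstep s = 4 * (1 - s)) | 1 <= s /\ (step s = 1 /\ dstep s = 0)].
Proof.
rewrite /step /dstep; have [[a0 ->]|[a0 ->]] := posP s; have [[b0 ->]|[b0 ->]] := posP (s - 2^-1);
have [[c0 ->]|[c0 ->]] := posP (s - 1).
- apply: Or44; split; first lra. by split; field.
- apply: Or43; split; first lra. by split; field.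
- by exfalso; lra.
- apply: Or42; split; first lra. by split; ring.
- by exfalso; lra.
- by exfalso; lra.
- by exfalso; lra.
- apply: Or41; split; first lra. by split; ring.
Qed.

Lemma step_ge0 s : 0 <= step s.
Proof. by have [] := step_cases s => -[h [-> _]]; nra. Qed.

Lemma step_le1 s : step s <= 1.
Proof. by have [] := step_cases s => -[h [-> _]]; nra. Qed.

Lemma step0 s : s <= 0 -> step s = 0.
Proof. by move=> s0; have [] := step_cases s => -[h [-> _]]; nra. Qed.

Lemma step1 s : 1 <= s -> step s = 1.
Proof. by move=> s0; have [] := step_cases s => -[h [-> _]]; nra. Qed.

Lemma dstep_norm_le s : `|dstep s| <= 2.
Proof. by rewrite ler_norml; have [] := step_cases s => -[h [_ ->]]; lra. Qed.

Lemma le_step s t : s <= t -> step s <= step t.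
Proof.
move=> st; have [] := step_cases s => -[h [-> _]]; have [] := step_cases t => -[k [-> _]]; nra.
Qed.

Lemma continuous_pos : continuous pos.
Proof.
rewrite (_ : pos = fun s => 2^-1 * (s + `|s|)).
  apply: continuous_scale; apply: continuous_add; [by move=> s; exact: cvg_id|exact: norm_continuous].
apply/funext => s; have [[a0 ->]|[a0 ->]] := posP s.
  by rewrite ger0_norm//; field.
by rewrite ler0_norm// subrr mulr0.
Qed.

Lemma continuous_dstep : continuous dstep.
Proof.
have cp c : continuous (fun s => pos (s - c)).
  move=> s; apply: (@continuous_comp _ _ _ (fun s : R => s - c) pos); last exact: continuous_pos.
  by apply: cvgB; [exact: cvg_id|exact: cvg_cst].
apply: continuous_add; last exact: continuous_scale.
by apply: continuous_sub; apply: continuous_scale; [exact: continuous_pos|exact: cp].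
Qed.

Lemma continuous_step : continuous step.
Proof.
move=> s; apply: differentiable_continuous; apply/derivable1_diffP.
by case: (is_derive_step s).
Qed.

End smooth_step.

Lemma is_derive_along (R : realType) (V : normedModType R) (h : V -> R) (x e : V) (g : R -> R) (d : R) :
  (forall s : R, h (s *: e + x) = g s) -> is_derive (0 : R) 1 g d -> is_derive x e h d.
Proof.
move=> hg [dg eg].
have E : (fun u : R => u^-1 *: (h (u *: e + x) - h x)) = fun u : R => u^-1 *: (g (u *: 1 + 0) - g 0).
  by apply/funext => u; rewrite hg -[in h x](add0r x) -(scale0r e) hg [u *: 1]mulr1 addr0.
split; first by rewrite /derivable E.
by rewrite -eg /derive E.
Qed.

(** * A C^1 partition of unity on a grid *)

Section partition.
Variables (R : realType) (N K : nat) (h : R).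
Hypothesis h_gt0 : 0 < h.
Local Notation E := 'rV[R]_N.

Let hV_gt0 : 0 < h^-1. Proof. by rewrite invr_gt0. Qed.

(** A difference of consecutive translates of [step], so that the sum over k telescopes; it is C^1
    and supported within [h] of [node k]. *)
Definition hat (k : nat) (s : R) : R := step (h^-1 * s + K%:R - k%:R) - step (h^-1 * s + K%:R - k.+1%:R).
Definition dhat (k : nat) (s : R) : R :=
  h^-1 * (dstep (h^-1 * s + K%:R - k%:R) - dstep (h^-1 * s + K%:R - k.+1%:R)).

Lemma hat_ge0 k s : 0 <= hat k s.
Proof. by rewrite subr_ge0 le_step// lerD2l lerN2 ler_nat. Qed.

Lemma hat_le1 k s : hat k s <= 1.
Proof. by have := step_le1 (h^-1 * s + K%:R - k%:R); have := step_ge0 (h^-1 * s + K%:R - k.+1%:R); rewrite /hat; lra. Qed.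

Definition node (k : nat) : R := h * (k.+1%:R - K%:R).

Lemma hat_eq0 k s : h <= `|s - node k| -> hat k s = 0.
Proof.
rewrite (_ : s - node k = h * (h^-1 * s + K%:R - k.+1%:R)); last by rewrite /node; field; rewrite gt_eqF.
rewrite normrM gtr0_norm// ler_pMr// /hat.
(* With r = (s - node k) / h, the hat is step(r + 1) - step(r): both values are 1 for r >= 1 and 0
   for r <= -1. *)
have -> : h^-1 * s + K%:R - k%:R = (h^-1 * s + K%:R - k.+1%:R) + 1 by rewrite -natr1; ring.
set r := _ - k.+1%:R; rewrite ler_normr => /orP[r1|r1].
  by rewrite !step1 ?subrr//; lra.
by rewrite !step0 ?subrr//; lra.
Qed.

Lemma sum_hat s : \sum_(k < K.*2) hat k s = step (h^-1 * s + K%:R) - step (h^-1 * s - K%:R).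
Proof.
transitivity (\sum_(0 <= k < K.*2) hat k s); first by rewrite big_mkord.
have -> : \sum_(0 <= k < K.*2) hat k s =
    - \sum_(0 <= k < K.*2) (step (h^-1 * s + K%:R - k.+1%:R) - step (h^-1 * s + K%:R - k%:R)).
  by rewrite -sumrN; apply: eq_bigr => k _; rewrite opprB.
rewrite (telescope_sumr (fun k => step (h^-1 * s + K%:R - k%:R)))// opprB subr0.
by congr (_ - step _); rewrite -addnn natrD; ring.
Qed.

Lemma sum_hat_ge0 s : 0 <= \sum_(k < K.*2) hat k s.
Proof. by apply: sumr_ge0 => k _; exact: hat_ge0. Qed.

Lemma sum_hat_le1 s : \sum_(k < K.*2) hat k s <= 1.
Proof.
rewrite sum_hat; have := step_le1 (h^-1 * s + K%:R); have := step_ge0 (h^-1 * s - K%:R); lra.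
Qed.

Lemma sum_hat1 s : `|s| <= h * (K%:R - 1) -> \sum_(k < K.*2) hat k s = 1.
Proof.
move=> sh; have : `|h^-1 * s| <= K%:R - 1.
  by rewrite normrM gtr0_norm ?invr_gt0// ler_pdivrMl.
rewrite sum_hat ler_norml => /andP[h1 h2].
by rewrite step1 ?step0 ?subr0//; lra.
Qed.

Lemma is_derive_hat k (s : R) : is_derive s 1 (hat k) (dhat k s).
Proof.
have d c : is_derive s 1 (fun s => step (h^-1 * s + K%:R - c)) (h^-1 * dstep (h^-1 * s + K%:R - c)).
  have h1 : is_derive s 1 (fun s : R => h^-1 * s + K%:R - c) h^-1.
    apply: is_derive_of_quadratic_error => u.
    by rewrite (_ : _ - _ = 0) ?normr0 ?sqr_ge0//; ring.
  have := @is_derive1_comp R (@step R) (fun s : R => h^-1 * s + K%:R - c) s _ _ (is_derive_step _) h1.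
  by move=> H; apply: (is_derive_eq H); rewrite mulrC.
have := is_derive_sub (d k%:R) (d k.+1%:R).
by move=> H; apply: (is_derive_eq H); rewrite /dhat mulrBr.
Qed.

Lemma dhat_le k s : `|dhat k s| <= 4 * h^-1.
Proof.
rewrite normrM (gtr0_norm hV_gt0) [leLHS]mulrC ler_wpM2r ?(ltW hV_gt0)//.
apply: le_trans (ler_normB _ _) _.
by have := dstep_norm_le (h^-1 * s + K%:R - k%:R); have := dstep_norm_le (h^-1 * s + K%:R - k.+1%:R); lra.
Qed.

Let ca c : continuous (fun s : R => h^-1 * s + K%:R - c).
Proof.
by move=> s; apply: cvgB; [apply: cvgD; [apply: cvgM; [exact: cvg_cst|exact: cvg_id]|exact: cvg_cst]|exact: cvg_cst].
Qed.

Lemma continuous_hat k : continuous (hat k).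
Proof.
have c c0 : continuous (fun s => step (h^-1 * s + K%:R - c0)).
  by move=> s; apply: (@continuous_comp _ _ _ (fun s : R => h^-1 * s + K%:R - c0) (@step R)); [exact: ca|exact: continuous_step].
by apply: continuous_sub; exact: c.
Qed.

Lemma continuous_dhat k : continuous (dhat k).
Proof.
have c c0 : continuous (fun s => dstep (h^-1 * s + K%:R - c0)).
  by move=> s; apply: (@continuous_comp _ _ _ (fun s : R => h^-1 * s + K%:R - c0) (@dstep R)); [exact: ca|exact: continuous_dstep].
by apply: continuous_scale; apply: continuous_sub; exact: c.
Qed.

Local Notation I := {ffun 'I_N -> 'I_K.*2}.

Definition bump (k : I) (x : E) : R := \prod_(i < N) hat (k i) (x 0 i).
Definition dbump (k : I) (i : 'I_N) (x : E) : R :=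
  dhat (k i) (x 0 i) * \prod_(l < N | l != i) hat (k l) (x 0 l).
Definition bnode (k : I) : E := \row_i node (k i).

Lemma bump_ge0 k x : 0 <= bump k x.
Proof. by apply: prodr_ge0 => i _; exact: hat_ge0. Qed.

Let prod_hat_le1 (P : pred 'I_N) (k : I) (x : E) : 0 <= \prod_(i < N | P i) hat (k i) (x 0 i) <= 1.
Proof.
rewrite prodr_ge0/=; last by move=> i _; exact: hat_ge0.
by apply: prodr_ile1 => i _; rewrite hat_ge0 hat_le1.
Qed.

Lemma bump_le1 k x : bump k x <= 1.
Proof. by have /andP[] := prod_hat_le1 predT k x. Qed.

Lemma bump_norm_le k x : `|bump k x| <= 1.
Proof. by rewrite ger0_norm ?bump_ge0 ?bump_le1. Qed.

Lemma dbump_norm_le k i x : `|dbump k i x| <= 4 * h^-1.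
Proof.
rewrite normrM; have /andP[h0 h1] := prod_hat_le1 (fun l => l != i) k x.
rewrite (ger0_norm h0); apply: le_trans (dhat_le (k i) (x 0 i)).
by rewrite ler_piMr.
Qed.

Lemma is_derive_bump k i x : is_derive x (delta_mx 0 i : E) (bump k) (dbump k i x).
Proof.
apply: (@is_derive_along R E _ _ _
  (fun s => (\prod_(l < N | l != i) hat (k l) (x 0 l)) * hat (k i) (s + x 0 i))).
  move=> s; rewrite /bump (bigD1 i)//= [LHS]mulrC !mxE !eqxx /= mulr1; congr (_ * _).
  by apply: eq_bigr => l li; rewrite !mxE (negbTE li) andbF mulr0 add0r.
have h1 : is_derive (0 : R) 1 (fun s : R => s + x 0 i) 1.
  apply: is_derive_of_quadratic_error => u.
  by rewrite (_ : _ - _ = 0) ?normr0 ?sqr_ge0//; ring.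
have H : is_derive (0 : R) 1 (hat (k i) \o (fun s : R => s + x 0 i)) (dhat (k i) (0 + x 0 i) * 1).
  exact: (@is_derive1_comp R (hat (k i)) (fun s : R => s + x 0 i) 0 _ _ (is_derive_hat (k i) (0 + x 0 i)) h1).
have := is_derive_scale H (\prod_(l < N | l != i) hat (k l) (x 0 l)).
by move=> G; apply: (is_derive_eq G); rewrite /dbump add0r mulr1 mulrC.
Qed.

Let continuous_prod (P : pred 'I_N) (k : I) : continuous (fun x : E => \prod_(i < N | P i) hat (k i) (x 0 i)).
Proof.
have c i : continuous (fun x : E => hat (k i) (x 0 i)).
  move=> x; apply: (@continuous_comp _ _ _ (fun x : E => x 0 i) (hat (k i))); last exact: continuous_hat.
  exact: continuous_coord.
elim: (index_enum 'I_N) => [|i r IH].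
  rewrite (_ : (fun x => _) = fun=> 1); first exact: cst_continuous.
  by apply/funext => x; rewrite big_nil.
rewrite (_ : (fun x => _) = fun x : E => (if P i then hat (k i) (x 0 i) else 1) *
    \prod_(i <- r | P i) hat (k i) (x 0 i)).
  by apply: continuous_mul => //; case: (P i) => //; exact: cst_continuous.
by apply/funext => x; rewrite big_cons; case: ifP => // _; rewrite mul1r.
Qed.

Lemma continuous_bump k : continuous (bump k).
Proof. exact: continuous_prod. Qed.

Lemma continuous_dbump k i : continuous (dbump k i).
Proof.
apply: continuous_mul; last exact: continuous_prod.
move=> x; apply: (@continuous_comp _ _ _ (fun x : E => x 0 i) (dhat (k i))); last exact: continuous_dhat.
exact: continuous_coord.
Qed.

Lemma bump_eq0 k x : h <= `|x - bnode k| -> bump k x = 0.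
Proof.
move=> hx; have [i hi] : exists i : 'I_N, h <= `|x 0 i - node (k i)|.
  apply/existsP; apply: contraTT hx; rewrite negb_exists => /forallP H.
  rewrite -ltNge [`|_|]mx_normrE; apply: bigmax_lt => // -[a b] _ /=.
  by rewrite (ord1 a) !mxE ltNge; exact: H.
by apply/eqP/prodf_eq0; exists i => //; apply/eqP; exact: hat_eq0.
Qed.

Lemma sum_bump x : \sum_(k : I) bump k x = \prod_(i < N) \sum_(k < K.*2) hat k (x 0 i).
Proof. by rewrite bigA_distr_bigA. Qed.

Lemma sum_bump_ge0 x : 0 <= \sum_(k : I) bump k x.
Proof. by apply: sumr_ge0 => k _; exact: bump_ge0. Qed.

Lemma sum_bump_le1 x : \sum_(k : I) bump k x <= 1.
Proof. by rewrite sum_bump; apply: prodr_ile1 => i _; rewrite sum_hat_ge0 sum_hat_le1. Qed.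

Lemma sum_bump1 x : `|x| <= h * (K%:R - 1) -> \sum_(k : I) bump k x = 1.
Proof.
move=> xh; rewrite sum_bump big1// => i _; apply: sum_hat1.
by apply: le_trans xh; exact: coord_le_norm.
Qed.

Lemma bump_support k : exists B : R, forall x, B < `|x| -> bump k x = 0.
Proof.
exists (h + `|bnode k|) => x xB; apply: bump_eq0.
have := ler_normB (x - bnode k) (- bnode k); rewrite opprK subrK normrN; lra.
Qed.

(* The error splits into the oscillation of [g] over one cell and the values of
   [g] outside the box on which the functions sum to 1. *)
Lemma partition_approx (g : E -> E -> R) (e : R) : 0 <= e ->
  (forall x y x' y', `|x - x'| < h -> `|y - y'| < h -> `|g x y - g x' y'| <= e) ->
  (forall x y, h * (K%:R - 1) < `|x| \/ h * (K%:R - 1) < `|y| -> `|g x y| <= e) ->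
  forall x y, `|g x y - \sum_(k : I) \sum_(l : I) g (bnode k) (bnode l) * (bump k x * bump l y)| <= 2 * e.
Proof.
move=> e0 osc tail x y.
pose s := (\sum_(k : I) bump k x) * (\sum_(l : I) bump l y).
have sE : s = \sum_(k : I) \sum_(l : I) bump k x * bump l y.
  by rewrite /s mulr_suml; apply: eq_bigr => k _; rewrite mulr_sumr.
have s01 : 0 <= s <= 1.
  rewrite mulr_ge0 ?sum_bump_ge0//= mulr_ile1 ?sum_bump_ge0 ?sum_bump_le1//.
have -> : g x y - \sum_(k : I) \sum_(l : I) g (bnode k) (bnode l) * (bump k x * bump l y) =
  (1 - s) * g x y + \sum_(k : I) \sum_(l : I) (g x y - g (bnode k) (bnode l)) * (bump k x * bump l y).
  have -> : \sum_(k : I) \sum_(l : I) (g x y - g (bnode k) (bnode l)) * (bump k x * bump l y) =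
      g x y * s - \sum_(k : I) \sum_(l : I) g (bnode k) (bnode l) * (bump k x * bump l y).
    rewrite sE mulr_sumr -sumrB; apply: eq_bigr => k _.
    by rewrite mulr_sumr -sumrB; apply: eq_bigr => l _; rewrite mulrBl.
  by ring.
apply: le_trans (ler_normD _ _) _; rewrite mulr_natl mulr2n; apply: lerD.
  have [xb|xb] := leP `|x| (h * (K%:R - 1)); last first.
    rewrite normrM ger0_norm ?subr_ge0; last by case/andP: s01.
    have := tail x y (or_introl xb); case/andP: s01 => s0 s1 gt.
    by apply: le_trans gt; rewrite ler_piMl// gerBl.
  have [yb|yb] := leP `|y| (h * (K%:R - 1)); last first.
    rewrite normrM ger0_norm ?subr_ge0; last by case/andP: s01.
    have := tail x y (or_intror yb); case/andP: s01 => s0 s1 gt.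
    by apply: le_trans gt; rewrite ler_piMl// gerBl.
  by rewrite /s !sum_bump1// mul1r subrr mul0r normr0.
apply: le_trans (ler_norm_sum _ _ _) _.
apply: (@le_trans _ _ (\sum_(k : I) \sum_(l : I) e * (bump k x * bump l y))); last first.
  have -> : \sum_(k : I) \sum_(l : I) e * (bump k x * bump l y) = e * s.
    by rewrite sE mulr_sumr; apply: eq_bigr => k _; rewrite mulr_sumr.
  by rewrite ler_piMr//; case/andP: s01.
apply: ler_sum => k _; apply: le_trans (ler_norm_sum _ _ _) _; apply: ler_sum => l _.
have b0 : 0 <= bump k x * bump l y by rewrite mulr_ge0 ?bump_ge0.
rewrite normrM (ger0_norm b0).
have [xk|xk] := ltP `|x - bnode k| h; last by rewrite (bump_eq0 xk) mul0r !mulr0.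
have [yl|yl] := ltP `|y - bnode l| h; last by rewrite (bump_eq0 yl) !mulr0.
by rewrite ler_wpM2r// osc.
Qed.

End partition.

(** The change of a square under a shift by [eta] grows with the argument; it is allowed to grow
    like [w ^+ 2], which the denominator [b] in [phi_kernel_osc] absorbs. *)
Lemma sqr_sub_le (R : realType) (eta u w : R) : 0 <= eta <= 1 -> `|u - w| <= eta ->
  w ^+ 2 - u ^+ 2 <= eta * 2 + eta * w ^+ 2.
Proof.
move=> /andP[e0 e1]; rewrite ler_norml => /andP[h1 h2].
have g1 : 0 <= (eta - (w - u)) * (w + 1) ^+ 2 by rewrite mulr_ge0 ?sqr_ge0//; lra.
have g2 : 0 <= (eta + (w - u)) * (w - 1) ^+ 2 by rewrite mulr_ge0 ?sqr_ge0//; lra.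
have g3 := sqr_ge0 (w - u); nra.
Qed.

(** * Kernel estimates *)

Section kernel_estimates.
Variables (R : realType) (lam : R).
Hypotheses (lam_gt0 : 0 < lam) (lam_le : lam <= 2^-1).
Local Notation phik := (phi_kernel lam).
Local Notation c := (clam lam).

Let c_gt0 : 0 < c. Proof. exact: clam_gt0. Qed.

Let lam2_le1 : 2 * lam <= 1.
Proof. by rewrite -ler_pdivlMl// mulr1. Qed.

Let lam_le1 : lam <= 1.
Proof. by apply: le_trans lam_le _; rewrite invf_le1// ler1n. Qed.

(** One formula for eps = 0 and eps different from 0. At eps = r = 0 both sides are 0, by the
    convention that 0 to a nonzero power is 0. *)
Lemma phi_kernel_powR eps r : 0 <= r -> phik eps r = (eps ^+ 2 + c * r ^+ 2) `^ (- lam).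
Proof.
move=> r0; rewrite /phi_kernel -/c; case: eqP => // ->.
rewrite expr0n/= add0r powRM ?sqr_ge0 ?ltW//; congr (_ * _).
by rewrite -mulrN powRrM powR_mulrn.
Qed.

(** Since [a / b] is at most 1 and [lam <= 1], the power (a / b)^lam is at least a / b. This
    replaces differentiation of the kernel throughout. *)
Lemma powRN_diff (a b : R) : 0 < a -> a <= b -> a `^ (- lam) - b `^ (- lam) <= a `^ (- lam) * ((b - a) / b).
Proof.
move=> a0 ab; have b0 : 0 < b by exact: lt_le_trans ab.
have ab1 : 0 < a / b <= 1 by rewrite divr_gt0//= ler_pdivrMr// mul1r.
have h : a / b <= (a / b) `^ lam by exact: ger1_powR ab1 lam_le1.
have e : b `^ (- lam) = a `^ (- lam) * (a / b) `^ lam.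
  have -> : (a / b) `^ lam = a `^ lam * b `^ (- lam).
    by rewrite powRM ?invr_ge0 ?ltW// -(powR_inv1 (ltW b0)) -powRrM mulN1r.
  by rewrite mulrA -powRD ?addNr ?powRr0 ?mul1r//; apply/implyP => _; rewrite gt_eqF.
have p0 : 0 <= a `^ (- lam) by exact: powR_ge0.
rewrite e (_ : (b - a) / b = 1 - a / b); last by field; rewrite gt_eqF.
by rewrite mulrBr mulr1 lerD2l lerN2 ler_wpM2l.
Qed.

Lemma phi_kernel0_sub eps r : 0 < r ->
  0 <= phik 0 r - phik eps r <= phik 0 r * (eps ^+ 2 / (c * r ^+ 2)).
Proof.
move=> r0; have r2 : 0 < c * r ^+ 2 by rewrite mulr_gt0// exprn_gt0.
rewrite !phi_kernel_powR ?(ltW r0)// expr0n/= add0r.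
have le : c * r ^+ 2 <= eps ^+ 2 + c * r ^+ 2 by rewrite lerDr sqr_ge0.
rewrite subr_ge0 ler_powRN//=; apply: le_trans (powRN_diff r2 le) _.
rewrite ler_wpM2l ?powR_ge0// addrK ler_wpM2l ?sqr_ge0//.
by rewrite lef_pV2 ?posrE//; exact: lt_le_trans le.
Qed.

Lemma phi_kernel_le0 eps r : 0 < r -> phik eps r <= phik 0 r.
Proof. by move=> r0; have /andP[] := phi_kernel0_sub eps r0; rewrite subr_ge0. Qed.

Definition k0 : R := c `^ (- lam).

(** Here [lam <= 1/2] is essential: r <= r^(2 lam) for r <= 1, so the singularity of phi_0 is at
    most 1/r, which the Lipschitz bound on the test field cancels. *)
Lemma phi_kernel0_mul_le r : 0 < r -> phik 0 r * Num.min r 1 <= k0.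
Proof.
move=> r0; rewrite /phi_kernel eqxx -/c -/k0 -mulrA ler_piMr ?powR_ge0//.
have [r1|r1] := leP r 1.
  have h : r <= r `^ (2 * lam) by apply: ger1_powR => //; rewrite r0 r1.
  rewrite powRN -ler_pdivlMl ?invr_gt0 ?powR_gt0// invrK mulr1.
  exact: h.
rewrite mulr1 powRN invf_le1 ?powR_gt0//.
have := ler_powR (ltW r1) (mulr_ge0 (ler0n R 2) (ltW lam_gt0)); rewrite powRr0; exact.
Qed.

(** * The kernels H^eps: bounds, comparison, decay and uniform continuity *)

Section H_kernel.
Variable N : nat.
Local Notation E := 'rV[R]_N.
Variables (phi : R -> E -> E) (B L B0 : R).
Hypotheses (phiB : forall i t x, `|phi t x 0 i| <= B)
  (phiL : forall i t x y, `|phi t x 0 i - phi t y 0 i| <= L * `|x - y|)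
  (phi0 : forall i t x, B0 < `|x| -> phi t x 0 i = 0)
  (B_ge0 : 0 <= B) (L_ge0 : 0 <= L).

Definition Hc eps i t x y : R := H_kernel lam eps phi t x y 0 i.

(** On the diagonal the difference of the test field vanishes, so the value given to the kernel
    there is immaterial and the case distinction disappears. *)
Lemma HcE eps i t x y : Hc eps i t x y = phik eps (enorm (x - y)) * (phi t x 0 i - phi t y 0 i).
Proof.
rewrite /Hc /H_kernel; case: eqP => [->|_]; first by rewrite (subrr (phi t y 0 i)) mulr0 mxE.
by rewrite !mxE.
Qed.

Lemma enorm_eq0 (x : E) : enorm x = 0 -> x = 0.
Proof. by move=> x0; apply/eqP; rewrite -normr_le0 -x0 norm_le_enorm. Qed.

Lemma phi_sub_le i t x y : `|phi t x 0 i - phi t y 0 i| <= 2 * B.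
Proof. by apply: le_trans (ler_normB _ _) _; rewrite mulr_natl mulr2n lerD. Qed.

(** The difference of the test field is at most [L] r and at most 2 [B], hence at most [L + 2 * B]
    times min(r, 1); [k0] then bounds phi_0(r) min(r, 1). *)
Definition KH : R := k0 * (L + 2 * B).

Lemma KH_ge0 : 0 <= KH.
Proof. by rewrite mulr_ge0 ?powR_ge0// addr_ge0// mulr_ge0. Qed.

Lemma phik_ge0 eps r : 0 <= r -> 0 <= phik eps r.
Proof. by move=> r0; rewrite phi_kernel_powR// powR_ge0. Qed.

Lemma Hc_le eps i t x y : `|Hc eps i t x y| <= KH.
Proof.
have [r0|r0] := eqVneq (enorm (x - y)) 0.
  have /eqP := enorm_eq0 r0; rewrite subr_eq0 => /eqP ->.
  by rewrite HcE (subrr (phi t y 0 i)) mulr0 normr0 KH_ge0.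
have rp : 0 < enorm (x - y) by rewrite lt_neqAle eq_sym r0 enorm_ge0.
rewrite HcE normrM ger0_norm ?phik_ge0 ?enorm_ge0//.
set r := enorm (x - y) in r0 rp *.
have d1 : `|phi t x 0 i - phi t y 0 i| <= (L + 2 * B) * Num.min r 1.
  have := phi_sub_le i t x y; have := phiL i t x y; have := norm_le_enorm (x - y).
  rewrite -/r; set d := `|_ - phi t y 0 i|; set n := `|x - y| => n_r dn dB.
  have [r1|r1] := leP r 1; last by rewrite mulr1; apply: le_trans dB _; rewrite lerDr.
  apply: le_trans dn _; apply: (@le_trans _ _ (L * r)); first by rewrite ler_wpM2l.
  by rewrite ler_wpM2r ?enorm_ge0// lerDl mulr_ge0.
apply: (@le_trans _ _ (phik 0 r * ((L + 2 * B) * Num.min r 1))).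
  by rewrite ler_pM ?phik_ge0 ?enorm_ge0// phi_kernel_le0.
rewrite mulrCA [leRHS]mulrC ler_wpM2l ?phi_kernel0_mul_le//.
by rewrite addr_ge0// mulr_ge0.
Qed.

(* Near the diagonal [phi_eps s^2] dominates a large multiple of [s]; away from
   it, the kernels converge uniformly. *)
Lemma Hc_compare e : 0 < e -> exists2 eb : R, 0 < eb & forall eps eps',
  0 < eps < eb -> 0 < eps' < eb -> forall i t x y s, 0 <= s ->
  `|Hc eps i t x y - Hc eps' i t x y| * s <=
  e * (1 + s ^+ 2 + phik eps (enorm (x - y)) * s ^+ 2).
Proof.
move=> e0; have K0 := KH_ge0.
(* If eps^2 + c r^2 <= mu then tau^2 phi_eps(r) >= 1, whence 2 s <= tau + s^2 / tau <= tau (1 +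
   phi_eps(r) s^2). The error is at most 2 [KH] s, and [KH] tau <= e. *)
pose tau := e / (KH + 1); have tau0 : 0 < tau by rewrite divr_gt0// ltr_wpDl.
pose mu := (tau ^+ 2) `^ lam^-1.
have mu0 : 0 < mu by rewrite powR_gt0// exprn_gt0.
(* Where c r^2 >= mu / 2, the difference phi_0 - phi_p is at most Q p^2, hence at most Q [eb]; [eb]
   is small enough that Q [eb] 2 [B] <= e. *)
pose Q := (mu / 2) `^ (- lam) / (mu / 2).
have Q0 : 0 <= Q by rewrite divr_ge0 ?powR_ge0// divr_ge0// ltW.
pose eb := Num.min 1 (Num.min (mu / 2) (e / (Q * (2 * B) + 1))).
have QB0 : 0 <= Q * (2 * B) by apply: mulr_ge0 => //; exact: mulr_ge0.
have eb0 : 0 < eb by rewrite !lt_min ltr01 !divr_gt0// ltr_wpDl.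
have eb1 : eb <= 1 by rewrite ge_min lexx.
have ebm : eb <= mu / 2 by rewrite !ge_min lexx !orbT.
have ebe : eb * (Q * (2 * B) + 1) <= e by rewrite -ler_pdivlMr ?ltr_wpDl// !ge_min lexx !orbT.
exists eb => // eps eps' /andP[p0 pb] /andP[p'0 p'b] i t x y s s0.
set r := enorm (x - y); have r0 : 0 <= r by exact: enorm_ge0.
have f0 : 0 <= phik eps r by exact: phik_ge0.
have s2 : 0 <= s ^+ 2 by exact: sqr_ge0.
have sq (p : R) : 0 < p -> p < eb -> p ^+ 2 <= eb.
  by move=> h1 h2; rewrite expr2; nra.
have [small|large] := leP (eps ^+ 2 + c * r ^+ 2) mu.
  have b0 : 0 < eps ^+ 2 + c * r ^+ 2 by rewrite ltr_pwDl ?exprn_gt0// mulr_ge0 ?sqr_ge0 ?ltW.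
  have tf : 1 <= tau ^+ 2 * phik eps r.
    rewrite phi_kernel_powR// powRN -ler_pdivrMr ?invr_gt0 ?powR_gt0// invrK mul1r.
    have -> : tau ^+ 2 = mu `^ lam.
      by rewrite /mu -powRrM mulVf ?gt_eqF// powRr1// sqr_ge0.
    by apply: ge0_ler_powR; rewrite ?nnegrE// ltW.
  have h1 : `|Hc eps i t x y - Hc eps' i t x y| <= 2 * KH.
    by apply: le_trans (ler_normB _ _) _; rewrite mulr_natl mulr2n lerD ?Hc_le.
  have h2 : 2 * s <= tau + tau * (phik eps r * s ^+ 2).
    rewrite -(ler_pM2l tau0) mulrDr.
    have : s ^+ 2 <= tau ^+ 2 * phik eps r * s ^+ 2 by rewrite ler_peMl.
    have := sqr_ge0 (tau - s); rewrite -!expr2 !expr2 => u1 u2; nra.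
  have h3 : KH * tau <= e.
    by rewrite /tau mulrCA ler_piMr ?(ltW e0)// ler_pdivrMr ?mul1r ?lerDl// ltr_wpDl.
  have h4 : `|Hc eps i t x y - Hc eps' i t x y| * s <= 2 * KH * s by rewrite ler_wpM2r.
  have h5 : KH * (2 * s) <= KH * (tau + tau * (phik eps r * s ^+ 2)) by rewrite ler_wpM2l.
  have h6 : KH * tau * (1 + phik eps r * s ^+ 2) <= e * (1 + phik eps r * s ^+ 2).
    by rewrite ler_wpM2r// addr_ge0// mulr_ge0.
  apply: le_trans h4 _; have -> : 2 * KH * s = KH * (2 * s) by ring.
  apply: le_trans h5 _.
  have -> : KH * (tau + tau * (phik eps r * s ^+ 2)) = KH * tau * (1 + phik eps r * s ^+ 2) by ring.
  by apply: le_trans h6 _; rewrite ler_pM2l// lerD2r lerDl.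
(* In the remaining case eps^2 <= [eb] <= mu / 2 leaves at least mu / 2 to c r^2. *)
have cr : mu / 2 <= c * r ^+ 2.
  by have := sq _ p0 pb; move: ebm large; clear => *; lra.
have m20 : 0 < mu / 2 by rewrite divr_gt0.
have rp : 0 < r.
  rewrite lt_neqAle r0 andbT; apply/negP => /eqP re; move: cr.
  by rewrite -re expr0n/= mulr0 leNgt m20.
have dif p : 0 < p -> p < eb -> phik 0 r - phik p r <= Q * eb.
  move=> h1 h2; have /andP[_ h] := phi_kernel0_sub p rp; apply: le_trans h _.
  rewrite {1}phi_kernel_powR// expr0n/= add0r /Q -mulrA.
  apply: ler_pM; rewrite ?powR_ge0//; first by rewrite divr_ge0 ?sqr_ge0// (le_trans (ltW m20)).
    exact: ler_powRN.
  rewrite mulrC ler_pM ?sqr_ge0 ?invr_ge0 ?(le_trans (ltW m20))//; last exact: sq.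
  by rewrite lef_pV2 ?posrE// (lt_le_trans m20).
have /andP[a1 _] := phi_kernel0_sub eps rp; have /andP[a2 _] := phi_kernel0_sub eps' rp.
have D : `|phik eps r - phik eps' r| <= Q * eb.
  have := dif _ p0 pb; have := dif _ p'0 p'b; rewrite ler_norml; move: a1 a2; clear => *; lra.
have -> : Hc eps i t x y - Hc eps' i t x y =
    (phik eps r - phik eps' r) * (phi t x 0 i - phi t y 0 i) by rewrite !HcE mulrBl.
rewrite normrM; have h2 := phi_sub_le i t x y.
have h1 : `|phik eps r - phik eps' r| * `|phi t x 0 i - phi t y 0 i| <= e.
  apply: le_trans (_ : Q * eb * (2 * B) <= _); first by rewrite ler_pM.
  by apply: le_trans ebe; rewrite mulrDr mulr1 mulrAC [leLHS]mulrC lerDl ltW.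
have h3 : 0 <= e * (phik eps r * s ^+ 2) by rewrite !mulr_ge0// ltW.
have h4 : e * s <= e * (1 + s ^+ 2).
  by rewrite ler_wpM2l ?(ltW e0)//; rewrite -subr_ge0 (_ : _ - _ = (s - 2^-1) ^+ 2 + 3 / 4) ?addr_ge0 ?sqr_ge0//; field.
apply: le_trans (ler_wpM2r s0 h1) _; rewrite mulrDr; apply: le_trans h4 _.
by rewrite lerDl.
Qed.

(** The threshold [eb] depends on the points: for lam = 1/2 the convergence is in general not
    uniform near the diagonal. Pointwise convergence is enough on the side of the limit charges. *)
Lemma Hc_cvg0 i t x y e : 0 < e -> exists2 eb : R, 0 < eb & forall eps, 0 <= eps < eb ->
  `|Hc eps i t x y - Hc 0 i t x y| <= e.
Proof.
move=> e0.
have [r0|r0] := eqVneq (enorm (x - y)) 0.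
  exists 1 => // eps _; have /eqP := enorm_eq0 r0; rewrite subr_eq0 => /eqP ->.
  by rewrite !HcE (subrr (phi t y 0 i)) !mulr0 subrr normr0 ltW.
have rp : 0 < enorm (x - y) by rewrite lt_neqAle eq_sym r0 enorm_ge0.
set r := enorm (x - y) in r0 rp *.
pose q := phik 0 r / (c * r ^+ 2) * (2 * B).
have q0 : 0 <= q.
  by rewrite mulr_ge0 ?mulr_ge0 ?phik_ge0 ?invr_ge0 ?mulr_ge0 ?sqr_ge0 ?(ltW c_gt0) ?(ltW rp).
have q1 : 0 < q + 1 by rewrite ltr_wpDl.
exists (Num.min 1 (e / (q + 1))); first by rewrite lt_min ltr01 divr_gt0.
move=> eps /andP[p0]; rewrite lt_min => /andP[p1 pe].
have pe' : eps * (q + 1) <= e by rewrite -ler_pdivlMr// ltW.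
rewrite !HcE -mulrBl normrM -/r distrC.
have /andP[a1 a2] := phi_kernel0_sub eps rp.
rewrite (ger0_norm a1); apply: le_trans pe'.
apply: (@le_trans _ _ (phik 0 r * (eps ^+ 2 / (c * r ^+ 2)) * (2 * B))).
  by rewrite ler_pM// phi_sub_le.
rewrite (_ : _ * (2 * B) = eps ^+ 2 * q); last by rewrite /q; ring.
have : eps ^+ 2 <= eps by rewrite expr2 ler_piMr// ltW.
move=> h; apply: (@le_trans _ _ (eps * q)); first by rewrite ler_wpM2r.
by rewrite ler_wpM2l// lerDl.
Qed.

(** If one point is far out, the field vanishes there; then either it vanishes at the other point
    too, or the points are far apart and the kernel is small. Antisymmetry in x and y halves the
    cases. *)
Lemma Hc_tail eps e : 0 < eps -> 0 < e -> exists Rb : R, forall i t x y,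
  Rb < `|x| \/ Rb < `|y| -> `|Hc eps i t x y| <= e.
Proof.
move=> p0 e0.
pose q := e / (2 * B + 1).
have B1 : 0 < 2 * B + 1 by rewrite ltr_wpDl// mulr_ge0.
have q0 : 0 < q by rewrite divr_gt0.
(* Chosen so that nu^(-lam) = q; as [ro] >= 1 and c [ro] >= nu, every r >= [ro] satisfies c r^2 >=
   nu. *)
pose nu := q `^ (- lam^-1); have nu0 : 0 < nu by exact: powR_gt0.
pose ro := 1 + nu / c.
have ro1 : 1 <= ro by rewrite lerDl divr_ge0 ?ltW.
exists (ro + `|B0|) => i t.
suff H x y : ro + `|B0| < `|x| -> `|Hc eps i t x y| <= e.
  move=> x y [|] h; first exact: H.
  have -> : Hc eps i t x y = - Hc eps i t y x by rewrite !HcE enormC -mulrN opprB.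
  by rewrite normrN; exact: H.
move=> xb.
have x0 : phi t x 0 i = 0 by apply: phi0; have := ler_norm B0; lra.
have [yb|yb] := leP `|y| B0; last by rewrite HcE x0 (phi0 _ _ yb) subrr mulr0 normr0 ltW.
have rr : ro <= enorm (x - y).
  apply: le_trans (norm_le_enorm _); have := lerB_dist x y; have := ler_norm B0; lra.
have rp : 0 < enorm (x - y) by apply: lt_le_trans rr; apply: lt_le_trans ro1.
rewrite HcE normrM ger0_norm ?phik_ge0 ?enorm_ge0//.
have fq : phik eps (enorm (x - y)) <= q.
  apply: le_trans (phi_kernel_le0 _ rp) _.
  rewrite phi_kernel_powR ?(ltW rp)// expr0n/= add0r.
  have -> : q = nu `^ (- lam).
    by rewrite /nu -powRrM mulrNN mulVf ?gt_eqF// powRr1// ltW.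
  apply: ler_powRN => //.
  have h1 : nu <= c * ro by rewrite /ro mulrDr mulrCA divff ?gt_eqF// !mulr1 lerDr ltW.
  apply: le_trans h1 _; rewrite ler_pM2l//; apply: le_trans (rr) _.
  by rewrite expr2 ler_peMl ?(ltW rp)// (le_trans ro1 rr).
apply: (@le_trans _ _ (q * (2 * B))).
  by rewrite ler_pM ?phik_ge0 ?enorm_ge0// phi_sub_le.
rewrite /q mulrAC ler_pdivrMr// ler_pM2l//; lra.
Qed.

(** The relative change of the base eps^2 + c |z|^2 is of order [eta] uniformly in z, by
    [sqr_sub_le], and [powRN_diff] carries it to the kernel. *)
Lemma phi_kernel_osc eps : 0 < eps -> exists2 K : R, 0 <= K & forall (eta : R) (z z' : E),
  0 <= eta <= 1 -> (forall i, `|z 0 i - z' 0 i| <= eta) ->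
  `|phik eps (enorm z) - phik eps (enorm z')| <= K * eta.
Proof.
move=> p0; have p2 : 0 < eps ^+ 2 by rewrite exprn_gt0.
pose K1 := 2 * N%:R * c / eps ^+ 2 + 1.
have K10 : 0 <= K1.
  by rewrite addr_ge0// divr_ge0 ?(ltW p2)// !mulr_ge0 ?ler0n// ltW.
exists (kphi lam eps * K1); first by rewrite mulr_ge0 ?kphi_ge0.
move=> eta; suff H (z z' : E) : 0 <= eta <= 1 -> (forall i, `|z 0 i - z' 0 i| <= eta) ->
    enorm z <= enorm z' ->
    `|phik eps (enorm z) - phik eps (enorm z')| <= kphi lam eps * K1 * eta.
  move=> z z' eta01 zz; have [h|/ltW h] := leP (enorm z) (enorm z'); first exact: H.
  by rewrite distrC; apply: H => // i; rewrite distrC.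
move=> /andP[eta0 eta1] zz le.
have le2 : enorm z ^+ 2 <= enorm z' ^+ 2 by rewrite ler_pXn2r ?nnegrE ?enorm_ge0.
rewrite !phi_kernel_powR ?enorm_ge0//.
set a := eps ^+ 2 + _; set b := eps ^+ 2 + c * enorm z' ^+ 2.
have a0 : 0 < a by rewrite ltr_pwDl// mulr_ge0 ?sqr_ge0 ?ltW.
have ab : a <= b by rewrite lerD2l ler_pM2l.
have b0 : 0 < b by exact: lt_le_trans ab.
rewrite ger0_norm ?subr_ge0 ?ler_powRN//.
apply: le_trans (powRN_diff a0 ab) _; rewrite -mulrA.
apply: ler_pM; rewrite ?powR_ge0//.
- by rewrite divr_ge0 ?subr_ge0 ?(ltW b0).
- by rewrite ler_powRN// lerDl mulr_ge0 ?sqr_ge0 ?ltW.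
rewrite ler_pdivrMr//.
have ba : b - a = c * \sum_(i < N) (z' 0 i ^+ 2 - z 0 i ^+ 2).
  by rewrite sumrB -!enorm_sqr /a /b; ring.
have S : \sum_(i < N) (z' 0 i ^+ 2 - z 0 i ^+ 2) <= eta * (2 * N%:R + enorm z' ^+ 2).
  rewrite enorm_sqr mulrDr.
  have -> : eta * (2 * N%:R) = \sum_(i < N) eta * 2.
    by rewrite sumr_const card_ord -[RHS]mulr_natl; ring.
  rewrite mulr_sumr -big_split/=; apply: ler_sum => i _.
  by apply: sqr_sub_le; rewrite ?eta0 ?zz.
rewrite ba; apply: le_trans (ler_wpM2l (ltW c_gt0) S) _.
have -> : c * (eta * (2 * N%:R + enorm z' ^+ 2)) = eta * (2 * N%:R * c + c * enorm z' ^+ 2) by ring.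
have -> : K1 * eta * b = eta * (K1 * b) by ring.
rewrite ler_wpM2l//.
have h1 : 2 * N%:R * c <= 2 * N%:R * c / eps ^+ 2 * b.
  have n0 : 0 <= 2 * N%:R * c by rewrite !mulr_ge0 ?ler0n// ltW.
  rewrite -[leRHS]mulrA -[leLHS]mulr1 ler_wpM2l// mulrC ler_pdivlMr// mul1r.
  by rewrite lerDl mulr_ge0 ?sqr_ge0 ?ltW.
have h2 : c * enorm z' ^+ 2 <= b by rewrite lerDr ltW.
have -> : K1 * b = 2 * N%:R * c / eps ^+ 2 * b + b by rewrite /K1; ring.
exact: lerD.
Qed.

Lemma Hc_osc eps e : 0 < eps -> 0 < e -> exists2 eta : R, 0 < eta & forall i t x y x' y',
  `|x - x'| < eta -> `|y - y'| < eta -> `|Hc eps i t x y - Hc eps i t x' y'| <= e.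
Proof.
move=> p0 e0; have [K K0 HK] := phi_kernel_osc p0.
pose M := K * 2 * (2 * B) + kphi lam eps * (2 * L).
have M0 : 0 <= M by rewrite addr_ge0// !mulr_ge0// kphi_ge0.
have M1 : 0 < M + 1 by rewrite ltr_wpDl.
(* The difference x - y moves by up to 2 [eta], which [phi_kernel_osc] wants at most 1. *)
pose eta := Num.min 2^-1 (e / (M + 1)).
have eta0 : 0 < eta by rewrite lt_min invr_gt0 ltr0n divr_gt0.
have eta1 : 2 * eta <= 1 by rewrite -ler_pdivlMl// mulr1 ge_min lexx.
have etae : eta * (M + 1) <= e by rewrite -ler_pdivlMr// ge_min lexx orbT.
exists eta => // i t x y x' y' /ltW xx /ltW yy.
apply: (@le_trans _ _ (M * eta)); last first.
  by apply: le_trans etae; rewrite mulrC ler_wpM2l ?(ltW eta0)// lerDl.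
rewrite !HcE; set f := phik _ _; set f' := phik _ (enorm (x' - y')).
set d := phi t x 0 i - _; set d' := phi t x' 0 i - _.
have -> : f * d - f' * d' = (f - f') * d + f' * (d - d') by ring.
apply: le_trans (ler_normD _ _) _; rewrite !normrM /M mulrDl lerD//.
  rewrite mulrAC; apply: ler_pM => //; last exact: phi_sub_le.
  rewrite -mulrA; apply: HK; first by rewrite mulr_ge0 ?(ltW eta0).
  move=> k; rewrite !mxE.
  have -> : x 0 k - y 0 k - (x' 0 k - y' 0 k) = (x - x') 0 k - (y - y') 0 k by rewrite !mxE; ring.
  apply: le_trans (ler_normB _ _) _; rewrite mulr_natl mulr2n lerD//.
    by apply: le_trans (coord_le_norm _ _) xx.
  by apply: le_trans (coord_le_norm _ _) yy.
rewrite -mulrA; apply: ler_pM => //.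
  by rewrite norm_phi_kernel_le.
have -> : d - d' = (phi t x 0 i - phi t x' 0 i) - (phi t y 0 i - phi t y' 0 i) by rewrite /d /d'; ring.
apply: le_trans (ler_normB _ _) _; rewrite -mulrA mulr_natl mulr2n lerD//.
  by apply: le_trans (phiL _ _ _ _) _; rewrite ler_wpM2l.
by apply: le_trans (phiL _ _ _ _) _; rewrite ler_wpM2l.
Qed.

End H_kernel.

End kernel_estimates.

(** * Bounds on the test field *)

Section compactly_supported_field.
Variables (R : realType) (N : nat).
Local Notation E := 'rV[R]_N.
Variable phi : R -> E -> E.
Let g (p : R * E) : E := phi p.1 p.2.
Hypothesis g_smooth : smooth g.
Variable K : set (R * E).
Hypotheses (cK : compact K) (gK : forall p, ~ K p -> g p = 0).

Lemma compact_norm_bounded (V W : normedModType R) (h : V -> W) (A : set V) :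
  compact A -> continuous h -> (forall x, ~ A x -> h x = 0) ->
  exists2 M : R, 0 <= M & forall x, `|h x| <= M.
Proof.
move=> cA ch h0.
have cn : {within A, continuous (fun x => `|h x|)}.
  apply: continuous_subspaceT => x.
  by apply: (@continuous_comp _ _ _ h (fun y : W => `|y|)); [exact: ch|exact: norm_continuous].
have [[a Aa]|nA] := pselect (A !=set0); last first.
  exists 0 => // x; rewrite h0 ?normr0// => Ax; apply: nA; by exists x.
have [c _ cmax] := compact_EVT_max (ex_intro _ a Aa) cA cn.
exists `|h c| => // x; have [Ax|Ax] := pselect (A x); last by rewrite h0// normr0.
by apply: cmax; rewrite inE.
Qed.

Let dg p : differentiable g p.
Proof. exact: (g_smooth [::] p). Qed.

Let cg : continuous g.
Proof. by move=> p; exact: differentiable_continuous. Qed.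

(** The derivative also vanishes off [K]: the complement is open, so the field is 0 near each of its
    points. *)
Lemma derive_bounded v : exists2 M : R, 0 <= M & forall p, `|'D_v g p| <= M.
Proof.
apply: (compact_norm_bounded cK) => [p|p Kp].
  by apply: differentiable_continuous; exact: (g_smooth [:: v] p).
have oK : open (~` K) by rewrite openC; apply: compact_closed cK; exact: norm_hausdorff.
have g0 : \forall y \near p, g y = (fun=> 0) y.
  by apply: filterS (open_nbhs_nbhs (conj oK Kp)) => y; exact: gK.
have [->|v0] := eqVneq v 0; first by rewrite deriveE// linear0.
by rewrite (near_eq_derive _ g0) derive_cst.
Qed.

Lemma line_le (i : 'I_N) p v C : (forall q, `|'D_v g q| <= C) ->
  `|g (p + v) 0 i - g p 0 i| <= C.
Proof.
move=> hC.
have der (u : R) : is_derive u 1 (fun u : R => g (p + u *: v) 0 i) ('D_v g (p + u *: v) 0 i).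
  have dv : derivable g (p + u *: v) v by exact: diff_derivable.
  have cv : (fun h : R => (h^-1 *: (g (h *: v + (p + u *: v)) - g (p + u *: v))) 0 i) @ 0^' -->
      'D_v g (p + u *: v) 0 i.
    exact: (@cvg_comp _ _ _ (fun h : R => h^-1 *: (g (h *: v + (p + u *: v)) - g (p + u *: v)))
      (fun y : E => y 0 i) _ _ _ dv (@continuous_coord R N i _)).
  have H : (fun h : R => h^-1 *: (g (p + (h *: 1 + u) *: v) 0 i - g (p + u *: v) 0 i)) @ 0^' -->
      'D_v g (p + u *: v) 0 i.
    rewrite (_ : (fun h : R => _) = (fun h : R => (h^-1 *: (g (h *: v + (p + u *: v)) - g (p + u *: v))) 0 i))//.
    apply/funext => h; rewrite !mxE; congr (_ * (g _ 0 i - _)).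
    by rewrite [h *: 1]mulr1 scalerDl addrCA.
  by split; [apply/cvg_ex; exists ('D_v g (p + u *: v) 0 i)|exact/cvg_lim].
have [|c _] := @MVT_segment R (fun u : R => g (p + u *: v) 0 i) (fun u => 'D_v g (p + u *: v) 0 i) 0 1 ler01 (fun u _ => der u).
  apply: continuous_subspaceT => u; apply: differentiable_continuous; apply/derivable1_diffP.
  by case: (der u).
rewrite scale1r scale0r addr0 subr0 mulr1 => ->.
by apply: le_trans (coord_le_norm _ _) _.
Qed.

Lemma derive_space_linear (w : E) p :
  'D_((0, w) : R * E) g p = \sum_(i < N) w 0 i *: 'D_((0, delta_mx 0 i) : R * E) g p.
Proof.
pose h (x : E) := 'd g p ((0, x) : R * E).
have hD x y : h (x + y) = h x + h y.
  by rewrite /h -linearD; congr ('d g p _); congr pair; rewrite addr0.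
have hZ a x : h (a *: x) = a *: h x.
  by rewrite /h -linearZ; congr ('d g p _); congr pair; rewrite scaler0.
have h0 : h 0 = 0 by have := hZ 0 0; rewrite scaler0 scale0r.
rewrite deriveE// -/(h w) {1}(row_sum_delta w) (big_morph h hD h0).
by apply: eq_bigr => i _; rewrite hZ deriveE.
Qed.

Lemma compactly_supported_bounds : exists B L B0 : R, [/\ 0 <= B, 0 <= L,
  [/\ forall i t x, `|phi t x 0 i| <= B,
      forall i t x y, `|phi t x 0 i - phi t y 0 i| <= L * `|x - y| &
      forall i t s x, `|phi t x 0 i - phi s x 0 i| <= L * `|t - s|] &
  forall i t x, B0 < `|x| -> phi t x 0 i = 0].
Proof.
have [B B_ge0 hB] := compact_norm_bounded cK cg gK.
have [Lt Lt_ge0 hLt] := derive_bounded (1, 0).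
have bd i := derive_bounded (0, delta_mx 0 i).
pose Mi i := s2val (cid2 (bd i)).
have Mi0 i : 0 <= Mi i := s2valP (cid2 (bd i)).
have hMi i p : `|'D_((0, delta_mx 0 i) : R * E) g p| <= Mi i := s2valP' (cid2 (bd i)) p.
pose L := Lt + \sum_(i < N) Mi i.
have [M0 [_ hM0]] := compact_bounded cK.
(* [compact_bounded] bounds [K] by every number above [M0], but not by [M0] itself. *)
exists B, L, (M0 + 1); split => //; first by rewrite addr_ge0// sumr_ge0.
  split => [i t x|i t x y|i t s x].
  - by apply: le_trans (coord_le_norm _ _) _; exact: (hB (t, x)).
  - have := @line_le i (t, y) (0, x - y) (L * `|x - y|).
    have -> : ((t, y) + (0, x - y) : R * E) = (t, x) by congr pair; rewrite /= ?addr0// addrC subrK.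
    apply => q; rewrite derive_space_linear; apply: le_trans (ler_norm_sum _ _ _) _.
    rewrite /L mulrDl ler_wpDl ?mulr_ge0// mulr_suml; apply: ler_sum => k _.
    by rewrite normrZ mulrC ler_pM// coord_le_norm.
  - have := @line_le i (s, x) (t - s, 0) (L * `|t - s|).
    have -> : ((s, x) + (t - s, 0) : R * E) = (t, x) by congr pair; rewrite /= ?addr0// addrC subrK.
    apply => q; rewrite deriveE//.
    have -> : ((t - s, 0) : R * E) = (t - s) *: (1, 0).
      by congr pair; [rewrite [_ *: _]mulr1|rewrite scaler0].
    rewrite linearZ normrZ mulrC ler_pM// -deriveE//.
    by apply: le_trans (hLt q) _; rewrite lerDl sumr_ge0.
move=> i t x xM; have -> : phi t x = 0; last by rewrite mxE.
apply: (gK (p := (t, x))) => Ktx.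
have := hM0 (M0 + 1) ltac:(by rewrite ltrDl) (t, x) Ktx.
rewrite /= prod_normE /= ge_max => /andP[_]; by rewrite leNgt xM.
Qed.

Lemma continuous_field i : continuous (fun p : R * E => phi p.1 p.2 0 i).
Proof.
move=> p; apply: (@continuous_comp _ _ _ g (fun y : E => y 0 i)); first exact: cg.
exact: continuous_coord.
Qed.

End compactly_supported_field.

(* The product Borel sigma-algebra of R x R^N is generated by the bijection
   with R^(N+1) along which Lebesgue measure was defined. *)
Lemma continuous_field_measurable (R : realType) (N : nat) (h : R * 'rV[R]_N -> R) :
  continuous h -> measurable_fun setT (h : measurableTypeR R * 'rV[R]_N -> R).
Proof.
move=> ch; pose s (y : 'rV[R]_N.+1) : R * 'rV[R]_N := (y 0 0, \row_i y 0 (lift 0 i)).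
have H1 : continuous (fun z : 'rV[R]_N.+1 => z 0 0) by exact: (@continuous_coord R N.+1 0).
have H2 : continuous (fun z : 'rV[R]_N.+1 => \row_i z 0 (lift 0 i) : 'rV[R]_N).
  move=> y A [P hP PA].
  have H : nbhs (y : 'rV[R]_N.+1) [set z : 'rV[R]_N.+1 | forall j : 'I_N, P 0 j (z 0 (lift 0 j))].
    have Hj (j : 'I_N) : nbhs (y : 'rV[R]_N.+1) [set z : 'rV[R]_N.+1 | P 0 j (z 0 (lift 0 j))].
      by have := hP 0 j; rewrite mxE => hj; exact: (@continuous_coord R N.+1 (lift 0 j) y _ hj).
    rewrite (_ : [set z | _] = [set z : 'rV[R]_N.+1 | forall j, [set z : 'rV[R]_N.+1 | P 0 j (z 0 (lift 0 j))] z])//.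
    exact: (@filter_forall 'rV[R]_N.+1 'I_N (fun j => [set z : 'rV[R]_N.+1 | P 0 j (z 0 (lift 0 j))]) (nbhs (y : 'rV[R]_N.+1)) _ Hj).
  by apply: filterS H => z hz; apply: PA => i j /=; rewrite (ord1 i) mxE; exact: hz.
have cs : continuous s by move=> y; exact: (cvg_pair (H1 y) (H2 y)).
have mh : measurable_fun setT (h \o s).
  apply: continuous_rV_measurable => y.
  by apply: (@continuous_comp _ _ _ s h); [exact: cs|exact: ch].
rewrite (_ : h = (h \o s) \o @consrV R N).
  exact: (measurableT_comp mh (@measurable_consrV R N)).
apply/funext => -[r x] /=; rewrite /s /consrV /=; congr (h (_, _)).
  have -> : (0 : 'I_N.+1) = lshift N (0 : 'I_1) by exact/val_inj.
  by apply/esym; exact: (etrans (row_mxEl (const_mx r : 'rV[R]_1) x 0 0) (mxE _ _ _ _)).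
apply/rowP => i; rewrite mxE.
have -> : lift 0 i = rshift 1 i by exact/val_inj.
by apply/esym; exact: (row_mxEr (const_mx r : 'rV[R]_1) x 0 i).
Qed.

(** * Approximation of H^eps by tensor products *)

Section kernel_approximation.
Variables (R : realType) (N : nat) (lam : R).
Hypotheses (lam_gt0 : 0 < lam) (lam_le : lam <= 2^-1).
Local Notation E := 'rV[R]_N.
Variables (phi : R -> E -> E).
Hypothesis phi_smooth : smooth (fun p : R * E => phi p.1 p.2).
Hypothesis phi_supp : supported_in setT (fun p : R * E => phi p.1 p.2).
Local Notation phik := (phi_kernel lam).
Local Notation H := (Hc lam phi).

(** The properties asked of the factors: compact support makes them tests for the weak-*
    convergences, bounded continuous derivatives make their density moments equicontinuous. *)
Record test_family (I : finType) (chi : I -> E -> R) : Prop := {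
  test_derivative : exists (dchi : I -> 'I_N -> E -> R) (C : R),
    [/\ forall k i x, is_derive x (delta_mx 0 i : E) (chi k) (dchi k i x),
        forall k i, continuous (dchi k i) & forall k i x, `|dchi k i x| <= C];
  test_continuous : forall k, continuous (chi k);
  test_le1 : forall k x, `|chi k x| <= 1;
  test_support : forall k, exists B : R, forall x, B < `|x| -> chi k x = 0
}.

Lemma measurable_Hc_section eps i x y : measurable_fun setT (fun t : measurableTypeR R => H eps i t x y).
Proof.
have [K [cK _ gK]] := phi_supp.
have m1 z : measurable_fun setT (fun t : measurableTypeR R => phi t z 0 i).
  have mp := continuous_field_measurable (@continuous_field _ _ _ phi_smooth i).
  have mz : measurable_fun setT (fun t : measurableTypeR R => (t, z)) by exact: pair2_measurable.
  exact: (measurableT_comp mp mz).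
under eq_fun do rewrite HcE.
by apply: measurable_funM => //; exact: measurable_funB.
Qed.

Lemma measurable_Hc eps i : 0 < eps ->
  measurable_fun setT (fun p : measurableTypeR R * (E * E) => H eps i p.1 p.2.1 p.2.2).
Proof.
move=> p0; have mp := continuous_field_measurable (@continuous_field _ _ _ phi_smooth i).
under eq_fun do rewrite HcE.
apply: measurable_funM.
  exact: (measurableT_comp (@measurable_phi_kernel R N lam eps p0) measurable_snd).
have m1 : measurable_fun setT (fun p : measurableTypeR R * (E * E) => (p.1, p.2.1)).
  by apply/measurable_fun_pair => //=; exact: measurableT_comp.
have m2 : measurable_fun setT (fun p : measurableTypeR R * (E * E) => (p.1, p.2.2)).
  by apply/measurable_fun_pair => //=; exact: measurableT_comp.
by apply: measurable_funB; [exact: (measurableT_comp mp m1)|exact: (measurableT_comp mp m2)].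
Qed.

Lemma Hc_bounded : exists2 K : R, 0 <= K & forall eps i t x y, `|H eps i t x y| <= K.
Proof.
have [K [cK _ gK]] := phi_supp.
have [B [L [B0 [B_ge0 L_ge0 [hB hL _] h0]]]] := compactly_supported_bounds phi_smooth cK gK.
exists (KH lam B L); first exact: KH_ge0.
by move=> eps i t x y; exact: (Hc_le lam_gt0 lam_le hB hL).
Qed.

Lemma Hc_cvg i t x y e : 0 < e -> exists2 eb : R, 0 < eb & forall eps, 0 <= eps < eb ->
  `|H eps i t x y - H 0 i t x y| <= e.
Proof.
have [K [cK _ gK]] := phi_supp.
have [B [L [B0 [B_ge0 L_ge0 [hB hL _] h0]]]] := compactly_supported_bounds phi_smooth cK gK.
by move=> e0; exact: (Hc_cvg0 lam_gt0 lam_le hB).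
Qed.

(** The same tensor product serves twice: against H^eps for all small eps, in the weighted sense
    that controls the fluxes, and uniformly against one H^eps' with eps' <= e, which identifies the
    limit as e tends to 0. *)
Lemma kernel_approximation (e : R) : 0 < e ->
  exists (I : finType) (chi : I -> E -> R) (c : 'I_N -> I -> I -> R -> R) (eb eps' : R),
  let h i t x y := \sum_(k : I) \sum_(l : I) c i k l t * (chi k x * chi l y) in
  [/\ test_family chi, forall i k l, measurable_fun setT (c i k l : measurableTypeR R -> R),
      exists C : R, forall i k l t, `|c i k l t| <= C,
      0 < eb /\ (forall eps, 0 < eps < eb -> forall i t x y s, 0 <= s ->
        `|H eps i t x y - h i t x y| * s <=
        e * (1 + s ^+ 2 + phik eps (enorm (x - y)) * s ^+ 2)) &
      0 < eps' <= e /\ forall i t x y, `|H eps' i t x y - h i t x y| <= e].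
Proof.
move=> e0; have [K [cK _ gK]] := phi_supp.
have [B [L [B0 [B_ge0 L_ge0 [hB hL _] h0]]]] := compactly_supported_bounds phi_smooth cK gK.
have e2 : 0 < e / 2 by rewrite divr_gt0.
have e4 : 0 < e / 2 / 2 by rewrite divr_gt0.
have [eb eb0 cmp] := Hc_compare lam_gt0 lam_le hB hL B_ge0 L_ge0 e2.
(* Below [eb], so that it can be compared with every small eps, and at most [e], so that it vanishes
   with [e]. *)
pose eps' := Num.min (eb / 2) e.
have p'0 : 0 < eps' by rewrite lt_min e0 divr_gt0.
have p'e : eps' <= e by rewrite ge_min lexx orbT.
have p'b : eps' < eb.
  by rewrite gt_min ltr_pdivrMr// mulr_natr mulr2n ltrDl eb0.
have [Rb tail] := Hc_tail lam_gt0 lam_le hB h0 B_ge0 p'0 e4.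
have [eta eta0 osc] := Hc_osc lam_gt0 lam_le hB hL B_ge0 L_ge0 p'0 e4.
(* Large enough for the box on which the partition sums to 1 to contain the radius [Rb] beyond which
   the kernel is small. *)
pose n := (Num.bound `|Rb / eta|).+1.
have nR : Rb <= eta * (n%:R - 1).
  rewrite -ler_pdivrMl// mulrC -natr1 addrK; apply: le_trans (ler_norm _) _.
  by apply/ltW/archi_boundP.
pose I : finType := {ffun 'I_N -> 'I_n.*2}.
pose nd (k : I) : E := bnode eta k.
exists I, (@bump R N n eta), (fun i k l t => H eps' i t (nd k) (nd l)), eb, eps' => h.
have hh i t x y : `|H eps' i t x y - h i t x y| <= e / 2.
  have := @partition_approx R N n eta eta0 (H eps' i t) (e / 2 / 2) (ltW e4).
  rewrite [X in _ -> _ -> forall x y, _ <= X](_ : _ = e / 2); last by field.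
  apply => [x1 y1 x2 y2|x1 y1 xy]; first exact: osc.
  by apply: tail; case: xy => xy; [left|right]; exact: le_lt_trans xy.
split.
- split.
  + exists (@dbump R N n eta), (4 * eta^-1); split => [k i x|k i|k i x].
    * exact: is_derive_bump.
    * exact: continuous_dbump.
    * exact: dbump_norm_le.
  + by move=> k; exact: continuous_bump.
  + by move=> k x; exact: bump_norm_le.
  + by move=> k; exact: bump_support.
- by move=> i k l; exact: measurable_Hc_section.
- exists (KH lam B L) => i k l t; exact: (Hc_le lam_gt0 lam_le hB hL).
- split => // eps pe i t x y s s0.
  have p'eb : 0 < eps' < eb by rewrite p'0 p'b.
  have h1 := cmp eps eps' pe p'eb i t x y s s0.
  have h2 : `|H eps' i t x y - h i t x y| * s <= e / 2 * s by rewrite ler_wpM2r.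
  have h3 : s <= 1 + s ^+ 2.
    by rewrite -subr_ge0 (_ : _ - _ = (s - 2^-1) ^+ 2 + 3 / 4) ?addr_ge0 ?sqr_ge0//; field.
  have h4 : 0 <= phik eps (enorm (x - y)) * s ^+ 2.
    by rewrite mulr_ge0 ?sqr_ge0// phi_kernel_ge0//; case/andP: pe.
  have h5 : e / 2 * s <= e / 2 * (1 + s ^+ 2 + phik eps (enorm (x - y)) * s ^+ 2).
    by rewrite ler_pM2l//; apply: le_trans h3 _; rewrite lerDl.
  have -> : H eps i t x y - h i t x y =
      (H eps i t x y - H eps' i t x y) + (H eps' i t x y - h i t x y) by ring.
  apply: le_trans (ler_wpM2r s0 (ler_normD _ _)) _; rewrite mulrDl.
  apply: le_trans (lerD h1 (le_trans h2 h5)) _.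
  by rewrite -mulrDl (_ : e / 2 + e / 2 = e)//; field.
- split; first by rewrite p'0 p'e.
  by move=> i t x y; apply: le_trans (hh i t x y) _; rewrite ler_pdivrMr// ler_peMr ?ltW// ltr1n.
Qed.

End kernel_approximation.

Lemma cvg_le_ub (R : realType) (u : nat -> R) (l C : R) :
  u n @[n --> \oo] --> l -> (forall n, u n <= C) -> l <= C.
Proof.
move=> c uC; rewrite -(cvg_lim (@Rhausdorff R) c); apply: limr_le; last exact: nearW.
by apply/cvg_ex; exists l.
Qed.

(** * Weak limits in L^1 *)

Section weak_L1_limits.
Context d (X : measurableType d) (R : realType) (mu : {measure set X -> \bar R}).

Lemma rint_fatou (f : nat -> X -> R) (g : X -> R) (C : R) : (forall n, rint mu (f n)) ->
  (forall x, f n x @[n --> \oo] --> g x) -> (forall n, \int[mu]_x `|f n x| <= C) ->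
  rint mu g /\ \int[mu]_x `|g x| <= C.
Proof.
move=> jf fg fC; have mf n := rint_measurable (jf n).
have mg : measurable_fun setT g.
  by apply: (@measurable_fun_cvg _ _ _ setT f) => // x _; exact: fg.
have le : (\int[mu]_x `|g x|%:E <= C%:E)%E.
  have F := @fatou _ _ _ mu setT measurableT (fun n x => `|f n x|%:E).
  have -> : (\int[mu]_x `|g x|%:E = \int[mu]_x limn_einf (fun n => `|f n x|%:E))%E.
    apply: eq_integral => x _; have c : `|f n x|%:E @[n --> \oo] --> `|g x|%:E.
      by apply: cvg_EFin; [exact: nearW|apply: cvg_norm; exact: fg].
    by rewrite is_cvg_limn_einfE; [rewrite (cvg_lim _ c)|apply/cvg_ex; eexists; exact: c].
  apply: le_trans (F _ _) _.
  - by move=> n; apply/measurable_EFinP; exact: measurableT_comp.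
  - by move=> n x _; rewrite lee_fin.
  rewrite limn_einf_lim; apply: lime_le; first exact: is_cvg_einfs.
  apply: nearW => n; apply: (@le_trans _ _ (\int[mu]_x `|f n x|%:E)%E).
    by apply: ereal_inf_lbound; exists n => //=.
  by rewrite -Rint_EFin ?lee_fin//; exact: rint_norm.
have jn : rint mu (fun x => `|g x|).
  apply/ge0_rintP => //; first exact: measurableT_comp.
  by apply: le_lt_trans le _; rewrite ltry.
by split; [exact: le_rint jn _|rewrite -lee_fin Rint_EFin].
Qed.

Lemma Rint_dominated_cvg (f : nat -> X -> R) (h g : X -> R) :
  (forall n, measurable_fun setT (f n)) -> measurable_fun setT h ->
  {ae mu, forall x, f n x @[n --> \oo] --> h x} -> rint mu g ->
  {ae mu, forall x, forall n, `|f n x| <= g x} ->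
  rint mu h /\ \int[mu]_x f n x @[n --> \oo] --> \int[mu]_x h x.
Proof.
move=> mf mh fh jg fg.
have fE : {ae mu, forall x, setT x -> (f n x)%:E @[n --> \oo] --> (h x)%:E}.
  by apply: filterS fh => x fx _; apply: cvg_EFin => //; exact: nearW.
have gE : {ae mu, forall x n, setT x -> (`|(f n x)%:E| <= (g x)%:E)%E}.
  by apply: filterS fg => x fx n _; rewrite /= lee_fin.
have [j _ c] := @dominated_convergence _ X R mu setT measurableT (fun n x => (f n x)%:E)
  (EFin \o h) (EFin \o g) (fun n => (measurable_EFinP _ _).2 (mf n)) ((measurable_EFinP _ _).2 mh)
  fE jg gE.
split => //; apply: fine_cvg; rewrite fineK; first exact: c.
exact: integrable_fin_num.
Qed.

Section sign_test.
Variables (D : set X).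
Hypotheses (mD : measurable D) (Dfin : (mu D < +oo)%E).

Definition bounded_test (eta : X -> R) := measurable_fun setT eta /\ forall x, `|eta x| <= 1.

(* Test with the sign of [h] truncated to where |h| <= K, and let K grow. *)
Lemma weak_limit_L1 (g : nat -> X -> R) (h : X -> R) (C : R) :
  measurable_fun setT h -> (forall x, ~ D x -> h x = 0) ->
  (forall n, rint mu (g n)) -> (forall n, \int[mu]_x `|g n x| <= C) ->
  (forall eta, bounded_test eta ->
    \int[mu]_x (eta x * g n x) @[n --> \oo] --> \int[mu]_x (eta x * h x)) ->
  rint mu h /\ \int[mu]_x `|h x| <= C.
Proof.
move=> mh h0 jg gC w.
pose A (k : nat) : set X := [set x | `|h x| <= k%:R].
have mA k : measurable (A k).
  have mn : measurable_fun setT (fun x => `|h x|) by exact: measurableT_comp.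
  rewrite (_ : A k = (fun x => `|h x|) @^-1` `]-oo, k%:R]).
    by rewrite -[X in measurable X]setTI; exact: mn.
  by apply/seteqP; split => x /=; rewrite in_itv.
pose f k x := h x * \1_(A k) x.
have m1 k : measurable_fun setT (\1_(A k) : X -> R) by exact: measurable_indic.
have i01 k x : 0 <= (\1_(A k) x : R) <= 1 by rewrite indicE lern1 ler0n; case: (_ \in _).
have jD : rint mu (\1_D : X -> R).
  by apply/ge0_rintP => //; rewrite integral_indic// setIT.
have jf k : rint mu (f k).
  apply: (le_rint (g := fun x => k%:R * \1_D x)).
  - exact: measurable_funM.
  - exact: rintZl.
  - move=> x; rewrite /f normrM; have [Dx|Dx] := pselect (D x); last first.
      by rewrite h0// normr0 mul0r mulr_ge0// indicE.
    rewrite [in X in _ <= X]indicE mem_set// mulr1 indicE.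
    have [xA|xA] := boolP (x \in A k); last by rewrite normr0 mulr0.
    by rewrite normr1 mulr1; move: xA; rewrite inE.
apply: (rint_fatou jf) => [x|k].
  apply: cvg_near_cst; exists (Num.bound `|h x|) => // k /= kb.
  rewrite /f indicE mem_set ?mulr1// /A /=; apply: le_trans (_ : (Num.bound `|h x|)%:R <= _).
    by apply/ltW/archi_boundP.
  by rewrite ler_nat.
pose eta x := Num.sg (h x) * \1_(A k) x.
have meta : measurable_fun setT eta.
  apply: measurable_funM => //.
  rewrite (_ : (fun x => _) = fun x => \1_[set x | 0 < h x] x - \1_[set x | h x < 0] x).
    apply: measurable_funB; apply: measurable_indic.
      rewrite (_ : [set x | _] = setT `&` h @^-1` `]0, +oo[); first exact: mh.
      by rewrite setTI; apply/seteqP; split => x /=; rewrite in_itv/= ?andbT.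
    rewrite (_ : [set x | _] = setT `&` h @^-1` `]-oo, 0[); first exact: mh.
    by rewrite setTI; apply/seteqP; split => x /=; rewrite in_itv.
  apply/funext => x; rewrite !indicE.
  have -> : (x \in [set x | 0 < h x]) = (0 < h x) by apply/idP/idP; rewrite inE.
  have -> : (x \in [set x | h x < 0]) = (h x < 0) by apply/idP/idP; rewrite inE.
  have [hx|hx|hx] := ltgtP (h x) 0.
  + by rewrite ltr0_sg// sub0r.
  + by rewrite gtr0_sg// subr0.
  + by rewrite hx sgr0 subrr.
have eta1 x : `|eta x| <= 1.
  have /andP[i0 i1] := i01 k x.
  by rewrite normrM normr_sg (ger0_norm i0) mulr_ile1// lern1; case: (h x != 0).
have e x : `|f k x| = eta x * h x.
  by rewrite /f /eta normrM (ger0_norm (andP (i01 k x)).1) mulrAC -normrEsg.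
under eq_Rintegral do rewrite e.
have c := w eta (conj meta eta1).
apply: (cvg_le_ub c) => n.
have je : rint mu (fun x => eta x * g n x).
  apply: (le_rint (g := fun x => `|g n x|)).
  - by apply: measurable_funM => //; exact: rint_measurable (jg n).
  - exact: rint_norm.
  - by move=> x; rewrite normrM ler_piMl.
apply: le_trans (gC n); apply: le_Rint => //; first exact: rint_norm.
by move=> x; apply: le_trans (ler_norm _) _; rewrite normrM ler_piMl.
Qed.

Lemma rint_bounded_mul (eta g : X -> R) : bounded_test eta -> rint mu g ->
  rint mu (fun x => eta x * g x) /\ `|\int[mu]_x (eta x * g x)| <= \int[mu]_x `|g x|.
Proof.
move=> [me e1] jg.
have le x : `|eta x * g x| <= `|g x| by rewrite normrM ler_piMl.
have j : rint mu (fun x => eta x * g x).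
  apply: (le_rint (g := fun x => `|g x|)) => //; last exact: rint_norm.
  by apply: measurable_funM => //; exact: rint_measurable jg.
split => //; apply: le_trans (le_normr_Rintegral measurableT j) _.
by apply: le_Rint => //; exact: rint_norm.
Qed.

Lemma bounded_test1 : bounded_test (fun=> 1).
Proof. by split => // x; rewrite normr1. Qed.

Lemma Rint_norm_sub_le (f g : X -> R) (c : R) : rint mu f -> rint mu g ->
  \int[mu]_x `|f x - g x| <= c -> `|\int[mu]_x f x - \int[mu]_x g x| <= c.
Proof.
move=> jf jg; apply: le_trans; rewrite -RintegralB//.
by apply: le_normr_Rintegral => //; exact: rintB.
Qed.

(* The approximations [Sm m] form a Cauchy sequence in L^1, because the
   distance between the [sm m n] passes to the weak limit. *)
Lemma limit_interchange (s : nat -> X -> R) (sm : nat -> nat -> X -> R) (Sm : nat -> X -> R)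
    (S : X -> R) (dom : nat -> X -> R) (e : nat -> R) (C : R) :
  (forall n, rint mu (s n)) -> (forall m n, rint mu (sm m n)) ->
  (forall n, rint mu (dom n)) -> (forall n, \int[mu]_x dom n x <= C) -> 0 <= C ->
  (forall m, 0 <= e m) -> e m @[m --> \oo] --> 0 ->
  (forall m, exists n0, forall n, (n0 <= n)%N ->
    {ae mu, forall x, `|s n x - sm m n x| <= e m * dom n x}) ->
  (forall m, measurable_fun setT (Sm m)) -> (forall m x, ~ D x -> Sm m x = 0) ->
  (forall m, exists Cm, forall n, \int[mu]_x `|sm m n x| <= Cm) ->
  (forall m eta, bounded_test eta ->
    \int[mu]_x (eta x * sm m n x) @[n --> \oo] --> \int[mu]_x (eta x * Sm m x)) ->
  (forall x, Sm m x @[m --> \oo] --> S x) ->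
  \int[mu]_x s n x @[n --> \oo] --> \int[mu]_x S x.
Proof.
move=> js jsm jd dC C0 e0 ecv app mS S0 bd weak ptw.
have jS m : rint mu (Sm m).
  have [Cm hCm] := bd m.
  by have [] := weak_limit_L1 (mS m) (S0 m) (jsm m) hCm (weak m).
have cauchy m k : \int[mu]_x `|Sm m x - Sm k x| <= (e m + e k) * C.
  have [n1 h1] := app m; have [n2 h2] := app k.
  (* The sequences are shifted so that both approximations hold from the first index on. *)
  pose n0 := maxn n1 n2; pose g n x := sm m (n + n0)%N x - sm k (n + n0)%N x.
  have jg n : rint mu (g n) by exact: rintB.
  apply: (proj2 (weak_limit_L1 (g := g) _ _ jg _ _)).
  - exact: measurable_funB.
  - by move=> x Dx; rewrite !S0// subrr.
  - move=> n; apply: (@le_trans _ _ (\int[mu]_x ((e m + e k) * dom (n + n0)%N x))).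
      apply: ae_le_Rint; [exact: rint_norm|exact: rintZl|].
      have l1 : (n1 <= n + n0)%N by rewrite (leq_trans (leq_maxl n1 n2))// leq_addl.
      have l2 : (n2 <= n + n0)%N by rewrite (leq_trans (leq_maxr n1 n2))// leq_addl.
      apply: filterS2 (h1 _ l1) (h2 _ l2) => x u1 u2.
      rewrite /g (_ : _ - _ = (s (n + n0)%N x - sm k (n + n0)%N x) - (s (n + n0)%N x - sm m (n + n0)%N x)); last by ring.
      by apply: le_trans (ler_normB _ _) _; rewrite mulrDl addrC lerD.
    by rewrite RintegralZl// ler_wpM2l// addr_ge0.
  - move=> eta teta.
    have j1 p n := (rint_bounded_mul teta (jsm p n)).1.
    have j2 p := (rint_bounded_mul teta (jS p)).1.
    have -> : \int[mu]_x (eta x * (Sm m x - Sm k x)) =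
        \int[mu]_x (eta x * Sm m x) - \int[mu]_x (eta x * Sm k x).
      by rewrite -RintegralB//; apply: eq_Rintegral => x _; rewrite mulrBr.
    have -> : (fun n => \int[mu]_x (eta x * g n x)) =
        (fun n => \int[mu]_x (eta x * sm m (n + n0)%N x) - \int[mu]_x (eta x * sm k (n + n0)%N x)).
      apply/funext => n; rewrite -RintegralB//.
      by apply: eq_Rintegral => x _; rewrite /g mulrBr.
    apply: cvgB.
      by rewrite (cvg_shiftn n0 (fun n => \int[mu]_x (eta x * sm m n x)) _); exact: weak.
    by rewrite (cvg_shiftn n0 (fun n => \int[mu]_x (eta x * sm k n x)) _); exact: weak.
(* The Cauchy estimate passes to the limit in its second index by Fatou, thanks to the pointwise
   convergence to [S]. *)
have lim (dl : R) M m : (forall k, (M <= k)%N -> e k <= dl) -> (M <= m)%N ->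
    rint mu (fun x => Sm m x - S x) /\ \int[mu]_x `|Sm m x - S x| <= 2 * dl * C.
  move=> hM Mm; apply: (rint_fatou (f := fun k x => Sm m x - Sm (k + M)%N x)).
  - by move=> k; exact: rintB.
  - move=> x; apply: cvgB; first exact: cvg_cst.
    by rewrite (cvg_shiftn M (fun k => Sm k x) _); exact: ptw.
  - move=> k; apply: le_trans (cauchy _ _) _; rewrite ler_wpM2r// mulr_natl mulr2n.
    by rewrite lerD// hM// leq_addl.
apply/cvgrPdist_le => ep ep0.
(* The distance from [S] to [Sm M] costs 2 [dl] [C] and that from [s n] to [sm M n] costs [dl] [C];
   the other half of [ep] is for the weak convergence at the fixed index [M]. *)
pose dl := ep / 2 / (3 * C + 1).
have C1 : 0 < 3 * C + 1 by rewrite ltr_wpDl// mulr_ge0.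
have dl0 : 0 < dl by rewrite !divr_gt0.
have dle : 2 * dl * C + dl * C <= ep / 2.
  have : dl * (3 * C + 1) = ep / 2 by rewrite /dl mulfVK// gt_eqF.
  nra.
have [M _ hM] : \forall m \near \oo, e m <= dl.
  by move/cvgrPdist_le: ecv => /(_ dl dl0); apply: filterS => m; rewrite sub0r normrN; apply: le_trans; exact: ler_norm.
have [jdS leS] := lim dl M M hM (leqnn M).
have jSS : rint mu S.
  have := rintB (jS M) jdS; apply: eq_integrable => // x _ /=; congr (_%:E); ring.
have [n0 h0] := app M.
have w1 : \int[mu]_x sm M n x @[n --> \oo] --> \int[mu]_x Sm M x.
  have := weak M _ bounded_test1.
  under eq_Rintegral do rewrite mul1r.
  by under eq_cvg do under eq_Rintegral do rewrite mul1r.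
have w2 : \forall n \near \oo, `|\int[mu]_x Sm M x - \int[mu]_x sm M n x| <= ep / 2.
  by move/cvgrPdist_le: w1; apply; rewrite divr_gt0.
near=> n.
have nn0 : (n0 <= n)%N by near: n; exact: nbhs_infty_ge.
have u1 : `|\int[mu]_x Sm M x - \int[mu]_x sm M n x| <= ep / 2 by near: n.
have u2 : `|\int[mu]_x Sm M x - \int[mu]_x S x| <= 2 * dl * C by exact: Rint_norm_sub_le.
have u3 : `|\int[mu]_x s n x - \int[mu]_x sm M n x| <= dl * C.
  apply: Rint_norm_sub_le => //.
  apply: (@le_trans _ _ (\int[mu]_x (e M * dom n x))).
    by apply: ae_le_Rint; [exact/rint_norm/rintB|exact: rintZl|exact: h0].
  rewrite RintegralZl//; apply: (@le_trans _ _ (e M * C)); first by rewrite ler_wpM2l.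
  by rewrite ler_wpM2r//; exact: (hM M (leqnn M)).
move: u1 u2 u3; set a := \int[mu]_x Sm M x; set b := \int[mu]_x sm M n x.
set cc := \int[mu]_x S x; set d0 := \int[mu]_x s n x => u1 u2 u3.
have -> : cc - d0 = - (a - cc) + (a - b) - (d0 - b) by ring.
apply: le_trans (ler_normB _ _) _; apply: le_trans (lerD (ler_normD _ _) (lexx _)) _.
rewrite normrN; lra.
Unshelve. all: by end_near. Qed.

End sign_test.

End weak_L1_limits.

(** * Pointwise limits and products of sequences of functions of time *)

Section time_sequences.
Variables (R : realType) (T : R).
Local Notation TR := (measurableTypeR R).
Local Notation leb := (lebR R).
Local Notation I0T := (`]0, T[%classic : set R).
Hypothesis T_gt0 : 0 < T.

Lemma measurable_I0T : measurable (I0T : set TR).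
Proof. exact: measurable_itv. Qed.

Lemma leb_itv_lty (a b : R) : (leb (`]a, b[%classic : set R) < +oo)%E.
Proof.
have h : (lebesgue_measure (`]a, b[%classic : set R) < +oo)%E.
  by rewrite lebesgue_measure_itv/=; case: ifP => // _; rewrite -EFinD ltry.
exact: h.
Qed.

Lemma rint_itv (a b : R) : rint leb (\1_(`]a, b[%classic : set R) : TR -> R).
Proof. exact: integrable_indic_itv. Qed.

Lemma Rint_itv (a b : R) : a <= b -> \int[leb]_t (\1_(`]a, b[%classic : set R) t : R) = b - a.
Proof.
rewrite le_eqVlt => /orP[/eqP ->|ab].
  rewrite subrr (_ : \1__ = fun=> 0); first by rewrite Rintegral_cst// mul0r.
  by apply/funext => t; rewrite set_itvoo0 indic0.
have lI : lebesgue_measure (`]a, b[%classic : set R) = (b - a)%:E.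
  by rewrite lebesgue_measure_itv/= lte_fin ab -EFinD.
by rewrite /Rintegral integral_indic// setIT; exact: (congr1 fine lI).
Qed.

Lemma near_approx_cvg (u : nat -> R) :
  (forall e, 0 < e -> exists x, \forall n \near \oo, `|u n - x| <= e) -> cvgn u.
Proof.
move=> h; apply: cauchy_cvg; apply: cauchy_exP => e e0.
have e2 : 0 < e / 2 by rewrite divr_gt0.
have [x hx] := h _ e2; exists x; apply: filterS hx => n; rewrite /ball /= distrC => /le_lt_trans; apply.
by rewrite ltr_pdivrMr// ltr_pMr// ltr1n.
Qed.

Lemma weak_scale (g : nat -> TR -> R) (h : TR -> R) :
  (forall n, rint leb (g n)) -> rint leb h ->
  (forall eta, bounded_test eta ->
    \int[leb]_t (eta t * g n t) @[n --> \oo] --> \int[leb]_t (eta t * h t)) ->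
  forall (eta : TR -> R) K, measurable_fun setT eta -> (forall t, `|eta t| <= K) ->
    \int[leb]_t (eta t * g n t) @[n --> \oo] --> \int[leb]_t (eta t * h t).
Proof.
move=> jg jh w eta K me eK.
have K0 : 0 <= K by apply: le_trans (eK 0).
have K1 : 0 < K + 1 by rewrite ltr_wpDl.
pose eta' t := (K + 1)^-1 * eta t.
have te : bounded_test eta'.
  split; first exact: measurable_funM.
  move=> t; rewrite normrM gtr0_norm ?invr_gt0// ler_pdivrMl// mulr1.
  by apply: le_trans (eK t) _; rewrite lerDl.
have e (f : TR -> R) : rint leb f -> \int[leb]_t (eta t * f t) = (K + 1) * \int[leb]_t (eta' t * f t).
  move=> jf; rewrite -RintegralZl//; last by case: (rint_bounded_mul te jf).
  by apply: eq_Rintegral => t _; rewrite /eta' mulrA mulVKf// gt_eqF.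
rewrite e//; under eq_cvg do rewrite e//.
by apply: cvgM; [exact: cvg_cst|exact: w].
Qed.

Section pointwise_limit.
Variables (u : nat -> TR -> R) (a : TR -> R) (A : R).
Hypotheses (ju : forall n, rint leb (u n)) (uA : forall n t, `|u n t| <= A).
Hypothesis u0 : forall n t, t \notin `]0, T[ -> u n t = 0.
Hypothesis equi : forall e, 0 < e -> exists2 dl, 0 < dl & forall n t1 t2,
  t1 \in `]0, T[ -> t2 \in `]0, T[ -> `|t2 - t1| <= dl -> `|u n t2 - u n t1| <= e.
Hypotheses (ma : measurable_fun setT a) (a0 : forall t, t \notin `]0, T[ -> a t = 0).
Hypothesis weak : forall eta, bounded_test eta ->
  \int[leb]_t (eta t * u n t) @[n --> \oo] --> \int[leb]_t (eta t * a t).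

Let A_ge0 : 0 <= A.
Proof. exact: le_trans (uA 0 0). Qed.

(** [u n t] is uniformly close to its average over a short interval to the right of [t], and these
    averages converge because the indicator of the interval is a bounded test. *)
Lemma cvg_of_equicontinuity t : cvgn (fun n => u n t).
Proof.
have [tI|tI] := boolP (t \in `]0, T[); last first.
  by apply/cvg_ex; exists 0; apply: cvg_near_cst; apply: nearW => n; exact: u0.
apply: near_approx_cvg => e e0.
have e2 : 0 < e / 2 by rewrite divr_gt0.
have [dl dl0 hdl] := equi e2.
have tT : t < T by move: tI; rewrite in_itv/= => /andP[].
have t0 : 0 < t by move: tI; rewrite in_itv/= => /andP[].
(* Short enough for equicontinuity, and such that the interval from t to t + r stays inside ]0,
   T[. *)
pose r := Num.min dl (T - t).
have r0 : 0 < r by rewrite lt_min dl0 subr_gt0.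
pose J : set R := `]t, (t + r)%R[%classic.
have te : bounded_test (\1_J : TR -> R).
  split; first exact: rint_measurable (rint_itv _ _).
  by move=> s; rewrite indicE ger0_norm// lern1; case: (_ \in _).
pose x := r^-1 * \int[leb]_s (\1_J s * a s); exists x.
have avg n : `|u n t - r^-1 * \int[leb]_s (\1_J s * u n s)| <= e / 2.
  have jm := (rint_bounded_mul te (ju n)).1.
  have jc : rint leb (fun s => u n t * (\1_J s : R)) by apply: rintZl; exact: rint_itv.
  have -> : u n t - r^-1 * \int[leb]_s (\1_J s * u n s) =
      r^-1 * \int[leb]_s (u n t * \1_J s - \1_J s * u n s).
    rewrite RintegralB// RintegralZl//; last exact: rint_itv.
    rewrite Rint_itv ?lerDl ?ltW// (_ : t + r - t = r); last by ring.
    by field; rewrite gt_eqF.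
  rewrite normrM gtr0_norm ?invr_gt0// ler_pdivrMl//.
  apply: le_trans (le_normr_Rintegral measurableT (rintB jc jm)) _.
  apply: (@le_trans _ _ (\int[leb]_s (e / 2 * \1_J s))); last first.
    rewrite RintegralZl//; last exact: rint_itv.
    have tr : t + r - t = r by ring.
    by rewrite Rint_itv ?lerDl ?(ltW r0)// tr mulrC.
  apply: le_Rint; [exact/rint_norm/rintB|by apply: rintZl; exact: rint_itv|] => s.
  rewrite indicE; have [sJ|sJ] := boolP (s \in J); last by rewrite !(mulr0, mul0r) subrr normr0.
  rewrite !(mulr1, mul1r) distrC; move: sJ; rewrite inE /J /= in_itv/= => /andP[ts sr].
  apply: hdl => //.
    rewrite in_itv/= (lt_trans t0)//=; apply: lt_le_trans sr _.
    by rewrite -lerBrDl ge_min lexx orbT.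
  have rd : r <= dl by rewrite ge_min lexx.
  by rewrite ger0_norm ?subr_ge0 ?(ltW ts)//; lra.
have c : r^-1 * \int[leb]_s (\1_J s * u n s) @[n --> \oo] --> x.
  by apply: cvgM; [exact: cvg_cst|exact: weak].
move/cvgrPdist_le: c => /(_ _ e2); apply: filterS => n hn.
rewrite (_ : u n t - x = (u n t - r^-1 * \int[leb]_s (\1_J s * u n s)) - (x - r^-1 * \int[leb]_s (\1_J s * u n s))); last by ring.
apply: le_trans (ler_normB _ _) _; rewrite [leRHS](_ : e = e / 2 + e / 2); last by field.
exact: lerD.
Qed.

(** By dominated convergence the pointwise limit is also a weak limit, so it agrees a.e. with [a],
    of which only measurability was known. *)
Lemma weak_limit_pointwise : exists ah : TR -> R,
  [/\ measurable_fun setT ah, forall t, `|ah t| <= A, forall t, t \notin `]0, T[ -> ah t = 0,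
      forall t, u n t @[n --> \oo] --> ah t & rint leb a /\ {ae leb, forall t, a t = ah t}].
Proof.
pose ah t := limn (fun n => u n t).
have c t : u n t @[n --> \oo] --> ah t by exact: cvg_of_equicontinuity.
have mu_ n := rint_measurable (ju n).
have mah : measurable_fun setT ah by apply: (@measurable_fun_cvg _ _ _ setT u) => // t _; exact: c.
have ahA t : `|ah t| <= A.
  have cn : `|u n t| @[n --> \oo] --> `|ah t| by apply: cvg_norm; exact: c.
  exact: (cvg_le_ub cn).
have ah0 t : t \notin `]0, T[ -> ah t = 0.
  move=> tI; apply/cvg_lim => //; apply: cvg_near_cst; apply: nearW => n; exact: u0.
have I01 t : t \in `]0, T[ -> (\1_I0T t : R) = 1 by move=> tI; rewrite indicE mem_set.
have uI n t : `|u n t| <= A * \1_I0T t.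
  have [tI|tI] := boolP (t \in `]0, T[); first by rewrite I01// mulr1.
  by rewrite u0// normr0 mulr_ge0// indicE.
have ahI t : `|ah t| <= A * \1_I0T t.
  have [tI|tI] := boolP (t \in `]0, T[); first by rewrite I01// mulr1.
  by rewrite ah0// normr0 mulr_ge0// indicE.
have jI : rint leb (fun t => A * (\1_I0T t : R)) by apply: rintZl; exact: rint_itv.
have jah : rint leb ah by apply: (le_rint mah jI).
have cah eta : bounded_test eta -> \int[leb]_t (eta t * u n t) @[n --> \oo] --> \int[leb]_t (eta t * ah t).
  move=> [me e1].
  have [] // := @Rint_dominated_cvg _ TR R leb (fun n t => eta t * u n t) (fun t => eta t * ah t) (fun t => A * \1_I0T t).
  - by move=> n; exact: measurable_funM.
  - exact: measurable_funM.
  - by apply: nearW => t; apply: cvgM; [exact: cvg_cst|exact: c].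
  - by apply: nearW => t n; rewrite normrM; apply: le_trans (uI n t); rewrite ler_piMl.
have nI t : ~ I0T t -> t \notin `]0, T[ by move=> h; apply/negP.
have [ja _] := weak_limit_L1 measurable_I0T (leb_itv_lty 0 T) ma (fun t h => a0 (nI t h)) ju
  (fun n => le_Rint (rint_norm (ju n)) jI (uI n)) weak.
have eq eta : bounded_test eta -> \int[leb]_t (eta t * a t) = \int[leb]_t (eta t * ah t).
  by move=> te; apply: (cvg_unique _ (weak te) (cah _ te)).
(* The zero sequence converges weakly to [a - ah], so the L^1 bound inherited by weak limits is
   0. *)
have [jd le0] : rint leb (fun t => a t - ah t) /\ \int[leb]_t `|a t - ah t| <= 0.
  apply: (@weak_limit_L1 _ TR R leb I0T measurable_I0T (leb_itv_lty 0 T) (fun _ _ => 0)).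
  - exact: measurable_funB.
  - by move=> t h; rewrite a0 ?ah0 ?subrr//; exact: nI.
  - by move=> _; exact: rint0.
  - by move=> _; rewrite normr0 Rintegral_cst// mul0r.
  - move=> eta te; apply: cvg_near_cst; apply: nearW => n.
    under eq_Rintegral do rewrite mulr0.
    rewrite Rintegral_cst// mul0r; apply/esym.
    have j1 := (rint_bounded_mul te ja).1; have j2 := (rint_bounded_mul te jah).1.
    transitivity (\int[leb]_t (eta t * a t) - \int[leb]_t (eta t * ah t)).
      by rewrite -RintegralB//; apply: eq_Rintegral => t _; rewrite mulrBr.
    by rewrite eq// subrr.
exists ah; split => //; split => //.
pose dif t := a t - ah t.
have mE : measurable_fun setT (EFin \o dif) by apply/measurable_EFinP; exact: measurable_funB.
have z : (\int[leb]_t `|(EFin \o dif) t| = 0)%E.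
  have -> : (\int[leb]_t `|(EFin \o dif) t| = (\int[leb]_t `|dif t|)%R%:E)%E.
    by rewrite Rint_EFin//; exact: rint_norm.
  by congr (_%:E); apply/eqP; rewrite eq_le le0/=; apply: Rintegral_ge0 => t _; exact: normr_ge0.
have := (ae_eq_integral_abs leb measurableT mE).1 z.
by apply: filterS => t /(_ I) [] /eqP; rewrite subr_eq0 => /eqP.
Qed.

End pointwise_limit.

(** Strong times weak convergence, although [b n] is not uniformly bounded: the term with [u n - ah]
    is split by the bound on [b n], its energy part being made small through [k], its mass part
    through the L^1 convergence of [u n]. *)
Lemma weak_product (u b kin : nat -> TR -> R) (ah bl be : TR -> R) (A K B M C : R) :
  (forall n, rint leb (u n)) -> (forall n t, `|u n t| <= A) ->
  (forall n t, t \notin `]0, T[ -> u n t = 0) ->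
  measurable_fun setT ah -> (forall t, `|ah t| <= A) -> (forall t, t \notin `]0, T[ -> ah t = 0) ->
  (forall t, u n t @[n --> \oo] --> ah t) ->
  (forall n, rint leb (b n)) -> rint leb bl ->
  (forall n, rint leb (kin n)) -> (forall n t, 0 <= kin n t) -> (forall n, \int[leb]_t kin n t <= C) ->
  0 <= B -> 0 <= M ->
  (forall n k, 0 < k -> {ae leb, forall t, `|b n t| <= B * (k * kin n t + k^-1 * M)}) ->
  (forall eta, bounded_test eta ->
    \int[leb]_t (eta t * b n t) @[n --> \oo] --> \int[leb]_t (eta t * bl t)) ->
  measurable_fun setT be -> (forall t, `|be t| <= K) ->
  [/\ forall n, rint leb (fun t => be t * (u n t * b n t)),
      rint leb (fun t => be t * (ah t * bl t)) &
  \int[leb]_t (be t * (u n t * b n t)) @[n --> \oo] --> \int[leb]_t (be t * (ah t * bl t))].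
Proof.
move=> ju uA u0 mah ahA ah0 c jb jbl jk k0 kC B0 M0 bk weak mbe beK.
have A0 : 0 <= A by exact: le_trans (uA 0 0).
have K0 : 0 <= K by exact: le_trans (beK 0).
have mu_ n := rint_measurable (ju n).
have bound (g v : TR -> R) : rint leb v -> measurable_fun setT g -> (forall t, `|g t| <= A) ->
    rint leb (fun t => be t * (g t * v t)).
  move=> jv mg gA; apply: (le_rint (g := fun t => K * A * `|v t|)).
  - by do 2 apply: measurable_funM => //; exact: rint_measurable jv.
  - by apply: rintZl; exact: rint_norm.
  - by move=> t; rewrite !normrM mulrA ler_wpM2r// ler_pM.
have j1 n : rint leb (fun t => be t * (u n t * b n t)) by exact: bound.
have j2 n : rint leb (fun t => be t * (ah t * b n t)) by exact: bound.
have j3 : rint leb (fun t => be t * (ah t * bl t)) by exact: bound.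
split => //.
have w : \int[leb]_t (be t * (ah t * b n t)) @[n --> \oo] --> \int[leb]_t (be t * (ah t * bl t)).
  have h := @weak_scale b bl jb jbl weak (fun t => be t * ah t) (K * A).
  under [X in _ --> X]eq_Rintegral do rewrite mulrA.
  rewrite (_ : (fun n => _) = (fun n => \int[leb]_t (be t * ah t * b n t))); last first.
    by apply/funext => n; apply: eq_Rintegral => t _; rewrite mulrA.
  by apply: h; [exact: measurable_funM|move=> t; rewrite normrM ler_pM].
have dc : \int[leb]_t `|u n t - ah t| @[n --> \oo] --> 0.
  have c0 : {ae leb, forall t, `|u n t - ah t| @[n --> \oo] --> (0 : R)}.
    apply: nearW => t; have h : (u n t - ah t) @[n --> \oo] --> ah t - ah t.
      by apply: cvgB; [exact: c|exact: cvg_cst].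
    rewrite subrr in h.
    exact/norm_cvg0P.
  have dom : {ae leb, forall t n, `| `|u n t - ah t| | <= 2 * A * \1_I0T t}.
    apply: nearW => t n; rewrite normr_id; have [tI|tI] := boolP (t \in `]0, T[); last first.
      by rewrite u0// ah0// subrr normr0 mulr_ge0 ?mulr_ge0// indicE.
    rewrite indicE mem_set// mulr1; apply: le_trans (ler_normB _ _) _.
    by rewrite mulr_natl mulr2n lerD.
  have md n : measurable_fun setT (fun t => `|u n t - ah t|).
    by apply: measurableT_comp => //; exact: measurable_funB.
  have [_] := @Rint_dominated_cvg _ TR R leb _ (fun=> 0) _ md (measurable_cst _) c0
    (rintZl (2 * A) (rint_itv 0 T)) dom.
  by rewrite Rintegral_cst// mul0r.
apply/cvgrPdist_le => e e0.
have C0 : 0 <= C by apply: le_trans (kC 0%N); apply: Rintegral_ge0.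
pose Q := K * B.
have Q0 : 0 <= Q by rewrite mulr_ge0.
(* Makes the energy part Q 2A k C at most e / 3; once [k] is fixed, the mass part is the constant
   [P] times the integral of |u n - ah|. *)
pose k := e / 3 / (Q * (2 * A) * C + 1).
have q1 : 0 < Q * (2 * A) * C + 1 by rewrite ltr_wpDl// !mulr_ge0.
have kp : 0 < k by rewrite !divr_gt0.
have kl : Q * (2 * A) * C * k <= e / 3.
  have : k * (Q * (2 * A) * C + 1) = e / 3 by rewrite /k mulfVK// gt_eqF.
  by move=> <-; rewrite mulrC ler_pM2l// lerDl.
pose P := Q * (k^-1 * M).
have P0 : 0 <= P by rewrite !mulr_ge0// invr_ge0 ltW.
have P1 : 0 < P + 1 by rewrite ltr_wpDl.
have e3 : 0 < e / 3 by rewrite divr_gt0.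
have n1 : \forall n \near \oo, `|\int[leb]_t (be t * (ah t * bl t)) - \int[leb]_t (be t * (ah t * b n t))| <= e / 3.
  by move/cvgrPdist_le: w; exact.
have n2 : \forall n \near \oo, \int[leb]_t `|u n t - ah t| <= e / 3 / (P + 1).
  move/cvgrPdist_le: dc => /(_ (e / 3 / (P + 1)) (divr_gt0 e3 P1)); apply: filterS => n.
  by rewrite sub0r normrN; apply: le_trans; exact: ler_norm.
apply: filterS2 n1 n2 => n h1 h2.
have h3 : `|\int[leb]_t (be t * (u n t * b n t)) - \int[leb]_t (be t * (ah t * b n t))| <= e / 3 + e / 3.
  apply: Rint_norm_sub_le => //.
  have jua : rint leb (fun t => `|u n t - ah t|).
    apply: rint_norm; apply: rintB => //; apply: (le_rint mah (rintZl A (rint_itv 0 T))) => t.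
    have [tI|tI] := boolP (t \in `]0, T[); last by rewrite ah0// normr0 mulr_ge0// indicE.
    by rewrite indicE mem_set// mulr1.
  apply: (@le_trans _ _ (\int[leb]_t (Q * (2 * A) * k * kin n t + P * `|u n t - ah t|))).
    apply: ae_le_Rint; [exact/rint_norm/rintB|by apply: rintD; apply: rintZl|].
    apply: filterS (bk n k kp) => t bt.
    rewrite -mulrBr -mulrBl !normrM.
    set D := `|u n t - ah t|; have D0 : 0 <= D by exact: normr_ge0.
    have D2 : D <= 2 * A by apply: le_trans (ler_normB _ _) _; rewrite mulr_natl mulr2n lerD.
    apply: (@le_trans _ _ (K * (D * (B * (k * kin n t + k^-1 * M))))).
      apply: ler_pM => //; first by rewrite mulr_ge0.
      by rewrite ler_wpM2l.
    have -> : K * (D * (B * (k * kin n t + k^-1 * M))) = Q * k * kin n t * D + P * D by rewrite /P /Q; ring.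
    rewrite lerD2r (_ : Q * (2 * A) * k * kin n t = Q * k * kin n t * (2 * A)); last by ring.
    by rewrite ler_wpM2l//; apply: mulr_ge0 => //; apply: mulr_ge0 => //; exact: ltW.
  rewrite RintegralD//; [|exact: rintZl|exact: rintZl].
  rewrite !RintegralZl//; apply: lerD.
    apply: le_trans kl; rewrite [leRHS]mulrAC ler_wpM2l//.
    by apply: mulr_ge0; [apply: mulr_ge0 => //; exact: mulr_ge0|exact: ltW].
  apply: le_trans (ler_wpM2l P0 h2) _.
  by rewrite mulrA ler_pdivrMr// mulrC ler_pM2l// lerDl.
move: h1 h3; set x := \int[leb]_t (be t * (ah t * bl t)); set y := \int[leb]_t (be t * (ah t * b n t)).
set z := \int[leb]_t (be t * (u n t * b n t)) => h1 h3.
rewrite (_ : x - z = (x - y) - (z - y)); last by ring.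
apply: le_trans (ler_normB _ _) _; apply: le_trans (lerD h1 h3) _.
by rewrite [leRHS](_ : e = e / 3 + (e / 3 + e / 3)) ?lerD//; field.
Qed.

End time_sequences.

(** * Bochner spaces *)

Section finitely_valued.
Variable R : realType.
Local Notation TR := (measurableTypeR R).

Definition finitely_valued U (s : TR -> U) :=
  finite_set (range s) /\ forall u, measurable (s @^-1` [set u]).

Lemma finitely_valued_comb U1 U2 U3 (F : U1 -> U2 -> U3) (s1 : TR -> U1) (s2 : TR -> U2) :
  finitely_valued s1 -> finitely_valued s2 -> finitely_valued (fun t => F (s1 t) (s2 t)).
Proof.
move=> [f1 m1] [f2 m2]; split.
  apply: (@sub_finite_set _ _ ((fun p => F p.1 p.2) @` (range s1 `*` range s2))).
    move=> _ [t _ <-]; exists (s1 t, s2 t) => //=; split => /=; by exists t.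
  by apply: finite_image; exact: finite_setX.
move=> u.
rewrite (_ : _ @^-1` _ = \bigcup_(p in (range s1 `*` range s2) `&` [set p | F p.1 p.2 = u])
    (s1 @^-1` [set p.1] `&` s2 @^-1` [set p.2])).
  apply: fin_bigcup_measurable; last by move=> p _; exact: measurableI.
  by apply: sub_finite_set (finite_setX f1 f2); exact: subIsetl.
apply/seteqP; split => [t /= e|t [[a b] [_ /= e] [/= -> ->]]//].
exists (s1 t, s2 t) => //; split => //=; split => /=; by exists t.
Qed.

Lemma finitely_valued_cst U (u : U) : finitely_valued (fun _ : TR => u).
Proof.
split; first by apply: sub_finite_set (finite_set1 u) => _ [t _ <-].
move=> v; have [uv|uv] := pselect (u = v).
  by rewrite (_ : _ @^-1` _ = setT)//; apply/seteqP; split => // t _ /=.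
by rewrite (_ : _ @^-1` _ = set0)//; apply/seteqP; split => // t /= e.
Qed.

(** Rounding (q + K)(n + 1) down to an integer takes finitely many values because [q] is bounded. *)
Lemma finitely_valued_approx (q : TR -> R) K (n : nat) : measurable_fun setT q ->
  (forall t, `|q t| <= K) -> exists2 s : TR -> R, finitely_valued s &
    forall t, `|s t - q t| <= n.+1%:R^-1.
Proof.
move=> mq qK; pose r t := (q t + K) * n.+1%:R.
have r0 t : 0 <= r t.
  by rewrite mulr_ge0//; have := qK t; rewrite ler_norml => /andP[]; lra.
have mr : measurable_fun setT r by apply: measurable_funM => //; exact: measurable_funD.
pose k t := Num.truncn (r t).
have fk : finitely_valued k.
  split.
    apply: (@sub_finite_set _ _ `I_((Num.truncn (2 * K * n.+1%:R)).+1)); last exact: finite_II.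
    move=> _ [t _ <-] /=; rewrite ltnS; apply: le_truncn; rewrite ler_wpM2r//.
    by have := qK t; rewrite ler_norml => /andP[]; lra.
  move=> j; rewrite (_ : _ @^-1` _ = setT `&` r @^-1` `[j%:R, j.+1%:R[).
    by apply: mr => //; exact: measurable_itv.
  rewrite setTI; apply/seteqP; split => t /=; rewrite in_itv/=.
    by move=> <-; exact: truncn_itv.
  by move=> h; apply/eqP; rewrite truncn_eq.
exists (fun t => (k t)%:R / n.+1%:R - K).
  exact: (finitely_valued_comb (fun a (_ : unit) => a%:R / n.+1%:R - K) fk (finitely_valued_cst tt)).
move=> t; have /andP[h1 h2] := truncn_itv (r0 t).
have -> : (k t)%:R / n.+1%:R - K - q t = ((k t)%:R - r t) / n.+1%:R by rewrite /r; field.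
rewrite normrM [in X in _ * X]gtr0_norm ?invr_gt0// ler_piMl// ler_norml.
by rewrite -natr1 in h2; move: h1 h2; rewrite /k => *; lra.
Qed.

(** Measurability of [F u] is only asked for values that [s] takes: simple functions take values in
    C_0, but the ambient type contains arbitrary functions. *)
Lemma measurable_finitely_valued_eval d (Y : measurableType d) U (s : TR -> U) (F : U -> Y -> R) :
  finitely_valued s -> (forall u, measurable_fun setT (F u) \/ forall t, s t <> u) ->
  measurable_fun setT (fun p : TR * Y => F (s p.1) p.2).
Proof.
move=> [fs ms] mF _ B mB; rewrite setTI.
rewrite (_ : _ @^-1` _ = \bigcup_(u in range s) ((s @^-1` [set u]) `*` (F u @^-1` B))).
  apply: fin_bigcup_measurable => // u [t _ su].
  apply: measurableX; first exact: ms.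
  rewrite -[X in measurable X]setTI; case: (mF u) => [m|/(_ t)//].
  exact: m.
apply/seteqP; split => [[t y] /= h|[t y] [u _ [/= <- //]]].
by exists (s t) => //; exists t.
Qed.

End finitely_valued.

(** * Admissible test functions in the Bochner spaces *)

Section bochner_spaces.
Variables (R : realType) (N : nat) (T : R).
Hypothesis T_gt0 : 0 < T.
Local Notation E := 'rV[R]_N.
Local Notation TR := (measurableTypeR R).
Local Notation leb := (lebR R).
Local Notation I0T := (`]0, T[%classic : set R).
Local Notation supv := (fun G : E -> E => sup_norm (@enorm R N \o G)).

Lemma sup_norm_ub (g : E -> R) x : (`|g x|%:E <= sup_norm g)%E.
Proof. by apply: ereal_sup_ubound; exists x. Qed.

Lemma sup_norm_le (g : E -> R) (K : \bar R) : (forall x, (`|g x|%:E <= K)%E) -> (sup_norm g <= K)%E.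
Proof. by move=> h; apply: ge_ereal_sup => _ [x _ <-]. Qed.

Lemma sup_norm_ge0 (g : E -> R) : (0 <= sup_norm g)%E.
Proof. by apply: le_trans (sup_norm_ub g 0); rewrite lee_fin. Qed.

Lemma C0_bounded (W : normedModType R) (g : E -> W) : C0 g -> exists2 K : R, 0 <= K & forall x, `|g x| <= K.
Proof.
move=> [cg /(_ 1 ltr01)[K cK hK]].
have cn : {within K, continuous (fun x => `|g x|)}.
  apply: continuous_subspaceT => x.
  by apply: (@continuous_comp _ _ _ g (fun y : W => `|y|)); [exact: cg|exact: norm_continuous].
have [[a Ka]|nK] := pselect (K !=set0); last first.
  by exists 1 => // x; apply/ltW/hK => Kx; apply: nK; exists x.
have [c _ cmax] := compact_EVT_max (ex_intro _ a Ka) cK cn.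
exists (Num.max 1 `|g c|); first by rewrite le_max ler01.
move=> x; rewrite le_max; have [Kx|Kx] := pselect (K x).
  by rewrite cmax ?inE// orbT.
by rewrite ltW// hK.
Qed.

Lemma C0_of_support (g : E -> R) : continuous g -> (exists B : R, forall x, B < `|x| -> g x = 0) -> C0 g.
Proof.
move=> cg [B hB]; split => // e e0.
exists [set x : E | `|x| <= B].
  apply: bounded_closed_compact.
    by exists B; split; [exact: num_real|move=> M BM x /= xB; exact: le_trans xB (ltW BM)].
  rewrite (_ : [set x : E | _] = (fun x : E => `|x|) @^-1` [set r | r <= B]); last by [].
  by apply: preimage_closed; [move=> x _; exact: norm_continuous|exact: closed_le].
by move=> x /= /negP; rewrite -ltNge => xB; rewrite hB// normr0.
Qed.

Lemma finitely_valued_simple (X : set (E -> R)) (s : R -> E -> R) :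
  finitely_valued (s : TR -> E -> R) -> (forall t, X (s t)) -> simple_in X s.
Proof. by move=> [f m] x; split. Qed.

(** The simple approximations are jointly measurable and, outside a null set of times, converge
    uniformly in x; the function cut off on that set inherits the joint measurability. *)
Lemma bochner_null_set (G : R -> E -> E) :
  Lp_bochner T 1%:E [set G : E -> E | C0 G] supv G ->
  exists A0 : set TR, [/\ measurable A0, leb A0 = 0%E & forall i, measurable_fun setT (Ft T G A0 i)].
Proof.
move=> [_ [s [ss [A [mA A0 hA]]]] _]; exists A; split => // i.
have mI : measurable (I0T `\` A : set TR) by apply: measurableD => //; exact: measurable_itv.
have m1 : measurable_fun setT (fun p : TR * E => \1_(I0T `\` A : set TR) p.1 : R).
  by apply: measurableT_comp => //; exact: measurable_indic.
pose q n (p : TR * E) : R := s n p.1 p.2 0 i * \1_(I0T `\` A : set TR) p.1.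
apply: (@measurable_fun_cvg _ _ _ setT q).
  move=> n; apply: measurable_funM => //.
  have [fs Xs ms] := ss n.
  apply: (@measurable_finitely_valued_eval R _ _ _ (s n) (fun (u : E -> E) x => u x 0 i)) => //.
  move=> u; have [[t <-]|nu] := pselect (exists t, s n t = u); last by right => t e; apply: nu; exists t.
  left; apply: continuous_rV_measurable => x.
  have [c _] := Xs t.
  apply: (@continuous_comp _ _ _ (s n t) (fun y : E => y 0 i)); first exact: c.
  exact: continuous_coord.
move=> [t x] _; rewrite /q /Ft /= indicE.
have [tI|tI] := boolP (t \in I0T `\` A); last first.
  by rewrite mulr0; apply: cvg_near_cst; apply: nearW => n; rewrite mulr0.
rewrite mulr1; under eq_cvg do rewrite mulr1.
move: tI; rewrite inE => -[t0 tA].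
have c : supv (s n t - G t) @[n --> \oo] --> 0%E.
  by apply: contrapT => h; apply: tA; apply: hA => /= /(_ t0).
apply/cvgrPdist_le => e e0.
move/fine_cvgP: c => [fn /cvgrPdist_le /(_ e e0) hn].
apply: filterS2 fn hn => n fin; rewrite sub0r normrN => h.
rewrite distrC -lee_fin; apply: (@le_trans _ _ (supv (s n t - G t))).
  apply: le_trans (sup_norm_ub _ x).
  rewrite lee_fin /= (ger0_norm (enorm_ge0 _)).
  by have := coord_le_enorm ((s n t - G t) x) i; rewrite !mxE.
by rewrite -(fineK fin) lee_fin; apply: le_trans h; exact: ler_norm.
Qed.

Lemma Lnorm_lty (h : TR -> \bar R) (r K : R) : 0 < r -> 0 <= K ->
  (forall t, (`|h t| <= (K * \1_I0T t)%:E)%E) -> (Lnorm leb r%:E h < +oo)%E.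
Proof.
move=> r0 K0 hK; rewrite unlock; apply: poweR_lty.
apply: (@le_lt_trans _ _ (\int[leb]_t (K `^ r * \1_I0T t)%:E)%E).
  apply: ge0_le_integral_nonmeasurable => t; first exact: poweR_ge0.
  apply: (@le_trans _ _ ((K * \1_I0T t)%:E `^ r)%E).
    apply: gt0_ler_poweR => //; rewrite ?in_itv/= ?leey ?andbT ?abse_ge0 ?(ltW r0)//.
    by rewrite lee_fin mulr_ge0// indicE.
  rewrite poweR_EFin lee_fin indicE; case: (t \in I0T); rewrite ?mulr1// !mulr0.
  by rewrite powR0 ?gt_eqF.
have j : rint leb (fun t => K `^ r * (\1_I0T t : R)) by apply: rintZl; exact: rint_itv.
by rewrite -Rint_EFin// ltry.
Qed.

Lemma squeeze_sup_norm (u : nat -> \bar R) (K : R) : (forall n, (0 <= u n)%E) ->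
  (forall n, (u n <= (K * n.+1%:R^-1)%:E)%E) -> u n @[n --> \oo] --> 0%E.
Proof.
move=> u0 uK; apply: (@squeeze_cvge _ _ _ _ (fun=> 0%E) _ (fun n => (K * n.+1%:R^-1)%:E)).
- by apply: nearW => n; rewrite u0 uK.
- exact: cvg_cst.
- apply: cvg_EFin; first exact: nearW.
  rewrite -[X in _ --> X](mulr0 K); apply: cvgM; [exact: cvg_cst|exact: cvg_harmonic].
Qed.

(** These products of a bounded function of time and a C_0 function turn weak-* convergence into
    convergence of moments tested in time. The exponent is free because density and current use
    different ones. *)
Lemma scalar_test (r K : R) (be : TR -> R) (chi : E -> R) : 0 < r ->
  measurable_fun setT be -> (forall t, `|be t| <= K) -> C0 chi ->
  Lp_bochner T r%:E [set h : E -> R | C0 h] (@sup_norm R N) (fun t x => be t * chi x).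
Proof.
move=> r0 mbe beK Cchi.
have K0 : 0 <= K by apply: le_trans (beK 0).
have [B B0 hB] := C0_bounded Cchi.
have CC c : C0 (fun x => c * chi x).
  case: Cchi => cc hc; split; first exact: continuous_scale.
  move=> e e0; have [|D cD hD] := hc (e / (`|c| + 1)); first by rewrite divr_gt0// ltr_wpDl.
  exists D => // x Dx; rewrite normrM; have := hD x Dx.
  rewrite ltr_pdivlMr ?ltr_wpDl//; apply: le_lt_trans.
  by rewrite mulrC ler_wpM2l// lerDl.
split.
- by apply: nearW => t _; exact: CC.
- have ap n := finitely_valued_approx n mbe beK.
  pose s n := s2val (cid2 (ap n)); have fs n : finitely_valued (s n) := s2valP (cid2 (ap n)).
  have hs n t : `|s n t - be t| <= n.+1%:R^-1 := s2valP' (cid2 (ap n)) t.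
  exists (fun n t x => s n t * chi x); split.
    move=> n; apply: finitely_valued_simple => //.
    + have h := finitely_valued_comb (fun (a : R) (_ : unit) (x : E) => a * chi x) (fs n) (finitely_valued_cst R tt).
      exact: h.
    + by move=> t; exact: CC.
  apply: nearW => t _; apply: (@squeeze_sup_norm _ B) => n; first exact: sup_norm_ge0.
  apply: sup_norm_le => x; rewrite lee_fin.
  have -> : ((fun x => s n t * chi x) - (fun x => be t * chi x)) x = chi x * (s n t - be t).
    by transitivity (s n t * chi x - be t * chi x) => //; ring.
  by rewrite normrM ler_pM.
- rewrite /Lp_time_norm; apply: (@Lnorm_lty _ r (K * B)) => //; first exact: mulr_ge0.
  move=> t; rewrite patchE indicE; case: ifPn => tI; last by rewrite mulr0 abse0.
  rewrite mulr1 gee0_abs ?sup_norm_ge0//; apply: sup_norm_le => x.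
  by rewrite lee_fin normrM ler_pM.
Qed.

Lemma dot_le (u w : E) B : (forall i, `|w 0 i| <= B) -> `|dot u w| <= N%:R * B * `|u|.
Proof.
move=> wB; apply: le_trans (ler_norm_sum _ _ _) _.
have -> : N%:R * B * `|u| = \sum_(i < N) `|u| * B.
  by rewrite sumr_const card_ord -[RHS]mulr_natl; ring.
by apply: ler_sum => i _; rewrite normrM ler_pM// coord_le_norm.
Qed.

Lemma dot_le_enorm (u w : E) B : (forall i, `|w 0 i| <= B) -> 0 <= B -> `|dot u w| <= N%:R * B * enorm u.
Proof.
move=> wB B0; apply: le_trans (dot_le u wB) _.
by rewrite ler_wpM2l ?norm_le_enorm// mulr_ge0.
Qed.

Lemma C0_dot (u w : E -> E) B : C0 u -> (forall i, continuous (fun x => w x 0 i)) ->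
  (forall i x, `|w x 0 i| <= B) -> 0 <= B -> C0 (fun x => dot (u x) (w x)).
Proof.
move=> [cu hu] cw wB B0; split.
  apply: continuous_sumr => i; apply: continuous_mul => // x.
  apply: (@continuous_comp _ _ _ u (fun y : E => y 0 i)); first exact: cu.
  exact: continuous_coord.
move=> e e0; have NB0 : 0 <= N%:R * B by rewrite mulr_ge0.
have NB1 : 0 < N%:R * B + 1 by rewrite ltr_wpDl.
have [|K cK hK] := hu (e / (N%:R * B + 1)); first by rewrite divr_gt0.
exists K => // x Kx; apply: le_lt_trans (dot_le (u x) (fun i => wB i x)) _.
have := hK x Kx; rewrite ltr_pdivlMr//; apply: le_lt_trans.
by rewrite mulrC ler_wpM2l// lerDl.
Qed.

Section field_test.
Variables (phi : R -> E -> E) (B L : R).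
Hypotheses (B_ge0 : 0 <= B) (L_ge0 : 0 <= L) (phiB : forall i t x, `|phi t x 0 i| <= B)
  (phiL : forall i t s x, `|phi t x 0 i - phi s x 0 i| <= L * `|t - s|)
  (phic : forall i t, continuous (fun x => phi t x 0 i)).

(** The simple approximation is [s n t] paired with the field at a time rounded to finitely many
    values; the Lipschitz bound in time controls the rounding. *)
Lemma field_test (G : R -> E -> E) :
  Lp_bochner T 1%:E [set G : E -> E | C0 G] supv G ->
  Lp_bochner T 1%:E [set h : E -> R | C0 h] (@sup_norm R N) (fun t x => dot (G t x) (phi t x)).
Proof.
move=> [C0G [s [ss cs]] Glty]; have NB0 : 0 <= N%:R * B by rewrite mulr_ge0.
(* Time clamped to [0, T], hence bounded, and unchanged on ]0, T[. *)
pose q (t : TR) : R := Num.max 0 (Num.min t T).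
have mq : measurable_fun setT q.
  by apply: measurable_maxr => //; apply: measurable_minr.
have qT t : `|q t| <= T.
  rewrite ger0_norm; last by rewrite /q le_max lexx.
  by rewrite /q ge_max (ltW T_gt0) ge_min lexx orbT.
have qE (t : TR) : t \in `]0, T[ -> q t = t.
  rewrite in_itv/= => /andP[t0 tT]; rewrite /q (min_idPl (ltW tT)).
  by rewrite (max_idPr (ltW t0)).
have ap n := finitely_valued_approx n mq qT.
pose ta n := s2val (cid2 (ap n)); have fta n : finitely_valued (ta n) := s2valP (cid2 (ap n)).
have hta n t : `|ta n t - q t| <= n.+1%:R^-1 := s2valP' (cid2 (ap n)) t.
have CC n r t : C0 (fun x => dot (s n t x) (phi r x)).
  have [_ Xs _] := ss n.
  by apply: (@C0_dot _ _ B) => //; exact: Xs.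
split.
- apply: (@filterS TR _ _ _ _ _ C0G) => t h tI.
  by apply: (@C0_dot _ _ B) => //; exact: h.
- exists (fun n t x => dot (s n t x) (phi (ta n t) x)); split.
    move=> n; apply: finitely_valued_simple => [|t]; last exact: CC.
    have [fs Xs ms] := ss n.
    have h := finitely_valued_comb (fun (u : E -> E) (r : R) (x : E) => dot (u x) (phi r x))
      (conj fs ms) (fta n).
    exact: h.
  apply: (@filterS2 TR _ _ _ _ _ _ C0G cs) => t C0t ct tI.
  have [KG KG0 hKG] := C0_bounded (C0t tI).
  have /fine_cvgP[fn cf] := ct tI.
  pose ub n : R := N%:R * B * fine (supv (s n t - G t)) + N%:R * KG * L * n.+1%:R^-1.
  have cub : (ub n)%:E @[n --> \oo] --> 0%E.
    apply: cvg_EFin; first exact: nearW.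
    have -> : (0 : R) = N%:R * B * 0 + N%:R * KG * L * 0 by rewrite !mulr0 addr0.
    apply: cvgD; apply: cvgM; [exact: cvg_cst|exact: cf|exact: cvg_cst|exact: cvg_harmonic].
  apply: (@squeeze_cvge _ _ _ _ (fun=> 0%E) _ (fun n => (ub n)%:E)) => //; last exact: cvg_cst.
  apply: filterS fn => n fin; rewrite sup_norm_ge0/=; apply: sup_norm_le => x.
  rewrite lee_fin.
  have -> : ((fun x => dot (s n t x) (phi (ta n t) x)) - (fun x => dot (G t x) (phi t x))) x =
      dot ((s n t - G t) x) (phi (ta n t) x) + dot (phi (ta n t) x - phi t x) (G t x).
    transitivity (dot (s n t x) (phi (ta n t) x) - dot (G t x) (phi t x)) => //.
    by rewrite /dot -sumrB -big_split/=; apply: eq_bigr => i _; rewrite !mxE; ring.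
  apply: le_trans (ler_normD _ _) _; apply: lerD.
    apply: le_trans (dot_le_enorm _ (fun i => phiB i _ _) B_ge0) _.
    rewrite ler_wpM2l// -lee_fin (fineK fin); apply: le_trans (sup_norm_ub _ x).
    by rewrite lee_fin /= ger0_norm ?enorm_ge0.
  apply: le_trans (dot_le _ (fun i => le_trans (coord_le_norm _ i) (hKG x))) _.
  rewrite -[leRHS]mulrA ler_wpM2l ?mulr_ge0//.
  rewrite [leLHS]mx_normrE; apply: bigmax_le => [|[a i] _ /=].
    by rewrite mulr_ge0// invr_ge0.
  rewrite (ord1 a) !mxE; apply: le_trans (phiL _ _ _ _) _.
  by rewrite ler_wpM2l//; have := hta n t; rewrite qE.
- move: Glty; rewrite /Lp_time_norm !Lnorm1 => Glty.
  pose g (t : TR) := (`|((supv \o G) \_ I0T) t|)%E.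
  apply: (@le_lt_trans _ _ (\int[leb]_t ((N%:R * B)%:E * g t))%E).
    apply: ge0_le_integral_nonmeasurable => t; first exact: abse_ge0.
    rewrite /g !patchE; case: ifPn => tI; last by rewrite !abse0 mule0.
    rewrite !gee0_abs ?sup_norm_ge0//; apply: sup_norm_le => x.
    apply: le_trans (_ : (N%:R * B * enorm (G t x))%:E <= _)%E.
      by rewrite lee_fin; exact: dot_le_enorm.
    rewrite EFinM lee_wpmul2l ?lee_fin//; apply: le_trans (sup_norm_ub _ x).
    by rewrite lee_fin /= ger0_norm ?enorm_ge0.
  have g0 t : (0 <= g t)%E by exact: abse_ge0.
  apply: le_lt_trans (lower_integralZl leb g0 NB0) _.
  by apply: lte_mul_pinfty => //; rewrite lee_fin.
Qed.

End field_test.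

End bochner_spaces.

(** * Integration against charges *)

Section finite_measures.
Context d (X : measurableType d) (R : realType).

Lemma rint_bounded (m : {finite_measure set X -> \bar R}) (g : X -> R) K :
  measurable_fun setT g -> (forall x, `|g x| <= K) -> rint m g.
Proof.
move=> mg gK; apply: (le_rint (g := fun=> K)) => //.
have [->|K0] := eqVneq K 0; first exact: rint0.
apply/integrableP; split; first exact/measurable_EFinP.
under eq_integral do rewrite /=.
by rewrite integral_cst//= lte_mul_pinfty// fin_num_fun_lty.
Qed.

Lemma cintZ (nu : {charge set X -> \bar R}) (g : X -> R) K c :
  measurable_fun setT g -> (forall x, `|g x| <= K) -> cint nu (fun x => c * g x) = c * cint nu g.
Proof.
by move=> mg gK; rewrite /cint !RintegralZl ?mulrBr//; exact: rint_bounded gK.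
Qed.

Section products.
Variables (m1 m2 : {finite_measure set X -> \bar R}).

Lemma rint_prod_bounded (h : X * X -> R) K : measurable_fun setT h -> (forall z, `|h z| <= K) ->
  rint (m1 \x m2)%E h.
Proof.
move=> mh hK; apply: (rint_prod_le (g := fun=> K * fine (m2 setT))) => //.
  exact: (@rint_bounded m1 _ `|K * fine (m2 setT)|).
apply: nearW => x; apply: (@le_trans _ _ (\int[m2]_y K%:E)%E).
  apply: ge0_le_integral => //.
  - have mx : measurable_fun setT (fun y => h (x, y)).
      by apply: (measurableT_comp mh); exact: pair1_measurable.
    by apply/measurable_EFinP; exact: measurableT_comp.
  - by move=> y _; rewrite lee_fin.
by rewrite integral_cst// EFinM fineK//; exact: fin_num_measure.
Qed.

Lemma Rint_prod_dominated_cvg (h : nat -> X * X -> R) (g : X * X -> R) K :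
  (forall n, measurable_fun setT (h n)) -> (forall n z, `|h n z| <= K) ->
  (forall z, h n z @[n --> \oo] --> g z) ->
  \int[(m1 \x m2)%E]_z h n z @[n --> \oo] --> \int[(m1 \x m2)%E]_z g z.
Proof.
move=> mh hK hg.
have mg : measurable_fun setT g by apply: (@measurable_fun_cvg _ _ _ setT h) => // z _; exact: hg.
have jK : rint (m1 \x m2)%E (fun=> K) by exact: (@rint_prod_bounded _ `|K|).
have [] // := @Rint_dominated_cvg _ _ R (m1 \x m2)%E h g (fun=> K) mh mg.
- exact: nearW.
- by apply: nearW => z n.
Qed.

Lemma Rint_prod_tensor (I : finType) (chi : I -> X -> R) (c : I -> I -> R) K :
  (forall k, measurable_fun setT (chi k)) -> (forall k x, `|chi k x| <= K) ->
  \int[(m1 \x m2)%E]_z (\sum_(k : I) \sum_(l : I) c k l * (chi k z.1 * chi l z.2)) =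
  \sum_(k : I) \sum_(l : I) c k l * (\int[m1]_x chi k x * \int[m2]_x chi l x).
Proof.
move=> mchi chiK.
have j1 k : rint m1 (chi k) by exact: rint_bounded (chiK k).
have j2 k : rint m2 (chi k) by exact: rint_bounded (chiK k).
have jkl k l : rint (m1 \x m2)%E (fun z => chi k z.1 * chi l z.2) by exact: rint_mul_prod.
have jc k l : rint (m1 \x m2)%E (fun z => c k l * (chi k z.1 * chi l z.2)) by exact: rintZl.
have js k : rint (m1 \x m2)%E (fun z => \sum_(l : I) c k l * (chi k z.1 * chi l z.2)).
  exact: rint_sum.
rewrite (Rint_sum _ _ js); apply: eq_bigr => k _.
rewrite (Rint_sum _ _ (jc k)); apply: eq_bigr => l _.
rewrite RintegralZl//; congr (_ * _).
have [_ <-] := rint_fubini1 (jkl k l).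
by under eq_Rintegral do rewrite /= RintegralZl//; rewrite RintegralZr.
Qed.

End products.

Lemma cint_prod_dominated_cvg (mu nu : {charge set X -> \bar R}) (h : nat -> X * X -> R) (g : X * X -> R) K :
  (forall n, measurable_fun setT (h n)) -> (forall n z, `|h n z| <= K) ->
  (forall z, h n z @[n --> \oo] --> g z) ->
  cint_prod mu nu (h n) @[n --> \oo] --> cint_prod mu nu g.
Proof.
by move=> mh hK hg; apply: cvgD; [apply: cvgB; [apply: cvgB|]|];
  exact: Rint_prod_dominated_cvg hg.
Qed.

Lemma cint_prod_tensor (mu nu : {charge set X -> \bar R}) (I : finType) (chi : I -> X -> R) (c : I -> I -> R) K :
  (forall k, measurable_fun setT (chi k)) -> (forall k x, `|chi k x| <= K) ->
  cint_prod mu nu (fun z => \sum_(k : I) \sum_(l : I) c k l * (chi k z.1 * chi l z.2)) =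
  \sum_(k : I) \sum_(l : I) c k l * (cint mu (chi k) * cint nu (chi l)).
Proof.
move=> mchi chiK; rewrite /cint_prod !(Rint_prod_tensor _ _ _ mchi chiK).
rewrite -!sumrB -big_split/=; apply: eq_bigr => k _.
rewrite -!sumrB -big_split/=; apply: eq_bigr => l _.
by rewrite /cint; ring.
Qed.

End finite_measures.

Lemma cvg_sum_seq (R : realType) (I : Type) (r : seq I) (u : I -> nat -> R) (l : I -> R) :
  (forall i, u i n @[n --> \oo] --> l i) ->
  \sum_(i <- r) u i n @[n --> \oo] --> \sum_(i <- r) l i.
Proof. by move=> ul; apply: cvg_big => //; exact: add_continuous. Qed.

Lemma cvgB_seq (R : realType) (u v : nat -> R) (a b : R) :
  u n @[n --> \oo] --> a -> v n @[n --> \oo] --> b -> u n - v n @[n --> \oo] --> a - b.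
Proof. exact: cvgB. Qed.

(** * Passage to the limit *)

Section limits.
Variables (R : realType) (N : nat) (lam T : R) (eps : nat -> R).
Local Notation E := 'rV[R]_N.
Local Notation TR := (measurableTypeR R).
Local Notation leb := (lebR R).
Local Notation lebN := (lebesgue_rV R N).
Local Notation I0T := (`]0, T[%classic : set R).
Variables (f : nat -> R -> E -> E -> R) (M C : R).
Variables (rho : R -> {charge set E -> \bar R}) (j : R -> 'I_N -> {charge set E -> \bar R}).
Hypotheses (N_gt0 : (0 < N)%N) (T_gt0 : 0 < T) (lam_gt0 : 0 < lam) (lam_le : lam <= 2^-1).
Hypotheses (eps_gt0 : forall n, 0 < eps n) (eps_cvg0 : eps n @[n --> \oo] --> 0).
Hypotheses (M_ge0 : 0 <= M) (C_ge0 : 0 <= C).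
Hypothesis KE : forall n, kinetic_estimates lam T (eps n) (f n) M C.
Hypothesis rhoP : Lq_measures T +oo%E rho.
Hypothesis jP : forall i, Lq_measures T 2%:E (fun t => j t i).
Hypothesis rho_cvg : weak_star_cvg T 1%:E (fun n => density (f n)) rho.
Hypothesis j_cvg : forall i, weak_star_cvg T 2%:E
  (fun n t x => current (f n) t x 0 i) (fun t => j t i).

(** Neither function has to be measurable: changing an integrand on a null set does not affect the
    lower integrals of its positive and negative parts. *)
Lemma Rint_restrict (F G : TR -> R) :
  {ae leb, forall t : TR, t \in `]0, T[ -> F t = G t} -> (forall t : TR, t \notin `]0, T[ -> G t = 0) ->
  \int[@lebesgue_measure R]_(t in `]0, T[) F t = \int[leb]_t G t.
Proof.
move=> FG G0; transitivity (fine (\int[leb]_t ((EFin \o F) \_ I0T) t)%E).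
  by rewrite /Rintegral integral_mkcond.
rewrite /Rintegral; congr fine; apply: ae_eq_integral_nonmeasurable.
apply: filterS FG => t FGt; rewrite patchE; case: ifPn => tI.
  by rewrite /= FGt//; move: tI; rewrite inE.
by rewrite G0//; apply/negP => tI'; move/negP: tI; apply; rewrite inE.
Qed.

Lemma Amom_out n chi (t : TR) : t \notin `]0, T[ -> Amom T (f n) chi t = 0.
Proof. by move=> tI; case: (ke_out (KE n) tI chi (Ordinal N_gt0) (fun _ _ => 0)). Qed.

Lemma Bmom_out n chi i (t : TR) : t \notin `]0, T[ -> Bmom T (f n) chi i t = 0.
Proof. by move=> tI; case: (ke_out (KE n) tI chi i (fun _ _ => 0)). Qed.

Lemma flux_out n h (t : TR) : t \notin `]0, T[ -> flux T (f n) h t = 0.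
Proof. by move=> tI; case: (ke_out (KE n) tI (fun=> 0) (Ordinal N_gt0) h). Qed.

(** Extended by 0 outside ]0, T[, like [Amom] and [Bmom], so that all weak convergences are between
    functions on the whole line. *)
Definition rhoC (chi : E -> R) (t : TR) : R := ((fun t => cint (rho t) chi) \_ I0T) t.
Definition jC (chi : E -> R) i (t : TR) : R := ((fun t => cint (j t i) chi) \_ I0T) t.

Lemma restrictE (F : R -> R) t : t \in `]0, T[ -> (F \_ I0T) t = F t.
Proof. by move=> tI; rewrite patchE mem_set. Qed.

Lemma restrict0 (F : R -> R) t : t \notin `]0, T[ -> (F \_ I0T) t = 0.
Proof. by move=> tI; rewrite patchE memNset//; apply/negP. Qed.

Lemma measurable_rhoC chi : C0 chi -> measurable_fun setT (rhoC chi).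
Proof.
move=> Cchi; have [m _] := rhoP.
by apply/(measurable_restrictT _ _).1; [exact: measurable_itv|exact: m].
Qed.

Lemma measurable_jC chi i : C0 chi -> measurable_fun setT (jC chi i).
Proof.
move=> Cchi; have [m _] := jP i.
by apply/(measurable_restrictT _ _).1; [exact: measurable_itv|exact: m].
Qed.

Lemma weak_density chi eta : C0 chi -> bounded_test eta ->
  \int[leb]_t (eta t * Amom T (f n) chi t) @[n --> \oo] --> \int[leb]_t (eta t * rhoC chi t).
Proof.
move=> Cchi [me e1]; have [K K0 hK] := C0_bounded Cchi.
have mchi : measurable_fun setT chi by case: Cchi => c _; exact: continuous_rV_measurable.
have mc c : measurable_fun setT (fun x => c * chi x) by exact: measurable_funM.
have hc c x : `|c * chi x| <= `|c| * K by rewrite normrM ler_wpM2l.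
have := rho_cvg (scalar_test T ltr01 me e1 Cchi).
have -> : \int[@lebesgue_measure R]_(t in `]0, T[) cint (rho t) (fun x => eta t * chi x) =
    \int[leb]_t (eta t * rhoC chi t).
  apply: Rint_restrict => [|t tI]; last by rewrite /rhoC restrict0// mulr0.
  by apply: nearW => t tI; rewrite (cintZ _ _ mchi hK) /rhoC restrictE.
have -> : (fun n => \int[@lebesgue_measure R]_(t in `]0, T[) \int[lebN]_x (density (f n) t x * (eta t * chi x))) =
    (fun n => \int[leb]_t (eta t * Amom T (f n) chi t)).
  apply/funext => n; apply: Rint_restrict => [|t tI]; last first.
    by rewrite Amom_out// mulr0.
  apply: nearW => t tI; rewrite (ke_density (KE n) (mc (eta t)) (hc (eta t)) tI).
  exact: (ke_AmomZ (KE n) mchi hK).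
exact.
Qed.

Lemma weak_current chi i eta : C0 chi -> bounded_test eta ->
  \int[leb]_t (eta t * Bmom T (f n) chi i t) @[n --> \oo] --> \int[leb]_t (eta t * jC chi i t).
Proof.
move=> Cchi [me e1]; have [K K0 hK] := C0_bounded Cchi.
have mchi : measurable_fun setT chi by case: Cchi => c _; exact: continuous_rV_measurable.
have mc c : measurable_fun setT (fun x => c * chi x) by exact: measurable_funM.
have hc c x : `|c * chi x| <= `|c| * K by rewrite normrM ler_wpM2l.
have := @j_cvg i _ (scalar_test T (ltr0Sn R 1) me e1 Cchi).
have -> : \int[@lebesgue_measure R]_(t in `]0, T[) cint (j t i) (fun x => eta t * chi x) =
    \int[leb]_t (eta t * jC chi i t).
  apply: Rint_restrict => [|t tI]; last by rewrite /jC restrict0// mulr0.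
  by apply: nearW => t tI; rewrite (cintZ _ _ mchi hK) /jC restrictE.
have -> : (fun n => \int[@lebesgue_measure R]_(t in `]0, T[) \int[lebN]_x (current (f n) t x 0 i * (eta t * chi x))) =
    (fun n => \int[leb]_t (eta t * Bmom T (f n) chi i t)).
  apply/funext => n; apply: Rint_restrict => [|t tI]; last first.
    by rewrite Bmom_out// mulr0.
  apply: filterS (ke_current (KE n)) => t h tI.
  have [-> _] := h tI _ _ i (mc (eta t)) (hc (eta t)).
  by have [_ ->] := h tI _ _ i mchi hK.
exact.
Qed.

(** The bound on the moments with k = 1 is uniform in L^1, and passes to the weak limit, whose
    integrability it yields. *)
Lemma current_limit chi i : C0 chi ->
  [/\ forall n, rint leb (Bmom T (f n) chi i), rint leb (jC chi i) &
   exists2 K : R, 0 <= K & forall n k, 0 < k ->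
     {ae leb, forall t : TR, `|Bmom T (f n) chi i t| <= K * (k * kinr T (f n) t + k^-1 * M)}].
Proof.
move=> Cchi; have [K K0 hK] := C0_bounded Cchi.
have mchi : measurable_fun setT chi by case: Cchi => c _; exact: continuous_rV_measurable.
have jB n := ke_rint_Bmom (KE n) i mchi hK.
split => //; last by exists K => // n k k0; exact: (ke_Bmom_le (KE n) i mchi hK k0).
have B0 n (t : TR) : t \notin `]0, T[ -> Bmom T (f n) chi i t = 0.
  by exact: Bmom_out.
have bd n : \int[leb]_t `|Bmom T (f n) chi i t| <= K * (C + M * T).
  have [jk k0 lek] := ke_kinetic (KE n).
  have jI : rint leb (fun t => K * (kinr T (f n) t + M * (\1_I0T t : R))).
    by apply: rintZl; apply: rintD => //; apply: rintZl; exact: rint_itv.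
  apply: (@le_trans _ _ (\int[leb]_t (K * (kinr T (f n) t + M * \1_I0T t)))).
    apply: ae_le_Rint => //; first exact: rint_norm.
    apply: filterS (ke_Bmom_le (KE n) i mchi hK ltr01) => t h.
    have [tI|tI] := boolP (t \in `]0, T[).
      by rewrite indicE mem_set// mulr1; move: h; rewrite mul1r invr1 mul1r.
    by rewrite B0// normr0 mulr_ge0// addr_ge0// mulr_ge0// indicE.
  rewrite RintegralZl//; last by apply: rintD => //; apply: rintZl; exact: rint_itv.
  rewrite ler_wpM2l// RintegralD//; last by apply: rintZl; exact: rint_itv.
  rewrite RintegralZl//; last exact: rint_itv.
  by rewrite Rint_itv ?(ltW T_gt0)// subr0 lerD2r.
have := @weak_limit_L1 _ TR R leb I0T (measurable_I0T T) (leb_itv_lty 0 T)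
  (fun n => Bmom T (f n) chi i) (jC chi i) _ (measurable_jC i Cchi) _ jB bd
  (fun eta te => weak_current Cchi te).
by case => // t tI; rewrite /jC restrict0//; apply/negP.
Qed.

Lemma density_limit chi (dchi : 'I_N -> E -> R) (K : R) : C0 chi ->
  (forall i x, is_derive x (delta_mx 0 i : E) chi (dchi i x)) -> (forall i, continuous (dchi i)) ->
  (forall i x, `|dchi i x| <= K) ->
  exists (ah : TR -> R) (A : R),
  [/\ [/\ measurable_fun setT ah, forall t, `|ah t| <= A & forall t, t \notin `]0, T[ -> ah t = 0],
      [/\ forall n, rint leb (Amom T (f n) chi), forall n t, `|Amom T (f n) chi t| <= A &
          forall n (t : TR), t \notin `]0, T[ -> Amom T (f n) chi t = 0],
      forall t, Amom T (f n) chi t @[n --> \oo] --> ah t & {ae leb, forall t, rhoC chi t = ah t}].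
Proof.
move=> Cchi dchi' cdchi dK; have [K1 K10 hK1] := C0_bounded Cchi.
have mchi : measurable_fun setT chi by case: Cchi => c _; exact: continuous_rV_measurable.
have jA n := ke_rint_Amom (KE n) mchi hK1.
have A0 n (t : TR) : t \notin `]0, T[ -> Amom T (f n) chi t = 0.
  by exact: Amom_out.
have AK n t := ke_Amom_le (KE n) mchi hK1 t.
pose K2 := Num.max K1 K.
have K20 : 0 <= K2 by rewrite le_max K10.
have h1 x : `|chi x| <= K2 by rewrite le_max hK1.
have h2 i x : `|dchi i x| <= K2 by rewrite le_max dK orbT.
have equi e : 0 < e -> exists2 dl, 0 < dl & forall n t1 t2,
    t1 \in `]0, T[ -> t2 \in `]0, T[ -> `|t2 - t1| <= dl ->
    `|Amom T (f n) chi t2 - Amom T (f n) chi t1| <= e.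
  (* First [k], to make the energy part at most e / 2, then the time increment, to make the mass
     part, now with a fixed constant, at most e / 2. *)
  move=> e0; pose k := e / 2 / (K2 * C + 1).
  have q1 : 0 < K2 * C + 1 by rewrite ltr_wpDl// mulr_ge0.
  have k0 : 0 < k by rewrite !divr_gt0.
  pose P := K2 * (N%:R / k * M).
  have P0 : 0 <= P by rewrite !mulr_ge0// invr_ge0 ltW.
  have P1 : 0 < P + 1 by rewrite ltr_wpDl.
  exists (e / 2 / (P + 1)) => [|n t1 t2 t1I t2I tt]; first by rewrite !divr_gt0.
  have [cchi _] := Cchi.
  apply: le_trans (ke_equicontinuity (KE n) K20 dchi' cchi cdchi h1 h2 k0 t1I t2I) _.
  rewrite mulrDr [leRHS](_ : e = e / 2 + e / 2); last by field.
  apply: lerD.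
    have -> : K2 * (k * C) = k * (K2 * C) by ring.
    by rewrite /k mulrAC ler_pdivrMr// ler_wpM2l ?divr_ge0 ?(ltW e0)// lerDl.
  have -> : K2 * (N%:R / k * M * `|t2 - t1|) = P * `|t2 - t1| by rewrite /P; ring.
  apply: le_trans (ler_wpM2l P0 tt) _.
  by rewrite mulrCA ler_piMr ?divr_ge0 ?(ltW e0)// ler_pdivrMr// mul1r lerDl.
have r0 (t : TR) : t \notin `]0, T[ -> rhoC chi t = 0 by move=> tI; rewrite /rhoC restrict0.
have [ah [m1 b1 z1 c1 [_ e1]]] := weak_limit_pointwise jA AK A0 equi
  (measurable_rhoC Cchi) r0 (fun eta te => weak_density Cchi te).
by exists ah, (K1 * M).
Qed.

(** Bounded derivatives are asked of [chi] alone, whose density moments have to converge pointwise;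
    the current moments only converge weakly. *)
Lemma product_limit chi (dchi : 'I_N -> E -> R) (K : R) chi' i (be : TR -> R) (L : R) : C0 chi ->
  (forall i x, is_derive x (delta_mx 0 i : E) chi (dchi i x)) -> (forall i, continuous (dchi i)) ->
  (forall i x, `|dchi i x| <= K) -> C0 chi' ->
  measurable_fun setT be -> (forall t, `|be t| <= L) ->
  [/\ forall n, rint leb (fun t => be t * (Amom T (f n) chi t * Bmom T (f n) chi' i t)),
      rint leb (fun t => be t * (rhoC chi t * jC chi' i t)) &
  \int[leb]_t (be t * (Amom T (f n) chi t * Bmom T (f n) chi' i t)) @[n --> \oo] -->
    \int[leb]_t (be t * (rhoC chi t * jC chi' i t))].
Proof.
move=> Cchi dchi' cdchi dK Cchi' mbe beL.
have [ah [A [[mah ahA ah0] [jA AA A0] cA eA]]] := density_limit Cchi dchi' cdchi dK.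
have [jB jj [K1 K10 hB]] := current_limit i Cchi'.
have jk n : rint leb (kinr T (f n)) by case: (ke_kinetic (KE n)).
have k0 n t : 0 <= kinr T (f n) t by case: (ke_kinetic (KE n)).
have kC n : \int[leb]_t kinr T (f n) t <= C by case: (ke_kinetic (KE n)).
have [h1 h2 h3] := weak_product jA AA A0 mah ahA ah0 cA jB jj jk k0 kC K10 M_ge0 hB
  (fun eta te => weak_current Cchi' te) mbe beL.
have eq : {ae leb, forall t, be t * (ah t * jC chi' i t) = be t * (rhoC chi t * jC chi' i t)}.
  by apply: filterS eA => t ->.
split => //.
- apply: rint_ae_eq eq h2; apply: measurable_funM => //.
  by apply: measurable_funM; [exact: measurable_rhoC|exact: measurable_jC].
- by rewrite -(ae_eq_Rint_nonmeasurable eq).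
Qed.

(** * The nonlocal term *)

Section nonlocal.
Variable phi : R -> E -> E.
Hypothesis phi_smooth : smooth (fun p : R * E => phi p.1 p.2).
Hypothesis phi_supp : supported_in setT (fun p : R * E => phi p.1 p.2).
Local Notation H := (Hc lam phi).

Definition tensor (I : finType) (chi : I -> E -> R) (c : 'I_N -> I -> I -> R -> R) i
    (p : TR * (E * E)) : R :=
  \sum_(k : I) \sum_(l : I) c i k l p.1 * (chi k p.2.1 * chi l p.2.2).

Definition tensor_limit (I : finType) (chi : I -> E -> R) (c : 'I_N -> I -> I -> R -> R) (t : TR) : R :=
  \sum_(i < N) \sum_(k : I) \sum_(l : I) c i k l t *
    (rhoC (chi k) t * jC (chi l) i t - jC (chi k) i t * rhoC (chi l) t).

Lemma flux0 n (t : TR) : flux T (f n) (fun _ _ => 0) t = 0.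
Proof.
rewrite /flux (_ : (fun q => _) = fun=> 0); first by rewrite Rintegral_cst// mul0r.
by apply/funext => q; rewrite /pairf big1// => i _; rewrite !mul0r.
Qed.

Section one_tensor.
Variables (I : finType) (chi : I -> E -> R) (c : 'I_N -> I -> I -> R -> R) (K : R).
Hypothesis chiP : test_family chi.
Hypothesis mc : forall i k l, measurable_fun setT (c i k l : TR -> R).
Hypothesis cK : forall i k l t, `|c i k l t| <= K.

Let mchi k : measurable_fun setT (chi k).
Proof. by apply: continuous_rV_measurable; exact: (test_continuous chiP). Qed.

Let Cchi k : C0 (chi k).
Proof. exact: (C0_of_support (test_continuous chiP (k := k)) (test_support chiP k)). Qed.

Lemma measurable_tensor i : measurable_fun setT (tensor chi c i).
Proof.
apply: measurable_sum => k; apply: measurable_sum => l.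
apply: measurable_funM; first exact: (measurableT_comp (mc i k l) measurable_fst).
by apply: measurable_funM; apply: (measurableT_comp (mchi _)); exact: measurableT_comp.
Qed.

Lemma measurable_tensor_limit : measurable_fun setT (tensor_limit chi c).
Proof.
apply: measurable_sum => i; apply: measurable_sum => k; apply: measurable_sum => l.
apply: measurable_funM => //; apply: measurable_funB; apply: measurable_funM;
  by [exact: measurable_rhoC|exact: measurable_jC].
Qed.

Lemma tensor_limit0 (t : TR) : t \notin `]0, T[ -> tensor_limit chi c t = 0.
Proof.
move=> tI; apply: big1 => i _; apply: big1 => k _; apply: big1 => l _.
by rewrite /rhoC /jC !restrict0// !mulr0 subrr mulr0.
Qed.

Lemma weak_tensor eta : bounded_test eta ->
  \int[leb]_t (eta t * flux T (f n) (tensor chi c) t) @[n --> \oo] -->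
  \int[leb]_t (eta t * tensor_limit chi c t).
Proof.
move=> [me e1]; have [dchi [Kd [d1 d2 d3]]] := test_derivative chiP.
pose be i k l (t : TR) := eta t * c i k l t.
have mbe i k l : measurable_fun setT (be i k l) by exact: measurable_funM.
have beK i k l t : `|be i k l t| <= K.
  by rewrite /be normrM; apply: le_trans (cK i k l t); rewrite ler_piMl.
have PL k l i k' l' := product_limit i (Cchi k) (d1 k) (d2 k) (d3 k) (Cchi l) (mbe i k' l') (beK i k' l').
pose g n i k l (t : TR) := be i k l t * (Amom T (f n) (chi k) t * Bmom T (f n) (chi l) i t)
  - be i k l t * (Amom T (f n) (chi l) t * Bmom T (f n) (chi k) i t).
pose gl i k l (t : TR) := be i k l t * (rhoC (chi k) t * jC (chi l) i t)
  - be i k l t * (rhoC (chi l) t * jC (chi k) i t).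
have jg n i k l : rint leb (g n i k l).
  by apply: rintB; [have [] := PL k l i k l|have [] := PL l k i k l].
have jgl i k l : rint leb (gl i k l).
  by apply: rintB; [have [] := PL k l i k l|have [] := PL l k i k l].
have js1 n i k : rint leb (fun t => \sum_(l : I) g n i k l t) by exact: rint_sum.
have js2 n i : rint leb (fun t => \sum_(k : I) \sum_(l : I) g n i k l t) by exact: rint_sum.
have jl1 i k : rint leb (fun t => \sum_(l : I) gl i k l t) by exact: rint_sum.
have jl2 i : rint leb (fun t => \sum_(k : I) \sum_(l : I) gl i k l t) by exact: rint_sum.
have -> : \int[leb]_t (eta t * tensor_limit chi c t) =
    \sum_(i < N) \sum_(k : I) \sum_(l : I) \int[leb]_t gl i k l t.
  transitivity (\int[leb]_t (\sum_(i < N) \sum_(k : I) \sum_(l : I) gl i k l t)).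
    apply: eq_Rintegral => t _; rewrite /tensor_limit mulr_sumr; apply: eq_bigr => i _.
    rewrite mulr_sumr; apply: eq_bigr => k _; rewrite mulr_sumr; apply: eq_bigr => l _.
    by rewrite /gl /be; ring.
  rewrite (Rint_sum _ _ jl2); apply: eq_bigr => i _; rewrite (Rint_sum _ _ (jl1 i)).
  by apply: eq_bigr => k _; rewrite (Rint_sum _ _ (jgl i k)).
have -> : (fun n => \int[leb]_t (eta t * flux T (f n) (tensor chi c) t)) =
    (fun n => \sum_(i < N) \sum_(k : I) \sum_(l : I) \int[leb]_t g n i k l t).
  apply/funext => n.
  transitivity (\int[leb]_t (\sum_(i < N) \sum_(k : I) \sum_(l : I) g n i k l t)).
    apply: ae_eq_Rint_nonmeasurable.
    apply: filterS (ke_flux_tensor (KE n) c mchi (test_le1 chiP)) => t.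
    rewrite -/(tensor chi c) => ->; rewrite mulr_sumr; apply: eq_bigr => i _.
    rewrite mulr_sumr; apply: eq_bigr => k _; rewrite mulr_sumr; apply: eq_bigr => l _.
    by rewrite /g /be; ring.
  rewrite (Rint_sum _ _ (js2 n)); apply: eq_bigr => i _; rewrite (Rint_sum _ _ (js1 n i)).
  by apply: eq_bigr => k _; rewrite (Rint_sum _ _ (jg n i k)).
apply: cvg_sum_seq => i; apply: cvg_sum_seq => k; apply: cvg_sum_seq => l.
have [a1 a2 a3] := PL k l i k l; have [b1 b2 b3] := PL l k i k l.
have -> : \int[leb]_t gl i k l t = \int[leb]_t (be i k l t * (rhoC (chi k) t * jC (chi l) i t))
    - \int[leb]_t (be i k l t * (rhoC (chi l) t * jC (chi k) i t)) by rewrite RintegralB.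
have -> : (fun n => \int[leb]_t g n i k l t) = (fun n =>
    \int[leb]_t (be i k l t * (Amom T (f n) (chi k) t * Bmom T (f n) (chi l) i t))
    - \int[leb]_t (be i k l t * (Amom T (f n) (chi l) t * Bmom T (f n) (chi k) i t))).
  by apply/funext => n; rewrite RintegralB.
exact: (@cvgB_seq _ _ _ _ _ a3 b3).
Qed.

Lemma tensor_limitE (t : TR) : t \in `]0, T[ -> tensor_limit chi c t =
  \sum_(i < N) (cint_prod (rho t) (j t i) (fun z => tensor chi c i (t, z))
    - cint_prod (j t i) (rho t) (fun z => tensor chi c i (t, z))).
Proof.
move=> tI; apply: eq_bigr => i _.
rewrite (cint_prod_tensor _ _ (fun k l => c i k l t) mchi (test_le1 chiP)).
rewrite (cint_prod_tensor _ _ (fun k l => c i k l t) mchi (test_le1 chiP)).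
rewrite -sumrB; apply: eq_bigr => k _; rewrite -sumrB; apply: eq_bigr => l _.
by rewrite /rhoC /jC !restrictE// mulrBr.
Qed.

End one_tensor.

(** Bundled so that one approximant can be chosen for each accuracy although the index type varies;
    [kernel_approximants] has a trivial conclusion so that [cid] extracts the record. *)
Record kernel_approximant (e : R) : Type := {
  ka_index : finType;
  ka_family : ka_index -> E -> R;
  ka_coef : 'I_N -> ka_index -> ka_index -> R -> R;
  ka_range : R;
  ka_level : R;
  ka_spec : [/\ test_family ka_family,
    forall i k l, measurable_fun setT (ka_coef i k l : TR -> R),
    exists C : R, forall i k l t, `|ka_coef i k l t| <= C,
    0 < ka_range /\ (forall eps, 0 < eps < ka_range -> forall i t x y s, 0 <= s ->
      `|H eps i t x y - tensor ka_family ka_coef i (t, (x, y))| * s <=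
      e * (1 + s ^+ 2 + phi_kernel lam eps (enorm (x - y)) * s ^+ 2)) &
    0 < ka_level <= e /\ forall i t x y,
      `|H ka_level i t x y - tensor ka_family ka_coef i (t, (x, y))| <= e]
}.

Lemma kernel_approximants (e : R) : 0 < e -> exists _ : kernel_approximant e, True.
Proof.
move=> e0.
have [I [chi [c [eb [ep spec]]]]] := kernel_approximation lam_gt0 lam_le phi_smooth phi_supp e0.
by exists (@Build_kernel_approximant e I chi c eb ep spec).
Qed.

(** An instance of [limit_interchange]: at a fixed accuracy the tensor fluxes converge weakly as eps
    tends to 0, and as the accuracy improves their limits converge pointwise in time. *)
Lemma flux_limit :
  \int[leb]_t flux T (f n) (fun i p => H (eps n) i p.1 p.2.1 p.2.2) t @[n --> \oo] -->
  \int[leb]_t ((fun t => \sum_(i < N)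
    (cint_prod (rho t) (j t i) (fun z => H 0 i t z.1 z.2)
     - cint_prod (j t i) (rho t) (fun z => H 0 i t z.1 z.2))) \_ I0T) t.
Proof.
have [K K0 HK] := Hc_bounded lam_gt0 lam_le phi_smooth phi_supp.
pose e m : R := m.+1%:R^-1.
have e0 m : 0 < e m by rewrite invr_gt0.
have e1 m : e m <= 1 by rewrite invf_le1// ler1n.
pose A m := sval (cid (kernel_approximants (e0 m))).
pose I m : finType := ka_index (A m).
pose chi m : I m -> E -> R := ka_family (k := A m).
pose c m : 'I_N -> I m -> I m -> R -> R := ka_coef (k := A m).
pose eb m : R := ka_range (A m).
pose ep m : R := ka_level (A m).
have kaP m := ka_spec (A m).
pose h m := tensor (chi m) (c m).
have mh m i : measurable_fun setT (h m i) by have [? ? _ _ _] := kaP m; exact: measurable_tensor.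
have hK m i p : `|h m i p| <= K + 1.
  have [_ _ _ _ [_ hd]] := kaP m; case: p => t [x y].
  rewrite (_ : h m i _ = H (ep m) i t x y - (H (ep m) i t x y - h m i (t, (x, y)))); last by ring.
  apply: le_trans (ler_normB _ _) _; apply: lerD; first exact: HK.
  exact: le_trans (hd i t x y) (e1 m).
pose Hn n i (p : TR * (E * E)) := H (eps n) i p.1 p.2.1 p.2.2.
have mH n i : measurable_fun setT (Hn n i) by exact: measurable_Hc.
have HnK n i p : `|Hn n i p| <= K by exact: HK.
pose Sm m := tensor_limit (chi m) (c m).
apply: (@limit_interchange _ TR R leb I0T (measurable_I0T T) (leb_itv_lty 0 T)
  (fun n => flux T (f n) (Hn n)) (fun m n => flux T (f n) (h m)) Sm _
  (fun n => DD lam T (eps n) (f n)) (fun m => N%:R * e m) C).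
- by move=> n; exact: (ke_rint_flux (KE n) (mH n) (HnK n)).
- by move=> m n; exact: (ke_rint_flux (KE n) (mh m) (hK m)).
- by move=> n; have [] := ke_DD (KE n).
- by move=> n; have [] := ke_DD (KE n).
- by [].
- by move=> m; rewrite mulr_ge0// ltW.
- rewrite -[X in _ --> X](mulr0 (N%:R : R)); apply: cvgM; [exact: cvg_cst|exact: cvg_harmonic].
- move=> m; have [_ _ _ [eb0 hc] _] := kaP m.
  have [n0 _ hn0] : \forall n \near \oo, eps n < eb m.
    move/cvgrPdist_lt: eps_cvg0 => /(_ (eb m) eb0); apply: filterS => n.
    by rewrite sub0r normrN; apply: le_lt_trans; exact: ler_norm.
  exists n0 => n n0n; apply: (ke_flux_sub_le (KE n) (mH n) (mh m) (HnK n) (hK m)).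
  by move=> i t x y s s0; apply: hc => //; rewrite eps_gt0; exact: hn0.
- by move=> m; have [? ? _ _ _] := kaP m; exact: measurable_tensor_limit.
- by move=> m t tI; rewrite /Sm tensor_limit0//; apply/negP.
- move=> m; exists (N%:R * (K + 1) * C) => n.
  have [jD leD] := ke_DD (KE n); have jf := ke_rint_flux (KE n) (mh m) (hK m).
  have K10 : 0 <= K + 1 by rewrite addr_ge0.
  apply: (@le_trans _ _ (\int[leb]_t (N%:R * (K + 1) * DD lam T (eps n) (f n) t))); last first.
    by rewrite RintegralZl// ler_wpM2l// mulr_ge0.
  apply: ae_le_Rint; [exact: rint_norm|exact: rintZl|].
  (* The uniform L^1 bound on the tensor fluxes is their comparison with the zero kernel, with
     [K + 1] as the error constant. *)
  have m0 (i : 'I_N) : measurable_fun setT ((fun _ _ => 0) i : TR * (E * E) -> R) by exact: measurable_cst.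
  have b0 (i : 'I_N) (p : TR * (E * E)) : `|(fun _ _ => 0 : R) i p| <= 0 by rewrite normr0.
  have cmp i (t : TR) x y s : 0 <= s -> `|h m i (t, (x, y)) - (fun _ _ => 0 : R) i (t, (x, y))| * s <=
      (K + 1) * (1 + s ^+ 2 + phi_kernel lam (eps n) (enorm (x - y)) * s ^+ 2).
    move=> s0; rewrite subr0; apply: ler_pM => //.
    have h1 : s <= 1 + s ^+ 2.
      by rewrite -subr_ge0 (_ : _ - _ = (s - 2^-1) ^+ 2 + 3 / 4) ?addr_ge0 ?sqr_ge0//; field.
    by apply: le_trans h1 _; rewrite lerDl mulr_ge0 ?sqr_ge0// phi_kernel_ge0.
  apply: filterS (ke_flux_sub_le (KE n) (mh m) m0 (hK m) b0 cmp) => t.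
  by rewrite flux0 subr0.
- by move=> m eta te; have [? ? [Kc hKc] _ _] := kaP m; exact: (weak_tensor _ _ hKc te).
move=> t; have [tI|tI] := boolP (t \in `]0, T[); last first.
  rewrite restrict0//; apply: cvg_near_cst; apply: nearW => m.
  by rewrite /Sm tensor_limit0.
rewrite restrictE//; have -> : Sm^~ t = fun m => \sum_(i < N)
    (cint_prod (rho t) (j t i) (fun z => h m i (t, z))
    - cint_prod (j t i) (rho t) (fun z => h m i (t, z))).
  by apply/funext => m; have [? ? _ _ _] := kaP m; rewrite /Sm tensor_limitE.
have mht m i : measurable_fun setT (fun z => h m i (t, z)).
  by apply: (measurableT_comp (mh m i)); exact: pair1_measurable.
(* The approximant is uniformly close to H at its level, and the level tends to 0, where H converges
   pointwise to H^0. *)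
have ch i (z : E * E) : h m i (t, z) @[m --> \oo] --> H 0 i t z.1 z.2.
  case: z => x y; apply/cvgrPdist_le => d d0 /=.
  have d2 : 0 < d / 2 by rewrite divr_gt0.
  have [b b0 hb] := Hc_cvg lam_gt0 lam_le phi_smooth phi_supp i t x y d2.
  have en : e m @[m --> \oo] --> (0 : R) by exact: cvg_harmonic.
  have n1 : \forall m \near \oo, e m < b.
    move/cvgrPdist_lt: en => /(_ b b0); apply: filterS => m.
    by rewrite sub0r normrN; apply: le_lt_trans; exact: ler_norm.
  have n2 : \forall m \near \oo, e m <= d / 2.
    move/cvgrPdist_le: en => /(_ _ d2); apply: filterS => m.
    by rewrite sub0r normrN; apply: le_trans; exact: ler_norm.
  apply: filterS2 n1 n2 => m mb md; have [_ _ _ _ [/andP[p0 pe] hd]] := kaP m.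
  rewrite (_ : _ - _ = - (H (ep m) i t x y - H 0 i t x y) + (H (ep m) i t x y - h m i (t, (x, y)))); last by ring.
  apply: le_trans (ler_normD _ _) _; rewrite normrN [leRHS](_ : d = d / 2 + d / 2); last by field.
  apply: lerD; last exact: le_trans (hd i t x y) md.
  by apply: hb; rewrite (ltW p0)/=; exact: le_lt_trans mb.
apply: cvg_sum_seq => i; apply: cvgB_seq; apply: cint_prod_dominated_cvg => //.
Qed.

Lemma nonlocal_limit :
  \int[@lebesgue_measure R]_(t in `]0, T[)
    \int[(lebN \x lebN)%E]_z dot (H_kernel lam (eps n) phi t z.1 z.2)
      (density (f n) t z.1 *: current (f n) t z.2 - density (f n) t z.2 *: current (f n) t z.1)
  @[n --> \oo] -->
  \int[@lebesgue_measure R]_(t in `]0, T[) \sum_(i < N)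
    (cint_prod (rho t) (j t i) (fun z => H_kernel lam 0 phi t z.1 z.2 0 i)
     - cint_prod (j t i) (rho t) (fun z => H_kernel lam 0 phi t z.1 z.2 0 i)).
Proof.
have [K K0 HK] := Hc_bounded lam_gt0 lam_le phi_smooth phi_supp.
pose Hn n i (p : TR * (E * E)) := H (eps n) i p.1 p.2.1 p.2.2.
have mH n i : measurable_fun setT (Hn n i) by exact: measurable_Hc.
have HnK n i p : `|Hn n i p| <= K by exact: HK.
have := flux_limit.
have -> : (fun n => \int[leb]_t flux T (f n) (Hn n) t) = (fun n =>
  \int[@lebesgue_measure R]_(t in `]0, T[)
    \int[(lebN \x lebN)%E]_z dot (H_kernel lam (eps n) phi t z.1 z.2)
      (density (f n) t z.1 *: current (f n) t z.2 - density (f n) t z.2 *: current (f n) t z.1)).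
  apply/funext => n; apply/esym/Rint_restrict => [|t tI]; last first.
    by exact: flux_out.
  apply: filterS (ke_flux (KE n) (mH n) (HnK n)) => t ht tI; rewrite -(ht tI).
  by apply: eq_Rintegral => z _; apply: eq_bigr => i _; rewrite !mxE.
congr (_ --> _); apply/esym; apply: Rint_restrict => [|t tI]; last by rewrite restrict0.
by apply: nearW => t tI; rewrite restrictE.
Qed.

End nonlocal.

End limits.

Lemma C0B (R : realType) (N : nat) (W : normedModType R) (g h : 'rV[R]_N -> W) :
  C0 g -> C0 h -> C0 (g - h).
Proof.
move=> [cg g0] [ch h0]; split.
  by move=> x; exact: (cvgB (cg x) (ch x)).
move=> e e0; have e2 : 0 < e / 2 by rewrite divr_gt0.
have [K cK hK] := g0 _ e2; have [L cL hL] := h0 _ e2.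
exists (K `|` L); first exact: compactU.
move=> x /not_orP[Kx Lx]; rewrite [e](_ : _ = e / 2 + e / 2); last by field.
by apply: le_lt_trans (ler_normB _ _) _; rewrite ltrD ?hK ?hL.
Qed.

(** * The force term *)

Section force.
Variables (R : realType) (N : nat) (lam T : R) (eps : nat -> R).
Local Notation E := 'rV[R]_N.
Local Notation TR := (measurableTypeR R).
Local Notation leb := (lebR R).
Local Notation lebN := (lebesgue_rV R N).
Local Notation I0T := (`]0, T[%classic : set R).
Local Notation supv := (fun G : E -> E => sup_norm (@enorm R N \o G)).
Local Notation C0v := [set G : E -> E | C0 G].

Lemma sup_norm_lty (G : E -> E) : C0 G -> (supv G < +oo)%E.
Proof.
move=> CG; have [K K0 hK] := C0_bounded CG.
apply: (@le_lt_trans _ _ (Num.sqrt N%:R * K)%:E); last exact: ltry.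
apply: sup_norm_le => x; rewrite lee_fin /= ger0_norm ?enorm_ge0//.
by apply: le_trans (enorm_le _) _; rewrite ler_wpM2l// sqrtr_ge0.
Qed.

(** The time norm of [u] enters only as a lower integral, so [supv] along [u] need not be measurable
    in time; [p] is. *)
Lemma rint_of_time_norm (p : TR -> R) (u : R -> E -> E) (c : R) : 0 <= c ->
  measurable_fun setT p -> (forall t, t \notin `]0, T[ -> p t = 0) ->
  {ae leb, forall t : TR, t \in `]0, T[ -> (`|p t|%:E <= c%:E * supv (u t))%E} ->
  (Lp_time_norm T 1%:E supv u < +oo)%E ->
  rint leb p /\ ((\int[leb]_t `|p t|)%:E <= c%:E * Lp_time_norm T 1%:E supv u)%E.
Proof.
move=> c0 mp p0 pu ulty.
have le : (\int[leb]_t `|p t|%:E <= c%:E * Lp_time_norm T 1%:E supv u)%E.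
  rewrite /Lp_time_norm Lnorm1.
  apply: (@le_trans _ _ (\int[leb]_t (c%:E * `|((supv \o u) \_ I0T) t|))%E); last first.
    by apply: lower_integralZl => // t; exact: abse_ge0.
  apply: ge0_ae_le_integral_nonmeasurable.
  - by move=> t; rewrite lee_fin.
  - by move=> t; rewrite mule_ge0 ?lee_fin ?abse_ge0.
  apply: (@filterS TR _ _ _ _ _ pu) => t h.
  have [tI|tI] := boolP (t \in `]0, T[).
    by rewrite patchE mem_set// gee0_abs ?sup_norm_ge0//; exact: h.
  by rewrite p0// normr0 mule_ge0// lee_fin.
have fin : (\int[leb]_t `|p t|%:E < +oo)%E.
  by apply: le_lt_trans le _; rewrite lte_mul_pinfty// lee_fin.
have jp : rint leb p.
  by apply/integrableP; split; [exact/measurable_EFinP|exact: fin].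
by split => //; rewrite Rint_EFin//; exact: rint_norm.
Qed.

Variables (f : nat -> R -> E -> E -> R) (M C : R).
Variables (rho : R -> {charge set E -> \bar R}).
Hypotheses (N_gt0 : (0 < N)%N) (T_gt0 : 0 < T) (M_ge0 : 0 <= M).
Hypothesis KE : forall n, kinetic_estimates lam T (eps n) (f n) M C.
Hypothesis rho_cvg : weak_star_cvg T 1%:E (fun n => density (f n)) rho.
Variable phi : R -> E -> E.
Hypothesis phi_smooth : smooth (fun p : R * E => phi p.1 p.2).
Hypothesis phi_supp : supported_in setT (fun p : R * E => phi p.1 p.2).
Variables (F : nat -> R -> E -> E) (F' : R -> E -> E).
Hypothesis FP : forall n, Lp_bochner T 1%:E C0v supv (F n).
Hypothesis F'P : Lp_bochner T 1%:E C0v supv F'.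
Hypothesis F_cvg : Lp_time_norm T 1%:E supv (fun t => F n t - F' t) @[n --> \oo] --> 0%E.

(** The limit force paired with [phi] is itself an admissible test for the convergence of the
    densities; the difference of the forces costs at most a constant times the mass bound times its
    L^1 norm in time. *)
Lemma force_limit :
  \int[@lebesgue_measure R]_(t in `]0, T[) \int[lebN]_x
    (density (f n) t x * dot (F n t x) (phi t x)) @[n --> \oo] -->
  \int[@lebesgue_measure R]_(t in `]0, T[) cint (rho t) (fun x => dot (F' t x) (phi t x)).
Proof.
have [K [cK _ gK]] := phi_supp.
have [B [L [_ [B0 L0 [phiB _ phiL] _]]]] := compactly_supported_bounds phi_smooth cK gK.
have cphi i := continuous_field phi_smooth i.
have phic i t : continuous (fun x => phi t x 0 i) by
  exact: (@continuous_pairl R E R (fun p : R * E => phi p.1 p.2 0 i) t (cphi i)).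
pose c := N%:R * B * M; have c0 : 0 <= c by rewrite !mulr_ge0.
pose D (G : E -> E) (t : TR) x := dot (G x) (phi t x).
have CD G t : C0 G -> C0 (D G t) by move=> CG; apply: (@C0_dot _ _ _ _ B).
have mD G t : C0 G -> measurable_fun setT (D G t).
  by move=> CG; apply: continuous_rV_measurable; have [] := CD G t CG.
have AD n G t : C0 G -> (`|Amom T (f n) (D G t) t|%:E <= c%:E * supv G)%E.
  move=> CG; have fin : supv G \is a fin_num.
    by rewrite ge0_fin_numE ?sup_norm_ge0// sup_norm_lty.
  rewrite -(fineK fin) -EFinM lee_fin /c mulrAC.
  apply: (ke_Amom_le (KE n) (mD _ _ CG)) => x.
  apply: le_trans (dot_le_enorm _ (fun i => phiB i _ _) B0) _.
  rewrite ler_wpM2l ?mulr_ge0// -lee_fin (fineK fin); apply: le_trans (sup_norm_ub _ x).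
  by rewrite lee_fin /= ger0_norm ?enorm_ge0.
(* A jointly measurable version of the force paired with [phi], cut off on a null set of times,
   whose moments are therefore measurable in time. *)
pose m_ (G : R -> E -> E) (A : set TR) (p : TR * E) := \sum_(i < N) Ft T G A i p * phi p.1 p.2 0 i.
have mphi i : measurable_fun setT (fun p : TR * E => phi p.1 p.2 0 i).
  exact: (continuous_field_measurable (cphi i)).
pose P G A n (t : TR) := Amom T (f n) (fun x => m_ G A (t, x)) t.
have PP G : Lp_bochner T 1%:E C0v supv G -> exists A : set TR,
    [/\ forall n, measurable_fun setT (P G A n),
        forall n t, t \notin `]0, T[ -> P G A n t = 0 &
        {ae leb, forall t : TR, t \in `]0, T[ -> C0 (G t) /\ forall n, P G A n t = Amom T (f n) (D (G t) t) t}].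
  move=> GP; have [A [mA A0 mG]] := bochner_null_set GP; have [CG _ _] := GP.
  exists A; split.
  - move=> n; apply: (ke_measurable_Amom (KE n) (g := m_ G A)).
    by apply: measurable_sum => i; apply: measurable_funM.
  - by move=> n t tI; rewrite /P (Amom_out N_gt0 KE).
  - have h0 : {ae leb, forall t : TR, t \in `]0, T[ -> C0 (G t)} := CG.
    apply: (@filterS2 TR _ _ _ _ _ _ h0 (FtE T G mA A0)) => t h1 h2 tI; split; first exact: h1.
    move=> n; rewrite /P; congr (Amom T (f n) _ t); apply/funext => x.
    by apply: eq_bigr => i _; rewrite h2.
have intP G A n : {ae leb, forall t : TR, t \in `]0, T[ -> C0 (G t) /\ forall n, P G A n t = Amom T (f n) (D (G t) t) t} ->
    (forall t, t \notin `]0, T[ -> P G A n t = 0) ->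
    \int[@lebesgue_measure R]_(t in `]0, T[) \int[lebN]_x (density (f n) t x * dot (G t x) (phi t x)) =
    \int[leb]_t P G A n t.
  move=> eG G0; apply: Rint_restrict => //.
  apply: (@filterS TR _ _ _ _ _ eG) => t h tI; have [CG ->] := h tI.
  have [KD _ hKD] := C0_bounded (CD _ t CG).
  exact: (ke_density (KE n) (mD _ t CG) hKD tI).
have [A' [mP' P'0 eP']] := PP _ F'P.
have := rho_cvg (field_test T_gt0 B0 L0 phiB phiL phic F'P).
have -> : (fun n => \int[@lebesgue_measure R]_(t in `]0, T[) \int[lebN]_x (density (f n) t x * dot (F' t x) (phi t x))) =
    (fun n => \int[leb]_t P F' A' n t).
  by apply/funext => n; exact: (intP _ _ n eP' (P'0 n)).
set l := \int[_]_(t in _) cint _ _ => hl.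
pose A n := sval (cid (PP _ (FP n))).
have AP n : [/\ forall k, measurable_fun setT (P (F n) (A n) k),
        forall k t, t \notin `]0, T[ -> P (F n) (A n) k t = 0 &
        {ae leb, forall t : TR, t \in `]0, T[ -> C0 (F n t) /\ forall k, P (F n) (A n) k t = Amom T (f k) (D (F n t) t) t}].
  exact: svalP (cid (PP _ (FP n))).
have -> : (fun n => \int[@lebesgue_measure R]_(t in `]0, T[) \int[lebN]_x (density (f n) t x * dot (F n t x) (phi t x))) =
    (fun n => \int[leb]_t P (F n) (A n) n t).
  by apply/funext => n; have [_ h0 eF] := AP n; exact: (intP _ _ n eF (h0 n)).
have jP' n : rint leb (P F' A' n).
  have [_ _ lty] := F'P; apply: (rint_of_time_norm c0 (mP' n) (P'0 n) _ lty).1.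
  by apply: (@filterS TR _ _ _ _ _ eP') => t h tI; have [CG ->] := h tI; exact: AD.
have jP n : rint leb (P (F n) (A n) n).
  have [mF F0 eF] := AP n; have [_ _ lty] := FP n.
  apply: (rint_of_time_norm c0 (mF n) (F0 n) _ lty).1.
  by apply: (@filterS TR _ _ _ _ _ eF) => t h tI; have [CG ->] := h tI; exact: AD.
have diff n : (Lp_time_norm T 1%:E supv (fun t => F n t - F' t)%R < +oo)%E ->
    ((`|\int[leb]_t P (F n) (A n) n t - \int[leb]_t P F' A' n t|)%:E <=
    c%:E * Lp_time_norm T 1%:E supv (fun t => F n t - F' t)%R)%E.
  move=> lty; have [mF F0 eF] := AP n.
  rewrite -RintegralB//.
  have [jd le] : rint leb (fun t => P (F n) (A n) n t - P F' A' n t) /\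
      ((\int[leb]_t `|P (F n) (A n) n t - P F' A' n t|)%:E <=
       c%:E * Lp_time_norm T 1%:E supv (fun t => F n t - F' t)%R)%E.
    apply: rint_of_time_norm => //; first exact: measurable_funB.
      by move=> t tI; rewrite F0// P'0// subrr.
    apply: (@filterS2 TR _ _ _ _ _ _ eF eP') => t h1 h2 tI.
    have [CF ->] := h1 tI; have [CF' ->] := h2 tI.
    have [K1 _ hK1] := C0_bounded (CD _ t CF); have [K2 _ hK2] := C0_bounded (CD _ t CF').
    rewrite -(ke_AmomB (KE n) (mD _ t CF) hK1 (mD _ t CF') hK2).
    have -> : (fun x => D (F n t) t x - D (F' t) t x) = D (F n t - F' t) t.
      by apply/funext => x; rewrite /D /dot -sumrB; apply: eq_bigr => i _; rewrite !mxE mulrBl.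
    by apply: AD; exact: C0B.
  by apply: le_trans le; rewrite lee_fin; exact: le_normr_Rintegral.
have small : \int[leb]_t P (F n) (A n) n t - \int[leb]_t P F' A' n t @[n --> \oo] --> 0.
  move/fine_cvgP: F_cvg => [fin cf].
  apply/cvgrPdist_le => e e0.
  have e1 : 0 < e / (c + 1) by rewrite divr_gt0// ltr_wpDl.
  move/cvgrPdist_le: cf => /(_ _ e1) cf.
  apply: filterS2 fin cf => n fn; rewrite !sub0r !normrN /= => h.
  rewrite -lee_fin; apply: le_trans (diff n _) _; first by rewrite ltey_eq fn.
  rewrite -(fineK fn) -EFinM lee_fin; apply: le_trans (_ : c * (e / (c + 1)) <= _).
    by rewrite ler_wpM2l//; apply: le_trans h; exact: ler_norm.
  by rewrite mulrCA ler_piMr ?(ltW e0)// ler_pdivrMr ?ltr_wpDl// mul1r lerDl.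
have -> : (fun n => \int[leb]_t P (F n) (A n) n t) = (fun n =>
    (\int[leb]_t P (F n) (A n) n t - \int[leb]_t P F' A' n t) + \int[leb]_t P F' A' n t).
  by apply/funext => n; rewrite subrK.
by rewrite -[l]add0r; apply: cvgD.
Qed.

End force.

(** * Uniform constants and conclusion *)

Lemma solution_estimates (R : realType) (N : nat) (T : R) (T_gt0 : 0 < T)
    (lam : R) (lam_gt0 : 0 < lam)
    (f0 : R -> 'rV[R]_N -> 'rV[R]_N -> R) (rho0 : {charge set 'rV[R]_N -> \bar R})
    (psi : R -> R -> 'rV[R]_N -> R) (dpsi : R -> R -> 'rV[R]_N -> 'rV[R]_N)
    (psi' : R -> 'rV[R]_N -> R) (dpsi' : R -> 'rV[R]_N -> 'rV[R]_N)
    (f : R -> R -> 'rV[R]_N -> 'rV[R]_N -> R) (emax : R) :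
  hypothesis_H1 f0 rho0 -> hypothesis_H2 T psi dpsi psi' dpsi' ->
  (forall eps, 0 < eps -> strong_solution lam T eps (dpsi eps) (f0 eps) (f eps)) ->
  exists M C : R, [/\ 0 <= M, 0 <= C &
    forall eps, 0 < eps <= emax -> kinetic_estimates lam T eps (f eps) M C].
Proof.
move=> [f0_ge0 _ [M0 [E0 [M0_gt0 E0_gt0 bd]]] _] [_ _ [F0 [F0_gt0 FL]] [FB _] _] fP.
(* The energy bound contains eps [E0], so it is uniform only for bounded eps, hence [emax]. *)
have Cdiss_le eps : eps <= emax -> Cdiss N T eps F0 M0 E0 <= Cdiss N T `|emax| F0 M0 E0.
  move=> e1; rewrite /Cdiss !lerD2r ler_wpM2r ?(ltW E0_gt0)//.
  by apply: le_trans e1 _; exact: ler_norm.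
have C1 : 0 <= Cdiss N T `|emax| F0 M0 E0.
  rewrite /Cdiss; apply: addr_ge0; first by rewrite addr_ge0 ?mulr_ge0 ?(ltW M0_gt0) ?(ltW E0_gt0) ?(ltW T_gt0).
  by rewrite mulr_ge0 ?sqr_ge0// addr_ge0 ?(ltW M0_gt0).
have C2 : 0 <= Csq N T `|emax| F0 M0 E0.
  by rewrite /Csq addr_ge0 ?mulr_ge0 ?sqr_ge0 ?(ltW M0_gt0) ?(ltW T_gt0).
exists M0, (Csq N T `|emax| F0 M0 E0 + Cdiss N T `|emax| F0 M0 E0).
split; [exact: ltW|exact: addr_ge0|move=> eps /andP[eps_gt0 eps_le]].
have sol := fP _ eps_gt0; have [h1 h2] := bd _ eps_gt0; have f00 := f0_ge0 _ eps_gt0.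
have mf0 : measurable_fun setT (fun z : 'rV[R]_N * 'rV[R]_N => f0 eps z.1 z.2).
  (* Joint measurability of the initial datum is read off from that of the solution at time 0. *)
  have m0 := measurable_f_section sol (t := 0) ltac:(by rewrite in_itv/= lexx (ltW T_gt0)).
  rewrite (_ : (fun z => _) = fun z : 'rV[R]_N * 'rV[R]_N => f eps 0 z.1 z.2)//.
  by apply/funext => z; rewrite (solution_initial sol).
have mv : measurable_fun setT (fun z : 'rV[R]_N * 'rV[R]_N => enorm z.2 ^+ 2 * f0 eps z.1 z.2).
  apply: measurable_funM => //; apply: measurable_funX.
  exact: (measurableT_comp (@measurable_enorm R N) measurable_snd).
have jf0 : rint (prodm (lebesgue_rV R N) (lebesgue_rV R N)) (fun z => f0 eps z.1 z.2).
  by apply/integrableP; split; [exact/measurable_EFinP|exact: le_lt_trans h1 (ltry _)].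
have jf0v : rint (prodm (lebesgue_rV R N) (lebesgue_rV R N)) (fun z => enorm z.2 ^+ 2 * f0 eps z.1 z.2).
  by apply/integrableP; split; [exact/measurable_EFinP|exact: le_lt_trans h2 (ltry _)].
have f0_le : \int[prodm (lebesgue_rV R N) (lebesgue_rV R N)]_z f0 eps z.1 z.2 <= M0.
  rewrite -lee_fin (Rint_EFin jf0); apply: le_trans h1; rewrite le_eqVlt; apply/orP; left; apply/eqP.
  by apply: eq_integral => z _; rewrite ger0_norm.
have f0v_le : \int[prodm (lebesgue_rV R N) (lebesgue_rV R N)]_z (enorm z.2 ^+ 2 * f0 eps z.1 z.2) <= E0.
  rewrite -lee_fin (Rint_EFin jf0v); apply: le_trans h2; rewrite le_eqVlt; apply/orP; left; apply/eqP.
  by apply: eq_integral => z _; rewrite ger0_norm// mulr_ge0// sqr_ge0.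
have [A0 [mA0 A00 mF]] := bochner_null_set (FB _ eps_gt0).
apply: (kinetic_estimatesP sol T_gt0 eps_gt0 lam_gt0 mA0 A00 mF (FL _ eps_gt0) f00 jf0 f0_le jf0v f0v_le) => //.
apply: lerD; last exact: Cdiss_le.
rewrite /Csq lerD2l ler_wpM2l ?Cdiss_le// mulr_ge0// ltW//.
Qed.

Theorem corollary3p13 (R : realType) (N : nat) (N_gt0 : (0 < N)%N)
  (T : R) (T_gt0 : 0 < T)
  (lam : R) (lam_gt0 : 0 < lam) (lam_le : lam <= 2^-1)
  (f0 : R -> 'rV[R]_N -> 'rV[R]_N -> R)
  (rho0 : {charge set 'rV[R]_N -> \bar R})
  (psi : R -> R -> 'rV[R]_N -> R) (dpsi : R -> R -> 'rV[R]_N -> 'rV[R]_N)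
  (psi' : R -> 'rV[R]_N -> R) (dpsi' : R -> 'rV[R]_N -> 'rV[R]_N)
  (H1 : hypothesis_H1 f0 rho0)
  (H2 : hypothesis_H2 T psi dpsi psi' dpsi')
  (f : R -> R -> 'rV[R]_N -> 'rV[R]_N -> R)
  (fP : forall eps, 0 < eps ->
    strong_solution lam T eps (dpsi eps) (f0 eps) (f eps))
  (eps : nat -> R) (eps_gt0 : forall n, 0 < eps n)
  (eps_cvg0 : eps n @[n --> \oo] --> 0)
  (rho : R -> {charge set 'rV[R]_N -> \bar R})
  (j : R -> 'I_N -> {charge set 'rV[R]_N -> \bar R})
  (rhoP : Lq_measures T +oo%E rho)
  (jP : forall i, Lq_measures T 2%:E (fun t => j t i))
  (rho_cvg : weak_star_cvg T 1%:E (fun n => density (f (eps n))) rho)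
  (j_cvg : forall i, weak_star_cvg T 2%:E
    (fun n t x => current (f (eps n)) t x 0 i) (fun t => j t i))
  (phi : R -> 'rV[R]_N -> 'rV[R]_N)
  (phi_smooth : smooth (fun p : R * 'rV[R]_N => phi p.1 p.2))
  (phi_supp : supported_in [set p : R * 'rV[R]_N | p.1 < T]
    (fun p => phi p.1 p.2)) :
  2^-1 * (\int[lebesgue_measure]_(t in `]0, T[)
    \int[(lebesgue_rV R N \x lebesgue_rV R N)%E]_z
      dot (H_kernel lam (eps n) phi t z.1 z.2)
        (density (f (eps n)) t z.1 *: current (f (eps n)) t z.2
         - density (f (eps n)) t z.2 *: current (f (eps n)) t z.1))
  @[n --> \oo] -->
  2^-1 * (\int[lebesgue_measure]_(t in `]0, T[)
    \sum_(i < N)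
      (cint_prod (rho t) (j t i)
         (fun z => H_kernel lam 0 phi t z.1 z.2 0 i)
       - cint_prod (j t i) (rho t)
         (fun z => H_kernel lam 0 phi t z.1 z.2 0 i)))
  /\
  \int[lebesgue_measure]_(t in `]0, T[) \int[lebesgue_rV R N]_x
    (density (f (eps n)) t x * dot (dpsi (eps n) t x) (phi t x))
  @[n --> \oo] -->
  \int[lebesgue_measure]_(t in `]0, T[)
    cint (rho t) (fun x => dot (dpsi' t x) (phi t x)).
Proof.
(* A convergent sequence is bounded, which supplies [emax] for [solution_estimates] with no passage
   to a tail. *)
have [emax _ eps_le] : exists2 emax, 0 <= emax & forall n, eps n <= emax.
  have [K [_ hK]] := cvg_seq_bounded (cvgP _ eps_cvg0).
  exists `|K + 1| => // n; apply: le_trans (ler_norm _) _.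
  by apply: le_trans (hK (K + 1) _ n I) (ler_norm _); rewrite ltrDl.
have [M [C [M0 C0 KE']]] := solution_estimates T_gt0 lam_gt0 emax H1 H2 fP.
have KE n : kinetic_estimates lam T (eps n) (f (eps n)) M C by apply: KE'; rewrite eps_gt0 eps_le.
have supp : supported_in setT (fun p : R * 'rV[R]_N => phi p.1 p.2).
  by have [K [cK _ hK]] := phi_supp; exists K; split.
split.
  apply: cvgM; first exact: cvg_cst.
  exact: (nonlocal_limit N_gt0 T_gt0 lam_gt0 lam_le eps_gt0 eps_cvg0 M0 C0 KE rhoP jP rho_cvg j_cvg phi_smooth supp).
have [_ _ _ [FB FB'] Fcvg] := H2.
apply: (force_limit N_gt0 T_gt0 M0 KE rho_cvg phi_smooth supp (fun n => FB _ (eps_gt0 n)) FB').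
(* The convergence of the forces is stated as eps tends to 0 from the right, so the positivity of
   [eps n] is needed to compose. *)
have e0 : eps n @[n --> \oo] --> (0 : R)^'+.
  move=> A hA; apply: (@filterS _ \oo _ [set n | 0 < eps n -> A (eps n)]) => [n /= h|].
    exact: h (eps_gt0 n).
  exact: (eps_cvg0 [set y | 0 < y -> A y] hA).
exact: (cvg_comp _ _ e0 Fcvg).
Qed.
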